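(* Let $H$ be a Hopf algebra over a field $k$ with a bijective antipode and set $\mathcal{C}={}_H^H\mathcal{YD}$. Suppose $B$ is a finite-dimensional Hopf algebra in $\mathcal{C}$ such that $\Phi_{B,M}=\Phi_{M,B}^{-1}$ for all $M\in\mathcal{C}$. Then there is an exact sequence of groups $$1\longrightarrow G(D(B)^* )\longrightarrow G(D(B))\stackrel{\Theta}{\longrightarrow}\operatorname{Aut}(\mathcal{C};B)\stackrel{\Pi}{\longrightarrow}\operatorname{BQ}(\mathcal{C};B).$$
   Context: **The category $\mathcal{C}$.** $\mathcal{C}={}_H^H\mathcal{YD}$ is the category of left-left Yetter-Drinfel'd $H$-modules: left $H$-modules and left $H$-comodules $M$ with $h_{(1)}m_{[-1]}\otimes h_{(2)}\cdot m_{[0]}=(h_{(1)}\cdot m)_{[-1]}h_{(2)}\otimes(h_{(1)}\cdot m)_{[0]}$; morphisms are the $H$-linear and $H$-colinear maps. It is braided monoidal (diagonal structures, unit $I=k$) with $\Phi_{M,N}(m\otimes n)=n_{[0]}\otimes S_H^{-1}(n_{[-1]})\cdot m$. $\operatorname{Aut}(\mathcal{C};B)$ is the group of Hopf algebra automorphisms of $B$ in $\mathcal{C}$. The structure of $B$ is $\nabla,\eta,\Delta,\varepsilon,S$. An object's name also denotes its identity morphism. **Yetter-Drinfel'd modules over $B$ in $\mathcal{C}$.** Objects of ${}_B^B\mathcal{YD}(\mathcal{C})$ are $M\in\mathcal{C}$ with a left $B$-action $\mu_M$ and left $B$-coaction $\lambda_M$ in $\mathcal{C}$ such that $$(\nabla\otimes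 M)(B\otimes\Phi_{M,B})(\lambda_M\mu_M\otimes B)(B\otimes\Phi_{B,M})(\Delta\otimes M)=(\nabla\otimes\mu_M)(B\otimes\Phi_{B,B}\otimes M)(\Delta\otimes\lambda_M).$$ Morphisms are $B$-linear and $B$-colinear morphisms in $\mathcal{C}$. The tensor product $\bar\otimes$ has the (co)diagonal structures (formed with $\Phi$), and the braiding is $\Psi_{M,N}=(N\otimes\mu_M)(\Phi_{N,B}^{-1}\otimes M)(S^{-1}\otimes N\otimes M)(\lambda_N\otimes M)\Phi_{N,M}^{-1}$. **Quantum Brauer group.** $\operatorname{BQ}(\mathcal{C};B)$ is the Brauer group of ${}_B^B\mathcal{YD}(\mathcal{C})$. The algebra $A\bar\otimes A'$ has multiplication $(\nabla_A\otimes\nabla_{A'})(A\otimes\Psi_{A',A}\otimes A')$, and the opposite algebra $\overline{A}$ of $A$ has multiplication $\nabla_A\Psi_{A,A}$. A nonzero finite-dimensional algebra $A$ in ${}_B^B\mathcal{YD}(\mathcal{C})$ is Azumaya if the maps $\overline F:A\bar\otimes\overline A\to\operatorname{End}(A)$, $\overline F(a\otimes b)(c)=\nabla(a\otimes\nabla\Psi(b\otimes c))$, and $\overline G:\overline A\bar\otimes A\to\overline{\operatorname{End}(A)}$, $\overline G(a\otimes b)(c)=\nabla(\nabla\Psi(c\otimes a)\otimes b)$, are isomorphisms. Azumaya algebras $A,A'$ are equivalent if $A\bar\otimes\operatorname{End}(M)\cong A'\bar\otimes\operatorname{End}(N)$ as algebras in ${}_B^B\mathcal{YD}(\mathcal{C})$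 for some nonzero finite-dimensional $M,N$ in that category. The product is induced by $\bar\otimes$, the unit is the class of the $\operatorname{End}(M)$, and $[A]^{-1}=[\overline A]$. For $M$ with $B$-action (corresponding algebra map $\theta:B\to\operatorname{End}(M)$) and $B$-coaction, $E=\operatorname{End}(M)$ has the $B$-action $$\nabla_E(\nabla_E\otimes E)(\theta\otimes E\otimes\theta)(B\otimes\Phi_{B,E})(B\otimes S\otimes E)(\Delta\otimes E)$$ and the $B$-coaction $\lambda_E$ determined by $$(B\otimes ev)(\lambda_E\otimes M)=(\nabla\Phi_{B,B}\otimes M)(B\otimes\lambda_M ev)(S^{-1}\otimes E\otimes M)(\Phi_{E,B}\otimes M)(E\otimes\lambda_M),$$ where $ev:E\otimes M\to M$ is evaluation. **The map $\Pi$.** For $\alpha\in\operatorname{Aut}(\mathcal{C};B)$, $B_\alpha=B$ as an object of $\mathcal{C}$, with $B$-action $\nabla\Phi_{B,B}(S^{-1}\otimes\nabla(\alpha\otimes B))(\Delta\otimes B)$ and $B$-coaction $\lambda_{B_\alpha}=(S\otimes B)\Phi_{B,B}^{-1}\Delta$. The object $B_\alpha$ itself need not be Yetter-Drinfel'd over $B$, but $E_\alpha=\operatorname{End}(B_\alpha)$, with the $B$-action $\nabla_{E_\alpha}(\nabla_{E_\alpha}\otimes E_\alpha)(\theta_\alpha\otimes E_\alpha\otimes\theta_\alpha)(B\otimes\Phi_{B,E_\alpha})(B\otimes S\otimes E_\alpha)(\Delta\otimes E_\alpha)$, where $\theta_\alpha:B\to E_\alpha$ is the algebra map corresponding to the $B$-action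 on $B_\alpha$, and with the $B$-coaction $\lambda_{E_\alpha}$ determined by $(B\otimes ev)(\lambda_{E_\alpha}\otimes B_\alpha)=(\nabla\Phi_{B,B}\otimes B_\alpha)(B\otimes\lambda_{B_\alpha}ev)(S^{-1}\otimes E_\alpha\otimes B_\alpha)(\Phi_{E_\alpha,B}\otimes B_\alpha)(E_\alpha\otimes\lambda_{B_\alpha})$, where $ev:E_\alpha\otimes B_\alpha\to B_\alpha$ is evaluation, is an algebra in ${}_B^B\mathcal{YD}(\mathcal{C})$, and $\Pi(\alpha)=[\operatorname{End}(B_{\alpha^{-1}})]$. **The Drinfel'd double.** $B^*$ is the dual of $B$ with evaluation $ev:B^*\otimes B\to I$, and $\overline{ev}=ev\,\Phi_{B,B^*}$. Its product and coproduct are given by $ev(\nabla_{B^*}\otimes B)=(ev\otimes ev)(B^*\otimes\Phi_{B^*,B}\otimes B)(B^*\otimes B^*\otimes\Delta)$ and $(ev\otimes ev)(B^*\otimes\Phi_{B^*,B}\otimes B)(\Delta_{B^*}\otimes B\otimes B)=ev(B^*\otimes\nabla)$. $(B^{op})^*$ is $B^*$ as an algebra, with coproduct $\Phi_{B^*,B^*}^{-1}\Delta_{B^*}$. Define $\triangleright:B\otimes(B^{op})^*\to(B^{op})^*$ and $\triangleleft:B\otimes(B^{op})^*\to B$ by $$\overline{ev}(B\otimes\triangleright)=\overline{ev}\big(\nabla\Phi_{B,B}(\nabla\otimes S^{-1})(B\otimes\Delta)\otimes B^*\big),$$ $$\triangleleft=(B\otimes\overline{ev})(B\otimes\nabla\Phi_{B,B}\otimes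 B^* )(\Phi_{B,B}^{-1}\otimes S^{-1}\otimes B^* )((\Delta\otimes B)\Delta\otimes B^* ).$$ $D(B)=(B^{op})^*\bowtie B$ is the Hopf algebra in $\mathcal{C}$ on $B^*\otimes B$ with codiagonal coproduct, componentwise unit and counit, and product $$(\nabla_{B^*}\otimes\nabla)(B^*\otimes\triangleright\otimes\triangleleft\otimes B)(B^*\otimes B\otimes\Phi_{B,B^*}\otimes B^*\otimes B)(B^*\otimes\Delta\otimes\Delta_{(B^{op})^*}\otimes B).$$ **Group-likes and $\Theta$.** For a finite Hopf algebra $X$, $G(X)$ is the group of coalgebra morphisms $I\to X$ (equivalently algebra morphisms $X^*\to I$) under convolution. For $g\in G(B)$ (as $I\to B$) and $\lambda\in G(B^* )$ (as an algebra map $B\to I$), put $\bar g=\nabla(\nabla\otimes B)(g\otimes B\otimes g^{-1})$ and $\bar\lambda=(\lambda\otimes B\otimes\lambda^{-1})(\Delta\otimes B)\Delta$, with convolution inverses $g^{-1},\lambda^{-1}$. Identify $G(D(B))\cong G(B^* )\times G(B)$ via $(\lambda,g)\mapsto(\lambda^*\otimes g:I\to B^*\otimes B)$, where $\lambda^*:I\to B^*$ corresponds to $\lambda$. Then $\Theta(\lambda,g)=\bar g\,\bar\lambda$. The map $G(D(B)^* )\to G(D(B))$ sends an algebra morphism $D(B)\to I$, with restriction $\lambda$ to $B$ and restriction to $B^*$ given by evaluation at the group-like $g$ of $B$, to $(\lambda,g)$.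
   Formalization: The map Θ is taken as Θ(λ,g) = ḡ·(λ⁻¹)‾ instead of ḡ·λ̄: with the stated conventions λ ↦ λ̄ reverses products (e.g. H = k, B = k^{S₃}), so the literal Θ is not a group homomorphism; its image in Aut(C;B) is unchanged. *)

(* Defs.v *)
From HB Require Import structures.
From mathcomp Require Import all_boot all_order all_algebra sesquilinear.
From mathcomp Require Import boolp classical_sets.

Set Implicit Arguments.
Unset Strict Implicit.
Unset Printing Implicit Defensive.

Import GRing.Theory.
Local Open Scope ring_scope.
Local Open Scope quotient_scope.

Section LinMap.
Variables (k : fieldType).
Implicit Types U V W : lmodType k.

Definition LinMap U V : Type := {linear U -> V}.
HB.instance Definition _ U V := gen_eqMixin (LinMap U V).
HB.instance Definition _ U V := gen_choiceMixin (LinMap U V).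

Definition mkLin U V (f : U -> V) (fl : linear f) : {linear U -> V} :=
  HB.pack f (GRing.isLinear.Build k U V *:%R f fl).

Lemma lin_ext U V (f g : {linear U -> V}) : f =1 g -> f = g.
Proof.
case: f => f [[fN] [fZ]]; case: g => g [[gN] [gZ]] /= /funext fg.
subst g; congr GRing.Linear.Pack; congr GRing.Linear.Class.
  by congr GRing.isNmodMorphism.Axioms_; exact: Prop_irrelevance.
by congr GRing.isScalable.Axioms_; exact: Prop_irrelevance.
Qed.

Section HomLmod.
Variables U V : lmodType k.

Fact hzero_lin : linear (fun _ : U => 0 : V).
Proof. by move=> a x y; rewrite scaler0 addr0. Qed.
Fact hadd_lin (f g : LinMap U V) : linear (fun x => f x + g x).
Proof. by move=> a x y; rewrite !linearP scalerDr addrACA. Qed.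
Fact hopp_lin (f : LinMap U V) : linear (fun x => - f x).
Proof. by move=> a x y; rewrite linearP opprD scalerN. Qed.
Fact hscale_lin (c : k) (f : LinMap U V) : linear (fun x => c *: f x).
Proof. by move=> a x y; rewrite linearP scalerDr !scalerA mulrC. Qed.

Definition hzero : LinMap U V := mkLin hzero_lin.
Definition hadd (f g : LinMap U V) : LinMap U V := mkLin (hadd_lin f g).
Definition hopp (f : LinMap U V) : LinMap U V := mkLin (hopp_lin f).
Definition hscale (c : k) (f : LinMap U V) : LinMap U V := mkLin (hscale_lin c f).

Fact haddA : associative hadd.
Proof. by move=> f g h; apply: lin_ext => x /=; rewrite addrA. Qed.
Fact haddC : commutative hadd.
Proof. by move=> f g; apply: lin_ext => x /=; rewrite addrC. Qed.
Fact hadd0 : left_id hzero hadd.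
Proof. by move=> f; apply: lin_ext => x /=; rewrite add0r. Qed.
Fact haddN : left_inverse hzero hopp hadd.
Proof. by move=> f; apply: lin_ext => x /=; rewrite addNr. Qed.
HB.instance Definition _ :=
  GRing.isZmodule.Build (LinMap U V) haddA haddC hadd0 haddN.

Fact hscaleA a b (f : LinMap U V) : hscale a (hscale b f) = hscale (a * b) f.
Proof. by apply: lin_ext => x /=; rewrite scalerA. Qed.
Fact hscale1 : left_id 1 hscale.
Proof. by move=> f; apply: lin_ext => x /=; rewrite scale1r. Qed.
Fact hscaleDr : right_distributive hscale +%R.
Proof. by move=> a f g; apply: lin_ext => x /=; rewrite scalerDr. Qed.
Fact hscaleDl (f : LinMap U V) : {morph hscale^~ f : a b / a + b}.
Proof. by move=> a b; apply: lin_ext => x /=; rewrite scalerDl. Qed.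
HB.instance Definition _ := GRing.Zmodule_isLmodule.Build k (LinMap U V)
  hscaleA hscale1 hscaleDr hscaleDl.
End HomLmod.

Definition lid U : {linear U -> U} := mkLin (fun a x y => erefl (a *: x + y)).
Definition lcomp U V W (g : {linear V -> W}) (f : {linear U -> V}) :
  {linear U -> W} := mkLin (fun a x y =>
    etrans (congr1 g (linearP f a x y)) (linearP g a (f x) (f y))).

(* the unique element of P when there is one *)
Definition the U V (P : set (LinMap U V)) : {linear U -> V} := xget (0 : LinMap U V) P.

(* inverse of a bijective linear map *)
Definition linv U V (f : {linear U -> V}) : {linear V -> U} :=
  the [set g | cancel f g /\ cancel g f].

Definition findim V : Prop := exists n, inhabited (vector_axiom_def n V).
Definition nonzero V : Prop := exists x : V, x != 0.

End LinMap.

(* Two finite sums of pure tensors are identified when no bilinear map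
   separates them. *)
Section Tensor.
Variables (k : fieldType) (U V : lmodType k).
Local Notation bilin f := (bilinear_for *:%R *:%R f).

Definition fsum (W : lmodType k) (f : U -> V -> W) (s : seq (U * V)) : W :=
  \sum_(p <- s) f p.1 p.2.

Definition teq (s t : seq (U * V)) : bool :=
  `[< forall (W : lmodType k) (f : U -> V -> W), bilin f -> fsum f s = fsum f t >].

Fact teq_equiv : equiv_class_of teq.
Proof.
split=> [s|s t|t s u]; first exact/asboolP.
  by apply/asboolP/asboolP => st W f fb; rewrite st.
by move=> /asboolP ts /asboolP su; apply/asboolP => W f fb; rewrite ts ?su.
Qed.
Canonical teq_canonical := EquivRelPack teq_equiv.

Definition tens : Type := {eq_quot teq}.
HB.instance Definition _ := Choice.on tens.
HB.instance Definition _ := EqQuotient.on tens.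

Definition teval (W : lmodType k) (f : U -> V -> W) (t : tens) : W :=
  fsum f (repr t).

Lemma teval_pi (W : lmodType k) (f : U -> V -> W) s :
  bilin f -> teval f (\pi_tens s) = fsum f s.
Proof.
move=> fb; have /eqmodP/asboolP : repr (\pi_tens s) = s %[mod tens] by rewrite reprK.
by apply.
Qed.

Lemma teval_ext (s t : tens) :
  (forall (W : lmodType k) (f : U -> V -> W), bilin f -> teval f s = teval f t) ->
  s = t.
Proof.
move=> st; rewrite -[s]reprK -[t]reprK; apply/eqmodP/asboolP => W f fb.
exact: st.
Qed.

Definition tpi (s : seq (U * V)) : tens := \pi_tens s.
Definition tzero : tens := tpi [::].
Definition tadd (s t : tens) : tens := tpi (repr s ++ repr t).
Definition tscale (a : k) (s : tens) : tens :=
  tpi [seq (a *: p.1, p.2) | p <- repr s].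
Definition topp (s : tens) : tens := tscale (-1) s.

Section Eval.
Variables (W : lmodType k) (f : U -> V -> W) (fb : bilin f).

Lemma teval0 : teval f tzero = 0.
Proof. by rewrite teval_pi // /fsum big_nil. Qed.
Lemma tevalD s t : teval f (tadd s t) = teval f s + teval f t.
Proof. by rewrite teval_pi // /fsum big_cat. Qed.
Lemma tevalZ a s : teval f (tscale a s) = a *: teval f s.
Proof.
rewrite teval_pi // /teval /fsum big_map scaler_sumr; apply: eq_bigr => p _ /=.
exact: (GRing.scalable_linear (fb.1 p.2)).
Qed.
End Eval.

Let tevalE W f fb := (@teval0 W f fb, @tevalD W f fb, @tevalZ W f fb).

Fact taddA : associative tadd.
Proof. by move=> r s t; apply: teval_ext => W f fb; rewrite !tevalE // addrA. Qed.
Fact taddC : commutative tadd.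
Proof. by move=> s t; apply: teval_ext => W f fb; rewrite !tevalE // addrC. Qed.
Fact tadd0 : left_id tzero tadd.
Proof. by move=> s; apply: teval_ext => W f fb; rewrite !tevalE // add0r. Qed.
Fact taddN : left_inverse tzero topp tadd.
Proof.
by move=> s; apply: teval_ext => W f fb; rewrite !tevalE // scaleN1r addNr.
Qed.
HB.instance Definition _ := GRing.isZmodule.Build tens taddA taddC tadd0 taddN.

Fact tscaleA a b s : tscale a (tscale b s) = tscale (a * b) s.
Proof. by apply: teval_ext => W f fb; rewrite !tevalE // scalerA. Qed.
Fact tscale1 : left_id 1 tscale.
Proof. by move=> s; apply: teval_ext => W f fb; rewrite !tevalE // scale1r. Qed.
Fact tscaleDr : right_distributive tscale +%R.
Proof.
by move=> a s t; apply: teval_ext => W f fb; rewrite !tevalE // scalerDr.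
Qed.
Fact tscaleDl s : {morph tscale^~ s : a b / a + b}.
Proof.
by move=> a b; apply: teval_ext => W f fb; rewrite !tevalE // scalerDl.
Qed.
HB.instance Definition _ := GRing.Zmodule_isLmodule.Build k tens
  tscaleA tscale1 tscaleDr tscaleDl.

Definition pure (u : U) (v : V) : tens := tpi [:: (u, v)].

Lemma teval_pure (W : lmodType k) (f : U -> V -> W) u v :
  bilin f -> teval f (pure u v) = f u v.
Proof. by move=> fb; rewrite teval_pi // /fsum big_seq1. Qed.

Lemma pure_bilin : bilin pure.
Proof.
split=> [v|u] a x y; apply: teval_ext => W f fb;
  rewrite tevalD // tevalZ // !teval_pure //.
  by rewrite (fb.1 v).
by rewrite (fb.2 u).
Qed.

Fact teval_lin (W : lmodType k) (f : U -> V -> W) (fb : bilin f) :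
  linear (teval f).
Proof. by move=> a s t; rewrite -tevalZ // -tevalD. Qed.

Definition tlift (W : lmodType k) (f : U -> V -> W) (fb : bilin f) :
  {linear tens -> W} := mkLin (teval_lin fb).

Lemma tlift_pure (W : lmodType k) (f : U -> V -> W) (fb : bilin f) u v :
  tlift fb (pure u v) = f u v.
Proof. exact: teval_pure. Qed.

Lemma tens_ext (W : lmodType k) (f g : {linear tens -> W}) :
  (forall u v, f (pure u v) = g (pure u v)) -> f =1 g.
Proof.
move=> fg t; suff -> : t = \sum_(p <- repr t) pure p.1 p.2.
  by rewrite !linear_sum; apply: eq_bigr => p _; exact: fg.
apply: teval_ext => X h hb; rewrite -[RHS]/(tlift hb _) linear_sum.
by apply: eq_bigr => p _; rewrite tlift_pure.
Qed.

End Tensor.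

(* With this hint [:: U; V] elaborates its entries at the expected type
   lmodType k, inserting coercions and canonical structures. *)
Arguments cons {A} & _ _ : rename.

(* A word [:: U1; ..; Un] stands for the tensor product U1 (x) (.. (x) Un), the
   empty word for k.  Tensoring maps of words concatenates the words, so that
   [f \ox g] is strictly associative on concrete words and the associators only
   appear in [tjoin] and [tsplit]. *)
Section Words.
Variables (k : fieldType).
Implicit Types U V W : lmodType k.
Local Notation bilin f := (bilinear_for *:%R *:%R f).

Fact tmap_bilin U V U' V' (f : {linear U -> U'}) (g : {linear V -> V'}) :
  bilin (fun u v => pure (f u) (g v)).
Proof.
split=> [v|u] a x y; rewrite linearP.
  exact: (pure_bilin U' V').1.
exact: (pure_bilin U' V').2.
Qed.
Definition tmap U V U' V' (f : {linear U -> U'}) (g : {linear V -> V'}) :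
  {linear tens U V -> tens U' V'} := tlift (tmap_bilin f g).

Fact tflip_bilin U V : bilin (fun (u : U) (v : V) => pure v u).
Proof. by split=> [v|u]; [exact: (pure_bilin V U).2|exact: (pure_bilin V U).1]. Qed.
Definition tflip U V : {linear tens U V -> tens V U} := tlift (tflip_bilin U V).

Fact lunit_bilin V : bilin (fun (a : k^o) (v : V) => a *: v).
Proof.
split=> [v|b] a x y; first by rewrite scalerDl; congr (_ + _); exact/esym/scalerA.
rewrite scalerDr; congr (_ + _).
by rewrite [LHS]scalerA [RHS]scalerA [_ * a]mulrC.
Qed.
Definition lunit V : {linear tens k^o V -> V} := tlift (lunit_bilin V).
Definition lunitV V : {linear V -> tens k^o V} := mkLin ((pure_bilin k^o V).2 1).

Definition runit V : {linear tens V k^o -> V} := lcomp (lunit V) (tflip V k^o).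
Definition runitV V : {linear V -> tens V k^o} := lcomp (tflip k^o V) (lunitV V).

Fact assoc1_bilin U V W (w : W) :
  bilin (fun (u : U) (v : V) => pure u (pure v w)).
Proof.
split=> [v|u] a x y; first exact: (pure_bilin U _).1.
by rewrite (pure_bilin V W).1 (pure_bilin U _).2.
Qed.
Fact assoc_bilin U V W :
  bilin (fun (t : tens U V) (w : W) => tlift (assoc1_bilin U V w) t).
Proof.
split=> [w|t] a x y; first by rewrite linearP.
pose g := hadd (hscale a (tlift (assoc1_bilin U V x))) (tlift (assoc1_bilin U V y)).
rewrite -[RHS]/(g t); apply: tens_ext => u v; rewrite tlift_pure.
rewrite -[RHS]/(a *: tlift (assoc1_bilin U V x) _ + tlift (assoc1_bilin U V y) _).
rewrite !tlift_pure.
by rewrite (pure_bilin V W).2 (pure_bilin U _).2.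
Qed.
Definition assoc U V W : {linear tens (tens U V) W -> tens U (tens V W)} :=
  tlift (assoc_bilin U V W).
Definition assocV U V W : {linear tens U (tens V W) -> tens (tens U V) W} :=
  lcomp (tflip W (tens U V)) (lcomp (tmap (lid W) (tflip V U))
    (lcomp (assoc W V U) (lcomp (tmap (tflip V W) (lid U)) (tflip U (tens V W))))).

Fixpoint tword (s : seq (lmodType k)) : lmodType k :=
  match s with
  | [::] => k^o
  | U :: s' => match s' with [::] => U | _ :: _ => tens U (tword s') end
  end.

Definition wmap (a b : seq (lmodType k)) : Type := {linear tword a -> tword b}.

Definition hid a : wmap a a := lid (tword a).
Definition hcomp a b c (g : wmap b c) (f : wmap a b) : wmap a c := lcomp g f.

Fixpoint tjoin (a r : seq (lmodType k)) :
    {linear tens (tword a) (tword r) -> tword (a ++ r)} :=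
  match a return {linear tens (tword a) (tword r) -> tword (a ++ r)} with
  | [::] => lunit (tword r)
  | U :: a' =>
    match a' return {linear tens (tword a') (tword r) -> tword (a' ++ r)} ->
                    {linear tens (tword (U :: a')) (tword r) -> tword (U :: (a' ++ r))} with
    | [::] => fun _ =>
      match r return {linear tens U (tword r) -> tword (U :: r)} with
      | [::] => runit U
      | V :: r' => lid (tens U (tword (V :: r')))
      end
    | V :: a'' => fun rec => lcomp (tmap (lid U) rec) (assoc U (tword (V :: a'')) (tword r))
    end (tjoin a' r)
  end.

Fixpoint tsplit (a r : seq (lmodType k)) :
    {linear tword (a ++ r) -> tens (tword a) (tword r)} :=
  match a return {linear tword (a ++ r) -> tens (tword a) (tword r)} with
  | [::] => lunitV (tword r)
  | U :: a' =>
    match a' return {linear tword (a' ++ r) -> tens (tword a') (tword r)} ->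
                    {linear tword (U :: (a' ++ r)) -> tens (tword (U :: a')) (tword r)} with
    | [::] => fun _ =>
      match r return {linear tword (U :: r) -> tens U (tword r)} with
      | [::] => runitV U
      | V :: r' => lid (tens U (tword (V :: r')))
      end
    | V :: a'' => fun rec => lcomp (assocV U (tword (V :: a'')) (tword r)) (tmap (lid U) rec)
    end (tsplit a' r)
  end.

Definition hox a b c d (f : wmap a b) (g : wmap c d) : wmap (a ++ c) (b ++ d) :=
  lcomp (tjoin b d) (lcomp (tmap f g) (tsplit a c)).

Definition idm (U : lmodType k) : wmap [:: U] [:: U] := hid [:: U].
Definition flip (U V : lmodType k) : wmap [:: U; V] [:: V; U] := tflip U V.

(* tword [:: tens U V] and tword [:: U; V] are the same space, but [ungrp] is needed to
   change the bracketing inside longer words. *)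
Definition grp (U V : lmodType k) : wmap [:: U; V] [:: tens U V] := lid (tens U V).
Definition ungrp (U V : lmodType k) : wmap [:: tens U V] [:: U; V] := lid (tens U V).

Fact ev_bilin U V : bilin (fun (f : LinMap U V) (u : U) => f u).
Proof. by split=> [u|f] a x y //; rewrite linearP. Qed.
Definition ev U V : wmap [:: LinMap U V; U] [:: V] := tlift (ev_bilin U V).

Fact curry1_lin U V W (f : {linear tens U V -> W}) (u : U) :
  linear (fun v => f (pure u v)).
Proof. by move=> a x y; rewrite (pure_bilin U V).2 linearP. Qed.
Fact curry_lin U V W (f : {linear tens U V -> W}) :
  linear (fun u => mkLin (curry1_lin f u) : LinMap V W).
Proof.
by move=> a x y; apply: lin_ext => v /=; rewrite (pure_bilin U V).1 linearP.
Qed.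
Definition curry a U V (f : wmap (a ++ [:: U]) [:: V]) : wmap a [:: LinMap U V] :=
  mkLin (curry_lin (lcomp f (tjoin a [:: U]))).

End Words.

Arguments idm {k} U.
Arguments flip {k} U V.
Arguments grp {k} U V.
Arguments ungrp {k} U V.
Arguments ev {k} U V.
Arguments curry {k} a {U V} f.

Declare Scope word_scope.
Delimit Scope word_scope with W.
Notation "f \ox g" := (hox f g) (at level 40, left associativity) : word_scope.
Notation "g \oc f" := (hcomp g f) (at level 50, left associativity) : word_scope.
Local Open Scope word_scope.

Record bialg (k : fieldType) (X : lmodType k) := Bialg {
  bmul : wmap [:: X; X] [:: X];
  bone : wmap [::] [:: X];
  bcomul : wmap [:: X] [:: X; X];
  bcounit : wmap [:: X] [::] }.

Record hopf (k : fieldType) (X : lmodType k) := Hopf {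
  hopf_bialg :> bialg X;
  antip : wmap [:: X] [:: X] }.

Section Laws.
Variables (k : fieldType) (X : lmodType k).

Definition is_algebra (m : wmap [:: X; X] [:: X]) (u : wmap [::] [:: X]) : Prop :=
  [/\ m \oc (m \ox idm X) =1 m \oc (idm X \ox m),
      m \oc (u \ox idm X) =1 idm X & m \oc (idm X \ox u) =1 idm X].

Definition is_coalgebra (d : wmap [:: X] [:: X; X]) (e : wmap [:: X] [::]) : Prop :=
  [/\ (d \ox idm X) \oc d =1 (idm X \ox d) \oc d,
      (e \ox idm X) \oc d =1 idm X & (idm X \ox e) \oc d =1 idm X].

Variable (tXX : wmap [:: X; X] [:: X; X]) (h : hopf X).
Local Notation nab := (bmul h).
Local Notation eta := (bone h).
Local Notation Del := (bcomul h).
Local Notation eps := (bcounit h).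
Local Notation S := (antip h).

Definition is_hopf : Prop :=
  [/\ is_algebra nab eta, is_coalgebra Del eps,
      [/\ Del \oc nab =1 (nab \ox nab) \oc (idm X \ox tXX \ox idm X) \oc (Del \ox Del),
          Del \oc eta =1 eta \ox eta,
          eps \oc nab =1 eps \ox eps & eps \oc eta =1 hid [::]],
      nab \oc (S \ox idm X) \oc Del =1 eta \oc eps &
      nab \oc (idm X \ox S) \oc Del =1 eta \oc eps].

Section Modules.
Variables M N : lmodType k.
Variables (tXM : wmap [:: X; M] [:: M; X]) (tMX : wmap [:: M; X] [:: X; M]).
Implicit Types (mu : wmap [:: X; M] [:: M]) (la : wmap [:: M] [:: X; M]).

Definition is_action mu : Prop :=
  mu \oc (nab \ox idm M) =1 mu \oc (idm X \ox mu) /\ mu \oc (eta \ox idm M) =1 idm M.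

Definition is_coaction la : Prop :=
  (Del \ox idm M) \oc la =1 (idm X \ox la) \oc la /\ (eps \ox idm M) \oc la =1 idm M.

Definition yd_condition mu la : Prop :=
  (nab \ox idm M) \oc (idm X \ox tMX) \oc ((la \oc mu) \ox idm X)
    \oc (idm X \ox tXM) \oc (Del \ox idm M)
  =1 (nab \ox mu) \oc (idm X \ox tXX \ox idm M) \oc (Del \ox la).

Definition diag_act mu (nu : wmap [:: X; N] [:: N]) : wmap [:: X; tens M N] [:: tens M N] :=
  (mu \ox nu) \oc (idm X \ox tXM \ox idm N) \oc (Del \ox idm M \ox idm N)
  : wmap [:: X; M; N] [:: M; N].

Definition diag_coact la (ka : wmap [:: N] [:: X; N])
  : wmap [:: tens M N] [:: X; tens M N] :=
  (nab \ox idm M \ox idm N) \oc (idm X \ox tMX \ox idm N) \oc (la \ox ka)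
  : wmap [:: M; N] [:: X; M; N].

End Modules.

(* the coaction on E = LinMap M N determined by the coactions of M and N *)
Definition hom_coact (M N : lmodType k)
    (tEX : wmap [:: LinMap M N; X] [:: X; LinMap M N])
    (la : wmap [:: M] [:: X; M]) (ka : wmap [:: N] [:: X; N])
  : wmap [:: LinMap M N] [:: X; LinMap M N] :=
  the [set rho : wmap [:: LinMap M N] [:: X; LinMap M N] |
    (idm X \ox ev M N) \oc (rho \ox idm M)
    =1 ((nab \oc tXX) \ox idm N) \oc (idm X \ox (ka \oc ev M N))
       \oc (linv S \ox idm (LinMap M N) \ox idm M)
       \oc (tEX \ox idm M) \oc (idm (LinMap M N) \ox la)].

End Laws.

Record ydobj (k : fieldType) (H : lmodType k) := YDObj {
  ycar :> lmodType k;
  yact : wmap [:: H; ycar] [:: ycar];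
  ycoact : wmap [:: ycar] [:: H; ycar] }.

Section CatC.
Variables (k : fieldType) (H : lmodType k) (hH : hopf H).
Implicit Types M N : ydobj H.

Definition is_yd M : Prop :=
  [/\ is_action hH (yact M), is_coaction hH (ycoact M) &
      yd_condition (flip H H) hH (flip H M) (flip M H) (yact M) (ycoact M)].

Definition is_morC M N (f : wmap [:: M] [:: N]) : Prop :=
  f \oc yact M =1 yact N \oc (idm H \ox f) /\ ycoact N \oc f =1 (idm H \ox f) \oc ycoact M.

Definition tensC M N : ydobj H :=
  YDObj (diag_act hH (flip H M) (yact M) (yact N))
        (diag_coact hH (flip M H) (ycoact M) (ycoact N)).

Definition unitC : ydobj H :=
  @YDObj k H k^o (bcounit hH \ox idm k^o) (bone hH \ox idm k^o).

(* m (x) n |-> n_[0] (x) S_H^-1(n_[-1]) . m *)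
Definition Phi M N : wmap [:: M; N] [:: N; M] :=
  (idm N \ox yact M) \oc (flip H N \ox idm M) \oc (linv (antip hH) \ox idm N \ox idm M)
  \oc (ycoact N \ox idm M) \oc flip M N.

(* the internal Hom: the structure on linear maps for which evaluation is a
   morphism, i.e. (h . f)(m) = h_(1) . f(S_H(h_(2)) . m) and
   f_[-1] (x) f_[0](m) = f(m_[0])_[-1] S_H^-1(m_[-1]) (x) f(m_[0])_[0] *)
Definition homC M N : ydobj H :=
  @YDObj k H (LinMap M N)
    (curry [:: H; LinMap M N]
       (yact N \oc (idm H \ox ev M N) \oc (idm H \ox idm (LinMap M N) \ox yact M)
        \oc (idm H \ox idm (LinMap M N) \ox antip hH \ox idm M)
        \oc (idm H \ox flip H (LinMap M N) \ox idm M)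
        \oc (bcomul hH \ox idm (LinMap M N) \ox idm M)))
    (hom_coact (flip H H) hH (flip (LinMap M N) H) (ycoact M) (ycoact N)).

Definition dualC M : ydobj H := homC M unitC.
Definition evC M : wmap [:: dualC M; M] [::] := ev M k^o.

Definition is_hopfC (B : ydobj H) (hB : hopf B) : Prop :=
  [/\ is_hopf (Phi B B) hB,
      @is_morC (tensC B B) B (bmul hB) /\ @is_morC unitC B (bone hB),
      @is_morC B (tensC B B) (bcomul hB) /\ @is_morC B unitC (bcounit hB) &
      @is_morC B B (antip hB)].

Definition grouplike (X : ydobj H) (b : bialg X) : set (wmap [::] [:: X]) :=
  [set g : wmap [::] [:: X] |
    [/\ @is_morC unitC X g, bcomul b \oc g =1 g \ox g & bcounit b \oc g =1 hid [::]]].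

Definition convolution (X : lmodType k) (b : bialg X) (g h : wmap [::] [:: X]) :
  wmap [::] [:: X] := bmul b \oc (g \ox h).

Definition dual_bialg (X : ydobj H) (b : bialg X) : bialg (dualC X) :=
  @Bialg k (dualC X)
    (curry [:: dualC X; dualC X] ((evC X \ox evC X)
       \oc (idm (dualC X) \ox Phi (dualC X) X \ox idm X)
       \oc (idm (dualC X) \ox idm (dualC X) \ox bcomul b)))
    (curry [::] (bcounit b))
    (the [set d : wmap [:: dualC X] [:: dualC X; dualC X] |
       (evC X \ox evC X) \oc (idm (dualC X) \ox Phi (dualC X) X \ox idm X)
         \oc (d \ox idm X \ox idm X)
       =1 evC X \oc (idm (dualC X) \ox bmul b)])
    (evC X \oc (idm (dualC X) \ox bone b)).

Variables (B : ydobj H) (hB : hopf B).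
Local Notation nab := (bmul hB).
Local Notation eta := (bone hB).
Local Notation Del := (bcomul hB).
Local Notation eps := (bcounit hB).
Local Notation S := (antip hB).
Local Notation Bd := (dualC B).
Local Notation hBd := (dual_bialg hB).

Definition evbar : wmap [:: B; Bd] [::] := evC B \oc Phi B Bd.

Definition Del_Bopd : wmap [:: Bd] [:: Bd; Bd] := linv (Phi Bd Bd) \oc bcomul hBd.

Definition trr : wmap [:: B; Bd] [:: Bd] :=
  the [set t : wmap [:: B; Bd] [:: Bd] |
    evbar \oc (idm B \ox t)
    =1 evbar \oc ((nab \oc Phi B B \oc (nab \ox linv S) \oc (idm B \ox Del)) \ox idm Bd)].

Definition trl : wmap [:: B; Bd] [:: B] :=
  (idm B \ox evbar) \oc (idm B \ox (nab \oc Phi B B) \ox idm Bd)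
  \oc (linv (Phi B B) \ox linv S \ox idm Bd) \oc (((Del \ox idm B) \oc Del) \ox idm Bd).

Definition DB : ydobj H := tensC Bd B.

Definition DB_mul : wmap [:: Bd; B; Bd; B] [:: Bd; B] :=
  (bmul hBd \ox nab) \oc (idm Bd \ox trr \ox trl \ox idm B)
  \oc (idm Bd \ox idm B \ox Phi B Bd \ox idm Bd \ox idm B)
  \oc (idm Bd \ox Del \ox Del_Bopd \ox idm B).

Definition DB_comul : wmap [:: Bd; B] [:: Bd; B; Bd; B] :=
  (idm Bd \ox Phi Bd B \ox idm B) \oc (Del_Bopd \ox Del).

Definition hDB : bialg DB :=
  @Bialg k DB
    (grp Bd B \oc DB_mul \oc (ungrp Bd B \ox ungrp Bd B))
    (grp Bd B \oc (bone hBd \ox eta))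
    ((grp Bd B \ox grp Bd B) \oc DB_comul \oc ungrp Bd B)
    ((bcounit hBd \ox eps) \oc ungrp Bd B).

End CatC.

Record bydobj (k : fieldType) (H B : lmodType k) := BYDObj {
  bobj :> ydobj H;
  bact : wmap [:: B; bobj] [:: bobj];
  bcoact : wmap [:: bobj] [:: B; bobj] }.

(* an object with a multiplication and a unit; the axioms are [is_algB] *)
Record algB (k : fieldType) (H B : lmodType k) := AlgB {
  aobj :> bydobj H B;
  amul : wmap [:: aobj; aobj] [:: aobj];
  aone : wmap [::] [:: aobj] }.

Section CatBYD.
Variables (k : fieldType) (H : lmodType k) (hH : hopf H).
Variables (B : ydobj H) (hB : hopf B).
Local Notation nab := (bmul hB).
Local Notation eta := (bone hB).
Local Notation Del := (bcomul hB).
Local Notation eps := (bcounit hB).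
Local Notation S := (antip hB).
Local Notation Phi := (Phi hH).
Local Notation obj := (bydobj H B).
Local Notation alg := (algB H B).

Definition is_byd (M : obj) : Prop :=
  [/\ is_yd hH M,
      is_morC (M := tensC hH B M) (N := M) (bact M) /\
      is_morC (M := M) (N := tensC hH B M) (bcoact M),
      is_action hB (bact M), is_coaction hB (bcoact M) &
      yd_condition (Phi B B) hB (Phi B M) (Phi M B) (bact M) (bcoact M)].

Definition is_morB (M N : obj) (f : wmap [:: M] [:: N]) : Prop :=
  [/\ is_morC (M := M) (N := N) f, f \oc bact M =1 bact N \oc (idm B \ox f) &
      bcoact N \oc f =1 (idm B \ox f) \oc bcoact M].

Definition tensB (M N : obj) : obj :=
  @BYDObj k H B (tensC hH M N)
    (diag_act hB (Phi B M) (bact M) (bact N))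
    (diag_coact hB (Phi M B) (bcoact M) (bcoact N)).

Definition unitB : obj :=
  @BYDObj k H B (unitC hH) (eps \ox idm k^o) (eta \ox idm k^o).

Definition Psi (M N : obj) : wmap [:: M; N] [:: N; M] :=
  (idm N \ox bact M) \oc (linv (Phi N B) \ox idm M) \oc (linv S \ox idm N \ox idm M)
  \oc (bcoact N \ox idm M) \oc linv (Phi N M).

Definition is_algB (A : alg) : Prop :=
  [/\ is_byd A, is_algebra (amul A) (aone A),
      is_morB (M := tensB A A) (N := A) (amul A) & is_morB (M := unitB) (N := A) (aone A)].

Definition alg_iso (A A' : alg) : Prop :=
  exists f : wmap [:: A] [:: A'],
    [/\ bijective f, is_morB (M := A) (N := A') f,
        f \oc amul A =1 amul A' \oc (f \ox f) & f \oc aone A =1 aone A'].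

Definition tensA (A A' : alg) : alg :=
  @AlgB k H B (tensB A A')
    (grp A A' \oc (amul A \ox amul A') \oc (idm A \ox Psi A' A \ox idm A')
     \oc (ungrp A A' \ox ungrp A A'))
    (grp A A' \oc (aone A \ox aone A')).

Definition oppA (A : alg) : alg := @AlgB k H B A (amul A \oc Psi A A) (aone A).

(* End(M) for M with a B-action and a B-coaction; M is not required to be
   Yetter-Drinfel'd over B, so that this covers both the End(M) of the
   equivalence relation and the algebras E_alpha. *)
Definition endA (M : obj) : alg :=
  let E := homC hH M M in
  let mulE : wmap [:: E; E] [:: E] :=
    curry [:: E; E] (ev M M \oc (idm E \ox ev M M)) in
  let theta : wmap [:: B] [:: E] := curry [:: B] (bact M) in
  @AlgB k H B
    (@BYDObj k H B E
       (mulE \oc (mulE \ox idm E) \oc (theta \ox idm E \ox theta) \oc (idm B \ox Phi B E)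
        \oc (idm B \ox S \ox idm E) \oc (Del \ox idm E))
       (hom_coact (Phi B B) hB (Phi E B) (bcoact M) (bcoact M)))
    mulE
    (curry [::] (idm M)).

Definition azF (A : alg) : wmap [:: tensA A (oppA A)] [:: endA A] :=
  curry [:: tensA A (oppA A)]
    (amul A \oc (idm A \ox (amul A \oc Psi A A)) \oc (ungrp A A \ox idm A)).

(* a (x) b (x) c is first brought to c (x) a (x) b by plain permutations *)
Definition azG (A : alg) : wmap [:: tensA (oppA A) A] [:: oppA (endA A)] :=
  curry [:: tensA (oppA A) A]
    (amul A \oc ((amul A \oc Psi A A) \ox idm A) \oc (flip A A \ox idm A)
     \oc (idm A \ox flip A A) \oc (ungrp A A \ox idm A)).

Definition azumaya (A : alg) : Prop :=
  [/\ is_algB A, nonzero A, findim A, bijective (azF A) & bijective (azG A)].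

Definition beq (A A' : alg) : Prop :=
  exists M N : obj,
    [/\ is_byd M /\ is_byd N, nonzero M /\ nonzero N, findim M /\ findim N &
        alg_iso (tensA A (endA M)) (tensA A' (endA N))].

End CatBYD.

(* a subset [gset] of a type [gtype] ([set gtype] would be too small for the
   classes of algebras), with a composition law and a unit *)
Record grpdata := GrpData {
  gtype : Type;
  gset : gtype -> Prop;
  gmul : gtype -> gtype -> gtype;
  gone : gtype }.

Arguments gset : clear implicits.
Arguments gmul : clear implicits.
Arguments gone : clear implicits.

Definition is_group (G : grpdata) : Prop :=
  [/\ forall x y, gset G x -> gset G y -> gset G (gmul G x y),
      forall x y z, gset G x -> gset G y -> gset G z ->
        gmul G x (gmul G y z) = gmul G (gmul G x y) z,
      gset G (gone G),
      forall x, gset G x -> gmul G (gone G) x = x /\ gmul G x (gone G) = x &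
      forall x, gset G x -> exists2 y, gset G y &
        gmul G x y = gone G /\ gmul G y x = gone G].

Definition is_hom (G K : grpdata) (f : gtype G -> gtype K) : Prop :=
  (forall x, gset G x -> gset K (f x)) /\
  (forall x y, gset G x -> gset G y -> f (gmul G x y) = gmul K (f x) (f y)).

Definition exact_at (G K L : grpdata) (f : gtype G -> gtype K) (g : gtype K -> gtype L) :
  Prop :=
  forall y, gset K y -> (g y = gone L <-> exists2 x, gset G x & f x = y).

(* 1 -> G1 -> G2 -> G3 -> G4 *)
Definition exact_seq (G1 G2 G3 G4 : grpdata)
    (f : gtype G1 -> gtype G2) (g : gtype G2 -> gtype G3) (h : gtype G3 -> gtype G4) :
  Prop :=
  [/\ [/\ is_group G1, is_group G2, is_group G3 & is_group G4],
      [/\ is_hom f, is_hom g & is_hom h],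
      forall x y, gset G1 x -> gset G1 y -> f x = f y -> x = y,
      exact_at f g & exact_at g h].

Section TheGroups.
Variables (k : fieldType) (H : lmodType k) (hH : hopf H).
Variables (B : ydobj H) (hB : hopf B).
Local Notation nab := (bmul hB).
Local Notation eta := (bone hB).
Local Notation Del := (bcomul hB).
Local Notation eps := (bcounit hB).
Local Notation S := (antip hB).
Local Notation Phi := (Phi hH).
Local Notation Bd := (dualC hH B).
Local Notation DB := (DB hH B).
Local Notation hDB := (hDB hH hB).
Local Notation alg := (algB H B).

Definition G_of (X : ydobj H) (b : bialg X) : grpdata :=
  @GrpData (wmap [::] [:: X]) (grouplike hH b) (convolution b) (bone b).

Definition G_DB : grpdata := G_of hDB.
Definition G_DBd : grpdata := G_of (dual_bialg hH hDB).

Definition is_autC (al : wmap [:: B] [:: B]) : Prop :=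
  [/\ bijective al, is_morC (M := B) (N := B) al,
      al \oc nab =1 nab \oc (al \ox al) /\ al \oc eta =1 eta,
      Del \oc al =1 (al \ox al) \oc Del /\ eps \oc al =1 eps & al \oc S =1 S \oc al].

Definition AutC : grpdata :=
  @GrpData (wmap [:: B] [:: B]) is_autC (fun al be => al \oc be) (idm B).

(* the class of an algebra among the Azumaya algebras *)
Definition brclass (A : alg) : alg -> Prop :=
  fun A' => azumaya hH hB A' /\ beq hH hB A' A.

Definition BQ : grpdata :=
  @GrpData (alg -> Prop)
    (fun c => exists2 A, azumaya hH hB A & c = brclass A)
    (fun c d X => exists A A', [/\ c A, d A' & brclass (tensA hH hB A A') X])
    (fun X => exists M : bydobj H B,
       [/\ is_byd hH hB M, nonzero M, findim M & brclass (endA hH hB M) X]).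

Definition Balpha (al : wmap [:: B] [:: B]) : bydobj H B :=
  @BYDObj k H B B
    (nab \oc Phi B B \oc (linv S \ox (nab \oc (al \ox idm B))) \oc (Del \ox idm B))
    ((S \ox idm B) \oc linv (Phi B B) \oc Del).

Definition Pi (al : gtype AutC) : gtype BQ := brclass (endA hH hB (Balpha (linv al))).

Implicit Types (la : wmap [:: B] [::]) (g : wmap [::] [:: B]).

(* The convolution inverses of a group-like g and of an algebra map la are
   S g and la S. *)
Definition conj_g g : wmap [:: B] [:: B] :=
  nab \oc (nab \ox idm B) \oc (g \ox idm B \ox (S \oc g)).

Definition conj_l la : wmap [:: B] [:: B] :=
  (la \ox idm B \ox (la \oc S)) \oc (Del \ox idm B) \oc Del.

(* the element of G(D(B)) identified with the pair (la, g), and back *)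
Definition dual_elt la : wmap [::] [:: Bd] := curry [::] la.
Definition pair_elt la g : wmap [::] [:: DB] := grp Bd B \oc (dual_elt la \ox g).
Definition elt_l (x : wmap [::] [:: DB]) : wmap [:: B] [::] :=
  evC hH B \oc (((idm Bd \ox eps) \oc ungrp Bd B \oc x) \ox idm B).
Definition elt_g (x : wmap [::] [:: DB]) : wmap [::] [:: B] :=
  (bcounit (dual_bialg hH hB) \ox idm B) \oc ungrp Bd B \oc x.

Definition incl (chi : gtype G_DBd) : gtype G_DB :=
  let f : wmap [:: DB] [::] := evC hH DB \oc (chi \ox idm DB) in
  let la : wmap [:: B] [::] := f \oc grp Bd B \oc (bone (dual_bialg hH hB) \ox idm B) in
  let r : wmap [:: Bd] [::] := f \oc grp Bd B \oc (idm Bd \ox eta) in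
  let g : wmap [::] [:: B] :=
    the [set g : wmap [::] [:: B] | evC hH B \oc (idm Bd \ox g) =1 r] in
  pair_elt la g.

Definition Theta_pair la g : wmap [:: B] [:: B] := conj_g g \oc conj_l la.

(* [conj_l] reverses products (conj_l la \oc conj_l mu = conj_l (mu * la)), and
   a pair (la, g) comes from G(D(B)^* ) exactly when conj_l la = conj_g g, so it is
   (la, g) |-> Theta_pair la^-1 g, and not Theta_pair itself, that is a group
   morphism on G(D(B)) and vanishes on the image of G(D(B)^* ). *)
Definition Theta (x : gtype G_DB) : gtype AutC := Theta_pair (elt_l x \oc S) (elt_g x).

End TheGroups.

Arguments incl {k H} hH {B} hB chi.
Arguments Theta {k H} hH {B} hB x.
Arguments Pi {k H} hH {B} hB al.

(* Main.v *)
(* Testing the transparency of B on H with its adjoint action, and on H with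
   its coadjoint coaction, shows that H acts and coacts trivially on B.  So B is
   an ordinary finite-dimensional Hopf algebra (with bijective antipode), and
   all braidings with B are flips.

   Call an object M with B-action and B-coaction ga-twisted when
     (b1 m)_(-1) ga(b2) (x) (b1 m)_(0) = b1 m_(-1) (x) b2 m_(0).
   Then B_al is al-twisted, and if M is ga-twisted and N is de-twisted, then
   M (x) N^ga, with the action of N pulled back along ga, is (de ga)-twisted and
   End(M) # End(N) is End(M (x) N^ga).  Therefore the class of End(M) depends only
   on ga, and Pi is a morphism.  That BQ is a group rests on replacing the
   conditions on azF and azG by surjectivity of two maps built from the inverse
   braiding, in which the tensor factors separate.

   If Pi(al) = 1, Skolem-Noether identifies the space B_al^-1 (x) M, for some M,
   with an honest Yetter-Drinfel'd module inducing the same structure on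
   endomorphisms.  Two such structures on one space differ by a character lam in
   the action and a group-like g in the coaction, and comparing their
   Yetter-Drinfel'd conditions gives al^-1 = conj_g g conj_l lam.  Conversely
   twisting B_al^-1 by lam and g makes it Yetter-Drinfel'd without changing End.

   The group-likes of D(B) are the tensors lam (x) g; the algebra maps D(B) -> k
   are f (x) b |-> f(g) lam(b) with g b1 lam(b2) = lam(b1) b2 g for all b, that is,
   conj_g g = conj_l lam. *)
Require Import Defs.
From HB Require Import structures.
From mathcomp Require Import all_boot all_order all_algebra sesquilinear.
From mathcomp Require Import boolp classical_sets.
Set Implicit Arguments.
Unset Strict Implicit.
Unset Printing Implicit Defensive.
Import GRing.Theory.
Local Open Scope ring_scope.

(** * Sweedler notation *)

(** What shapes the proof is that only B becomes trivial over H: a general module over B still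
    carries its own H-action and H-coaction. For trivial B the morphism conditions on a B-structure
    say that it commutes with both H-structures, so the same computations run over two ordinary Hopf
    algebras at once. The braiding [Psi] mixes them: it uses the H-coaction and the B-action of its
    first argument, the H-action and the B-coaction of its second.

    Bijectivity of the antipode of B comes from finite dimension, through a Fitting decomposition.

    Coactions on endomorphisms are given by a description, so each must be shown to exist, which
    takes a finite basis of the source. Afterwards a statement about endomorphisms is reduced to one
    about evaluation, a nondegenerate pairing. Isomorphisms of endomorphism algebras are obtained by
    proving surjectivity and counting dimensions, so that only preimages have to be constructed. *)

Notation "\sw_ ( a , b <- t ) E" := (teval (fun a b => E) t)
  (at level 41, E at level 41, t at level 60, a name, b name,
   format "'[' \sw_ ( a ,  b  <-  t ) '/  '  E ']'") : ring_scope.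

(** The annotation [T] serves components that are applied as functions, such as elements of
    [LinMap V W]. *)
Notation "\sw_ ( a , b : T <- t ) E" := (teval (fun a (b : T) => E) t)
  (at level 41, E at level 41, t at level 60, T at level 60, a name, b name, only parsing) : ring_scope.

Section Multilinear.
Variables (k : fieldType).
Implicit Types U V W X : lmodType k.

(** Stated argument by argument, so that the tactic [lin] meets two plain linearity goals; [bilinE]
    returns to the packaged form. *)
Definition bilin U V W (F : U -> V -> W) : Prop :=
  (forall v, linear (fun u => F u v)) /\ (forall u, linear (F u)).
Definition trilin U V X W (F : U -> V -> X -> W) : Prop :=
  [/\ forall v x, linear (fun u => F u v x), forall u x, linear (fun v => F u v x)
    & forall u v, linear (F u v)].

Lemma bilinE U V W (F : U -> V -> W) : bilin F -> bilinear_for *:%R *:%R F.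
Proof. by case=> Fl Fr; split. Qed.

Lemma lin_id U : linear (fun u : U => u). Proof. by []. Qed.
Lemma lin_zero U V : linear (fun _ : U => 0 : V).
Proof. by move=> a x y; rewrite scaler0 addr0. Qed.
Lemma lin_app U V W (g : {linear V -> W}) (f : U -> V) :
  linear f -> linear (fun u => g (f u)).
Proof. by move=> fl a x y; rewrite fl linearP. Qed.
Lemma lin_comp U V W (g : V -> W) (f : U -> V) :
  linear g -> linear f -> linear (fun u => g (f u)).
Proof. by move=> gl fl a x y; rewrite fl gl. Qed.
Lemma lin_purel U V W (f : U -> V) (w : W) : linear f -> linear (fun u => pure (f u) w).
Proof. by move=> fl a x y; rewrite fl (pure_bilin V W).1. Qed.
Lemma lin_purer U V W (f : U -> V) (w : W) : linear f -> linear (fun u => pure w (f u)).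
Proof. by move=> fl a x y; rewrite fl (pure_bilin W V).2. Qed.
Lemma lin_sca U V (f : U -> k^o) (v : V) : linear f -> linear (fun u => (f u : k) *: v).
Proof. by move=> fl a x y; rewrite fl scalerDl -scalerA. Qed.
Lemma lin_scale U V (f : U -> V) (c : k) : linear f -> linear (fun u => c *: f u).
Proof. by move=> fl a x y; rewrite fl scalerDr !scalerA mulrC. Qed.
Lemma lin_add U V (f g : U -> V) : linear f -> linear g -> linear (fun u => f u + g u).
Proof. by move=> fl gl a x y; rewrite fl gl scalerDr addrACA. Qed.
Lemma lin_sub U V (f g : U -> V) : linear f -> linear g -> linear (fun u => f u - g u).
Proof. by move=> fl gl a x y; rewrite fl gl scalerBr opprD addrACA. Qed.
Lemma lin_sum U V (I : Type) (r : seq I) (P : pred I) (f : I -> U -> V) :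
  (forall i, linear (f i)) -> linear (fun u => \sum_(i <- r | P i) f i u).
Proof.
move=> fl a x y; rewrite scaler_sumr -big_split /=.
by apply: eq_bigr => i _; rewrite fl.
Qed.
Lemma lin_swt U V W X (f : X -> tens U V) (F : U -> V -> W) :
  bilin F -> linear f -> linear (fun x => teval F (f x)).
Proof. by move=> /bilinE Fb fl a x y; rewrite fl (teval_lin Fb). Qed.
Lemma lin_swF U V W X (t : tens U V) (F : X -> U -> V -> W) :
  (forall u v, linear (fun x => F x u v)) -> linear (fun x => teval (F x) t).
Proof. by move=> Fl; apply: lin_sum => i; apply: Fl. Qed.
Lemma lin_ev U V W (f : U -> LinMap V W) (v : V) :
  linear f -> linear (fun u => f u v).
Proof. by move=> fl a x y; rewrite fl. Qed.
Lemma lin_mk U V W (f : U -> V -> W) (fl : forall u, linear (f u)) :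
  (forall v, linear (fun u => f u v)) ->
  linear (fun u => mkLin (fl u) : LinMap V W).
Proof. by move=> fu a x y; apply: lin_ext => v; apply: fu. Qed.
Lemma lin_compl U V W X (f : U -> LinMap W X) (g : {linear V -> W}) :
  linear f -> linear (fun u => lcomp (f u) g : LinMap V X).
Proof. by move=> fl a x y; apply: lin_ext => v /=; rewrite fl. Qed.
Lemma lin_compr U V W X (f : U -> LinMap V W) (g : {linear W -> X}) :
  linear f -> linear (fun u => lcomp g (f u) : LinMap V X).
Proof. by move=> fl a x y; apply: lin_ext => v /=; rewrite fl linearP. Qed.

Lemma linZ U V (f : U -> V) c u : linear f -> f (c *: u) = c *: f u.
Proof. by move=> fl; apply: (GRing.scalable_linear fl). Qed.
Lemma lin0 U V (f : U -> V) : linear f -> f 0 = 0.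
Proof. by move=> fl; rewrite -(scale0r (0 : U)) linZ // scale0r. Qed.
Lemma pureZl U V c (u : U) (v : V) : pure (c *: u) v = c *: pure u v.
Proof. by apply: (@linZ _ _ (fun u => pure u v)); apply: (@lin_purel _ _ _ id v). Qed.
Lemma pureZr U V c (u : U) (v : V) : pure u (c *: v) = c *: pure u v.
Proof. by apply: (@linZ _ _ (fun v => pure u v)); apply: (@lin_purer _ _ _ id u). Qed.

Lemma linS U V (f : U -> V) (I : Type) (r : seq I) (P : pred I) (F : I -> U) :
  linear f -> f (\sum_(i <- r | P i) F i) = \sum_(i <- r | P i) f (F i).
Proof. by move=> fl; rewrite -[LHS]/(mkLin fl _) linear_sum. Qed.
Lemma pureSl U V (I : Type) (r : seq I) (P : pred I) (F : I -> U) (v : V) :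
  pure (\sum_(i <- r | P i) F i) v = \sum_(i <- r | P i) pure (F i) v.
Proof. by apply: (@linS _ _ (fun u => pure u v)); apply: (@lin_purel _ _ _ id v). Qed.
Lemma pureSr U V (I : Type) (r : seq I) (P : pred I) (F : I -> V) (u : U) :
  pure u (\sum_(i <- r | P i) F i) = \sum_(i <- r | P i) pure u (F i).
Proof. by apply: (@linS _ _ (fun v => pure u v)); apply: (@lin_purer _ _ _ id u). Qed.
Lemma LinMap_sum U V (I : Type) (r : seq I) (P : pred I) (F : I -> LinMap U V) u :
  (\sum_(i <- r | P i) F i : LinMap U V) u = \sum_(i <- r | P i) F i u.
Proof. by apply: (@linS _ _ (fun f : LinMap U V => f u)) => a x y. Qed.

Fact rank1_subproof U V (c : {linear U -> k^o}) (v : V) :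
  linear (fun u => (c u : k) *: v).
Proof. exact: (@lin_sca _ _ c v (linearP c)). Qed.
Definition rank1 U V (c : {linear U -> k^o}) (v : V) : LinMap U V :=
  mkLin (rank1_subproof c v).
Lemma rank1E U V (c : {linear U -> k^o}) (v : V) u : rank1 c v u = (c u : k) *: v.
Proof. by []. Qed.
Lemma lin_rank1 U V W (c : {linear U -> k^o}) (f : W -> V) :
  linear f -> linear (fun w => rank1 c (f w)).
Proof.
move=> fl a x y; apply: lin_ext => u; rewrite /= fl.
by rewrite scalerDr !scalerA mulrC.
Qed.

Section Sweedler.
Variables (U V : lmodType k).
Implicit Types (t : tens U V).

(** [teval] is a sum over a chosen representative of [t]. Rewriting under the sum, exchanging two
    sums and pulling out a linear map work for any [F]; bilinearity enters where the representative
    changes, in [sw_pure] and [sw_sw]. *)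
Lemma sw_ext W (F G : U -> V -> W) t :
  (forall a b, F a b = G a b) -> teval F t = teval G t.
Proof. by move=> FG; apply: eq_bigr => p _; apply: FG. Qed.
Lemma sw_pure W (F : U -> V -> W) u v : bilin F -> teval F (pure u v) = F u v.
Proof. by move=> /bilinE Fb; rewrite teval_pure. Qed.
Lemma sw_lin W W' (F : U -> V -> W) (g : {linear W -> W'}) t :
  g (teval F t) = \sw_(a, b <- t) g (F a b).
Proof. exact: linear_sum. Qed.
Lemma sw_linear W W' (F : U -> V -> W) (g : W -> W') t : linear g ->
  g (teval F t) = \sw_(a, b <- t) g (F a b).
Proof. by move=> gl; apply: (sw_lin F (mkLin gl)). Qed.
Lemma sw_id t : \sw_(a, b <- t) pure a b = t.
Proof.
apply: teval_ext => W f fb; rewrite -[LHS]/(tlift fb _) linear_sum.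
by apply: eq_bigr => p _; rewrite tlift_pure.
Qed.
Lemma sw_exp W (g : tens U V -> W) t : linear g -> g t = \sw_(a, b <- t) g (pure a b).
Proof. by move=> gl; rewrite -{1}[t]sw_id sw_linear. Qed.
Lemma sw_C U' V' W (F : U -> V -> U' -> V' -> W) t (t' : tens U' V') :
  \sw_(a, b <- t) \sw_(c, d <- t') F a b c d = \sw_(c, d <- t') \sw_(a, b <- t) F a b c d.
Proof. exact: exchange_big. Qed.
Lemma sw_app W X (F : U -> V -> LinMap X W) t x :
  (teval F t : LinMap X W) x = \sw_(a, b <- t) F a b x.
Proof.
by apply: (@sw_linear _ _ F (fun f : LinMap X W => f x)).
Qed.
Lemma sw_scal W (F : U -> V -> k^o) t (w : W) :
  (teval F t : k) *: w = \sw_(a, b <- t) (F a b : k) *: w.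
Proof. exact: scaler_suml. Qed.
Lemma sw_scale W (F : U -> V -> W) t (c : k) :
  c *: teval F t = \sw_(a, b <- t) c *: F a b.
Proof. exact: scaler_sumr. Qed.
Lemma sw_purel W X (F : U -> V -> W) t (x : X) :
  pure (teval F t) x = \sw_(a, b <- t) pure (F a b) x.
Proof. by apply: (@sw_linear _ _ F (fun w => pure w x)); apply: (@lin_purel _ _ _ id x). Qed.
Lemma sw_purer W X (F : U -> V -> W) t (x : X) :
  pure x (teval F t) = \sw_(a, b <- t) pure x (F a b).
Proof. by apply: (@sw_linear _ _ F (fun w => pure x w)); apply: (@lin_purer _ _ _ id x). Qed.
Lemma sw_sum W (I : Type) (r : seq I) (P : pred I) (F : I -> U -> V -> W) t :
  \sw_(a, b <- t) (\sum_(i <- r | P i) F i a b) = \sum_(i <- r | P i) teval (F i) t.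
Proof. exact: exchange_big. Qed.
End Sweedler.
Lemma sw_sw U V U' V' W (F : U -> V -> W) (G : U' -> V' -> tens U V) (t : tens U' V') :
  bilin F -> teval F (teval G t) = \sw_(a, b <- t) teval F (G a b).
Proof. by move=> /bilinE Fb; rewrite -[LHS]/(tlift Fb _) sw_lin. Qed.
End Multilinear.

(** Linearity goals are solved by recursion on the term: each clause of [lin1] peels off one
    operation known to be linear, and hypotheses on an unknown multilinear map are tried when none
    applies. *)
Ltac lin_hyp := first [assumption
  | match goal with
    | H : _ |- _ => first [ exact H | solve [simple apply H] | solve [simple apply (proj1 H)] | solve [simple apply (proj2 H)]]
    end ].
Ltac lin1 :=
  lazymatch goal with
  | |- bilin _ => split; intros
  | |- trilin _ => split; intros
  | |- _ =>
  match goal with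
  | |- GRing.linear_for _ (fun x => x) => apply: lin_id
  | |- GRing.linear_for _ (fun x => pure (@?f x) ?v) => simple refine (@lin_purel _ _ _ _ f v _)
  | |- GRing.linear_for _ (fun x => pure ?v (@?f x)) => simple refine (@lin_purer _ _ _ _ f v _)
  | |- GRing.linear_for _ (fun x => @pure _ ?U ?V ?v (@?f x)) => simple refine (@lin_purer _ _ V U f v _)
  | |- GRing.linear_for _ (fun x => @pure _ ?U ?V (@?f x) ?v) => simple refine (@lin_purel _ _ U V f v _)
  | |- GRing.linear_for _ (fun x => teval ?F (@?f x)) => simple refine (@lin_swt _ _ _ _ _ f F _ _)
  | |- GRing.linear_for _ (fun x => teval (@?F x) ?t) => simple refine (@lin_swF _ _ _ _ _ t F _); intros
  | |- GRing.linear_for _ (fun x => GRing.Linear.sort ?g (@?f x)) => simple refine (@lin_app _ _ _ _ g f _)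
  | |- GRing.linear_for _ (fun x => GRing.Linear.sort (@?f x) ?v) => simple refine (@lin_ev _ _ _ _ f v _)
  | |- GRing.linear_for _ (fun x => rank1 ?c (@?f x)) => simple refine (@lin_rank1 _ _ _ _ c f _)
  | |- GRing.linear_for _ (fun x => lcomp (@?f x) ?g) => simple refine (@lin_compl _ _ _ _ _ f g _)
  | |- GRing.linear_for _ (fun x => lcomp ?g (@?f x)) => simple refine (@lin_compr _ _ _ _ _ f g _)
  | |- GRing.linear_for _ (fun x => mkLin (@?fl x)) => apply: lin_mk; intros
  | |- GRing.linear_for _ (fun x => ?c *: (@?f x)) => simple refine (@lin_scale _ _ _ f c _)
  | |- GRing.linear_for _ (fun x => (@?f x) *: ?v) => simple refine (@lin_sca _ _ _ f v _)
  | |- GRing.linear_for _ (fun x => (@?f x) + (@?g x)) => simple refine (@lin_add _ _ _ f g _ _)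
  | |- GRing.linear_for _ (fun x => (@?f x) - (@?g x)) => simple refine (@lin_sub _ _ _ f g _ _)
  | |- GRing.linear_for _ (fun x => 0) => apply: lin_zero
  | |- GRing.linear_for _ (GRing.Linear.sort ?g) => apply: linearP
  | |- GRing.linear_for _ (pure ?v) => apply: lin_purer
  | |- GRing.linear_for _ (teval ?F) => simple refine (@lin_swt _ _ _ _ _ id F _ (@lin_id _ _))
  | |- GRing.linear_for _ (rank1 ?c) => exact: (lin_rank1 c (@lin_id _ _))
  | |- GRing.linear_for _ (fun x => ?g (@?f x)) =>
      simple refine (@lin_comp _ _ _ _ g f _ _); [solve [lin_hyp] | ]
  | |- GRing.linear_for _ (fun x => ?g (@?f x) ?v) =>
      simple refine (@lin_comp _ _ _ _ (fun y => g y v) f _ _); [solve [lin_hyp] | ]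
  | |- GRing.linear_for _ (fun x => ?g (@?f x) ?v ?w) =>
      simple refine (@lin_comp _ _ _ _ (fun y => g y v w) f _ _); [solve [lin_hyp] | ]
  | |- GRing.linear_for _ (fun x => ?g (@?f x) ?v ?w ?z) =>
      simple refine (@lin_comp _ _ _ _ (fun y => g y v w z) f _ _); [solve [lin_hyp] | ]
  end end.
Ltac lin := repeat first [solve [lin_hyp] | lin1 | progress (cbv beta)].

(** * Evaluation of maps of words on pure tensors *)

Section WordEval.
Variables (k : fieldType).
Implicit Types U V W X : lmodType k.

Lemma lcompE U V W (g : {linear V -> W}) (f : {linear U -> V}) u :
  lcomp g f u = g (f u).
Proof. by []. Qed.
Lemma hcompE (a b c : seq (lmodType k)) (g : wmap b c) (f : wmap a b) v :
  hcomp g f v = g (f v).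
Proof. by []. Qed.
Lemma hoxE (a b c d : seq (lmodType k)) (f : wmap a b) (g : wmap c d) v :
  hox f g v = tjoin b d (tmap f g (tsplit a c v)).
Proof. by []. Qed.
Lemma tmap_pure U V U' V' (f : {linear U -> U'}) (g : {linear V -> V'}) u v :
  tmap f g (pure u v) = pure (f u) (g v).
Proof. exact: tlift_pure. Qed.
Lemma tflip_pure U V (u : U) (v : V) : tflip U V (pure u v) = pure v u.
Proof. exact: tlift_pure. Qed.
Lemma assoc_pure U V W (u : U) (v : V) (w : W) :
  assoc U V W (pure (pure u v) w) = pure u (pure v w).
Proof. by rewrite /assoc !tlift_pure. Qed.
Lemma assocV_pure U V W (u : U) (v : V) (w : W) :
  assocV U V W (pure u (pure v w)) = pure (pure u v) w.
Proof.
by rewrite /assocV !lcompE tflip_pure tmap_pure tflip_pure assoc_pure tmap_pure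
  tflip_pure tflip_pure.
Qed.
Lemma lunit_pure V (c : k^o) (v : V) : lunit V (pure c v) = (c : k) *: v.
Proof. exact: tlift_pure. Qed.
Lemma lunitV_E V (v : V) : lunitV V v = pure (1 : k^o) v.
Proof. by []. Qed.
Lemma runit_pure V (c : k^o) (v : V) : runit V (pure v c) = (c : k) *: v.
Proof. by rewrite /runit lcompE tflip_pure lunit_pure. Qed.
Lemma runitV_E V (v : V) : runitV V v = pure v (1 : k^o).
Proof. by rewrite /runitV lcompE lunitV_E tflip_pure. Qed.
Lemma sw_tmap U V U' V' W (f : {linear U -> U'}) (g : {linear V -> V'})
    (F : U' -> V' -> W) t :
  bilin F -> teval F (tmap f g t) = \sw_(a, b <- t) F (f a) (g b).
Proof.
move=> Fb; rewrite [tmap f g t]sw_exp; last exact: linearP.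
rewrite sw_sw //; apply: sw_ext => a b; rewrite tmap_pure sw_pure //.
Qed.
End WordEval.

Section HoxShapes.
Variables (k : fieldType).
Implicit Types U V W X : lmodType k.
Implicit Types a b c d : seq (lmodType k).

(** [tword] gives the last letter no trailing unit. A split with empty right part must therefore
    create a factor 1 in k and obeys separate rules, [tsplit10] and [tsplit20]; the present ones ask
    for a nonempty rest [V :: c]. *)
Lemma tsplit1 U V c u (t : tword (V :: c)) : tsplit [:: U] (V :: c) (pure u t) = pure u t.
Proof. by []. Qed.
Lemma tsplit2 U U' V c u u' (t : tword (V :: c)) :
  tsplit [:: U; U'] (V :: c) (pure u (pure u' t)) = pure (pure u u') t.
Proof.
rewrite -[LHS]/(assocV _ _ _ (tmap (lid U) (tsplit [:: U'] (V :: c)) (pure u (pure u' t)))).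
by rewrite tmap_pure tsplit1 assocV_pure.
Qed.
Lemma tsplit3 U U' U'' V c u u' u'' (t : tword (V :: c)) :
  tsplit [:: U; U'; U''] (V :: c) (pure u (pure u' (pure u'' t))) =
  pure (pure u (pure u' u'')) t.
Proof.
rewrite -[LHS]/(assocV _ _ _ (tmap (lid U) (tsplit [:: U'; U''] (V :: c)) (pure u _))).
by rewrite tmap_pure tsplit2 assocV_pure.
Qed.
Lemma tsplit4 U U' U'' U3 V c u u' u'' u3 (t : tword (V :: c)) :
  tsplit [:: U; U'; U''; U3] (V :: c) (pure u (pure u' (pure u'' (pure u3 t)))) =
  pure (pure u (pure u' (pure u'' u3))) t.
Proof.
rewrite -[LHS]/(assocV _ _ _ (tmap (lid U) (tsplit [:: U'; U''; U3] (V :: c)) (pure u _))).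
by rewrite tmap_pure tsplit3 assocV_pure.
Qed.
Lemma tsplit10 U (u : U) : tsplit [:: U] [::] u = pure u (1 : k^o).
Proof. exact: runitV_E. Qed.
Lemma tsplit20 U V (u : U) (v : V) : tsplit [:: U; V] [::] (pure u v) = pure (pure u v) (1 : k^o).
Proof.
rewrite -[LHS]/(assocV _ _ _ (tmap (lid U) (tsplit [:: V] [::]) (pure u v))).
by rewrite tmap_pure tsplit10 assocV_pure.
Qed.
Lemma hox1 U V b c d (f : wmap [:: U] b) (g : wmap (V :: c) d) u (t : tword (V :: c)) :
  hox f g (pure u t) = tjoin b d (pure (f u) (g t)).
Proof. by rewrite hoxE tsplit1 tmap_pure. Qed.
Lemma hox2 U U' V b c d (f : wmap [:: U; U'] b) (g : wmap (V :: c) d) u u'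
    (t : tword (V :: c)) :
  hox f g (pure u (pure u' t)) = tjoin b d (pure (f (pure u u')) (g t)).
Proof. by rewrite hoxE tsplit2 tmap_pure. Qed.
Lemma hox3 U U' U'' V b c d (f : wmap [:: U; U'; U''] b) (g : wmap (V :: c) d) u u' u''
    (t : tword (V :: c)) :
  hox f g (pure u (pure u' (pure u'' t))) = tjoin b d (pure (f (pure u (pure u' u''))) (g t)).
Proof. by rewrite hoxE tsplit3 tmap_pure. Qed.
Lemma hox4 U U' U'' U3 V b c d (f : wmap [:: U; U'; U''; U3] b) (g : wmap (V :: c) d) u u' u'' u3
    (t : tword (V :: c)) :
  hox f g (pure u (pure u' (pure u'' (pure u3 t)))) =
  tjoin b d (pure (f (pure u (pure u' (pure u'' u3)))) (g t)).
Proof. by rewrite hoxE tsplit4 tmap_pure. Qed.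
Lemma hox0l b c d (f : wmap [::] b) (g : wmap c d) (t : tword c) :
  hox f g t = tjoin b d (pure (f 1) (g t)).
Proof. by rewrite hoxE tmap_pure. Qed.
Lemma hox10 U b d (f : wmap [:: U] b) (g : wmap [::] d) (t : U) :
  hox f g t = tjoin b d (pure (f t) (g 1)).
Proof. by rewrite hoxE tsplit10 tmap_pure. Qed.
Lemma hox20 U V b d (f : wmap [:: U; V] b) (g : wmap [::] d) (u : U) (v : V) :
  hox f g (pure u v) = tjoin b d (pure (f (pure u v)) (g 1)).
Proof. by rewrite hoxE tsplit20 tmap_pure. Qed.
Lemma tjoin1 U V d u (t : tword (V :: d)) : tjoin [:: U] (V :: d) (pure u t) = pure u t.
Proof. by []. Qed.
Lemma tjoin2 U U' V d u u' (t : tword (V :: d)) :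
  tjoin [:: U; U'] (V :: d) (pure (pure u u') t) = pure u (pure u' t).
Proof.
rewrite -[LHS]/(tmap (lid U) (tjoin [:: U'] (V :: d)) (assoc _ _ _ (pure (pure u _) _))).
by rewrite assoc_pure tmap_pure tjoin1.
Qed.
Lemma tjoin3 U U' U'' V d u u' u'' (t : tword (V :: d)) :
  tjoin [:: U; U'; U''] (V :: d) (pure (pure u (pure u' u'')) t) =
  pure u (pure u' (pure u'' t)).
Proof.
rewrite -[LHS]/(tmap (lid U) (tjoin [:: U'; U''] (V :: d)) (assoc _ _ _ (pure (pure u _) _))).
by rewrite assoc_pure tmap_pure tjoin2.
Qed.
Lemma tjoin4 U U' U'' U3 V d u u' u'' u3 (t : tword (V :: d)) :
  tjoin [:: U; U'; U''; U3] (V :: d) (pure (pure u (pure u' (pure u'' u3))) t) =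
  pure u (pure u' (pure u'' (pure u3 t))).
Proof.
rewrite -[LHS]/(tmap (lid U) (tjoin [:: U'; U''; U3] (V :: d)) (assoc _ _ _ (pure (pure u _) _))).
by rewrite assoc_pure tmap_pure tjoin3.
Qed.
Lemma tjoin0l d (c : k^o) (t : tword d) : tjoin [::] d (pure c t) = (c : k) *: t.
Proof. exact: lunit_pure. Qed.
Lemma tjoin10 U u (c : k^o) : tjoin [:: U] [::] (pure u c) = (c : k) *: u.
Proof. exact: runit_pure. Qed.
Lemma tjoin20 U V u v (c : k^o) :
  tjoin [:: U; V] [::] (pure (pure u v) c) = (c : k) *: pure u v.
Proof.
rewrite -[LHS]/(tmap (lid U) (tjoin [:: V] [::]) (assoc _ _ _ (pure (pure u _) _))).
by rewrite assoc_pure tmap_pure tjoin10 pureZr.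
Qed.
Lemma idmE U (u : U) : idm U u = u. Proof. by []. Qed.
Lemma hidE a (u : tword a) : hid a u = u. Proof. by []. Qed.
Lemma flip_pure U V (u : U) (v : V) : flip U V (pure u v) = pure v u.
Proof. exact: tflip_pure. Qed.
Lemma grpE U V (t : tens U V) : grp U V t = t. Proof. by []. Qed.
Lemma ungrpE U V (t : tens U V) : ungrp U V t = t. Proof. by []. Qed.
Lemma ev_pure U V (f : LinMap U V) (u : U) : ev U V (pure f u) = f u.
Proof. exact: tlift_pure. Qed.
End HoxShapes.

Ltac wev := rewrite ?(hcompE, idmE, hidE, flip_pure, grpE, ungrpE, ev_pure,
  tjoin1, tjoin2, tjoin3, tjoin4, tjoin10, tjoin20, tjoin0l,
  hox1, hox2, hox3, hox4, hox10, hox20).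
(** Expands the tensor [t] on the left of the goal into pure components, the left side being linear
    in it, and matches the result with a Sweedler sum over the same tensor on the right. *)
Ltac swx t := let T := fresh "T" in set T := (t in LHS);
  match goal with |- ?L = ?R => let g := eval pattern T in L in
  match g with ?g' T => apply: (etrans (@sw_exp _ _ _ _ g' T _)); [lin | cbv beta; apply: sw_ext] end end.

(** * Hopf algebras *)

Section HopfOps.
Variables (k : fieldType) (X : lmodType k) (h : hopf X).
(** Copies of the operations typed as maps of spaces instead of words, so that rewriting and the
    tactic [lin] do not meet [tword]. [hantV] is the inverse antipode only once the antipode is
    bijective. *)
Definition hmul : {linear tens X X -> X} := bmul h.
Definition hone : X := bone h (1 : k^o).
Definition hcom : {linear X -> tens X X} := bcomul h.
Definition hcou : {linear X -> k^o} := bcounit h.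
Definition hant : {linear X -> X} := antip h.
Definition hantV : {linear X -> X} := linv (antip h).
End HopfOps.

Section Laws.
Variables (k : fieldType) (X : lmodType k) (h : hopf X).
Hypothesis hopfX : is_hopf (flip X X) h.
Local Notation "x ∙ y" := (hmul h (pure x y)) (at level 40, left associativity).
Local Notation one := (hone h).
Local Notation D := (hcom h).
Local Notation e := (hcou h).
Local Notation S := (hant h).

Lemma hmulA x y z : (x ∙ y) ∙ z = x ∙ (y ∙ z).
Proof.
case: hopfX => [[+ _ _] _ _ _ _] => /(_ (pure x (pure y z))); wev; exact.
Qed.
Lemma hmul1l x : one ∙ x = x.
Proof.
case: hopfX => [[_ + _] _ _ _ _] => /(_ x); rewrite hcompE hox0l; wev; exact.
Qed.
Lemma hmul1r x : x ∙ one = x.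
Proof.
case: hopfX => [[_ _ +] _ _ _ _] => /(_ x); wev; exact.
Qed.
(** Coassociativity is tested on an arbitrary trilinear [F], so that an iterated Sweedler sum can be
    rebracketed in place, without associators. *)
Lemma hcomA (W : lmodType k) (F : X -> X -> X -> W) x : trilin F ->
  \sw_(a, b <- D x) \sw_(c, d <- D a) F c d b = \sw_(a, b <- D x) \sw_(c, d <- D b) F a c d.
Proof.
move=> [F1 F2 F3].
case: hopfX => [_ [+ _ _] _ _ _] => /(_ x); rewrite !hcompE => E.
pose G (a : X) (t : tens X X) := \sw_(c, d <- t) F a c d.
have Gl : bilin G by rewrite /G; lin.
transitivity (teval G (hox (bcomul h) (idm X) (bcomul h x))); last first.
  by rewrite E; swx (bcomul h x) => a b; wev; rewrite sw_pure.
symmetry; swx (bcomul h x) => a b. wev.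
swx (bcomul h a) => c d. by wev; rewrite sw_pure // /G sw_pure //; lin.
Qed.

Lemma hcou1l (W : lmodType k) (F : X -> W) x : linear F -> \sw_(a, b <- D x) (e a : k) *: F b = F x.
Proof.
move=> Fl; case: hopfX => [_ [_ + _] _ _ _] => /(_ x); rewrite hcompE idmE => E.
rewrite -[in RHS]E; symmetry; swx (bcomul h x) => a b; wev.
exact: linZ.
Qed.
Lemma hcou1r (W : lmodType k) (F : X -> W) x : linear F -> \sw_(a, b <- D x) (e b : k) *: F a = F x.
Proof.
move=> Fl; case: hopfX => [_ [_ _ +] _ _ _] => /(_ x); rewrite hcompE idmE => E.
rewrite -[in RHS]E; symmetry; swx (bcomul h x) => a b; wev.
exact: linZ.
Qed.
Lemma hcomM (W : lmodType k) (F : X -> X -> W) x y : bilin F ->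
  teval F (D (x ∙ y)) = \sw_(a, b <- D x) \sw_(c, d <- D y) F (a ∙ c) (b ∙ d).
Proof.
move=> Fb; case: hopfX => [_ _ [+ _ _ _] _ _] => /(_ (pure x y)); wev => E.
transitivity (teval F (bcomul h (bmul h (pure x y)))); first by [].
rewrite E. swx (bcomul h x) => a b. swx (bcomul h y) => c d. wev.
by rewrite sw_pure.
Qed.
Lemma hcom1 : D one = pure one one.
Proof. case: hopfX => [_ _ [_ + _ _] _ _] => /(_ 1); rewrite hcompE hox0l; exact. Qed.
Lemma hcouM x y : e (x ∙ y) = (e x : k) * (e y : k).
Proof. 
case: hopfX => [_ _ [_ _ + _] _ _] => /(_ (pure x y)); wev; exact.
Qed.
Lemma hcou1 : e one = 1.
Proof. case: hopfX => [_ _ [_ _ _ +] _ _] => /(_ 1); rewrite hcompE; exact. Qed.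
Lemma hantl (W : lmodType k) (F : X -> W) x : linear F ->
  \sw_(a, b <- D x) F (S a ∙ b) = (e x : k) *: F one.
Proof. 
move=> Fl; case: hopfX => [_ _ _ + _] => /(_ x); rewrite !hcompE => E.
rewrite -(linZ _ _ Fl) /hone.
transitivity (F (bone h (bcounit h x))); last by rewrite -[X in _ = F (_ *: _ X)]/(1 : k^o) -linearZ /GRing.scale /= mulr1.
rewrite -E; symmetry; swx (bcomul h x) => a b; wev. by [].
Qed.
Lemma hantr (W : lmodType k) (F : X -> W) x : linear F ->
  \sw_(a, b <- D x) F (a ∙ S b) = (e x : k) *: F one.
Proof. 
move=> Fl; case: hopfX => [_ _ _ _ +] => /(_ x); rewrite !hcompE => E.
rewrite -(linZ _ _ Fl) /hone.
transitivity (F (bone h (bcounit h x))); last by rewrite -[X in _ = F (_ *: _ X)]/(1 : k^o) -linearZ /GRing.scale /= mulr1.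
rewrite -E; symmetry; swx (bcomul h x) => a b; wev. by [].
Qed.
End Laws.

(** The set-theoretic inverse of a linear bijection is linear, so the description behind [linv] has
    a witness. *)
Lemma linvP (k : fieldType) (U V : lmodType k) (f : {linear U -> V}) :
  bijective f -> cancel f (linv f) /\ cancel (linv f) f.
Proof.
case=> g fg gf.
have gl : linear g.
  by move=> a x y; apply: (can_inj fg); rewrite gf linearP !gf.
rewrite /linv /the; case: xgetP => [y _ []//|/(_ (mkLin gl))[]]; split => //.
Qed.

(** * The antipode and its inverse *)

Section Antipode.
Variables (k : fieldType) (X : lmodType k) (h : hopf X).
Hypothesis hopfX : is_hopf (flip X X) h.
Local Notation "x ∙ y" := (hmul h (pure x y)) (at level 40, left associativity).
Local Notation one := (hone h).
Local Notation D := (hcom h).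
Local Notation e := (hcou h).
Local Notation S := (hant h).
Local Notation Sb := (hantV h).
Local Notation mA := (hmulA hopfX).

(** Both sides are convolution inverses of the multiplication. The intermediate expression is S(x1
    y1) (x2 y2) (S(y3) S(x3)): contracting its first two factors gives the right side, contracting
    its last two the left side. *)
Lemma hantM x y : S (x ∙ y) = S y ∙ S x.
Proof.
transitivity (\sw_(p, c <- D x) \sw_(q, d <- D y) \sw_(a, x' <- D p) \sw_(b, y' <- D q)
   S (a ∙ b) ∙ ((x' ∙ y') ∙ (S d ∙ S c))); last first.
  transitivity (\sw_(p, c <- D x) \sw_(q, d <- D y) (e p : k) *: ((e q : k) *: (S d ∙ S c))).
    apply: sw_ext => p c; apply: sw_ext => q d.
    rewrite scalerA -(hcouM hopfX) -[S d ∙ S c in RHS](hmul1l hopfX).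
    rewrite -(hantl hopfX (F := fun z => z ∙ (S d ∙ S c))); last by lin.
    rewrite (hcomM hopfX) //; last by lin.
    by apply: sw_ext => a x'; apply: sw_ext => b y'; rewrite !mA.
  transitivity (\sw_(p, c <- D x) (e p : k) *: (S y ∙ S c)).
    apply: sw_ext => p c; rewrite -(hcou1l hopfX (F := fun d => S d ∙ S c)); last by lin.
    by rewrite sw_scale.
  by rewrite (hcou1l hopfX (F := fun c => S y ∙ S c)) //; lin.
transitivity (\sw_(a, x' <- D x) \sw_(b, y' <- D y) \sw_(c, x3 <- D x') \sw_(d, y3 <- D y')
   S (a ∙ b) ∙ ((c ∙ d) ∙ (S y3 ∙ S x3))).
  transitivity (\sw_(a, x' <- D x) \sw_(b, y' <- D y) (e x' : k) *: ((e y' : k) *: S (a ∙ b))).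
    rewrite -(hcou1r hopfX (F := fun x => S (x ∙ y))); last by lin.
    apply: sw_ext => a x'; rewrite -(hcou1r hopfX (F := fun y => S (a ∙ y))); last by lin.
    by rewrite sw_scale.
  apply: sw_ext => a x'; apply: sw_ext => b y'; symmetry.
  transitivity (\sw_(c, x3 <- D x') (e y' : k) *: (S (a ∙ b) ∙ (c ∙ S x3))).
    apply: sw_ext => c x3.
    rewrite -[X in _ = _ *: (_ ∙ (X ∙ _))](hmul1r hopfX).
    rewrite -(hantr hopfX (F := fun z => S (a ∙ b) ∙ ((c ∙ z) ∙ S x3))); last by lin.
    by apply: sw_ext => d y3; rewrite !mA.
  rewrite scalerA mulrC -scalerA -sw_scale.
  congr (_ *: _); rewrite (hantr hopfX (F := fun z => S (a ∙ b) ∙ z)); last by lin.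
  by rewrite (hmul1r hopfX).
transitivity (\sw_(a, x' <- D x) \sw_(c, x3 <- D x') \sw_(b, y' <- D y) \sw_(d, y3 <- D y')
   S (a ∙ b) ∙ ((c ∙ d) ∙ (S y3 ∙ S x3))).
  by apply: sw_ext => a x'; rewrite sw_C.
rewrite -(hcomA hopfX (F := fun a c x3 => \sw_(b, y' <- D y) \sw_(d, y3 <- D y')
   S (a ∙ b) ∙ ((c ∙ d) ∙ (S y3 ∙ S x3)))); last by lin.
apply: sw_ext => p x3; rewrite [RHS]sw_C; apply: sw_ext => a c.
by rewrite -(hcomA hopfX (F := fun b d y3 => S (a ∙ b) ∙ ((c ∙ d) ∙ (S y3 ∙ S x3)))) //; lin.
Qed.

Lemma hant1 : S one = one.
Proof.
have := hantl hopfX (F := id) one; rewrite (hcom1 hopfX) sw_pure; last by lin.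
by rewrite (hmul1r hopfX) (hcou1 hopfX) scale1r => -> //; lin.
Qed.
Lemma hcouS x : e (S x) = e x.
Proof.
have := hantl hopfX (F := e) x; rewrite (hcou1 hopfX).
rewrite -[X in _ = X]/((e x : k) * 1) mulr1 => <-; last by lin.
rewrite -[in LHS](hcou1r hopfX (F := id) x); last by lin.
rewrite !sw_lin; apply: sw_ext => a b; rewrite (hcouM hopfX) !linearZ /= .
by rewrite /GRing.scale /= mulrC.
Qed.

(** The argument of [hantM] for the coproduct: the coproduct after S, and S (x) S after the flipped
    coproduct, are both convolution inverses of the coproduct, and the nested sum is the triple
    convolution. *)
Lemma hcomS (W : lmodType k) (F : X -> X -> W) x : bilin F ->
  teval F (D (S x)) = \sw_(a, b <- D x) F (S b) (S a).
Proof.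
move=> Fb; have [Fl Fr] := Fb.
transitivity (\sw_(p, x3 <- D x) \sw_(a, c <- D p) \sw_(s, t <- D (S a)) \sw_(c1, c2 <- D c)
  \sw_(u, v <- D x3) F ((s ∙ c1) ∙ S v) ((t ∙ c2) ∙ S u)); last first.
  rewrite -[RHS](hcou1l hopfX (F := fun y => \sw_(a, b <- D y) F (S b) (S a))); last by lin.
  apply: sw_ext => p x3; rewrite sw_scale.
  transitivity (\sw_(u, v <- D x3) \sw_(a, c <- D p) \sw_(s, t <- D (S a)) \sw_(c1, c2 <- D c)
     F ((s ∙ c1) ∙ S v) ((t ∙ c2) ∙ S u)).
    rewrite [RHS]sw_C; apply: sw_ext => a c; rewrite [RHS]sw_C; apply: sw_ext => s t.
    by rewrite [RHS]sw_C.
  apply: sw_ext => u v.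
  transitivity (\sw_(a, c <- D p) \sw_(y, z <- D (S a ∙ c)) F (y ∙ S v) (z ∙ S u)).
    by apply: sw_ext => a c; rewrite (hcomM hopfX) //; lin.
  rewrite (hantl hopfX (F := fun w => \sw_(y, z <- D w) F (y ∙ S v) (z ∙ S u))); last by lin.
  rewrite (hcom1 hopfX) sw_pure; last by lin.
  by rewrite !(hmul1l hopfX).
rewrite (hcomA hopfX (F := fun a c x3 => \sw_(s, t <- D (S a)) \sw_(c1, c2 <- D c)
  \sw_(u, v <- D x3) F ((s ∙ c1) ∙ S v) ((t ∙ c2) ∙ S u))); last by lin.
rewrite -(hcou1r hopfX (F := fun a => teval F (D (S a)))); last by lin.
apply: sw_ext => a x'; rewrite sw_scale [RHS]sw_C.
transitivity (\sw_(s, t <- D (S a)) \sw_(c, x3 <- D x') \sw_(c1, c2 <- D c)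
  \sw_(u, v <- D x3) F ((s ∙ c1) ∙ S v) ((t ∙ c2) ∙ S u)); last by rewrite sw_C.
apply: sw_ext => s t.
rewrite (hcomA hopfX (F := fun c1 c2 x3 => \sw_(u, v <- D x3) F ((s ∙ c1) ∙ S v) ((t ∙ c2) ∙ S u)));
  last by lin.
transitivity (\sw_(c1, y <- D x') F (s ∙ (c1 ∙ S y)) t).
  rewrite (hantr hopfX (F := fun w => F (s ∙ w) t)); last by lin.
  by rewrite (hmul1r hopfX).
apply: sw_ext => c1 y.
rewrite -(hcomA hopfX (F := fun c2 u v => F ((s ∙ c1) ∙ S v) ((t ∙ c2) ∙ S u))); last by lin.
rewrite -(hcou1l hopfX (F := fun v => F (s ∙ (c1 ∙ S v)) t)); last by lin.
apply: sw_ext => z v.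
transitivity (\sw_(c, d <- D z) F (s ∙ (c1 ∙ S v)) (t ∙ (c ∙ S d))).
  rewrite (hantr hopfX (F := fun w => F (s ∙ (c1 ∙ S v)) (t ∙ w))); last by lin.
  by rewrite (hmul1r hopfX).
by apply: sw_ext => c d; rewrite !mA.
Qed.

Hypothesis bijS : bijective (antip h).

Lemma hantK : cancel S Sb. Proof. by have [] := linvP bijS. Qed.
Lemma hantVK : cancel Sb S. Proof. by have [] := linvP bijS. Qed.
Lemma hantV1 : Sb one = one. Proof. by rewrite -{1}hant1 hantK. Qed.
Lemma hantVM x y : Sb (x ∙ y) = Sb y ∙ Sb x.
Proof. by rewrite -{1}[x]hantVK -{1}[y]hantVK -hantM hantK. Qed.
Lemma hcouSb x : e (Sb x) = e x.
Proof. by rewrite -{2}[x]hantVK hcouS. Qed.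
Lemma hcomSb (W : lmodType k) (F : X -> X -> W) x : bilin F ->
  teval F (D (Sb x)) = \sw_(a, b <- D x) F (Sb b) (Sb a).
Proof.
move=> Fb; have [Fl Fr] := Fb; rewrite -[x in RHS]hantVK hcomS; last by lin.
by apply: sw_ext => a b; rewrite !hantK.
Qed.
(** The inverse antipode satisfies the antipode laws for the opposite coproduct; they arise by
    applying it to those of [S]. *)
Lemma hantVl (W : lmodType k) (F : X -> W) x : linear F ->
  \sw_(a, b <- D x) F (Sb b ∙ a) = (e x : k) *: F one.
Proof.
move=> Fl; rewrite -hantV1 -(hantl hopfX (F := fun w => F (Sb w))); last by lin.
by apply: sw_ext => a b; rewrite hantVM hantK.
Qed.
Lemma hantVr (W : lmodType k) (F : X -> W) x : linear F ->
  \sw_(a, b <- D x) F (b ∙ Sb a) = (e x : k) *: F one.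
Proof.
move=> Fl; rewrite -hantV1 -(hantr hopfX (F := fun w => F (Sb w))); last by lin.
by apply: sw_ext => a b; rewrite hantVM hantK.
Qed.
End Antipode.

Lemma tens_ext3 (k : fieldType) (U V X W : lmodType k)
    (f g : {linear tens U (tens V X) -> W}) :
  (forall u v x, f (pure u (pure v x)) = g (pure u (pure v x))) -> f =1 g.
Proof.
move=> fg; apply: tens_ext => u t; rewrite -[t]sw_id !sw_purer !sw_lin.
by apply: sw_ext => a b; apply: fg.
Qed.

Ltac swF := repeat (rewrite sw_sw //; apply: sw_ext => ? ?); rewrite sw_pure //.

Lemma tens_lin_eq (k : fieldType) (U V W : lmodType k) (f g : tens U V -> W) :
  linear f -> linear g -> (forall u v, f (pure u v) = g (pure u v)) ->
  forall t, f t = g t.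
Proof.
by move=> fl gl fg t; rewrite (sw_exp t fl) (sw_exp t gl); apply: sw_ext.
Qed.
Ltac tens_elim t := move: t; apply: tens_lin_eq; [by lin | by lin | ].

(** * Twisted Yetter-Drinfel'd modules *)

Section ModPred.
Variables (k : fieldType) (X : lmodType k) (h : hopf X) (M : lmodType k).
Implicit Types (mu : {linear tens X M -> M}) (la : {linear M -> tens X M}).
Local Notation "x ∙ y" := (hmul h (pure x y)) (at level 40, left associativity).
Local Notation one := (hone h).
Local Notation D := (hcom h).
Local Notation e := (hcou h).

Definition isact mu : Prop :=
  (forall x y m, mu (pure (x ∙ y) m) = mu (pure x (mu (pure y m)))) /\
  (forall m, mu (pure one m) = m).
Definition iscoact la : Prop :=
  (forall (W : lmodType k) (F : X -> X -> M -> W) m, trilin F ->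
     \sw_(x, n <- la m) \sw_(a, b <- D x) F a b n =
     \sw_(x, n <- la m) \sw_(y, n' <- la n) F x y n') /\
  (forall (W : lmodType k) (F : M -> W) m, linear F ->
     \sw_(x, n <- la m) (e x : k) *: F n = F m).
(** One twist on each side, because twists compose: a tensor product of a module with twists (al,
    be) and one with twists (be, ga) has twists (al, ga). *)
Definition isYD (gl ga : {linear X -> X}) mu la : Prop :=
  forall (W : lmodType k) (F : X -> M -> W) x m, bilin F ->
    \sw_(a, b <- D x) \sw_(y, n <- la (mu (pure a m))) F (y ∙ ga b) n =
    \sw_(a, b <- D x) \sw_(y, n <- la m) F (gl a ∙ y) (mu (pure b n)).

Lemma actP mu : is_action h mu <-> isact mu.
Proof.
split=> [[E1 E2]|[E1 E2]]; split.
- by move=> x y m; have := E1 (pure x (pure y m)); wev; exact.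
- by move=> m; have := E2 m; rewrite hcompE hox0l; wev; exact.
- by apply: tens_ext3 => x y m; wev; apply: E1.
- by move=> m; rewrite hcompE hox0l; wev; apply: E2.
Qed.
Lemma coactP la : is_coaction h la <-> iscoact la.
Proof.
split=> [[E1 E2]|[E1 E2]]; split.
- move=> W F m [F1 F2 F3]; have := E1 m; rewrite !hcompE => E.
  pose G (a : X) (t : tens X M) := \sw_(c, d <- t) F a c d.
  have Gl : bilin G by rewrite /G; lin.
  transitivity (teval G (hox (bcomul h) (idm M) (la m))).
    symmetry; swx (la m) => x n; wev; swx (bcomul h x) => a b; wev.
    by rewrite sw_pure // /G sw_pure //; lin.
  by rewrite E; swx (la m) => x n; wev; rewrite sw_pure.
- move=> W F m Fl; have := E2 m; rewrite hcompE idmE => E.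
  by rewrite -[in RHS]E; symmetry; swx (la m) => x n; wev; rewrite linZ.
- move=> m; wev.
  transitivity (\sw_(x, n <- la m) \sw_(a, b <- D x) pure a (pure b n)).
    by swx (la m) => x n; wev; swx (bcomul h x) => a b; wev.
  rewrite E1; last by lin.
  by symmetry; swx (la m) => x n; wev; swx (la n) => a b.
- move=> m; wev; rewrite -[RHS](E2 _ id); last by lin.
  by swx (la m) => x n; wev.
Qed.
Lemma ydP mu la :
  yd_condition (flip X X) h (flip X M) (flip M X) mu la <-> isYD (lid X) (lid X) mu la.
Proof.
have L x m : hcomp (hcomp (hcomp (hcomp (hox (bmul h) (idm M)) (hox (idm X) (flip M X)))
   (hox (hcomp (la : wmap [:: M] [:: X; M]) (mu : wmap [:: X; M] [:: M])) (idm X))) (hox (idm X) (flip X M))) (hox (bcomul h) (idm M)) (pure x m)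
  = \sw_(a, b <- D x) \sw_(y, n <- la (mu (pure a m))) pure (y ∙ b) n.
  wev; swx (bcomul h x) => a b; wev; swx (la (mu (pure a m))) => y n; by wev.
have R x m : hcomp (hcomp (hox (bmul h) (mu : wmap [:: X; M] [:: M])) (hox (hox (idm X) (flip X X)) (idm M)))
    (hox (bcomul h) (la : wmap [:: M] [:: X; M])) (pure x m)
  = \sw_(a, b <- D x) \sw_(y, n <- la m) pure (a ∙ y) (mu (pure b n)).
  wev; swx (bcomul h x) => a b; swx (la m) => y n; by wev.
split=> E.
  move=> W F x m Fb; have := E (pure x m); rewrite L R => /(congr1 (teval F)) E'.
  by apply: etrans (etrans E' _); [symmetry|]; swF.
by apply: tens_ext => x m; rewrite L R E //; lin.
Qed.
End ModPred.

(** * Finite-dimensional spaces, bases and rank one maps *)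

Section FiniteDim.
Variables (k : fieldType).
Implicit Types U V W X : lmodType k.

(** Indexed by an arbitrary finite type, since tensor products and Hom spaces get bases indexed by
    pairs. *)
Definition isbasis (I : finType) V (e : I -> V) (c : I -> {linear V -> k^o}) : Prop :=
  (forall v, v = \sum_i (c i v : k) *: e i) /\ (forall i j, c i (e j) = (i == j)%:R).
Definition hasdim n V : Prop := inhabited (vector_axiom_def n V).

Lemma findim_basis n V : hasdim n V ->
  exists (e : 'I_n -> V) (c : 'I_n -> {linear V -> k^o}), isbasis e c.
Proof.
case=> -[f fl [g fg gf]].
have gl : linear g by move=> a x y; apply: (can_inj fg); rewrite fl !gf.
have cl i : linear (fun v => f v 0 i : k^o) by move=> a x y; rewrite fl !mxE.
exists (fun i => g (delta_mx 0 i)), (fun i => mkLin (cl i)); split => [v|i j] /=.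
  apply: (can_inj fg); rewrite [X in _ = f X](_ : _ = g (\sum_i f v 0 i *: delta_mx 0 i)).
    by rewrite gf [LHS]row_sum_delta.
  rewrite -[g _]/(mkLin gl _) linear_sum; apply: eq_bigr => i _.
  by rewrite linearZ.
by rewrite gf mxE eqxx eq_sym.
Qed.

Lemma basis_findim (I : finType) V (e : I -> V) c : isbasis e c -> hasdim #|I| V.
Proof.
move=> [ev ce]; constructor; exists (fun v => \row_i c (enum_val i) v).
  by move=> a x y; apply/rowP => i; rewrite !mxE linearP.
exists (fun r : 'rV[k]_#|I| => \sum_i r 0 (enum_rank i) *: e i) => [v|r].
  by rewrite [RHS]ev; apply: eq_bigr => i _; rewrite mxE enum_rankK.
apply/rowP => i; rewrite mxE linear_sum (bigD1 (enum_val i)) //= linearZ /= ce eqxx.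
rewrite big1 => [|j ji]; last by rewrite linearZ /= ce eq_sym (negPf ji) scaler0.
by rewrite addr0 enum_valK /GRing.scale /= mulr1.
Qed.

(** In coordinates, surjectivity supplies row by row a matrix [B] with [B *m A = 1]; for square
    matrices this is a two-sided inverse. *)
Lemma surj_bij n U V (f : {linear U -> V}) : hasdim n U -> hasdim n V ->
  (forall v, exists u, f u = v) -> bijective f.
Proof.
case=> -[a al [a' aa' a'a]] [[b bl [b' bb' b'b]]] fs.
have a'l : linear a' by move=> c x y; apply: (can_inj aa'); rewrite al !a'a.
have gl : linear (fun r => b (f (a' r))) by move=> c x y; rewrite a'l linearP bl.
pose g := mkLin gl; pose A := lin1_mx g.
have gE r : r *m A = g r by rewrite mul_rV_lin1.
have [B BA] : exists B : 'M_n, B *m A = 1%:M.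
  have /choice [B BE] : forall i : 'I_n, exists r, g r = delta_mx 0 i.
    move=> i; have [u fu] := fs (b' (delta_mx 0 i)); exists (a u).
    by rewrite /= aa' fu b'b.
  exists (\matrix_i B i); apply/row_matrixP => i.
  by rewrite row_mul rowK gE BE row1.
have AB := mulmx1C BA.
exists (fun v => a' (b v *m B)) => [u|v].
  have -> : b (f u) = a u *m A by rewrite gE /= aa'.
  by rewrite -mulmxA AB mulmx1 aa'.
apply: (can_inj bb'); rewrite -[LHS]/(g _) -gE -mulmxA BA.
by rewrite mulmx1.
Qed.

Lemma basis_lin (I : finType) V W (e : I -> V) c (F : V -> W) v :
  isbasis e c -> linear F -> F v = \sum_i (c i v : k) *: F (e i).
Proof.
move=> [eb _] Fl; rewrite {1}[v]eb linS //; apply: eq_bigr => i _.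
exact: linZ.
Qed.

Lemma basis_exp (I : finType) U V (e : I -> U) c (f : LinMap U V) : isbasis e c ->
  f = \sum_i rank1 (c i) (f (e i)).
Proof.
move=> [ev ce]; apply: lin_ext => u.
transitivity (\sum_i rank1 (c i) (f (e i)) u).
  by rewrite {1}[u]ev linear_sum; apply: eq_bigr => i _; rewrite linearZ.
by rewrite LinMap_sum.
Qed.
(** Reduces an identity between maps on a Hom space to values at basis vectors, where the defining
    formulas for the action and the coaction on Hom apply. *)
Lemma basis_linexp (I : finType) U V W (e : I -> U) c (F : LinMap U V -> W) f :
  isbasis e c -> linear F -> F f = \sum_i F (rank1 (c i) (f (e i))).
Proof.
by move=> eb Fl; rewrite {1}(basis_exp f eb) -[LHS]/(mkLin Fl _) linear_sum.
Qed.

Lemma hasdim_tens n m U V : hasdim n U -> hasdim m V -> hasdim (n * m) (tens U V).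
Proof.
move=> /findim_basis[e [c [eE ce]]] /findim_basis[e' [c' [eE' ce']]].
have -> : (n * m = #|{: 'I_n * 'I_m}|)%N by rewrite card_prod !card_ord.
have cl (p : 'I_n * 'I_m) : bilin (fun u v => (c p.1 u : k) *: c' p.2 v) by lin.
apply: (@basis_findim _ _ (fun p => pure (e p.1) (e' p.2)) (fun p => tlift (bilinE (cl p)))).
split=> [t|[i j] [i' j']]; last first.
  by apply: etrans (tlift_pure _ _ _) _; rewrite /= ce ce' xpair_eqE -mulnb natrM.
rewrite -{1}[t]sw_id (eq_bigr (fun p => \sw_(a, b <- t) (c p.1 a * c' p.2 b : k) *: pure (e p.1) (e' p.2))).
  rewrite -sw_sum; apply: sw_ext => a b.
  rewrite {1}[a]eE {1}[b]eE' -(pair_bigA _ (fun i j => (c i a * c' j b : k) *: pure (e i) (e' j))) /=.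
  rewrite pureSl; apply: eq_bigr => i _ /=.
  rewrite pureSr; apply: eq_bigr => j _ /=.
  by rewrite pureZl pureZr scalerA.
move=> p _; rewrite [RHS]/= -sw_scal; congr (_ *: _).
Qed.
Lemma hasdim_hom n m U V : hasdim n U -> hasdim m V -> hasdim (n * m) (LinMap U V).
Proof.
move=> /findim_basis[e [c eb]] /findim_basis[e' [c' [eE' ce']]].
have -> : (n * m = #|{: 'I_n * 'I_m}|)%N by rewrite card_prod !card_ord.
have cl (p : 'I_n * 'I_m) : linear (fun f : LinMap U V => c' p.2 (f (e p.1))) by lin.
apply: (@basis_findim _ _ (fun p => rank1 (c p.1) (e' p.2)) (fun p => mkLin (cl p))).
split=> [f|[i j] [i' j']]; last first.
  by rewrite /= eb.2 linearZ /= ce' xpair_eqE -mulnb natrM eq_sym.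
rewrite {1}(basis_exp f eb) -(pair_bigA _ (fun i j => (c' j (f (e i)) : k) *: rank1 (c i) (e' j))) /=.
apply: eq_bigr => i _; rewrite {1}[f (e i)]eE'.
rewrite (linS (f := rank1 (c i))); last exact: (lin_rank1 _ (@lin_id _ _)).
apply: eq_bigr => j _ /=.
by rewrite linZ //; apply: (lin_rank1 (c i) (@lin_id _ _)).
Qed.
Lemma findimP V : findim V <-> exists n, hasdim n V.
Proof. by []. Qed.
(** The values at a basis recover the tensor by rank one maps. Coactions on Hom are known only
    through evaluation, and this makes them unique. *)
Lemma hom_uniq n U V W (t t' : tens W (LinMap U V)) : hasdim n U ->
  (forall u, \sw_(x, f : LinMap U V <- t) pure x (f u) = \sw_(x, f : LinMap U V <- t') pure x (f u)) -> t = t'.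
Proof.
move=> /findim_basis[e [c eb]] E.
have X (s : tens W (LinMap U V)) : s = \sum_i \sw_(x, v <- \sw_(x, f : LinMap U V <- s) pure x (f (e i))) pure x (rank1 (c i) v).
  rewrite -{1}[s]sw_id.
  transitivity (\sw_(x, f : LinMap U V <- s) \sum_i pure x (rank1 (c i) (f (e i)))).
    apply: sw_ext => x f; apply: (basis_linexp (F := pure x)) => //.
    exact: (lin_purer _ (@lin_id _ _)).
  rewrite sw_sum; apply: eq_bigr => i _; rewrite sw_sw; last first.
    by split=> ?; [lin | apply: lin_purer; apply: lin_rank1].
  apply: sw_ext => x f; rewrite sw_pure //.
  by split=> ?; [lin | apply: lin_purer; apply: lin_rank1].
by rewrite [t]X [t']X; apply: eq_bigr => i _; rewrite E.
Qed.
End FiniteDim.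

(** * Tensor products of twisted modules *)

Section TensorYD.
Variables (k : fieldType) (X : lmodType k) (h : hopf X).
Hypothesis hopfX : is_hopf (flip X X) h.
Local Notation "x ∙ y" := (hmul h (pure x y)) (at level 40, left associativity).
Local Notation D := (hcom h).
Local Notation e := (hcou h).
Variables M N : lmodType k.
Variables (mu : {linear tens X M -> M}) (la : {linear M -> tens X M}).
Variables (nu : {linear tens X N -> N}) (ka : {linear N -> tens X N}).

Lemma diag_actE x m n :
  diag_act h (flip X M) mu nu (pure x (pure m n)) =
  \sw_(a, b <- D x) pure (mu (pure a m)) (nu (pure b n)).
Proof.
by rewrite /diag_act; wev; swx (bcomul h x) => a b; wev.
Qed.
Lemma diag_coactE m n :
  diag_coact h (flip M X) la ka (pure m n) =
  \sw_(y, m' <- la m) \sw_(z, n' <- ka n) pure (y ∙ z) (pure m' n').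
Proof.
rewrite /diag_coact; wev; swx (la m) => y m'; swx (ka n) => z n'; by wev.
Qed.

Definition tact : {linear tens X (tens M N) -> tens M N} := diag_act h (flip X M) mu nu.
Definition tcoact : {linear tens M N -> tens X (tens M N)} := diag_coact h (flip M X) la ka.
Lemma tactE x m n :
  tact (pure x (pure m n)) = \sw_(a, b <- D x) pure (mu (pure a m)) (nu (pure b n)).
Proof. exact: diag_actE. Qed.
Lemma tcoactE m n : tcoact (pure m n) =
  \sw_(y, m' <- la m) \sw_(z, n' <- ka n) pure (y ∙ z) (pure m' n').
Proof. exact: diag_coactE. Qed.
Lemma sw_tcoact (W : lmodType k) (F : X -> tens M N -> W) m n : bilin F ->
  teval F (tcoact (pure m n)) =
  \sw_(y, m' <- la m) \sw_(z, n' <- ka n) F (y ∙ z) (pure m' n').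
Proof. by move=> Fb; rewrite tcoactE; swF. Qed.

Lemma tact_isact : isact h mu -> isact h nu -> isact h tact.
Proof.
move=> [mA m1] [nA n1]; split.
  move=> x y t; tens_elim t => m n; rewrite !tactE (hcomM hopfX) //; last by lin.
  rewrite !(sw_purer, sw_lin) sw_C; apply: sw_ext => c d; rewrite tactE.
  by apply: sw_ext => a b; rewrite mA nA.
move=> t; tens_elim t => m n.
by rewrite tactE (hcom1 hopfX) sw_pure ?m1 ?n1 //; lin.
Qed.

Lemma tcoact_iscoact : iscoact h la -> iscoact h ka -> iscoact h tcoact.
Proof.
move=> [lA l1] [kA k1]; split.
  move=> W F t [F1 F2 F3]; tens_elim t => m n; rewrite !sw_tcoact; try by lin.
  transitivity (\sw_(y, m' <- la m) \sw_(a, b <- D y) \sw_(z, n' <- ka n)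
      \sw_(c, d <- D z) F (a ∙ c) (b ∙ d) (pure m' n')).
    apply: sw_ext => y m'; rewrite [RHS]sw_C; apply: sw_ext => z n'.
    by rewrite (hcomM hopfX) //; lin.
  rewrite (lA _ (fun a b m' => \sw_(z, n' <- ka n)
      \sw_(c, d <- D z) F (a ∙ c) (b ∙ d) (pure m' n'))); last by lin.
  apply: sw_ext => y m'.
  transitivity (\sw_(y', m'' <- la m') \sw_(z, n' <- ka n) \sw_(z', n'' <- ka n')
     F (y ∙ z) (y' ∙ z') (pure m'' n'')).
    by apply: sw_ext => y' m''; rewrite (kA _ (fun c d n' => F (y ∙ c) (y' ∙ d) (pure m'' n'))) //; lin.
  rewrite sw_C; apply: sw_ext => z n'; rewrite sw_tcoact; last by lin.
  by [].
move=> W F t Fl; tens_elim t => m n; rewrite sw_tcoact; last by lin.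
transitivity (\sw_(y, m' <- la m) (e y : k) *: F (pure m' n)).
  apply: sw_ext => y m'; rewrite -(k1 _ (fun n' => F (pure m' n'))); last by lin.
  rewrite sw_scale; apply: sw_ext => z n'; rewrite (hcouM hopfX).
  by rewrite -scalerA.
by rewrite (l1 _ (fun m' => F (pure m' n))) //; lin.
Qed.

(** For components b1, b2, b3 of x, the condition of [N] at b2 and b3 trades ga(b3) on the right for
    be(b2) in the middle, which is exactly the factor that the condition of [M] at b1 and b2
    absorbs. *)
Lemma tens_isYD (al be ga : {linear X -> X}) :
  isYD h al be mu la -> isYD h be ga nu ka -> isYD h al ga tact tcoact.
Proof.
move=> My Ny W F x t Fb; have [Fl Fr] := Fb.
tens_elim t => m n.
transitivity (\sw_(a, b <- D x) \sw_(a1, a2 <- D a) \sw_(y, m' <- la (mu (pure a1 m)))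
   \sw_(z, n' <- ka (nu (pure a2 n))) F (y ∙ z ∙ ga b) (pure m' n')).
  apply: sw_ext => a b; rewrite tactE sw_lin sw_sw; last by lin.
  by apply: sw_ext => a1 a2; rewrite sw_tcoact //; lin.
rewrite (hcomA hopfX (F := fun a1 a2 b => \sw_(y, m' <- la (mu (pure a1 m)))
   \sw_(z, n' <- ka (nu (pure a2 n))) F (y ∙ z ∙ ga b) (pure m' n'))); last by lin.
transitivity (\sw_(a, b <- D x) \sw_(y, m' <- la (mu (pure a m))) \sw_(b1, b2 <- D b)
   \sw_(z, n' <- ka n) F (y ∙ (be b1 ∙ z)) (pure m' (nu (pure b2 n')))).
  apply: sw_ext => a b; rewrite sw_C; apply: sw_ext => y m'.
  rewrite -(Ny _ (fun w n' => F (y ∙ w) (pure m' n'))); last by lin.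
  by apply: sw_ext => b1 b2; apply: sw_ext => z n'; rewrite (hmulA hopfX).
transitivity (\sw_(a, b <- D x) \sw_(a1, a2 <- D a) \sw_(y, m' <- la (mu (pure a1 m)))
   \sw_(z, n' <- ka n) F (y ∙ be a2 ∙ z) (pure m' (nu (pure b n')))).
  rewrite (hcomA hopfX (F := fun a1 a2 b => \sw_(y, m' <- la (mu (pure a1 m)))
   \sw_(z, n' <- ka n) F (y ∙ be a2 ∙ z) (pure m' (nu (pure b n'))))); last by lin.
  apply: sw_ext => a b; rewrite sw_C; apply: sw_ext => y m'.
  by apply: sw_ext => b1 b2; apply: sw_ext => z n'; rewrite (hmulA hopfX).
transitivity (\sw_(a, b <- D x) \sw_(a1, a2 <- D a) \sw_(y, m' <- la m)
   \sw_(z, n' <- ka n) F (al a1 ∙ y ∙ z) (pure (mu (pure a2 m')) (nu (pure b n')))).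
  apply: sw_ext => a b.
  by rewrite (My _ (fun w m' => \sw_(z, n' <- ka n) F (w ∙ z) (pure m' (nu (pure b n'))))) //; lin.
rewrite (hcomA hopfX (F := fun a1 a2 b => \sw_(y, m' <- la m)
   \sw_(z, n' <- ka n) F (al a1 ∙ y ∙ z) (pure (mu (pure a2 m')) (nu (pure b n'))))); last by lin.
apply: sw_ext => a b; rewrite sw_tcoact; last by lin.
rewrite sw_C; apply: sw_ext => y m'; rewrite sw_C; apply: sw_ext => z n'.
rewrite tactE (sw_linear _ _ (Fr _)); apply: sw_ext => a1 a2.
by rewrite (hmulA hopfX).
Qed.
End TensorYD.

(** * Actions and coactions on Hom spaces *)

Section HomYD.
Variables (k : fieldType) (X : lmodType k) (h : hopf X).
Hypothesis hopfX : is_hopf (flip X X) h.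
Hypothesis bijS : bijective (antip h).
Local Notation "x ∙ y" := (hmul h (pure x y)) (at level 40, left associativity).
Local Notation D := (hcom h).
Local Notation e := (hcou h).
Local Notation S := (hant h).
Local Notation Sb := (hantV h).
Variables M N : lmodType k.
Variables (mu : {linear tens X M -> M}) (la : {linear M -> tens X M}).
Variables (nu : {linear tens X N -> N}) (ka : {linear N -> tens X N}).
Local Notation E := (LinMap M N).

Definition is_homact (act : {linear tens X E -> E}) : Prop :=
  forall x (f : E) m, act (pure x f) m =
    \sw_(a, b <- D x) nu (pure a (f (mu (pure (S b) m)))).
Definition is_homcoact (rho : {linear E -> tens X E}) : Prop :=
  forall (W : lmodType k) (F : X -> N -> W) (f : E) m, bilin F ->
    \sw_(x, f' : E <- rho f) F x (f' m) =
    \sw_(y, m' <- la m) \sw_(z, n <- ka (f m')) F (z ∙ Sb y) n.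

Lemma homact_unique act (x : X) (f : E) (g : E) : is_homact act ->
  (forall m, g m = \sw_(a, b <- D x) nu (pure a (f (mu (pure (S b) m))))) ->
  act (pure x f) = g.
Proof. by move=> aE gE; apply: lin_ext => m; rewrite aE gE. Qed.

(** This is linearity of evaluation: the inner factors meet as S(x2) x3 and cancel. *)
Lemma homact_cancel act x (f : E) m : is_homact act -> isact h mu ->
  \sw_(a, b <- D x) act (pure a f) (mu (pure b m)) = nu (pure x (f m)).
Proof.
move=> aE [mA m1].
transitivity (\sw_(a, b <- D x) \sw_(c, d <- D a) nu (pure c (f (mu (pure (S d ∙ b) m))))).
  by apply: sw_ext => a b; rewrite aE; apply: sw_ext => c d; rewrite mA.
rewrite (hcomA hopfX (F := fun c d b => nu (pure c (f (mu (pure (S d ∙ b) m)))))); last by lin.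
rewrite -[RHS](hcou1r hopfX (F := fun a => nu (pure a (f m)))); last by lin.
apply: sw_ext => a b.
rewrite (hantl hopfX (F := fun z => nu (pure a (f (mu (pure z m)))))) ?m1 //; lin.
Qed.

(** This is colinearity of evaluation, by the corresponding cancellation with the inverse
    antipode. *)
Lemma homcoact_cancel rho (W : lmodType k) (F : X -> N -> W) (f : E) m :
  is_homcoact rho -> iscoact h la -> bilin F ->
  \sw_(x, f' : E <- rho f) \sw_(y, m' <- la m) F (x ∙ y) (f' m') =
  \sw_(z, n <- ka (f m)) F z n.
Proof.
move=> rE [lA l1] Fb.
transitivity (\sw_(y, m' <- la m) \sw_(y', m'' <- la m') \sw_(z, n <- ka (f m'')) F (z ∙ (Sb y' ∙ y)) n).
  rewrite sw_C; apply: sw_ext => y m'.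
  rewrite (rE _ (fun x n => F (x ∙ y) n)); last by lin.
  by apply: sw_ext => y' m''; apply: sw_ext => z n; rewrite (hmulA hopfX).
rewrite -(lA _ (fun y y' m'' => \sw_(z, n <- ka (f m'')) F (z ∙ (Sb y' ∙ y)) n)); last by lin.
transitivity (\sw_(y, m' <- la m) (e y : k) *: \sw_(z, n <- ka (f m')) F z n).
  apply: sw_ext => y m'.
  rewrite (hantVl hopfX bijS (F := fun w => \sw_(z, n <- ka (f m')) F (z ∙ w) n)); last by lin.
  by congr (_ *: _); apply: sw_ext => z n; rewrite (hmul1r hopfX).
by rewrite (l1 _ (fun m' => \sw_(z, n <- ka (f m')) F z n)) //; lin.
Qed.

Lemma homact_isact act : is_homact act -> isact h mu -> isact h nu -> isact h act.
Proof.
move=> aE [mA m1] [nA n1]; split => [x y f|f]; apply: lin_ext => m.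
  rewrite aE (hcomM hopfX); last by lin.
  rewrite [RHS]aE; apply: sw_ext => a b; rewrite aE sw_purer sw_lin; apply: sw_ext => c d.
  by rewrite (hantM hopfX) mA nA.
rewrite aE (hcom1 hopfX) sw_pure ?(hant1 hopfX) ?m1 ?n1 //; lin.
Qed.

Section FinDim.
Variable n0 : nat.
Hypothesis fdM : hasdim n0 M.

(** The formula prescribes f_(-1) (x) f_(0)(m) for each m separately. A finite basis of [M] with its
    dual functionals assembles these values into one tensor, as a finite sum of rank one maps. *)
Lemma homcoact_exists : exists rho, is_homcoact rho.
Proof.
have [b [c bc]] := findim_basis fdM.
pose r (f : E) : tens X E := \sum_i \sw_(y, m' <- la (b i)) \sw_(z, n <- ka (f m'))
  pure (z ∙ Sb y) (rank1 (c i) n).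
have rl : linear r.
  by apply: lin_sum => i; lin; apply: lin_rank1; lin.
exists (mkLin rl) => W F f m Fb; rewrite /= /r.
have Fl (u : M) : linear (fun t : tens X E => \sw_(x, f' : E <- t) F x (f' u)).
  by lin.
rewrite -[LHS]/((fun t : tens X E => \sw_(x, f' : E <- t) F x (f' m)) _) linS //.
transitivity (\sum_i (c i m : k) *: \sw_(y, m' <- la (b i)) \sw_(z, n <- ka (f m')) F (z ∙ Sb y) n).
  apply: eq_bigr => i _; rewrite sw_scale sw_sw; last by lin.
  apply: sw_ext => y m'; rewrite sw_scale sw_sw; last by lin.
  apply: sw_ext => z n; rewrite sw_pure; last by lin.
  by rewrite rank1E linZ //; lin.
by rewrite [RHS](basis_lin (F := fun m => \sw_(y, m' <- la m) \sw_(z, n <- ka (f m')) F (z ∙ Sb y) n) m bc) //; lin.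
Qed.

Lemma homcoact_unique rho rho' : is_homcoact rho -> is_homcoact rho' -> rho =1 rho'.
Proof.
move=> r1 r2 f; apply: (hom_uniq fdM) => m.
by rewrite r1 ?r2 //; lin.
Qed.

(** The equation describing [hom_coact] is equivalent to [is_homcoact], which has a solution, so the
    description does not fall back on its default value. *)
Lemma hom_coactP : is_homcoact (hom_coact (flip X X) h (flip E X) la ka).
Proof.
have sE rho : (hcomp (hox (idm X) (ev M N)) (hox (rho : wmap [:: E] [:: X; E]) (idm M)) =1
  hcomp (hcomp (hcomp (hcomp (hox (hcomp (bmul h) (flip X X)) (idm N)) (hox (idm X) (hcomp (ka : wmap [:: N] [:: X; N]) (ev M N))))
       (hox (hox (linv (antip h)) (idm (LinMap M N))) (idm M)))
       (hox (flip E X) (idm M))) (hox (idm (LinMap M N)) (la : wmap [:: M] [:: X; M]))) <-> is_homcoact rho.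
  have R (f : E) m : hcomp (hcomp (hcomp (hcomp (hox (hcomp (bmul h) (flip X X)) (idm N)) (hox (idm X) (hcomp (ka : wmap [:: N] [:: X; N]) (ev M N))))
       (hox (hox (linv (antip h)) (idm (LinMap M N))) (idm M)))
       (hox (flip E X) (idm M))) (hox (idm (LinMap M N)) (la : wmap [:: M] [:: X; M])) (pure f m) =
       \sw_(y, m' <- la m) \sw_(z, n <- ka (f m')) pure (z ∙ Sb y) n.
    wev; swx (la m) => y m'; wev; swx (ka (f m')) => z n; by wev.
  have L (f : E) m : hcomp (hox (idm X) (ev M N)) (hox (rho : wmap [:: E] [:: X; E]) (idm M)) (pure f m) =
     \sw_(x, f' : E <- rho f) pure x (f' m).
    by wev; swx (rho f) => x f'; wev.
  split=> H.
    move=> W F f m Fb; have := H (pure f m); rewrite L R => /(congr1 (teval F)) H'.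
    by apply: etrans (etrans H' _); [symmetry|]; swF.
  by apply: tens_ext => f m; rewrite L R H //; lin.
have [rho /sE rhoP] := homcoact_exists.
apply/sE; rewrite /hom_coact /the; case: xgetP => [y _ //|/(_ rho)[]]; exact: rhoP.
Qed.

Lemma homcoact_iscoact rho : is_homcoact rho -> iscoact h la -> iscoact h ka -> iscoact h rho.
Proof.
move=> rE [lA l1] [kA k1]; split=> [W F f [F1 F2 F3]|W F f Fl].
  have b1 (c : {linear M -> k^o}) a b : linear (fun n => F a b (rank1 c n)).
    by apply: lin_comp => //; apply: lin_rank1.
  have [b [c bc]] := findim_basis fdM.
  have expand G : trilin G -> \sw_(x, f' <- rho f) teval (fun a b => G a b f') (D x) = 
    \sum_i \sw_(x, f' : E <- rho f) \sw_(a, b0 <- D x) G a b0 (rank1 (c i) (f' (b i))) :> W.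
    move=> [G1 G2 G3]; rewrite -sw_sum; apply: sw_ext => x f'.
    by rewrite -sw_sum; apply: sw_ext => a b'; apply: (basis_linexp _ bc).
  rewrite expand //.
  transitivity (\sum_i \sw_(x, f' : E <- rho f) \sw_(y, f'' : E <- rho f') F x y (rank1 (c i) (f'' (b i)))); last first.
    rewrite -sw_sum; apply: sw_ext => x f'; rewrite -sw_sum; apply: sw_ext => y f''.
    by symmetry; apply: (basis_linexp _ bc).
  apply: eq_bigr => i _; set m := b i; set ci := c i.
  have b2 a c' : linear (fun n => F a c' (rank1 ci n)) by apply: b1.
  rewrite (rE _ (fun x n => \sw_(a, b0 <- D x) F a b0 (rank1 ci n))); last by lin.
  transitivity (\sw_(x, f' : E <- rho f) \sw_(y, m' <- la m) \sw_(z, n <- ka (f' m')) F x (z ∙ Sb y) (rank1 ci n)); last first.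
    by apply: sw_ext => x f'; rewrite (rE _ (fun y n => F x y (rank1 ci n))) //; lin.
  rewrite [RHS]sw_C.
  transitivity (\sw_(y, m' <- la m) \sw_(y', m'' <- la m') \sw_(z, n <- ka (f m''))
     \sw_(z', n' <- ka n) F (z ∙ Sb y') (z' ∙ Sb y) (rank1 ci n')); last first.
    by apply: sw_ext => y m'; rewrite (rE _ (fun x n => \sw_(z, n' <- ka n) F x (z ∙ Sb y) (rank1 ci n'))) //; lin.
  rewrite -(lA _ (fun y y' m'' => \sw_(z, n <- ka (f m''))
     \sw_(z', n' <- ka n) F (z ∙ Sb y') (z' ∙ Sb y) (rank1 ci n'))); last by lin.
  apply: sw_ext => y m'; rewrite [RHS]sw_C.
  transitivity (\sw_(z, n <- ka (f m')) \sw_(a, b0 <- D z) \sw_(y1, y2 <- D y) F (a ∙ Sb y2) (b0 ∙ Sb y1) (rank1 ci n)).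
    apply: sw_ext => z n; rewrite (hcomM hopfX); last by lin.
    by apply: sw_ext => a b'; rewrite (hcomSb hopfX bijS) //; lin.
  rewrite (kA _ (fun a b0 n => \sw_(y1, y2 <- D y) F (a ∙ Sb y2) (b0 ∙ Sb y1) (rank1 ci n))); last by lin.
  by apply: sw_ext => z n; rewrite [RHS]sw_C.
have [b [c bc]] := findim_basis fdM.
have b1 i : linear (fun n => F (rank1 (c i) n)).
  by apply: lin_comp => //; apply: lin_rank1.
rewrite (basis_linexp f bc Fl).
transitivity (\sum_i \sw_(x, f' : E <- rho f) (e x : k) *: F (rank1 (c i) (f' (b i)))).
  rewrite -sw_sum; apply: sw_ext => x f'; rewrite -scaler_sumr; congr (_ *: _).
  exact: (basis_linexp _ bc).
apply: eq_bigr => i _; rewrite (rE _ (fun x n => (e x : k) *: F (rank1 (c i) n))); last by lin.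
transitivity (\sw_(y, m' <- la (b i)) (e y : k) *: F (rank1 (c i) (f m'))).
  apply: sw_ext => y m'; rewrite -(k1 _ (fun n => F (rank1 (c i) n))) // sw_scale.
  by apply: sw_ext => z n; rewrite (hcouM hopfX) (hcouSb hopfX bijS) mulrC scalerA.
by rewrite (l1 _ (fun m' => F (rank1 (c i) (f m')))) //; lin.
Qed.
End FinDim.
End HomYD.

Section HomYD2.
Variables (k : fieldType) (X : lmodType k) (h : hopf X).
Hypothesis hopfX : is_hopf (flip X X) h.
Hypothesis bijS : bijective (antip h).
Local Notation "x ∙ y" := (hmul h (pure x y)) (at level 40, left associativity).
Local Notation one := (hone h).
Local Notation D := (hcom h).
Local Notation S := (hant h).
Local Notation Sb := (hantV h).

(* The image of the Yetter-Drinfel'd condition for [S x] under the inverse antipode. *)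
Lemma isYD_antip (M W : lmodType k) (al be : {linear X -> X}) mu la (F : X -> M -> W) x m :
  (forall x, be (S x) = S (be x)) -> (forall x, al (S x) = S (al x)) ->
  isYD h al be mu la -> bilin F ->
  \sw_(a, b <- D x) \sw_(u, m' <- la (mu (pure (S b) m))) F (be a ∙ Sb u) m' =
  \sw_(u, m' <- la m) \sw_(a, b <- D x) F (Sb u ∙ al b) (mu (pure (S a) m')).
Proof.
move=> beS alS My Fb.
have := My _ (fun y n => F (Sb y) n) (S x) m; rewrite !(hcomS hopfX); try by lin.
move=> /(_ _) E; rewrite [RHS]sw_C.
transitivity (\sw_(a, b <- D x) \sw_(y, n <- la (mu (pure (S b) m))) F (Sb (y ∙ be (S a))) n).
  apply: sw_ext => a b; apply: sw_ext => y n.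
  by rewrite (hantVM hopfX bijS) beS (hantK bijS).
rewrite E; last by lin.
apply: sw_ext => a b; apply: sw_ext => y n.
by rewrite (hantVM hopfX bijS) alS (hantK bijS).
Qed.

(** The twist [be] shared by source and target cancels: [isYD_antip] produces it next to the
    antipode of the source coaction, and the condition of [N] uses it up, leaving [al] on both
    sides. *)
Lemma hom_isYD (M N : lmodType k) n0 (al be : {linear X -> X}) mu la nu ka act rho :
  hasdim n0 M ->
  (forall x, be (S x) = S (be x)) -> (forall x, al (S x) = S (al x)) ->
  isYD h al be mu la -> @isYD _ _ h N al be nu ka ->
  is_homact h mu nu act -> @is_homcoact _ _ h M N la ka rho ->
  isYD h al al act rho.
Proof.
move=> fdM beS alS My Ny aE rE W F x f Fb; have [Fl Fr] := Fb.
have [b [c bc]] := findim_basis fdM.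
transitivity (\sum_i \sw_(a, b' <- D x) \sw_(y, f' : LinMap M N <- rho (act (pure a f))) F (y ∙ al b') (rank1 (c i) (f' (b i)))).
  rewrite -sw_sum; apply: sw_ext => a b'; rewrite -sw_sum; apply: sw_ext => y f'.
  exact: (basis_linexp _ bc).
transitivity (\sum_i \sw_(a, b' <- D x) \sw_(y, f' : LinMap M N <- rho f) F (al a ∙ y) (rank1 (c i) ((act (pure b' f') : LinMap M N) (b i)))); last first.
  rewrite -sw_sum; apply: sw_ext => a b'; rewrite -sw_sum; apply: sw_ext => y f'.
  by symmetry; exact: (basis_linexp _ bc).
apply: eq_bigr => i _; set m := b i; pose G y n := F y (rank1 (c i) n).
have Gb : bilin G by rewrite /G; lin.
rewrite -/(G _ _).
transitivity (\sw_(a, b' <- D x) \sw_(y, f' : LinMap M N <- rho (act (pure a f))) G (y ∙ al b') (f' m)); first by [].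
transitivity (\sw_(a, b' <- D x) \sw_(a1, a2 <- D a) \sw_(u, m' <- la m)
   \sw_(z, n <- ka (nu (pure a1 (f (mu (pure (S a2) m')))))) G (z ∙ Sb u ∙ al b') n).
  apply: sw_ext => a b'; rewrite (rE _ (fun y n => G (y ∙ al b') n)); last by lin.
  by rewrite [RHS]sw_C; apply: sw_ext => u m'; rewrite aE sw_lin sw_sw //; lin.
rewrite (hcomA hopfX (F := fun a1 a2 b' => \sw_(u, m' <- la m)
   \sw_(z, n <- ka (nu (pure a1 (f (mu (pure (S a2) m')))))) G (z ∙ Sb u ∙ al b') n)); last by lin.
transitivity (\sw_(a, b' <- D x) \sw_(c1, c2 <- D b') \sw_(u, m' <- la (mu (pure (S c2) m)))
    \sw_(z, n <- ka (nu (pure a (f m')))) G (z ∙ (be c1 ∙ Sb u)) n).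
  apply: sw_ext => a b'; rewrite (isYD_antip (F := fun w m' => 
    \sw_(z, n <- ka (nu (pure a (f m')))) G (z ∙ w) n) _ _ beS alS My); last by lin.
  rewrite [RHS]sw_C; apply: sw_ext => c1 c2; apply: sw_ext => u m'; apply: sw_ext => z n.
  by rewrite (hmulA hopfX).
transitivity (\sw_(a, b' <- D x) \sw_(a1, a2 <- D a) \sw_(u, m' <- la (mu (pure (S b') m)))
    \sw_(z, n <- ka (nu (pure a1 (f m')))) G (z ∙ be a2 ∙ Sb u) n).
  rewrite (hcomA hopfX (F := fun a1 a2 b' => \sw_(u, m' <- la (mu (pure (S b') m)))
    \sw_(z, n <- ka (nu (pure a1 (f m')))) G (z ∙ be a2 ∙ Sb u) n)); last by lin.
  apply: sw_ext => a b'; apply: sw_ext => c1 c2; apply: sw_ext => u m'; apply: sw_ext => z n.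
  by rewrite (hmulA hopfX).
transitivity (\sw_(a, b' <- D x) \sw_(a1, a2 <- D a) \sw_(u, m' <- la (mu (pure (S b') m)))
    \sw_(z, n <- ka (f m')) G (al a1 ∙ z ∙ Sb u) (nu (pure a2 n))).
  apply: sw_ext => a b'; rewrite sw_C [RHS]sw_C; apply: sw_ext => u m'.
  by apply: (Ny _ (fun w n => G (w ∙ Sb u) n)); lin.
rewrite (hcomA hopfX (F := fun a1 a2 b' => \sw_(u, m' <- la (mu (pure (S b') m)))
    \sw_(z, n <- ka (f m')) G (al a1 ∙ z ∙ Sb u) (nu (pure a2 n)))); last by lin.
apply: sw_ext => a b'.
transitivity (\sw_(c1, c2 <- D b') \sw_(y, f' : LinMap M N <- rho f) G (al a ∙ y) (nu (pure c1 (f' (mu (pure (S c2) m)))))).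
  apply: sw_ext => c1 c2; rewrite (rE _ (fun y n => G (al a ∙ y) (nu (pure c1 n)))); last by lin.
  by apply: sw_ext => u m'; apply: sw_ext => z n; rewrite (hmulA hopfX).
rewrite sw_C; apply: sw_ext => y f'; rewrite aE.
by rewrite -/(G _ _) [RHS]sw_linear //; lin.
Qed.

(** * Linear and colinear maps, and their detection through pairings *)

Section Morphisms.
Definition islin (M N : lmodType k) (mu : {linear tens X M -> M}) (nu : {linear tens X N -> N})
  (f : M -> N) : Prop := forall x m, f (mu (pure x m)) = nu (pure x (f m)).
Definition iscol (M N : lmodType k) (la : {linear M -> tens X M}) (ka : {linear N -> tens X N})
  (f : M -> N) : Prop := forall m, ka (f m) = \sw_(x, m' <- la m) pure x (f m').

Lemma sw_col (M N W : lmodType k) la ka (f : M -> N) (F : X -> N -> W) m :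
  iscol la ka f -> bilin F -> teval F (ka (f m)) = \sw_(x, m' <- la m) F x (f m').
Proof. by move=> fc Fb; rewrite fc; swF. Qed.

Lemma islin_comp (M N P : lmodType k) mu nu pi (f : M -> N) (g : N -> P) :
  islin mu nu f -> islin nu pi g -> islin mu pi (g \o f).
Proof. by move=> fl gl x m /=; rewrite fl gl. Qed.
Lemma iscol_comp (M N P : lmodType k) la ka pa (f : M -> N) (g : {linear N -> P}) :
  iscol la ka f -> iscol ka pa g -> iscol la pa (g \o f).
Proof. by move=> fc gc m /=; rewrite gc (sw_col _ fc) //; lin. Qed.
Lemma islin_can (M N : lmodType k) mu nu (f : M -> N) (g : N -> M) :
  cancel f g -> cancel g f -> islin mu nu f -> islin nu mu g.
Proof. by move=> fg gf fl x n; rewrite -{1}[n]gf -fl fg. Qed.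
Lemma iscol_can (M N : lmodType k) la ka (f : M -> N) (g : {linear N -> M}) :
  cancel f g -> cancel g f -> iscol la ka f -> iscol ka la g.
Proof.
move=> fg gf fc n; rewrite -{2}[n]gf (sw_col _ fc); last by lin.
by rewrite -{1}[la _]sw_id; apply: sw_ext => x m; rewrite fg.
Qed.

Lemma tmap_islin (M N M' N' : lmodType k) mu nu mu' nu' (f : {linear M -> M'}) (g : {linear N -> N'}) :
  islin mu mu' f -> islin nu nu' g -> islin (tact h mu nu) (tact h mu' nu') (tmap f g).
Proof.
move=> fl gl x t; tens_elim t => m n; rewrite tmap_pure !tactE sw_lin.
by apply: sw_ext => a b; rewrite tmap_pure fl gl.
Qed.
Lemma tmap_iscol (M N M' N' : lmodType k) la ka la' ka' (f : {linear M -> M'}) (g : {linear N -> N'}) :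
  iscol la la' f -> iscol ka ka' g -> iscol (tcoact h la ka) (tcoact h la' ka') (tmap f g).
Proof.
move=> fc gc t; tens_elim t => m n; rewrite tmap_pure sw_tcoact; last by lin.
rewrite tcoactE (sw_col (F := fun y m' => \sw_(z, n' <- ka' (g n)) pure (y ∙ z) (pure m' n')) _ fc); last by lin.
apply: sw_ext => y m'; rewrite (sw_col (F := fun z n' => pure (y ∙ z) (pure (f m') n')) _ gc); last by lin.
by apply: sw_ext => z n'; rewrite tmap_pure.
Qed.
Lemma assoc_islin (M N P : lmodType k) mu nu pi :
  islin (tact h (tact h mu nu) pi) (tact h mu (tact h nu pi)) (assoc M N P).
Proof.
move=> x t; tens_elim t => t p; tens_elim t => m n; rewrite assoc_pure !tactE sw_lin.
transitivity (\sw_(a, b <- D x) \sw_(c, d <- D a) pure (mu (pure c m)) (pure (nu (pure d n)) (pi (pure b p)))).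
  apply: sw_ext => a b; rewrite tactE sw_purel sw_lin; apply: sw_ext => c d.
  by rewrite assoc_pure.
rewrite (hcomA hopfX (F := fun c d b => pure (mu (pure c m)) (pure (nu (pure d n)) (pi (pure b p))))); last by lin.
by apply: sw_ext => a b; rewrite tactE sw_purer.
Qed.
Lemma assoc_iscol (M N P : lmodType k) la ka pa :
  iscol (tcoact h (tcoact h la ka) pa) (tcoact h la (tcoact h ka pa)) (assoc M N P).
Proof.
move=> t; tens_elim t => t p; tens_elim t => m n; rewrite assoc_pure tcoactE.
rewrite sw_tcoact; last by lin.
rewrite sw_tcoact; last by lin.
apply: sw_ext => y m'; rewrite sw_tcoact; last by lin.
apply: sw_ext => z n'; apply: sw_ext => u p'.
by rewrite assoc_pure (hmulA hopfX).
Qed.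
Lemma assocK (M N P : lmodType k) : cancel (assoc M N P) (assocV M N P).
Proof. by move=> t; tens_elim t => t p; tens_elim t => m n; rewrite assoc_pure assocV_pure. Qed.
Lemma assocVK (M N P : lmodType k) : cancel (assocV M N P) (assoc M N P).
Proof. by move=> t; tens_elim t => m t; tens_elim t => n p; rewrite assocV_pure assoc_pure. Qed.

(* A map is a morphism as soon as its composite with a nondegenerate
   pairing morphism [kap] is one. *)
Section Detect.
Variables (M Y Z W : lmodType k) (kap : {linear tens Y M -> W}) (F : {linear tens Z M -> W}).
Variables (T : {linear Z -> Y}) (n0 : nat).
Hypothesis fdM : hasdim n0 M.
Variable L : {linear LinMap M W -> Y}.
Hypothesis kapL : forall y, L (mkLin (curry1_lin kap y)) = y.
Hypothesis TE : forall z m, kap (pure (T z) m) = F (pure z m).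

(** Inserting x2 S(x3) turns linearity of the pairing into a formula for the action on its first
    factor alone. *)
Lemma pairing_islin (V : lmodType k) mu nu pi (G : {linear tens V M -> W}) : isact h mu ->
  islin (tact h nu mu) pi G -> forall x y m,
  G (pure (nu (pure x y)) m) = \sw_(a, b <- D x) pi (pure a (G (pure y (mu (pure (S b) m))))).
Proof.
move=> [mA m1] Gl x y m.
transitivity (\sw_(a, b <- D x) \sw_(c, d <- D a) G (pure (nu (pure c y)) (mu (pure (d ∙ S b) m)))).
  rewrite (hcomA hopfX (F := fun c d b => G (pure (nu (pure c y)) (mu (pure (d ∙ S b) m))))); last by lin.
  rewrite -(hcou1r hopfX (F := fun a => G (pure (nu (pure a y)) m))); last by lin.
  apply: sw_ext => a b.
  rewrite (hantr hopfX (F := fun w => G (pure (nu (pure a y)) (mu (pure w m))))); last by lin.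
  by rewrite m1.
apply: sw_ext => a b; rewrite -Gl tactE sw_lin; apply: sw_ext => c d.
by rewrite mA.
Qed.
Lemma detect_islin mu nu pi ze : isact h mu ->
  islin (tact h nu mu) pi kap -> islin (tact h ze mu) pi F -> islin ze nu T.
Proof.
move=> mact kl Fl x z; rewrite -[LHS]kapL -[RHS]kapL; congr (L _).
apply: lin_ext => m /=; rewrite TE (pairing_islin mact Fl) (pairing_islin mact kl).
by apply: sw_ext => a b; rewrite TE.
Qed.
Lemma pairing_iscol (V U : lmodType k) la ka pa (G : {linear tens V M -> W}) (R : X -> W -> U) :
  iscoact h la ->
  iscol (tcoact h ka la) pa G -> bilin R -> forall y m,
  \sw_(x, y' <- ka y) R x (G (pure y' m)) =
  \sw_(u, m' <- la m) \sw_(z, w <- pa (G (pure y m'))) R (z ∙ Sb u) w.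
Proof.
move=> [lA l1] Gc Rb y m.
transitivity (\sw_(u, m' <- la m) \sw_(x, y' <- ka y) \sw_(u', m'' <- la m') R (x ∙ (u' ∙ Sb u)) (G (pure y' m''))); last first.
  apply: sw_ext => u m'; rewrite (sw_col (F := fun z w => R (z ∙ Sb u) w) _ Gc); last by lin.
  rewrite sw_tcoact; last by lin.
  by apply: sw_ext => x y'; apply: sw_ext => u' m''; rewrite (hmulA hopfX).
rewrite [RHS]sw_C; apply: sw_ext => x y'.
rewrite -(lA _ (fun u u' m'' => R (x ∙ (u' ∙ Sb u)) (G (pure y' m'')))); last by lin.
rewrite -(l1 _ (fun m => R x (G (pure y' m)))); last by lin.
apply: sw_ext => u m'.
rewrite (hantVr hopfX bijS (F := fun w => R (x ∙ w) (G (pure y' m')))); last by lin.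
by rewrite (hmul1r hopfX).
Qed.
Lemma detect_iscol la ka pa za : iscoact h la ->
  iscol (tcoact h ka la) pa kap -> iscol (tcoact h za la) pa F -> iscol za ka T.
Proof.
move=> lc kc Fc z.
(* Nondegeneracy reconstructs a tensor from the operators that its components define through [kap],
   so [hom_uniq] can compare the two sides vector by vector. *)
have kE (t : tens X Y) : t = tmap (lid X) L (\sw_(x, y <- t) pure x (mkLin (curry1_lin kap y) : LinMap M W)).
  by rewrite sw_lin -{1}[t]sw_id; apply: sw_ext => x y; rewrite tmap_pure kapL.
rewrite [LHS]kE [RHS]kE; congr (tmap _ _ _); apply: (hom_uniq fdM) => m.
have cb (u : M) : bilin (fun x (f : LinMap M W) => pure x (f u)) by lin.
transitivity (\sw_(x, y <- ka (T z)) pure x (kap (pure y m))).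
  by rewrite sw_sw //; apply: sw_ext => x y; rewrite sw_pure.
transitivity (\sw_(x, y <- \sw_(x, z' <- za z) pure x (T z')) pure x (kap (pure y m))); last first.
  by rewrite [RHS]sw_sw //; apply: sw_ext => x y; rewrite sw_pure.
rewrite (pairing_iscol lc kc) ?sw_sw; try by lin.
transitivity (\sw_(x, z' <- za z) pure x (F (pure z' m))).
  rewrite (pairing_iscol lc Fc); last by lin.
  by apply: sw_ext => u m'; rewrite TE.
by apply: sw_ext => x z'; rewrite sw_pure ?TE //; lin.
Qed.
End Detect.
End Morphisms.
End HomYD2.

(** * Commuting structures over two Hopf algebras *)

Section Commuting.
Variables (k : fieldType).
Implicit Types M N X Y : lmodType k.

(** When H acts and coacts trivially on B, a B-action or B-coaction is a morphism over H exactly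
    when it commutes with the H-action and the H-coaction; these are the cases that arise. *)
Definition comm_aa X Y M (mu : {linear tens X M -> M}) (mu' : {linear tens Y M -> M}) : Prop :=
  forall x y m, mu (pure x (mu' (pure y m))) = mu' (pure y (mu (pure x m))).
Definition comm_ac X Y M (mu : {linear tens X M -> M}) (la : {linear M -> tens Y M}) : Prop :=
  forall x m, la (mu (pure x m)) = \sw_(y, n <- la m) pure y (mu (pure x n)).
Definition comm_cc X Y M (la : {linear M -> tens X M}) (ka : {linear M -> tens Y M}) : Prop :=
  forall (W : lmodType k) (F : X -> Y -> M -> W) m, trilin F ->
  \sw_(x, n <- la m) \sw_(y, n' <- ka n) F x y n' = \sw_(y, n <- ka m) \sw_(x, n' <- la n) F x y n'.

Lemma sw_comm_ac X Y M mu la (W : lmodType k) (F : Y -> M -> W) (x : X) m :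
  comm_ac mu la -> bilin F ->
  teval F (la (mu (pure x m))) = \sw_(y, n <- la m) F y (mu (pure x n)).
Proof. by move=> E Fb; rewrite E; swF. Qed.

Variables (X Y : lmodType k) (h : hopf X) (g : hopf Y).
Hypothesis hopfX : is_hopf (flip X X) h.
Hypothesis hopfY : is_hopf (flip Y Y) g.
Hypothesis bijX : bijective (antip h).
Hypothesis bijY : bijective (antip g).

Section Tens.
Variables M N : lmodType k.
Variables (mu : {linear tens X M -> M}) (la : {linear M -> tens X M}).
Variables (nu : {linear tens X N -> N}) (ka : {linear N -> tens X N}).
Variables (mu' : {linear tens Y M -> M}) (la' : {linear M -> tens Y M}).
Variables (nu' : {linear tens Y N -> N}) (ka' : {linear N -> tens Y N}).

Lemma tens_comm_aa : comm_aa mu mu' -> comm_aa nu nu' ->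
  comm_aa (tact h mu nu) (tact g mu' nu').
Proof.
move=> cM cN x y t; tens_elim t => m n; rewrite !tactE !(sw_purer, sw_lin).
transitivity (\sw_(c, d <- hcom g y) \sw_(a, b <- hcom h x)
   pure (mu (pure a (mu' (pure c m)))) (nu (pure b (nu' (pure d n))))).
  by apply: sw_ext => c d; rewrite tactE.
rewrite sw_C; apply: sw_ext => a b; rewrite tactE; apply: sw_ext => c d.
by rewrite cM cN.
Qed.
Lemma tens_comm_ac : comm_ac mu la' -> comm_ac nu ka' ->
  comm_ac (tact h mu nu) (tcoact g la' ka').
Proof.
move=> cM cN x t; tens_elim t => m n; rewrite tactE sw_lin sw_tcoact; last by lin.
transitivity (\sw_(a, b <- hcom h x) \sw_(y, m' <- la' m) \sw_(z, n' <- ka' n)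
   pure (hmul g (pure y z)) (pure (mu (pure a m')) (nu (pure b n')))).
  apply: sw_ext => a b; rewrite tcoactE (sw_comm_ac _ _ cM); last by lin.
  by apply: sw_ext => y m'; rewrite (sw_comm_ac _ _ cN) //; lin.
rewrite sw_C; apply: sw_ext => y m'; rewrite sw_C; apply: sw_ext => z n'.
by rewrite tactE sw_purer.
Qed.
Lemma tens_comm_cc : comm_cc la la' -> comm_cc ka ka' ->
  comm_cc (tcoact h la ka) (tcoact g la' ka').
Proof.
move=> cM cN W F t [F1 F2 F3]; tens_elim t => m n; rewrite !sw_tcoact; try by lin.
transitivity (\sw_(x, m' <- la m) \sw_(y, m'' <- la' m') \sw_(x', n' <- ka n) \sw_(y', n'' <- ka' n')
   F (hmul h (pure x x')) (hmul g (pure y y')) (pure m'' n'')).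
  apply: sw_ext => x m'; rewrite sw_C; apply: sw_ext => x' n'.
  by rewrite sw_tcoact //; lin.
rewrite (cM _ (fun x y m'' => \sw_(x', n' <- ka n) \sw_(y', n'' <- ka' n')
   F (hmul h (pure x x')) (hmul g (pure y y')) (pure m'' n''))); last by lin.
apply: sw_ext => y m'.
transitivity (\sw_(x, m'' <- la m') \sw_(y', n' <- ka' n) \sw_(x', n'' <- ka n')
   F (hmul h (pure x x')) (hmul g (pure y y')) (pure m'' n'')).
  by apply: sw_ext => x m''; rewrite (cN _ (fun x' y' n'' => F (hmul h (pure x x')) (hmul g (pure y y')) (pure m'' n''))) //; lin.
by rewrite sw_C; apply: sw_ext => y' n'; rewrite sw_tcoact //; lin.
Qed.
End Tens.

Section Hom.
Variables M N : lmodType k.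
Variable (n0 : nat).
Hypothesis fdM : hasdim n0 M.
Variables (mu : {linear tens X M -> M}) (la : {linear M -> tens X M}).
Variables (nu : {linear tens X N -> N}) (ka : {linear N -> tens X N}).
Variables (mu' : {linear tens Y M -> M}) (la' : {linear M -> tens Y M}).
Variables (nu' : {linear tens Y N -> N}) (ka' : {linear N -> tens Y N}).
Variables (act : {linear tens X (LinMap M N) -> LinMap M N}).
Variables (act' : {linear tens Y (LinMap M N) -> LinMap M N}).
Variables (rho : {linear LinMap M N -> tens X (LinMap M N)}).
Variables (rho' : {linear LinMap M N -> tens Y (LinMap M N)}).

Lemma hom_comm_aa : is_homact h mu nu act -> is_homact g mu' nu' act' ->
  comm_aa mu mu' -> comm_aa nu nu' -> comm_aa act act'.
Proof.
move=> aE aE' cM cN x y f; apply: lin_ext => m.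
rewrite aE aE' [RHS](_ : _ = \sw_(c, d <- hcom g y) \sw_(a, b <- hcom h x)
   nu' (pure c (nu (pure a (f (mu (pure (hant h b) (mu' (pure (hant g d) m))))))))); last first.
  by apply: sw_ext => c d; rewrite aE sw_purer sw_lin.
rewrite [RHS]sw_C; apply: sw_ext => a b; rewrite aE' sw_purer sw_lin.
by apply: sw_ext => c d; rewrite cM cN.
Qed.
Lemma hom_comm_ac : is_homact h mu nu act -> is_homcoact g la' ka' rho' ->
  comm_ac mu la' -> comm_ac nu ka' -> comm_ac act rho'.
Proof.
move=> aE rE cM cN x f; apply: (hom_uniq fdM) => m.
rewrite rE; last by lin.
rewrite sw_sw; last by lin.
transitivity (\sw_(y, f' : LinMap M N <- rho' f) pure y ((act (pure x f') : LinMap M N) m)); last first.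
  by apply: sw_ext => y f'; rewrite sw_pure //; lin.
transitivity (\sw_(a, b <- hcom h x) \sw_(y, f' : LinMap M N <- rho' f) pure y (nu (pure a (f' (mu (pure (hant h b) m)))))); last first.
  by rewrite sw_C; apply: sw_ext => y f'; rewrite aE sw_purer.
transitivity (\sw_(a, b <- hcom h x) \sw_(u, m' <- la' m) \sw_(z, n <- ka' (f (mu (pure (hant h b) m'))))
   pure (hmul g (pure z (hantV g u))) (nu (pure a n))).
  rewrite sw_C; apply: sw_ext => u m'; rewrite aE sw_lin sw_sw; last by lin.
  by apply: sw_ext => a b; rewrite (sw_comm_ac _ _ cN) //; lin.
apply: sw_ext => a b; rewrite (rE _ (fun y n => pure y (nu (pure a n)))); last by lin.
by rewrite (sw_comm_ac (F := fun u m' => \sw_(z, n <- ka' (f m'))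
   pure (hmul g (pure z (hantV g u))) (nu (pure a n))) _ _ cM) //; lin.
Qed.
Lemma hom_comm_cc : is_homcoact h la ka rho -> is_homcoact g la' ka' rho' ->
  comm_cc la la' -> comm_cc ka ka' -> comm_cc rho rho'.
Proof.
move=> rE rE' cM cN W F f [F1 F2 F3]; have [b [c bc]] := findim_basis fdM.
transitivity (\sum_i \sw_(x, f' : LinMap M N <- rho f) \sw_(y, f'' : LinMap M N <- rho' f') F x y (rank1 (c i) (f'' (b i)))).
  rewrite -sw_sum; apply: sw_ext => x f'; rewrite -sw_sum; apply: sw_ext => y f''.
  exact: (basis_linexp _ bc).
transitivity (\sum_i \sw_(y, f' : LinMap M N <- rho' f) \sw_(x, f'' : LinMap M N <- rho f') F x y (rank1 (c i) (f'' (b i)))); last first.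
  rewrite -sw_sum; apply: sw_ext => x f'; rewrite -sw_sum; apply: sw_ext => y f''.
  by symmetry; exact: (basis_linexp _ bc).
apply: eq_bigr => i _; set m := b i.
transitivity (\sw_(u', m' <- la' m) \sw_(u, m'' <- la m') \sw_(z, n <- ka (f m'')) \sw_(z', n' <- ka' n)
   F (hmul h (pure z (hantV h u))) (hmul g (pure z' (hantV g u'))) (rank1 (c i) n')).
  transitivity (\sw_(u', m' <- la' m) \sw_(x, f' : LinMap M N <- rho f) \sw_(z', n' <- ka' (f' m')) F x (hmul g (pure z' (hantV g u'))) (rank1 (c i) n')).
    rewrite sw_C; apply: sw_ext => x f'.
    by rewrite (rE' _ (fun y n => F x y (rank1 (c i) n))) //; lin.
  apply: sw_ext => u' m'.
  by rewrite (rE _ (fun x n => \sw_(z', n' <- ka' n) F x (hmul g (pure z' (hantV g u'))) (rank1 (c i) n'))) //; lin.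
rewrite -(cM _ (fun u u' m'' => \sw_(z, n <- ka (f m'')) \sw_(z', n' <- ka' n)
   F (hmul h (pure z (hantV h u))) (hmul g (pure z' (hantV g u'))) (rank1 (c i) n'))); last by lin.
transitivity (\sw_(u, m' <- la m) \sw_(y, f' : LinMap M N <- rho' f) \sw_(z, n <- ka (f' m')) F (hmul h (pure z (hantV h u))) y (rank1 (c i) n)); last first.
  rewrite sw_C; apply: sw_ext => y f'.
  by rewrite (rE _ (fun x n => F x y (rank1 (c i) n))) //; lin.
apply: sw_ext => u m'.
rewrite (rE' _ (fun y n => \sw_(z, n' <- ka n) F (hmul h (pure z (hantV h u))) y (rank1 (c i) n'))); last by lin.
apply: sw_ext => u' m''.
by rewrite (cN _ (fun z z' n' => F (hmul h (pure z (hantV h u))) (hmul g (pure z' (hantV g u'))) (rank1 (c i) n'))) //; lin.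
Qed.
End Hom.
End Commuting.

(** * Evaluation, composition and unit of an endomorphism algebra *)

Section EndAlgebra.
Variables (k : fieldType) (X : lmodType k) (h : hopf X).
Hypothesis hopfX : is_hopf (flip X X) h.
Hypothesis bijS : bijective (antip h).
Variables (M : lmodType k) (n0 : nat).
Hypothesis fdM : hasdim n0 M.
Variables (mu : {linear tens X M -> M}) (la : {linear M -> tens X M}).
Variables (act : {linear tens X (LinMap M M) -> LinMap M M}).
Variables (rho : {linear LinMap M M -> tens X (LinMap M M)}).
Hypothesis mact : isact h mu.
Hypothesis mcoact : iscoact h la.
Hypothesis aE : is_homact h mu mu act.
Hypothesis rE : is_homcoact h la la rho.
Definition evm : {linear tens (LinMap M M) M -> M} := ev M M.
Lemma evmE (f : LinMap M M) m : evm (pure f m) = f m.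
Proof. exact: ev_pure. Qed.
Lemma evm_islin : islin (tact h act mu) mu evm.
Proof.
move=> x t; tens_elim t => f m; rewrite tactE sw_lin evmE.
rewrite -(homact_cancel hopfX _ _ _ aE mact).
by apply: sw_ext => a b; rewrite evmE.
Qed.
Lemma evm_iscol : iscol (tcoact h rho la) la evm.
Proof.
move=> t; tens_elim t => f m; rewrite evmE -[LHS]sw_id -(homcoact_cancel hopfX bijS _ _ rE mcoact); last by lin.
rewrite sw_tcoact; last by lin.
by apply: sw_ext => x f'; apply: sw_ext => y m'; rewrite evmE.
Qed.
Lemma evm_nondeg (f : LinMap M M) : lid _ (mkLin (curry1_lin evm f) : LinMap M M) = f.
Proof. by apply: lin_ext => m; apply: evmE. Qed.

(* Composition on [LinMap M M] is a morphism by detection through evaluation. *)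
Variable (m : {linear tens (LinMap M M) (LinMap M M) -> LinMap M M}).
Hypothesis mE : forall f g : LinMap M M, m (pure f g) = lcomp f g.
Let F : {linear tens (tens (LinMap M M) (LinMap M M)) M -> M} :=
  lcomp evm (lcomp (tmap (lid _) evm) (assoc _ _ _)).
Let FE t u : evm (pure (m t) u) = F (pure t u).
Proof.
tens_elim t => f g; rewrite mE evmE /F !lcompE assoc_pure tmap_pure !evmE.
by [].
Qed.
Lemma comp_islin : islin (tact h act act) act m.
Proof.
apply: (detect_islin hopfX (L := lid _) evm_nondeg FE mact evm_islin).
have lidl : islin act act (lid (LinMap M M)) by [].
exact: (islin_comp (islin_comp (assoc_islin hopfX act act mu)
  (tmap_islin h lidl evm_islin)) evm_islin).
Qed.
Lemma comp_iscol : iscol (tcoact h rho rho) rho m.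
Proof.
apply: (detect_iscol hopfX bijS fdM (L := lid _) evm_nondeg FE mcoact evm_iscol).
have lidc : iscol rho rho (lid (LinMap M M)) by move=> f; rewrite -[LHS]sw_id.
exact: (iscol_comp (iscol_comp (assoc_iscol hopfX rho rho la)
  (tmap_iscol h lidc evm_iscol)) evm_iscol).
Qed.
Lemma unit_islin x : act (pure x (lid M : LinMap M M)) = (hcou h x : k) *: (lid M : LinMap M M).
Proof.
case: (mact) => mA m1; apply: (homact_unique aE) => u.
transitivity (\sw_(a, b <- hcom h x) mu (pure (hmul h (pure a (hant h b))) u)).
  by rewrite (hantr hopfX (F := fun w => mu (pure w u))) ?m1 //; lin.
by apply: sw_ext => a b; rewrite mA.
Qed.
Lemma unit_iscol : rho (lid M) = pure (hone h) (lid M : LinMap M M).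
Proof.
case: (mcoact) => lA l1; apply: (hom_uniq fdM) => u; rewrite sw_pure; last by lin.
rewrite rE; last by lin.
rewrite -[RHS]/(pure (hone h) u).
transitivity (\sw_(y, m' <- la u) \sw_(z, n <- la m') pure (hmul h (pure z (hantV h y))) n); first by [].
rewrite -(lA _ (fun y z n => pure (hmul h (pure z (hantV h y))) n)); last by lin.
rewrite -(l1 _ (fun m => pure (hone h) m)); last by lin.
apply: sw_ext => y m'.
by rewrite (hantVr hopfX bijS (F := fun w => pure w m')) //; lin.
Qed.
End EndAlgebra.

(** * Transparent objects *)

Section Adjoint.
Variables (k : fieldType) (X : lmodType k) (h : hopf X).
Hypothesis hopfX : is_hopf (flip X X) h.
Local Notation "x ∙ y" := (hmul h (pure x y)) (at level 40, left associativity).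
Local Notation D := (hcom h).
Local Notation S := (hant h).

Fact adj_bilin : bilin (fun x m => \sw_(a, b <- D x) a ∙ m ∙ S b).
Proof. lin. Qed.
Definition adj : {linear tens X X -> X} := tlift (bilinE adj_bilin).
Lemma adjE x m : adj (pure x m) = \sw_(a, b <- D x) a ∙ m ∙ S b.
Proof. exact: tlift_pure. Qed.
Fact coadj_lin : linear (fun x => \sw_(a, b <- D x) \sw_(c, d <- D b) pure (a ∙ S d) c).
Proof. lin. Qed.
Definition coadj : {linear X -> tens X X} := mkLin coadj_lin.
Lemma coadjE x : coadj x = \sw_(a, b <- D x) \sw_(c, d <- D b) pure (a ∙ S d) c.
Proof. by []. Qed.

Lemma adj_isact : isact h adj.
Proof.
split=> [x y m|m]; last first.
  by rewrite adjE (hcom1 hopfX) sw_pure ?(hant1 hopfX) ?(hmul1l hopfX) ?(hmul1r hopfX) //; lin.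
rewrite !adjE (hcomM hopfX); last by lin.
apply: sw_ext => a b; rewrite !(sw_purer, sw_purel, sw_lin).
by apply: sw_ext => c d; rewrite (hantM hopfX) !(hmulA hopfX).
Qed.
Lemma com_iscoact : iscoact h (D : {linear X -> tens X X}).
Proof.
split=> [W F m Ft|W F m Fl]; first exact: (hcomA hopfX).
exact: (hcou1l hopfX).
Qed.
Lemma adj_isYD : isYD h (lid X) (lid X) adj D.
Proof.
move=> W F x m Fb; have [Fl Fr] := Fb.
transitivity (\sw_(a, b <- D x) \sw_(a1, a2 <- D a) \sw_(y, z <- D (a1 ∙ m)) \sw_(c, d <- D a2)
  F (y ∙ (S d ∙ b)) (z ∙ S c)).
  apply: sw_ext => a b; rewrite adjE sw_lin sw_sw; last by lin.
  apply: sw_ext => a1 a2; rewrite [LHS](hcomM hopfX); last by lin.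
  apply: sw_ext => y z; rewrite [LHS](hcomS hopfX); last by lin.
  by apply: sw_ext => c d; rewrite (hmulA hopfX).
rewrite (hcomA hopfX (F := fun a1 a2 b => \sw_(y, z <- D (a1 ∙ m)) \sw_(c, d <- D a2)
  F (y ∙ (S d ∙ b)) (z ∙ S c))); last by lin.
transitivity (\sw_(a, b <- D x) \sw_(y, z <- D (a ∙ m)) F y (z ∙ S b)).
  apply: sw_ext => a b; rewrite sw_C; apply: sw_ext => y z.
  rewrite (hcomA hopfX (F := fun c d b => F (y ∙ (S d ∙ b)) (z ∙ S c))); last by lin.
  rewrite -(hcou1r hopfX (F := fun b => F y (z ∙ S b))); last by lin.
  apply: sw_ext => c d; rewrite (hantl hopfX (F := fun w => F (y ∙ w) (z ∙ S c))); last by lin.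
  by rewrite (hmul1r hopfX).
transitivity (\sw_(a, b <- D x) \sw_(a1, a2 <- D a) \sw_(y, z <- D m) F (a1 ∙ y) (a2 ∙ z ∙ S b)).
  by apply: sw_ext => a b; rewrite (hcomM hopfX) //; lin.
rewrite (hcomA hopfX (F := fun a1 a2 b => \sw_(y, z <- D m) F (a1 ∙ y) (a2 ∙ z ∙ S b))); last by lin.
apply: sw_ext => a b; rewrite sw_C; apply: sw_ext => y z.
by rewrite adjE (sw_linear _ _ (Fr _)).
Qed.

Lemma mul_isact : isact h (hmul h).
Proof. by split=> [x y m|m]; rewrite ?(hmulA hopfX) ?(hmul1l hopfX). Qed.
Lemma sw_coadj (W : lmodType k) (F : X -> X -> W) x : bilin F ->
  teval F (coadj x) = \sw_(a, b <- D x) \sw_(c, d <- D b) F (a ∙ S d) c.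
Proof. by move=> Fb; rewrite coadjE; swF. Qed.
Lemma coadj_iscoact : iscoact h coadj.
Proof.
split=> [W F m [F1 F2 F3]|W F m Fl]; last first.
  rewrite sw_coadj; last by lin.
  rewrite -[RHS](hcou1l hopfX); last by lin.
  apply: sw_ext => a b; rewrite -(hcou1r hopfX (F := F)) // sw_scale; apply: sw_ext => c d.
  by rewrite (hcouM hopfX) (hcouS hopfX) scalerA.
rewrite !sw_coadj; try by lin.
transitivity (\sw_(a, b <- D m) \sw_(a1, a2 <- D a) \sw_(c, d <- D b) \sw_(d1, d2 <- D d)
   F (a1 ∙ S d2) (a2 ∙ S d1) c).
  apply: sw_ext => a b; rewrite [RHS]sw_C; apply: sw_ext => c d.
  rewrite (hcomM hopfX); last by lin.
  by apply: sw_ext => a1 a2; rewrite (hcomS hopfX) //; lin.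
rewrite (hcomA hopfX (F := fun a1 a2 b => \sw_(c, d <- D b) \sw_(d1, d2 <- D d)
   F (a1 ∙ S d2) (a2 ∙ S d1) c)); last by lin.
apply: sw_ext => a b.
transitivity (\sw_(c, d <- D b) \sw_(p, q <- D c) \sw_(u, v <- D q) F (a ∙ S d) (p ∙ S v) u); last first.
  by apply: sw_ext => c d; rewrite sw_coadj //; lin.
rewrite (hcomA hopfX (F := fun p q d => \sw_(u, v <- D q) F (a ∙ S d) (p ∙ S v) u)); last by lin.
apply: sw_ext => p q.
by rewrite (hcomA hopfX (F := fun u v d => F (a ∙ S d) (p ∙ S v) u)) //; lin.
Qed.
Lemma mul_isYD : isYD h (lid X) (lid X) (hmul h) coadj.
Proof.
move=> W F x m Fb; have [Fl Fr] := Fb.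
transitivity (\sw_(a, b <- D x) \sw_(a1, a2 <- D a) \sw_(c1, c2 <- D a2)
   \sw_(m1, m2 <- D m) \sw_(n1, n2 <- D m2) F (a1 ∙ m1 ∙ S n2 ∙ (S c2 ∙ b)) (c1 ∙ n1)).
  apply: sw_ext => a b; rewrite sw_coadj; last by lin.
  rewrite (hcomM hopfX); last by lin.
  apply: sw_ext => a1 a2; rewrite [RHS]sw_C; apply: sw_ext => m1 m2.
  rewrite (hcomM hopfX); last by lin.
  apply: sw_ext => c1 c2; apply: sw_ext => n1 n2.
  by rewrite (hantM hopfX) !(hmulA hopfX).
rewrite (hcomA hopfX (F := fun a1 a2 b => \sw_(c1, c2 <- D a2)
   \sw_(m1, m2 <- D m) \sw_(n1, n2 <- D m2) F (a1 ∙ m1 ∙ S n2 ∙ (S c2 ∙ b)) (c1 ∙ n1))); last by lin.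
apply: sw_ext => a b.
rewrite (hcomA hopfX (F := fun c1 c2 b => \sw_(m1, m2 <- D m) \sw_(n1, n2 <- D m2) F (a ∙ m1 ∙ S n2 ∙ (S c2 ∙ b)) (c1 ∙ n1))); last by lin.
transitivity (\sw_(m1, m2 <- D m) \sw_(n1, n2 <- D m2) F (a ∙ m1 ∙ S n2) (b ∙ n1)); last first.
  rewrite sw_coadj; last by lin.
  by apply: sw_ext => m1 m2; apply: sw_ext => n1 n2; rewrite !(hmulA hopfX).
rewrite -(hcou1r hopfX (F := fun b => \sw_(m1, m2 <- D m) \sw_(n1, n2 <- D m2) F (a ∙ m1 ∙ S n2) (b ∙ n1))); last by lin.
apply: sw_ext => c1 b'.
rewrite (hantl hopfX (F := fun w => \sw_(m1, m2 <- D m) \sw_(n1, n2 <- D m2) F (a ∙ m1 ∙ S n2 ∙ w) (c1 ∙ n1))); last by lin.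
by congr (_ *: _); apply: sw_ext => m1 m2; apply: sw_ext => n1 n2; rewrite (hmul1r hopfX).
Qed.
End Adjoint.

Section Objects.
Variables (k : fieldType) (H : lmodType k).
Definition ha (M : ydobj H) : {linear tens H M -> M} := yact M.
Definition hc (M : ydobj H) : {linear M -> tens H M} := ycoact M.

Variables (hH : hopf H).
Hypothesis hopfH : is_hopf (flip H H) hH.
Hypothesis bijS : bijective (antip hH).
Implicit Types M N : ydobj H.

Lemma ydobjP M : is_yd hH M <->
  [/\ isact hH (ha M), iscoact hH (hc M) & isYD hH (lid H) (lid H) (ha M) (hc M)].
Proof.
by split=> -[/(@actP _ _ hH _ (ha M)) ? /(@coactP _ _ hH _ (hc M)) ? /(@ydP _ _ hH _ (ha M) (hc M)) ?].
Qed.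
Lemma PhiE M N (m : M) (n : N) :
  Phi hH M N (pure m n) = \sw_(x, n' <- hc N n) pure n' (ha M (pure (hantV hH x) m)).
Proof.
rewrite /Phi; wev; swx (ycoact N n) => x n'; by wev.
Qed.

Definition PhiV M N : {linear tens N M -> tens M N} :=
  tlift (bilinE (F := fun (n : N) (m : M) => \sw_(x, n' <- hc N n) pure (ha M (pure x m)) n')
    ltac:(lin)).
Lemma PhiVE M N (m : M) (n : N) :
  PhiV M N (pure n m) = \sw_(x, n' <- hc N n) pure (ha M (pure x m)) n'.
Proof. exact: tlift_pure. Qed.
Lemma PhiK M N : isact hH (ha M) -> iscoact hH (hc N) -> cancel (Phi hH M N) (PhiV M N).
Proof.
move=> [mA m1] [nA n1] t; tens_elim t => m n; rewrite PhiE sw_lin.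
rewrite -[RHS](n1 _ (fun n => pure m n)); last by lin.
transitivity (\sw_(x, n' <- hc N n) \sw_(y, n'' <- hc N n') pure (ha M (pure (hmul hH (pure y (hantV hH x))) m)) n'').
  by apply: sw_ext => x n'; rewrite PhiVE; apply: sw_ext => y n''; rewrite mA.
rewrite -(nA _ (fun x y n'' => pure (ha M (pure (hmul hH (pure y (hantV hH x))) m)) n'')); last by lin.
apply: sw_ext => x n'.
by rewrite (hantVr hopfH bijS (F := fun w => pure (ha M (pure w m)) n')) ?m1 //; lin.
Qed.
Lemma PhiVK M N : isact hH (ha M) -> iscoact hH (hc N) -> cancel (PhiV M N) (Phi hH M N).
Proof.
move=> [mA m1] [nA n1] t; tens_elim t => n m; rewrite PhiVE sw_lin.
rewrite -[RHS](n1 _ (fun n => pure n m)); last by lin.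
transitivity (\sw_(x, n' <- hc N n) \sw_(y, n'' <- hc N n') pure n'' (ha M (pure (hmul hH (pure (hantV hH y) x)) m))).
  by apply: sw_ext => x n'; rewrite PhiE; apply: sw_ext => y n''; rewrite mA.
rewrite -(nA _ (fun x y n'' => pure n'' (ha M (pure (hmul hH (pure (hantV hH y) x)) m)))); last by lin.
apply: sw_ext => x n'.
by rewrite (hantVl hopfH bijS (F := fun w => pure n' (ha M (pure w m)))) ?m1 //; lin.
Qed.
Lemma linv_uniq (U V : lmodType k) (f : {linear U -> V}) (g : {linear V -> U}) :
  cancel f g -> cancel g f -> linv f = g.
Proof.
move=> fg gf; apply: lin_ext => v; rewrite -[v]gf fg.
by have [-> //] := linvP (Bijective fg gf).
Qed.
Lemma linv_Phi M N : isact hH (ha M) -> iscoact hH (hc N) -> linv (Phi hH M N) = PhiV M N.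
Proof. by move=> Ma Nc; apply: linv_uniq; [apply: PhiK | apply: PhiVK]. Qed.

(* A transparent object is braided trivially with H itself, once with the
   adjoint action and the regular coaction and once with the regular action and
   the coadjoint coaction; this makes its action and coaction trivial. *)
Variable B : ydobj H.
Hypothesis ydB : is_yd hH B.
Hypothesis transB : forall M, is_yd hH M -> Phi hH B M =1 linv (Phi hH M B).

(** By transparency the double braiding fixes b (x) y. Applying the counit of H to the second factor
    removes the adjoint action there and leaves Sb(y) b = e(y) b; taking y = S(x) gives the
    claim. *)
Lemma trivial_action x b : ha B (pure x b) = (hcou hH x : k) *: b.
Proof.
have [[aB a1] cB _] := (ydobjP B).1 ydB.
pose M := YDObj (adj hH) (hcom hH).
have ydM : is_yd hH M by apply/ydobjP; split; [exact: (adj_isact hopfH)|exact: (com_iscoact hopfH)|exact: (adj_isYD hopfH)].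
rewrite -[x](hantK bijS); set y := hant hH x.
have [Ma Mc _] := (ydobjP M).1 ydM.
have := transB ydM (pure b y); rewrite linv_Phi //.
move/(congr1 (Phi hH M B)); rewrite PhiVK // PhiE sw_lin.
move=> /(congr1 (teval (fun (b : B) (z : H) => (hcou hH z : k) *: b))).
rewrite sw_pure; last by lin.
rewrite (hcouSb hopfH bijS) => <-; rewrite sw_sw; last by lin.
transitivity (\sw_(p, q <- hcom hH y) (hcou hH q : k) *: ha B (pure (hantV hH p) b)).
  by rewrite (hcou1r hopfH (F := fun p => ha B (pure (hantV hH p) b))) //; lin.
apply: sw_ext => p q; rewrite PhiE sw_sw; last by lin.
rewrite -{1}[ha B _](cB.2 _ id) // sw_scale; apply: sw_ext => z b'; rewrite sw_pure; last by lin.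
rewrite -[ha M _]/(adj hH _) adjE sw_lin scalerA; congr (_ *: _).
have -> : \sw_(a, b <- hcom hH (hantV hH z)) hcou hH (hmul hH (pure (hmul hH (pure a q)) (hant hH b))) = 
  \sw_(a, b <- hcom hH (hantV hH z)) (hcou hH b : k) *: (hcou hH (hmul hH (pure a q))).
  by apply: sw_ext => u v; rewrite (hcouM hopfH) (hcouS hopfH) mulrC.
rewrite (hcou1r hopfH (F := fun a => hcou hH (hmul hH (pure a q)))); last by lin.
by rewrite (hcouM hopfH) (hcouSb hopfH bijS) mulrC.
Qed.
(** The coadjoint coaction of 1 is 1 (x) 1, so the double braiding sends b (x) 1 to b_[0] (x)
    Sb(b_[-1]), which has to be b (x) 1 again. *)
Lemma trivial_coaction b : hc B b = pure (hone hH) b.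
Proof.
have [[aB a1] cB _] := (ydobjP B).1 ydB.
pose M := YDObj (hmul hH) (coadj hH).
have ydM : is_yd hH M by apply/ydobjP; split; [exact: (mul_isact hopfH)|exact: (coadj_iscoact hopfH)|exact: (mul_isYD hopfH)].
have [Ma Mc _] := (ydobjP M).1 ydM.
have := transB ydM (pure b (hone hH : M)); rewrite linv_Phi //.
move/(congr1 (Phi hH M B)); rewrite PhiVK // PhiE sw_lin.
rewrite -[hc M _]/(coadj hH _) coadjE (hcom1 hopfH) sw_pure; last by lin.
rewrite (hcom1 hopfH) sw_pure; last by lin.
rewrite (hant1 hopfH) (hmul1l hopfH) sw_pure; last by lin.
rewrite PhiE (hantV1 hopfH bijS) a1 => /(congr1 (teval (fun (b : B) (z : H) => pure (hant hH z) b))).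
rewrite sw_pure; last by lin.
rewrite (hant1 hopfH) => <-; rewrite sw_sw; last by lin.
rewrite -[LHS]sw_id; apply: sw_ext => x b'; rewrite sw_pure; last by lin.
by rewrite -[ha M _]/(hmul hH _) (hmul1r hopfH) (hantVK bijS).
Qed.
End Objects.

(** * Bijectivity of the antipode of a finite-dimensional Hopf algebra *)

Lemma mx_power_stable (k : fieldType) n (A : 'M[k]_n.+1) :
  exists2 N, (0 < N)%N & \rank (A ^+ N.*2 *m A ^+ N.*2) = \rank (A ^+ N.*2).
Proof.
(* The exponent doubles from one j to the next, so a minimal rank along this sequence is unchanged
   by squaring; the additional doubling keeps the exponent even. *)
pose f j := \rank (A ^+ (2 ^ j).*2).
have [j0 j0min] : exists j0, forall j, (f j0 <= f j)%N.
  have ex : exists r, [exists j : 'I_r.+1, false] || `[< exists j, f j = r >].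
    by exists (f 0%N); apply/orP; right; apply/asboolP; exists 0%N.
  case: (ex_minnP ex) => r /orP[/existsP[]//|/asboolP[j <-]] rmin.
  by exists j => j'; apply: rmin; apply/orP; right; apply/asboolP; exists j'.
exists (2 ^ j0)%N; first by rewrite expn_gt0.
apply/eqP; rewrite eqn_leq mxrankM_maxl /=.
by have := j0min j0.+1; rewrite /f expnS mul2n -[(_.*2).*2]addnn exprD.
Qed.

(** [P] is the Fitting projection onto the image of a high power [T] of [f], along its kernel; [D]
    and [E] factor it through [T] on either side. The exponent is even because even powers of an
    antipode preserve the coproduct. *)
Lemma fitting (k : fieldType) (V : lmodType k) (f : {linear V -> V}) : findim V -> nonzero V ->
  exists2 N, (0 < N)%N & exists P D E : {linear V -> V}, let T := iter N.*2 f in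
  [/\ forall x, P x = E (T x), forall x, P x = T (D x),
      forall x, P (T x) = T x & forall x, T (P x) = T x].
Proof.
move=> [n [[a al [a' aa' a'a]]]] [v0 v0n].
case: n a al a' aa' a'a => [|n] a al a' aa' a'a.
  by case/eqP: v0n; apply: (can_inj aa'); apply/rowP => -[].
have a'l : linear a' by move=> c x y; apply: (can_inj aa'); rewrite al !a'a.
have gl : linear (fun r => a (f (a' r))) by move=> c x y; rewrite a'l linearP al.
pose A := lin1_mx (mkLin gl).
have AE r : r *m A = a (f (a' r)) by rewrite mul_rV_lin1.
have [N N0 rk] := mx_power_stable A; exists N => //.
have TE x : a (iter N.*2 f x) = a x *m A ^+ N.*2.
  elim: (N.*2) x => [|m IH] x; first by rewrite expr0 mulmx1.
  by rewrite iterSr IH exprS -[A * _]/(A *m _) mulmxA AE aa'.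
set T := A ^+ N.*2 in rk TE.
have ml (M : 'M_n.+1) : linear (fun x => a' (a x *m M)).
  by move=> c x y; rewrite al mulmxDl -scalemxAl a'l.
have /submxP[D DE] : (T <= T *m T)%MS.
  by rewrite -(geq_leqif (mxrank_leqif_sup (submxMl T T))) rk.
have /submxP[E' EE] : (T^T <= T^T *m T^T)%MS.
  by rewrite -(geq_leqif (mxrank_leqif_sup (submxMl _ _))) -trmx_mul !mxrank_tr rk.
pose E := E'^T; have {}EE : T = T *m T *m E.
  by rewrite -[LHS]trmxK EE !trmx_mul !trmxK -/E.
have DTE : D *m T = T *m E by rewrite {1}EE !mulmxA -[D *m T *m T]mulmxA -DE.
exists (mkLin (ml (D *m T))), (mkLin (ml D)), (mkLin (ml E)).
split=> x /=.
- by rewrite TE DTE mulmxA.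
- by apply: (can_inj aa'); rewrite TE !a'a mulmxA.
- by apply: (can_inj aa'); rewrite a'a TE -mulmxA DTE [T *m (T *m E)]mulmxA -EE.
- by apply: (can_inj aa'); rewrite TE a'a TE -mulmxA -[D *m T *m T]mulmxA -DE.
Qed.

Section AntipodeBijective.
Variables (k : fieldType) (X : lmodType k) (h : hopf X).
Hypothesis hopfX : is_hopf (flip X X) h.
Local Notation "x ∙ y" := (hmul h (pure x y)) (at level 40, left associativity).
Local Notation one := (hone h).
Local Notation D := (hcom h).
Local Notation e := (hcou h).
Local Notation S := (hant h).

Fact iter_lin (V : lmodType k) (f : {linear V -> V}) n : linear (iter n f).
Proof. by elim: n => [|n IH] a x y //=; rewrite IH linearP. Qed.
Definition iterL (V : lmodType k) (f : {linear V -> V}) n : {linear V -> V} :=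
  mkLin (iter_lin f n).

Lemma hcom_iterS n (W : lmodType k) (F : X -> X -> W) x : bilin F ->
  teval F (D (iterL S n x)) =
  if odd n then \sw_(a, b <- D x) F (iterL S n b) (iterL S n a)
  else \sw_(a, b <- D x) F (iterL S n a) (iterL S n b).
Proof.
elim: n F => [|n IH] F Fb //.
rewrite -[iterL S n.+1 x]/(S (iterL S n x)) (hcomS hopfX) // [LHS]IH /=; last by lin.
by case: (odd n).
Qed.

(** The Fitting projection [P] of the antipode preserves coproduct and counit. If S^(j+1) P =
    S^(j+1), then S^j P and S^j have a common convolution inverse and therefore agree. Descending
    from j = 2N to j = 0 gives P = 1, so a power of S is invertible. *)
Theorem antipode_bijective : findim X -> bijective S.
Proof.
move=> fd.
have nz : nonzero X.
  exists one; apply/eqP => E; have := hcou1 hopfX; rewrite E linear0 => /eqP.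
  by rewrite eq_sym oner_eq0.
have [N N0 [P [DD [E [PE PD PT TP]]]]] := fitting S fd nz.
set T := iterL S N.*2.
have Tcom (W : lmodType k) (F : X -> X -> W) x : bilin F ->
    teval F (D (T x)) = \sw_(a, b <- D x) F (T a) (T b).
  by move=> Fb; rewrite hcom_iterS // odd_double.
have Pcom (W : lmodType k) (F : X -> X -> W) x : bilin F ->
    teval F (D (P x)) = \sw_(a, b <- D x) F (P a) (P b).
  (* P x lies in the image of [T], where [P] is the identity, so both components of its coproduct
     may be projected; then P = E T and comultiplicativity of [T] reduce everything to the coproduct
     of x. *)
  move=> Fb; transitivity (\sw_(a, b <- D (P x)) F (P a) (P b)).
    rewrite PD -[iter _ _ _]/(T (DD x)) Tcom // [RHS]Tcom; last by lin.
    by apply: sw_ext => a b; rewrite !PT.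
  transitivity (\sw_(a, b <- D (T (P x))) F (E a) (E b)).
    rewrite Tcom; last by lin.
    by apply: sw_ext => a b; rewrite !PE.
  rewrite -[T (P x)]/(iter _ _ (P x)) TP -[iter _ _ _]/(T x) Tcom; last by lin.
  by apply: sw_ext => a b; rewrite !PE.
have Pcou x : e (P x) = e x.
  have eT y : e (T y) = e y.
    by rewrite /T /=; elim: (N.*2) => //= m <-; rewrite (hcouS hopfX).
  by rewrite -[in LHS]eT -[T (P x)]/(iter _ _ (P x)) TP -[iter _ _ _]/(T x) eT.
have step j : (forall x, iterL S j.+1 (P x) = iterL S j.+1 x) ->
    forall x, iterL S j (P x) = iterL S j x.
  move=> IH x; pose f := iterL S j; pose f' := lcomp f P.
  have IH' y : S (f' y) = S (f y) by apply: IH.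
  have ef y : e (f y) = e y.
    by rewrite /f /=; elim: (j) => //= m <-; rewrite (hcouS hopfX).
  have ef' y : e (f' y) = e y by rewrite /f' lcompE ef Pcou.
  rewrite -[LHS]/(f' x) -[RHS]/(f x).
  have fcom (W : lmodType k) (F : X -> X -> W) y : bilin F -> teval F (D (f y)) =
    if odd j then \sw_(a, b <- D y) F (f b) (f a) else \sw_(a, b <- D y) F (f a) (f b).
    exact: hcom_iterS.
  have f'com (W : lmodType k) (F : X -> X -> W) y : bilin F -> teval F (D (f' y)) =
    if odd j then \sw_(a, b <- D y) F (f' b) (f' a) else \sw_(a, b <- D y) F (f' a) (f' b).
    move=> Fb; rewrite /f' lcompE fcom //; case: (odd j); rewrite [LHS]Pcom //; lin.
  (* For odd j the two maps reverse the coproduct, so the convolution is formed with the opposite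
     coproduct and the common inverse stands on the other side. *)
  case: (odd j) fcom f'com => fcom f'com.
    transitivity (\sw_(a, b <- D x) \sw_(c, d <- D b) f' d ∙ (S (f c) ∙ f a)).
      rewrite -(hcomA hopfX (F := fun a c d => f' d ∙ (S (f c) ∙ f a))); last by lin.
      rewrite -[LHS](hcou1l hopfX (F := fun x => f' x)); last by lin.
      apply: sw_ext => a b.
      rewrite -(fcom _ (fun p q => f' b ∙ (S p ∙ q))); last by lin.
      by rewrite (hantl hopfX (F := fun w => f' b ∙ w)) ?ef ?(hmul1r hopfX) //; lin.
    rewrite -[RHS](hcou1r hopfX (F := fun x => f x)); last by lin.
    apply: sw_ext => a b.
    transitivity (\sw_(c, d <- D b) f' d ∙ S (f' c) ∙ f a).
      by apply: sw_ext => c d; rewrite IH' (hmulA hopfX).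
    rewrite -(f'com _ (fun p q => p ∙ S q ∙ f a)); last by lin.
    by rewrite (hantr hopfX (F := fun w => w ∙ f a)) ?ef' ?(hmul1l hopfX) //; lin.
  transitivity (\sw_(a, b <- D x) \sw_(c, d <- D a) f c ∙ (S (f d) ∙ f' b)).
    rewrite -[LHS](hcou1l hopfX (F := fun x => f' x)); last by lin.
    apply: sw_ext => a b; transitivity (\sw_(c, d <- D a) f c ∙ S (f d) ∙ f' b); last first.
      by apply: sw_ext => c d; rewrite (hmulA hopfX).
    rewrite -(fcom _ (fun p q => p ∙ S q ∙ f' b)); last by lin.
    by rewrite (hantr hopfX (F := fun w => w ∙ f' b)) ?ef ?(hmul1l hopfX) //; lin.
  rewrite (hcomA hopfX (F := fun c d b => f c ∙ (S (f d) ∙ f' b))); last by lin.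
  rewrite -[RHS](hcou1r hopfX (F := fun x => f x)); last by lin.
  apply: sw_ext => a b.
  transitivity (\sw_(c, d <- D b) f a ∙ (S (f' c) ∙ f' d)).
    by apply: sw_ext => c d; rewrite IH'.
  rewrite -(f'com _ (fun p q => f a ∙ (S p ∙ q))); last by lin.
  by rewrite (hantl hopfX (F := fun w => f a ∙ w)) ?ef' ?(hmul1r hopfX) //; lin.
have P1 x : P x = x.
  suff H j : (j <= N.*2)%N -> iterL S (N.*2 - j) (P x) = iterL S (N.*2 - j) x.
    by have := H _ (leqnn _); rewrite subnn.
  suff : forall y, (j <= N.*2)%N -> iterL S (N.*2 - j) (P y) = iterL S (N.*2 - j) y by apply.
  elim: j => [|j IH] y jN; first by rewrite subn0; apply: TP.
  apply: step => z; rewrite -subnSK // in IH; exact: IH (ltnW jN).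
have SP x : S (iterL S N.*2.-1 x) = T x by rewrite /T -[N.*2]prednK ?double_gt0.
have Sinj : injective S.
  move=> x y xy; rewrite -[x]P1 -[y]P1 !PE; congr (E _).
  by rewrite -[N.*2]prednK ?double_gt0 // !iterSr xy.
exists (fun x => iterL S N.*2.-1 (DD x)) => [x|x]; last by rewrite SP -[T _]/(iter _ _ _) -PD P1.
by apply: Sinj; rewrite SP -[T _]/(iter _ _ _) -PD P1.
Qed.
End AntipodeBijective.

Local Open Scope word_scope.

(** * Modules and comodules over B *)

Section BObjects.
Variables (k : fieldType) (H : lmodType k) (B : ydobj H).
Definition ba (M : bydobj H B) : {linear tens B M -> M} := bact M.
Definition bc (M : bydobj H B) : {linear M -> tens B M} := bcoact M.
Definition pull (ga : {linear B -> B}) (M : bydobj H B) : bydobj H B :=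
  @BYDObj k H B M (lcomp (ba M) (tmap ga (lid M)) : wmap [:: B; ycar M] [:: ycar M]) (bc M).
Lemma pullE ga (M : bydobj H B) (b : B) (m : M) :
  ba (pull ga M) (pure b m) = ba M (pure (ga b) m).
Proof. by rewrite -[LHS]/(ba M (tmap ga (lid M) (pure b m))) tmap_pure. Qed.
Lemma curryE (a : seq (lmodType k)) (U V : lmodType k) (f : wmap (a ++ [:: U]) [:: V]) (v : tword a) (u : U) :
  (curry a f v : LinMap U V) u = f (tjoin a [:: U] (pure v u)).
Proof. by []. Qed.
End BObjects.

Section BYD.
Variables (k : fieldType) (H : lmodType k) (hH : hopf H).
Hypothesis hopfH : is_hopf (flip H H) hH.
Hypothesis bijH : bijective (antip hH).
Variables (B : ydobj H) (hB : hopf B).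
Hypothesis hopfB : is_hopf (flip B B) hB.
Hypothesis bijB : bijective (antip hB).
Hypothesis actB : forall x b, ha B (pure x b) = (hcou hH x : k) *: b.
Hypothesis coactB : forall b, hc B b = pure (hone hH) b.
Implicit Types M N P Q : bydobj H B.

(** The conditions of [is_byd] unfolded for trivial [B]. Only the B-condition is twisted; the last
    four fields are what being a morphism over H means for the B-action and the B-coaction. *)
Record gyd (al be : {linear B -> B}) M : Prop := Gyd {
  gHa : isact hH (ha M);
  gHc : iscoact hH (hc M);
  gHy : isYD hH (lid H) (lid H) (ha M) (hc M);
  gBa : isact hB (ba M);
  gBc : iscoact hB (bc M);
  gBy : isYD hB al be (ba M) (bc M);
  gaa : comm_aa (ha M) (ba M);
  gac : comm_ac (ha M) (bc M);
  gca : comm_ac (ba M) (hc M);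
  gcc : comm_cc (hc M) (bc M) }.
Local Notation byd := (gyd (lid B) (lid B)).

Definition morK M N (f : {linear M -> N}) : Prop :=
  [/\ islin (ha M) (ha N) f, iscol (hc M) (hc N) f,
      islin (ba M) (ba N) f & iscol (bc M) (bc N) f].

Lemma Phi_BM M : iscoact hH (hc M) -> Phi hH B M = flip B M.
Proof.
move=> [cA c1]; apply: lin_ext; apply: tens_ext => b m; rewrite flip_pure.
apply: etrans (PhiE hH _ _) _; rewrite -[RHS](c1 _ (fun m => pure m b)); last by lin.
by apply: sw_ext => x m'; rewrite actB (hcouSb hopfH bijH) pureZr.
Qed.
Lemma Phi_MB M : isact hH (ha M) -> Phi hH M B = flip M B.
Proof.
move=> [mA m1]; apply: lin_ext; apply: tens_ext => m b; rewrite flip_pure.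
apply: etrans (PhiE hH _ _) _; rewrite coactB sw_pure; last by lin.
by rewrite (hantV1 hopfH bijH) m1.
Qed.
Lemma Phi_BB : Phi hH B B = flip B B.
Proof.
apply: lin_ext; apply: tens_ext => b c; rewrite flip_pure.
apply: etrans (PhiE hH _ _) _; rewrite coactB sw_pure; last by lin.
by rewrite actB (hcouSb hopfH bijH) (hcou1 hopfH) scale1r.
Qed.
Lemma linv_flip (U V : lmodType k) : linv (flip U V) = flip V U.
Proof.
apply: linv_uniq => t; [tens_elim t => u v|tens_elim t => u v]; by rewrite !flip_pure.
Qed.

Lemma ha_tensB M N : ha (tensB hH hB M N) = tact hH (ha M) (ha N).
Proof. by []. Qed.
Lemma hc_tensB M N : hc (tensB hH hB M N) = tcoact hH (hc M) (hc N).
Proof. by []. Qed.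
Lemma ba_tensB M N : iscoact hH (hc M) -> ba (tensB hH hB M N) = tact hB (ba M) (ba N).
Proof. by move=> Mc; rewrite /ba /= /tact Phi_BM. Qed.
Lemma bc_tensB M N : isact hH (ha M) -> bc (tensB hH hB M N) = tcoact hB (bc M) (bc N).
Proof. by move=> Ma; rewrite /bc /= /tcoact Phi_MB. Qed.

Lemma haB_tens M x b m : ha (tensC hH B M) (pure x (pure b m)) = pure b (ha M (pure x m)).
Proof.
rewrite -[ha _]/(tact hH (ha B) (ha M)) tactE.
rewrite -[RHS](hcou1l hopfH (F := fun y => pure b (ha M (pure y m)))); last by lin.
by apply: sw_ext => y z; rewrite actB pureZl.
Qed.
Lemma hcB_tens M b m : hc (tensC hH B M) (pure b m) = \sw_(x, m' <- hc M m) pure x (pure b m').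
Proof.
rewrite -[hc _]/(tcoact hH (hc B) (hc M)) tcoactE coactB sw_pure; last by lin.
by apply: sw_ext => x m'; rewrite (hmul1l hopfH).
Qed.

Lemma haB_tens_sw M x t :
  ha (tensC hH B M) (pure x t) = \sw_(b, m <- t) pure b (ha M (pure x m)).
Proof. tens_elim t => b m; rewrite sw_pure; [exact: haB_tens|lin]. Qed.
Lemma hcB_tens_sw M t :
  hc (tensC hH B M) t = \sw_(b, m <- t) hc (tensC hH B M) (pure b m).
Proof. by apply: sw_exp; lin. Qed.

(** On B (x) M the H-structures touch only the factor in [M], so each of the two morphism conditions
    splits into two commutation relations. *)
Lemma bydP M : is_byd hH hB M <-> byd M.
Proof.
have act_cond : is_morC (M := tensC hH B M) (N := M) (bact M) <->
    comm_aa (ha M) (ba M) /\ comm_ac (ba M) (hc M).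
  split=> [[E1 E2]|[E1 E2]]; split.
  - move=> x b m; have E : bact M (ha (tensC hH B M) (pure x (pure b m))) =
      yact M ((idm H \ox bact M) (pure x (pure b m))) := E1 (pure x (pure b m)).
    by move: E; rewrite haB_tens; wev.
  - move=> b m; have E : ycoact M (bact M (pure b m)) =
      (idm H \ox bact M) (hc (tensC hH B M) (pure b m)) := E2 (pure b m).
    by apply: etrans E _; rewrite hcB_tens sw_lin; apply: sw_ext => x m'; wev.
  - apply: tens_ext => x t; move: t; apply: (tens_ext (f := lcomp (bact M) (lcomp (yact (tensC hH B M)) (mkLin ((pure_bilin H (tens B M)).2 x))))
       (g := lcomp (yact M) (lcomp (hox (idm H) (bact M) : {linear tens H (tens B M) -> tens H M}) (mkLin ((pure_bilin H (tens B M)).2 x))))) => b m.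
    rewrite -[LHS]/(bact M (ha (tensC hH B M) (pure x (pure b m)))) haB_tens.
    rewrite -[RHS]/(yact M ((idm H \ox bact M) (pure x (pure b m)))); wev.
    by symmetry; apply: E1.
  - apply: tens_ext => b m; apply: etrans (E2 b m) _.
    rewrite -[RHS]/((idm H \ox bact M) (hc (tensC hH B M) (pure b m))) hcB_tens sw_lin.
    by apply: sw_ext => x m'; wev.
have coact_cond : is_morC (M := M) (N := tensC hH B M) (bcoact M) <->
    comm_ac (ha M) (bc M) /\ (forall m, \sw_(y, n <- bc M m) hc (tensC hH B M) (pure y n) = \sw_(x, n <- hc M m) pure x (bc M n)).
  split=> [[E1 E2]|[E1 E2]]; split.
  - move=> x m; have E : bcoact M (yact M (pure x m)) =
      ha (tensC hH B M) ((idm H \ox bcoact M) (pure x m)) := E1 (pure x m).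
    have W : (idm H \ox bcoact M) (pure x m) = pure x (bc M m) by wev.
    by apply: etrans E _; rewrite W haB_tens_sw.
  - move=> m; have E : hc (tensC hH B M) (bcoact M m) =
      (idm H \ox bcoact M) (ycoact M m) := E2 m.
    rewrite -hcB_tens_sw; apply: etrans E _.
    by swx (ycoact M m) => x n; wev.
  - apply: tens_ext => x m; apply: etrans (E1 x m) _.
    have W : (idm H \ox bcoact M) (pure x m) = pure x (bc M m) by wev.
    by rewrite -[RHS]/(ha (tensC hH B M) ((idm H \ox bcoact M) (pure x m))) W haB_tens_sw.
  - move=> m; rewrite -[LHS]/(hc (tensC hH B M) (bcoact M m)) hcB_tens_sw.
    by rewrite [LHS]E2 hcompE; symmetry; swx (ycoact M m) => x n; wev.
have ccE : (forall m, \sw_(y, n <- bc M m) hc (tensC hH B M) (pure y n) = \sw_(x, n <- hc M m) pure x (bc M n)) <->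
    comm_cc (hc M) (bc M).
  split=> [E W F m [F1 F2 F3]|E m].
    have /(congr1 (teval (fun x t => \sw_(y, n : M <- t) F x y n))) := E m.
    rewrite !sw_sw; try by lin.
    move=> E'; apply: etrans (etrans (esym E') _).
      by apply: sw_ext => x n; rewrite sw_pure //; lin.
    apply: sw_ext => y n; rewrite hcB_tens sw_sw; last by lin.
    apply: sw_ext => x n'; rewrite sw_pure; last by lin.
    by rewrite sw_pure //; lin.
  transitivity (\sw_(y, n <- bc M m) \sw_(x, n' <- hc M n) pure x (pure y n')).
    by apply: sw_ext => y n; rewrite hcB_tens.
  rewrite -(E _ (fun x y n => pure x (pure y n))); last by lin.
  by apply: sw_ext => x n; rewrite -sw_purer sw_id.
split=> [[/(ydobjP hH)[? ? ?] [/act_cond[? ?] /coact_cond[? /ccE ?]] /(@actP _ _ hB _ (ba M)) ? /(@coactP _ _ hB _ (bc M)) ?]|[? ? ? ? ? ? ? ? ? ?]].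
  by rewrite Phi_BB Phi_BM // Phi_MB // => /(@ydP _ _ hB _ (ba M) (bc M)).
split; first by apply/(ydobjP hH).
- by split; [apply/act_cond | apply/coact_cond; split => //; apply/ccE].
- exact/(@actP _ _ hB _ (ba M)).
- exact/(@coactP _ _ hB _ (bc M)).
- by rewrite Phi_BB Phi_BM // Phi_MB //; apply/(@ydP _ _ hB _ (ba M) (bc M)).
Qed.

Lemma morBP M N (f : wmap [:: ycar M] [:: ycar N]) : is_morB (M := M) (N := N) f <-> morK (f : {linear M -> N}).
Proof.
have colP (U : lmodType k) (la : {linear M -> tens U M}) (ka : {linear N -> tens U N}) :
   (ka : wmap [:: ycar N] [:: U; ycar N]) \oc f =1 (idm U \ox f) \oc (la : wmap [:: ycar M] [:: U; ycar M]) <-> iscol la ka f.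
  split=> E m.
    apply: etrans (E m) _; rewrite hcompE; swx (la m) => x n; by wev.
  apply: etrans (E m) _; rewrite hcompE; symmetry; swx (la m) => x n; by wev.
have linP (U : lmodType k) (mu : {linear tens U M -> M}) (nu : {linear tens U N -> N}) :
   f \oc (mu : wmap [:: U; ycar M] [:: ycar M]) =1 (nu : wmap [:: U; ycar N] [:: ycar N]) \oc (idm U \ox f) <-> islin mu nu f.
  split=> E; first by move=> x m; have := E (pure x m); wev.
  by apply: tens_ext => x m; wev; apply: E.
split=> [[[/(linP _ (ha M) (ha N)) ? /(colP _ (hc M) (hc N)) ?] /(linP _ (ba M) (ba N)) ? /(colP _ (bc M) (bc N)) ?]|[? ? ? ?]] //.
split; [split|..].
- exact/(linP _ (ha M) (ha N)).
- exact/(colP _ (hc M) (hc N)).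
- exact/(linP _ (ba M) (ba N)).
- exact/(colP _ (bc M) (bc N)).
Qed.

Lemma tensB_gyd al be ga M N : gyd al be M -> gyd be ga N -> gyd al ga (tensB hH hB M N).
Proof.
move=> gM gN; have [Mc Ma] := (gHc gM, gHa gM).
split; rewrite ?ha_tensB ?hc_tensB ?(ba_tensB N Mc) ?(bc_tensB N Ma).
- by apply: (tact_isact hopfH) => //; exact: gHa gN.
- by apply: (tcoact_iscoact hopfH) => //; exact: gHc gN.
- by apply: (tens_isYD hopfH (gHy gM) (gHy gN)).
- exact: (tact_isact hopfB (gBa gM) (gBa gN)).
- exact: (tcoact_iscoact hopfB (gBc gM) (gBc gN)).
- exact: (tens_isYD hopfB (gBy gM) (gBy gN)).
- exact: (tens_comm_aa hH hB (gaa gM) (gaa gN)).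
- exact: (tens_comm_ac hH hB (gac gM) (gac gN)).
- exact: (tens_comm_ac hB hH (gca gM) (gca gN)).
- exact: (tens_comm_cc hH hB (gcc gM) (gcc gN)).
Qed.
End BYD.

(** * Forms of the twisted Yetter-Drinfel'd condition with the inverse antipode *)

Section YDIdentities.
Variables (k : fieldType) (X : lmodType k) (h : hopf X).
Hypothesis hopfX : is_hopf (flip X X) h.
Hypothesis bijS : bijective (antip h).
Local Notation "x ∙ y" := (hmul h (pure x y)) (at level 40, left associativity).
Local Notation one := (hone h).
Local Notation D := (hcom h).
Local Notation e := (hcou h).
Local Notation Sb := (hantV h).
Variables (M : lmodType k) (mu : {linear tens X M -> M}) (la : {linear M -> tens X M}).
Variables (al be : {linear X -> X}).
Hypothesis beM : forall x y, be (x ∙ y) = be x ∙ be y.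
Hypothesis be1 : be one = one.
Hypothesis beSb : forall x, be (Sb x) = Sb (be x).
Hypothesis alM : forall x y, al (x ∙ y) = al x ∙ al y.
Hypothesis al1 : al one = one.
Hypothesis alSb : forall x, al (Sb x) = Sb (al x).

(** Inserting be(t Sb(s)) in front makes the condition applicable under [Sb] to the components r and
    s; the remaining factor al(Sb(r) b1) then contracts. This is the identity behind B-linearity of
    the braiding. *)
Lemma isYD_Sbl (W : lmodType k) (F : X -> M -> W) b m : isYD h al be mu la -> bilin F ->
  \sw_(b1, b2 <- D b) \sw_(y, n <- la (mu (pure b2 m))) F (Sb y ∙ al b1) n =
  \sw_(b1, b2 <- D b) \sw_(y, n <- la m) F (be b2 ∙ Sb y) (mu (pure b1 n)).
Proof.
move=> My Fb.
pose G b1 := \sw_(p, q <- D b1) \sw_(r, s <- D q) \sw_(y, n <- la (mu (pure r m)))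
     F ((be s ∙ (Sb y)) ∙ al p) n.
transitivity (\sw_(b1, b2 <- D b) \sw_(r, q <- D b2) \sw_(s, t <- D q) \sw_(y, n <- la (mu (pure r m)))
     F ((be (t ∙ Sb s) ∙ (Sb y)) ∙ al b1) n).
  apply: sw_ext => b1 b2; rewrite -(hcou1r hopfX (F := fun r => \sw_(y, n <- la (mu (pure r m))) F (Sb y ∙ al b1) n)); last by lin.
  apply: sw_ext => r q.
  rewrite (hantVr hopfX bijS (F := fun w => \sw_(y, n <- la (mu (pure r m))) F ((be w ∙ (Sb y)) ∙ al b1) n)); last by lin.
  by congr (_ *: _); apply: sw_ext => y n; rewrite be1 (hmul1l hopfX).
transitivity (\sw_(b1, b2 <- D b) \sw_(q, t <- D b2) \sw_(r, s <- D q) \sw_(y, n <- la (mu (pure r m)))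
     F ((be t ∙ Sb (y ∙ be s)) ∙ al b1) n).
  apply: sw_ext => b1 b2.
  rewrite (hcomA hopfX (F := fun r s t => \sw_(y, n <- la (mu (pure r m))) F ((be t ∙ Sb (y ∙ be s)) ∙ al b1) n)); last by lin.
  apply: sw_ext => r q; apply: sw_ext => s t; apply: sw_ext => y n.
  by rewrite beM beSb (hantVM hopfX bijS) !(hmulA hopfX).
transitivity (\sw_(b1, b2 <- D b) \sw_(q, t <- D b2) \sw_(r, s <- D q) \sw_(y, n <- la m)
     F ((be t ∙ Sb (al r ∙ y)) ∙ al b1) (mu (pure s n))).
  apply: sw_ext => b1 b2; apply: sw_ext => q t.
  by rewrite (My _ (fun w n => F ((be t ∙ Sb w) ∙ al b1) n)) //; lin.
transitivity (\sw_(b1, b2 <- D b) \sw_(r, q <- D b2) \sw_(s, t <- D q) \sw_(y, n <- la m)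
     F (be t ∙ Sb y ∙ al (Sb r ∙ b1)) (mu (pure s n))).
  apply: sw_ext => b1 b2.
  rewrite (hcomA hopfX (F := fun r s t => \sw_(y, n <- la m)
     F ((be t ∙ Sb (al r ∙ y)) ∙ al b1) (mu (pure s n)))); last by lin.
  apply: sw_ext => r q; apply: sw_ext => s t; apply: sw_ext => y n.
  by rewrite alM alSb (hantVM hopfX bijS) !(hmulA hopfX).
rewrite -(hcomA hopfX (F := fun b1 r q => \sw_(s, t <- D q) \sw_(y, n <- la m)
     F (be t ∙ Sb y ∙ al (Sb r ∙ b1)) (mu (pure s n)))); last by lin.
transitivity (\sw_(p, q <- D b) (e p : k) *: (\sw_(s, t <- D q) \sw_(y, n <- la m) F (be t ∙ Sb y) (mu (pure s n)))).
  apply: sw_ext => p q; rewrite (hantVl hopfX bijS (F := fun w => \sw_(s, t <- D q) \sw_(y, n <- la m)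
     F (be t ∙ Sb y ∙ al w) (mu (pure s n)))); last by lin.
  congr (_ *: _); apply: sw_ext => s t; apply: sw_ext => y n.
  by rewrite al1 (hmul1r hopfX).
by rewrite (hcou1l hopfX (F := fun q => \sw_(s, t <- D q) \sw_(y, n <- la m) F (be t ∙ Sb y) (mu (pure s n)))) //; lin.
Qed.

(** After inserting be(Sb(u2) u1), this is the condition at an element Sb(q). It is the identity
    behind B-colinearity of the braiding. *)
Lemma isYD_Sbr (W : lmodType k) (F : X -> M -> W) b m : isYD h al be mu la -> bilin F ->
  \sw_(b1, b2 <- D b) \sw_(y, n <- la (mu (pure (Sb b1) m))) F (al b2 ∙ y) n =
  \sw_(b1, b2 <- D b) \sw_(y, n <- la m) F (y ∙ be b1) (mu (pure (Sb b2) n)).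
Proof.
move=> My Fb.
transitivity (\sw_(p, t <- D b) \sw_(u, v <- D p) \sw_(u1, u2 <- D u)
   \sw_(y, n <- la (mu (pure (Sb v) m))) F (al t ∙ (y ∙ be (Sb u2) ∙ be u1)) n).
  apply: sw_ext => p t; rewrite -(hcou1l hopfX (F := fun v => \sw_(y, n <- la (mu (pure (Sb v) m))) F (al t ∙ y) n)); last by lin.
  apply: sw_ext => u v.
  transitivity (\sw_(u1, u2 <- D u) \sw_(y, n <- la (mu (pure (Sb v) m))) F (al t ∙ (y ∙ be (Sb u2 ∙ u1))) n).
    rewrite (hantVl hopfX bijS (F := fun w => \sw_(y, n <- la (mu (pure (Sb v) m))) F (al t ∙ (y ∙ be w)) n)); last by lin.
    by congr (_ *: _); apply: sw_ext => y n; rewrite be1 (hmul1r hopfX).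
  by apply: sw_ext => u1 u2; apply: sw_ext => y n; rewrite beM !(hmulA hopfX).
transitivity (\sw_(u1, r <- D b) \sw_(q, t <- D r) \sw_(u2, v <- D q)
   \sw_(y, n <- la (mu (pure (Sb v) m))) F (al t ∙ (y ∙ be (Sb u2) ∙ be u1)) n).
  rewrite -[RHS](hcomA hopfX (F := fun u1 q t => \sw_(u2, v <- D q)
   \sw_(y, n <- la (mu (pure (Sb v) m))) F (al t ∙ (y ∙ be (Sb u2) ∙ be u1)) n)); last by lin.
  apply: sw_ext => p t.
  by rewrite (hcomA hopfX (F := fun u1 u2 v => \sw_(y, n <- la (mu (pure (Sb v) m))) F (al t ∙ (y ∙ be (Sb u2) ∙ be u1)) n)) //; lin.
apply: sw_ext => u1 r.
transitivity (\sw_(q, t <- D r) \sw_(u2, v <- D q) \sw_(y, n <- la m)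
   F (al t ∙ (al (Sb v) ∙ y ∙ be u1)) (mu (pure (Sb u2) n))).
  apply: sw_ext => q t.
  have := My _ (fun w n => F (al t ∙ (w ∙ be u1)) n) (Sb q) m.
  by rewrite !(hcomSb hopfX bijS); [apply | ..]; lin.
rewrite (hcomA hopfX (F := fun u2 v t => \sw_(y, n <- la m)
   F (al t ∙ (al (Sb v) ∙ y ∙ be u1)) (mu (pure (Sb u2) n)))); last by lin.
rewrite -(hcou1r hopfX (F := fun r => \sw_(y, n <- la m) F (y ∙ be u1) (mu (pure (Sb r) n)))); last by lin.
apply: sw_ext => u2 w.
transitivity (\sw_(v, t <- D w) \sw_(y, n <- la m) F (al (t ∙ Sb v) ∙ (y ∙ be u1)) (mu (pure (Sb u2) n))).
  by apply: sw_ext => v t; apply: sw_ext => y n; rewrite alM !(hmulA hopfX).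
rewrite (hantVr hopfX bijS (F := fun w => \sw_(y, n <- la m) F (al w ∙ (y ∙ be u1)) (mu (pure (Sb u2) n)))); last by lin.
by congr (_ *: _); apply: sw_ext => y n; rewrite al1 (hmul1l hopfX).
Qed.
End YDIdentities.

(** * The braiding Psi, its inverse, naturality and hexagons *)

Section Braiding.
Variables (k : fieldType) (H : lmodType k) (hH : hopf H).
Hypothesis hopfH : is_hopf (flip H H) hH.
Hypothesis bijH : bijective (antip hH).
Variables (B : ydobj H) (hB : hopf B).
Hypothesis hopfB : is_hopf (flip B B) hB.
Hypothesis bijB : bijective (antip hB).
Hypothesis actB : forall x b, ha B (pure x b) = (hcou hH x : k) *: b.
Hypothesis coactB : forall b, hc B b = pure (hone hH) b.
Implicit Types M N P Q : bydobj H B.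

Local Notation SbB := (hantV hB).
Local Notation SbH := (hantV hH).
Local Notation Psi := (Psi hH hB).
Local Notation gyd := (gyd hH hB).

Lemma PsiE M N (m : M) (n : N) : isact hH (ha N) -> iscoact hH (hc M) ->
  comm_ac (ha N) (bc N) ->
  Psi M N (pure m n) = \sw_(x, m' <- hc M m) \sw_(y, n' <- bc N n)
    pure (ha N (pure x n')) (ba M (pure (SbB y) m')).
Proof.
move=> Na Mc Nac; have [Mc1 Mc2] := Mc.
rewrite /Defs.Psi (linv_Phi hopfH bijH Na Mc) (Phi_MB hopfH bijH coactB Na) linv_flip.
transitivity (\sw_(x, m' <- hc M m) \sw_(y, n' <- bc N (ha N (pure x n))) pure n' (ba M (pure (SbB y) m'))).
  rewrite hcompE PhiVE sw_lin; apply: sw_ext => x m'; wev.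
  by swx (bcoact N (ha N (pure x n))) => y n'; wev.
by apply: sw_ext => x m'; rewrite (sw_comm_ac _ _ Nac) //; lin.
Qed.

Definition PsiV M N : {linear tens N M -> tens M N} :=
  tlift (bilinE (F := fun (n : N) (m : M) => \sw_(x, m' <- hc M m) \sw_(y, n' <- bc N n)
    pure (ba M (pure y m')) (ha N (pure (SbH x) n'))) ltac:(lin)).
Lemma PsiVE M N (m : M) (n : N) : PsiV M N (pure n m) =
  \sw_(x, m' <- hc M m) \sw_(y, n' <- bc N n) pure (ba M (pure y m')) (ha N (pure (SbH x) n')).
Proof. exact: tlift_pure. Qed.

Lemma PsiK a b c d M N : gyd a b M -> gyd c d N -> cancel (Psi M N) (PsiV M N).
Proof.
move=> gM gN t; tens_elim t => m n; rewrite (PsiE m n (gHa gN) (gHc gM) (gac gN)).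
have [[HaA Ha1] [HcA Hc1] [BaA Ba1] [BcA Bc1]] := And4 (gHa gN) (gHc gM) (gBa gM) (gBc gN).
rewrite !sw_lin -[RHS](Hc1 _ (fun m => pure m n)); last by lin.
transitivity (\sw_(x, m' <- hc M m) \sw_(x', m'' <- hc M m') \sw_(y, n' <- bc N n) \sw_(y', n'' <- bc N n')
   pure (ba M (pure (hmul hB (pure y' (SbB y))) m'')) (ha N (pure (hmul hH (pure (SbH x') x)) n''))).
  apply: sw_ext => x m'; rewrite sw_lin [RHS]sw_C; apply: sw_ext => y n'.
  rewrite PsiVE (sw_comm_ac _ _ (gca gM)); last by lin.
  apply: sw_ext => x' m''; rewrite (sw_comm_ac _ _ (gac gN)); last by lin.
  by apply: sw_ext => y' n''; rewrite HaA BaA.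
rewrite -(HcA _ (fun x x' m'' => \sw_(y, n' <- bc N n) \sw_(y', n'' <- bc N n')
   pure (ba M (pure (hmul hB (pure y' (SbB y))) m'')) (ha N (pure (hmul hH (pure (SbH x') x)) n'')))); last by lin.
apply: sw_ext => x m'.
rewrite (hantVl hopfH bijH (F := fun w => \sw_(y, n' <- bc N n) \sw_(y', n'' <- bc N n')
   pure (ba M (pure (hmul hB (pure y' (SbB y))) m')) (ha N (pure w n'')))); last by lin.
congr (_ *: _); rewrite -(BcA _ (fun y y' n'' => 
   pure (ba M (pure (hmul hB (pure y' (SbB y))) m')) (ha N (pure (hone hH) n'')))); last by lin.
rewrite -(Bc1 _ (fun n => pure m' n)); last by lin.
apply: sw_ext => y n'.
rewrite (hantVr hopfB bijB (F := fun w => pure (ba M (pure w m')) (ha N (pure (hone hH) n')))); last by lin.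
by rewrite Ba1 Ha1.
Qed.
Lemma PsiVK a b c d M N : gyd a b M -> gyd c d N -> cancel (PsiV M N) (Psi M N).
Proof.
move=> gM gN t; tens_elim t => n m; rewrite PsiVE.
have [[HaA Ha1] [HcA Hc1] [BaA Ba1] [BcA Bc1]] := And4 (gHa gN) (gHc gM) (gBa gM) (gBc gN).
rewrite !sw_lin -[RHS](Hc1 _ (fun m => pure n m)); last by lin.
transitivity (\sw_(x, m' <- hc M m) \sw_(x', m'' <- hc M m') \sw_(y, n' <- bc N n) \sw_(y', n'' <- bc N n')
   pure (ha N (pure (hmul hH (pure x' (SbH x))) n'')) (ba M (pure (hmul hB (pure (SbB y') y)) m''))).
  apply: sw_ext => x m'; rewrite sw_lin [RHS]sw_C; apply: sw_ext => y n'.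
  rewrite (PsiE _ _ (gHa gN) (gHc gM) (gac gN)) (sw_comm_ac _ _ (gca gM)); last by lin.
  apply: sw_ext => x' m''; rewrite (sw_comm_ac _ _ (gac gN)); last by lin.
  by apply: sw_ext => y' n''; rewrite HaA BaA.
rewrite -(HcA _ (fun x x' m'' => \sw_(y, n' <- bc N n) \sw_(y', n'' <- bc N n')
   pure (ha N (pure (hmul hH (pure x' (SbH x))) n'')) (ba M (pure (hmul hB (pure (SbB y') y)) m'')))); last by lin.
apply: sw_ext => x m'.
rewrite (hantVr hopfH bijH (F := fun w => \sw_(y, n' <- bc N n) \sw_(y', n'' <- bc N n')
   pure (ha N (pure w n'')) (ba M (pure (hmul hB (pure (SbB y') y)) m')))); last by lin.
congr (_ *: _); rewrite -(BcA _ (fun y y' n'' => 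
   pure (ha N (pure (hone hH) n'')) (ba M (pure (hmul hB (pure (SbB y') y)) m')))); last by lin.
rewrite -(Bc1 _ (fun n => pure n m')); last by lin.
apply: sw_ext => y n'.
rewrite (hantVl hopfB bijB (F := fun w => pure (ha N (pure (hone hH) n')) (ba M (pure w m')))); last by lin.
by rewrite Ba1 Ha1.
Qed.

Lemma sw_Psi a b c d M N (W : lmodType k) (F : N -> M -> W) (m : M) (n : N) :
  gyd a b M -> gyd c d N -> bilin F ->
  teval F (Psi M N (pure m n)) = \sw_(x, m' <- hc M m) \sw_(y, n' <- bc N n)
    F (ha N (pure x n')) (ba M (pure (SbB y) m')).
Proof. by move=> gM gN Fb; rewrite (PsiE m n (gHa gN) (gHc gM) (gac gN)); swF. Qed.

(** Each map has to respect only the structures of its object that the formula for [Psi] uses: the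
    H-coaction and B-action on the left, the H-action and B-coaction on the right. *)
Lemma Psi_nat a b c d a' b' c' d' M N M' N' (f : {linear M -> M'}) (g : {linear N -> N'}) m n :
  gyd a b M -> gyd c d N -> gyd a' b' M' -> gyd c' d' N' ->
  iscol (hc M) (hc M') f -> islin (ba M) (ba M') f ->
  islin (ha N) (ha N') g -> iscol (bc N) (bc N') g ->
  Psi M' N' (pure (f m) (g n)) = tmap g f (Psi M N (pure m n)).
Proof.
move=> gM gN gM' gN' fc fl gl gc.
rewrite (PsiE _ _ (gHa gN') (gHc gM') (gac gN')) (PsiE _ _ (gHa gN) (gHc gM) (gac gN)).
rewrite (sw_col (F := fun x m' => \sw_(y, n' <- bc N' (g n))
    pure (ha N' (pure x n')) (ba M' (pure (SbB y) m'))) _ fc); last by lin.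
rewrite sw_lin; apply: sw_ext => x m'; rewrite sw_lin.
rewrite (sw_col (F := fun y n' => pure (ha N' (pure x n')) (ba M' (pure (SbB y) (f m')))) _ gc); last by lin.
by apply: sw_ext => y n'; rewrite tmap_pure fl gl.
Qed.

Lemma Psi_tensl a b b' c d M M' N (W : lmodType k) (F : N -> tens M M' -> W) m m' n :
  gyd a b M -> gyd b b' M' -> gyd c d N -> bilin F ->
  teval F (Psi (tensB hH hB M M') N (pure (pure m m') n)) =
  \sw_(n1, m1' <- Psi M' N (pure m' n)) \sw_(n2, m1 <- Psi M N (pure m n1)) F n2 (pure m1 m1').
Proof.
move=> gM gM' gN Fb.
have gT := tensB_gyd hopfH bijH hopfB actB coactB gM gM'.
rewrite (sw_Psi _ _ gT gN Fb) hc_tensB sw_tcoact; last by lin.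
rewrite (sw_Psi _ _ gM' gN); last by lin.
have [HaA _] := gHa gN.
have [BcA _] := gBc gN.
rewrite sw_C; apply: sw_ext => x' m1'.
transitivity (\sw_(y, n' <- bc N n) \sw_(y', n'' <- bc N n') \sw_(x, m1 <- hc M m)
   F (ha N (pure x (ha N (pure x' n'')))) (pure (ba M (pure (SbB y') m1)) (ba M' (pure (SbB y) m1')))); last first.
  apply: sw_ext => y n'; rewrite (sw_Psi _ _ gM gN); last by lin.
  rewrite [RHS]sw_C (sw_comm_ac (F := fun y' n'' => \sw_(x, m1 <- hc M m) F (ha N (pure x n'')) (pure (ba M (pure (SbB y') m1)) (ba M' (pure (SbB y) m1')))) _ _ (gac gN)); last by lin.
  by [].
rewrite -(BcA _ (fun y y' n'' => \sw_(x, m1 <- hc M m)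
   F (ha N (pure x (ha N (pure x' n'')))) (pure (ba M (pure (SbB y') m1)) (ba M' (pure (SbB y) m1'))))); last by lin.
rewrite sw_C; apply: sw_ext => y n'; rewrite [RHS]sw_C; apply: sw_ext => x m1.
rewrite (ba_tensB hopfH bijH _ actB) ?tactE; last exact: gHc gM.
have [Fl Fr] := Fb; rewrite (sw_linear _ _ (Fr _)).
rewrite (hcomSb hopfB bijB); last by lin.
by apply: sw_ext => y1 y2; rewrite HaA.
Qed.

Lemma Psi_tensr a b c d d' M N N' (W : lmodType k) (F : tens N N' -> M -> W) m n n' :
  gyd a b M -> gyd c d N -> gyd d d' N' -> bilin F ->
  teval F (Psi M (tensB hH hB N N') (pure m (pure n n'))) =
  \sw_(n1, m1 <- Psi M N (pure m n)) \sw_(n1', m2 <- Psi M N' (pure m1 n')) F (pure n1 n1') m2.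
Proof.
move=> gM gN gN' Fb.
have gT := tensB_gyd hopfH bijH hopfB actB coactB gN gN'.
rewrite (sw_Psi _ _ gM gT Fb) (bc_tensB hopfH bijH _ coactB); last exact: gHa gN.
rewrite (sw_Psi _ _ gM gN); last by lin.
have [HcA _] := gHc gM; have [BaA _] := gBa gM.
transitivity (\sw_(x, m' <- hc M m) \sw_(x', m'' <- hc M m') \sw_(y, n1 <- bc N n) \sw_(y', n1' <- bc N' n')
   F (pure (ha N (pure x n1)) (ha N' (pure x' n1'))) (ba M (pure (SbB y') (ba M (pure (SbB y) m''))))); last first.
  apply: sw_ext => x m'; rewrite sw_C; apply: sw_ext => y n1.
  rewrite (sw_Psi _ _ gM gN'); last by lin.
  by rewrite (sw_comm_ac (F := fun x' m'' => \sw_(y', n1' <- bc N' n')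
   F (pure (ha N (pure x n1)) (ha N' (pure x' n1'))) (ba M (pure (SbB y') m''))) _ _ (gca gM)) //; lin.
rewrite -(HcA _ (fun x x' m'' => \sw_(y, n1 <- bc N n) \sw_(y', n1' <- bc N' n')
   F (pure (ha N (pure x n1)) (ha N' (pure x' n1'))) (ba M (pure (SbB y') (ba M (pure (SbB y) m'')))))); last by lin.
apply: sw_ext => x m'; rewrite sw_tcoact; last by lin.
rewrite [RHS]sw_C; apply: sw_ext => y n1; rewrite [RHS]sw_C; apply: sw_ext => y' n1'.
have [Fl Fr] := Fb; rewrite ha_tensB tactE (sw_linear _ _ (Fl _)).
by apply: sw_ext => x1 x2; rewrite (hantVM hopfB bijB) BaA.
Qed.
End Braiding.

(** * The braiding as a morphism into a pulled back module *)

Section PsiMorphism.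
Variables (k : fieldType) (H : lmodType k) (hH : hopf H).
Hypothesis hopfH : is_hopf (flip H H) hH.
Hypothesis bijH : bijective (antip hH).
Variables (B : ydobj H) (hB : hopf B).
Hypothesis hopfB : is_hopf (flip B B) hB.
Hypothesis bijB : bijective (antip hB).
Hypothesis actB : forall x b, ha B (pure x b) = (hcou hH x : k) *: b.
Hypothesis coactB : forall b, hc B b = pure (hone hH) b.
Implicit Types M N P Q : bydobj H B.
Local Notation gyd := (gyd hH hB).
Local Notation byd := (gyd (lid B) (lid B)).
Local Notation Psi := (Psi hH hB).
Local Notation tensB := (tensB hH hB).

Local Notation D := (hcom hB).
Local Notation SbB := (hantV hB).
Variable be : {linear B -> B}.
Hypothesis beM : forall x y, be (hmul hB (pure x y)) = hmul hB (pure (be x) (be y)).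
Hypothesis be1 : be (hone hB) = hone hB.
Hypothesis beSb : forall x, be (SbB x) = SbB (be x).
Hypothesis becom : forall (W : lmodType k) (F : B -> B -> W) x, bilin F ->
  teval F (D (be x)) = \sw_(a, b <- D x) F (be a) (be b).
Hypothesis becou : forall x, hcou hB (be x) = hcou hB x.

Lemma pull_gyd (al ga de : {linear B -> B}) N : gyd al ga N ->
  (forall x, al (be x) = de x) -> gyd de (lcomp ga be) (pull be N).
Proof.
move=> gN alE; split; try by case: gN.
- have [A1 A2] := gBa gN; split=> [x y n|n]; rewrite !pullE ?beM ?be1 ?A1 ?A2 //.
- move=> W F x n Fb.
  have yN := gBy gN; have := yN W F (be x) n Fb; rewrite !becom; try by lin.
  move=> E; transitivity (\sw_(a, b <- D x) \sw_(y, n0 <- bc N (ba N (pure (be a) n))) F (hmul hB (pure y (ga (be b)))) n0).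
    by apply: sw_ext => a b; rewrite pullE.
  by rewrite E; apply: sw_ext => a b; apply: sw_ext => y n0; rewrite pullE alE.
- by move=> x b n; rewrite !pullE; apply: (gaa gN).
- move=> b n; rewrite pullE; apply: etrans (gca gN _ _) _.
  by apply: sw_ext => x n'; rewrite pullE.
Qed.

(** Moving a module across a [be]-twisted one twists its action by [be], since in [isYD_Sbl] the
    component b2 reappears as be(b2). This is the origin of the pullback in tensor products of
    twisted modules. *)
Lemma Psi_morK X M : byd X -> gyd (lid B) be M ->
  morK (M := tensB X M) (N := tensB M (pull be X)) (Psi X M).
Proof.
move=> gX gM.
have [yHX yHM ccM ccX] := And4 (gHy gX) (gHy gM) (gcc gM) (gcc gX).
have [HMa HXa HMc HXc] := And4 (gHa gM) (gHa gX) (gHc gM) (gHc gX).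
have [BMa BXa BMc BXc] := And4 (gBa gM) (gBa gX) (gBc gM) (gBc gX).
have [[HMA HM1] [HXA HX1] [HMcA HMc1] [HXcA HXc1]] := And4 HMa HXa HMc HXc.
have [[BMA BM1] [BXA BX1] [BMcA BMc1] [BXcA BXc1]] := And4 BMa BXa BMc BXc.
split.
- move=> h t; tens_elim t => x m; rewrite !ha_tensB tactE sw_lin.
  rewrite (PsiE hopfH bijH _ coactB _ _ HMa HXc (gac gM)).
  transitivity (\sw_(a, b <- hcom hH h) \sw_(z, x' <- hc X (ha X (pure a x))) \sw_(y, m' <- bc M m)
     pure (ha M (pure (hmul hH (pure z b)) m')) (ba X (pure (SbB y) x'))).
    apply: sw_ext => a b; rewrite (PsiE hopfH bijH _ coactB _ _ HMa HXc (gac gM)).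
    apply: sw_ext => z x'; rewrite (sw_comm_ac _ _ (gac gM)); last by lin.
    by apply: sw_ext => y m'; rewrite HMA.
  rewrite (yHX _ (fun w x' => \sw_(y, m' <- bc M m) pure (ha M (pure w m')) (ba X (pure (SbB y) x')))); last by lin.
  rewrite sw_purer sw_lin sw_C; apply: sw_ext => z x'.
  rewrite sw_purer sw_lin sw_C; apply: sw_ext => y m'; rewrite tactE.
  by apply: sw_ext => a b; rewrite HMA (gaa gX).
- move=> t; tens_elim t => x m; rewrite !hc_tensB sw_tcoact; last by lin.
  rewrite (PsiE hopfH bijH _ coactB _ _ HMa HXc (gac gM)) sw_lin.
  transitivity (\sw_(z, x' <- hc X x) \sw_(z', x'' <- hc X x') \sw_(y, m' <- bc M m) \sw_(u, m'' <- hc M (ha M (pure z m')))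
    pure (hmul hH (pure u z')) (pure m'' (ba X (pure (SbB y) x'')))).
    apply: sw_ext => z x'; rewrite sw_lin [RHS]sw_C; apply: sw_ext => y m'.
    rewrite tcoactE [RHS]sw_C; apply: sw_ext => u m''.
    by rewrite (sw_comm_ac _ _ (gca gX)) //; lin.
  rewrite -(HXcA _ (fun z z' x'' => \sw_(y, m' <- bc M m) \sw_(u, m'' <- hc M (ha M (pure z m')))
    pure (hmul hH (pure u z')) (pure m'' (ba X (pure (SbB y) x''))))); last by lin.
  transitivity (\sw_(z, x' <- hc X x) \sw_(u, m' <- hc M m) \sw_(z', x'' <- hc X x')
     \sw_(y, m'' <- bc M m') pure (hmul hH (pure z u)) (pure (ha M (pure z' m'')) (ba X (pure (SbB y) x'')))); last first.
    apply: sw_ext => z x'; apply: sw_ext => u m'.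
    rewrite (PsiE hopfH bijH _ coactB _ _ HMa HXc (gac gM)) sw_purer; apply: sw_ext => z' x''.
    by rewrite sw_purer.
  transitivity (\sw_(z, x' <- hc X x) \sw_(z', x'' <- hc X x') \sw_(u, m' <- hc M m)
     \sw_(y, m'' <- bc M m') pure (hmul hH (pure z u)) (pure (ha M (pure z' m'')) (ba X (pure (SbB y) x'')))); last first.
    by apply: sw_ext => z x'; rewrite sw_C.
  rewrite -(HXcA _ (fun z z' x'' => \sw_(u, m' <- hc M m) \sw_(y, m'' <- bc M m')
     pure (hmul hH (pure z u)) (pure (ha M (pure z' m'')) (ba X (pure (SbB y) x''))))); last by lin.
  apply: sw_ext => z x'; rewrite sw_C.
  transitivity (\sw_(y, m' <- bc M m) \sw_(z1, z2 <- hcom hH z) \sw_(u, m'' <- hc M m')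
    pure (hmul hH (pure z1 u)) (pure (ha M (pure z2 m'')) (ba X (pure (SbB y) x')))).
    by apply: sw_ext => y m'; rewrite (yHM _ (fun w m'' => pure w (pure m'' (ba X (pure (SbB y) x'))))) //; lin.
  rewrite sw_C; apply: sw_ext => z1 z2.
  by rewrite (ccM _ (fun u y m'' => pure (hmul hH (pure z1 u)) (pure (ha M (pure z2 m'')) (ba X (pure (SbB y) x'))))) //; lin.
- move=> b t; tens_elim t => x m; rewrite (ba_tensB hopfH bijH _ actB) // (ba_tensB hopfH bijH _ actB) //.
  rewrite tactE sw_lin (PsiE hopfH bijH _ coactB _ _ HMa HXc (gac gM)).
  transitivity (\sw_(z, x' <- hc X x) \sw_(b1, b2 <- D b) \sw_(y, m' <- bc M (ba M (pure b2 m)))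
     pure (ha M (pure z m')) (ba X (pure (hmul hB (pure (SbB y) b1)) x'))).
    rewrite [RHS]sw_C; apply: sw_ext => b1 b2; rewrite (PsiE hopfH bijH _ coactB _ _ HMa HXc (gac gM)).
    rewrite (sw_comm_ac _ _ (gca gX)); last by lin.
    by apply: sw_ext => z x'; apply: sw_ext => y m'; rewrite BXA.
  rewrite sw_purer sw_lin; apply: sw_ext => z x'.
  rewrite (isYD_Sbl hopfB bijB (F := fun w m' => pure (ha M (pure z m')) (ba X (pure w x'))) _ _ _ _ _ _ _ _ (gBy gM)) //; last by lin.
  rewrite sw_C sw_purer sw_lin; apply: sw_ext => y m'; rewrite tactE.
  by apply: sw_ext => b1 b2; rewrite pullE BXA (gaa gM).
- move=> t; tens_elim t => x m; rewrite (bc_tensB hopfH bijH _ coactB) // (bc_tensB hopfH bijH _ coactB) //.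
  rewrite sw_tcoact; last by lin.
  rewrite (PsiE hopfH bijH _ coactB _ _ HMa HXc (gac gM)) sw_lin.
  transitivity (\sw_(z, x' <- hc X x) \sw_(y, m' <- bc M m) \sw_(y', m'' <- bc M m') \sw_(v, x'' <- bc X (ba X (pure (SbB y) x')))
     pure (hmul hB (pure y' v)) (pure (ha M (pure z m'')) x'')).
    apply: sw_ext => z x'; rewrite sw_lin; apply: sw_ext => y m'.
    by rewrite tcoactE (sw_comm_ac _ _ (gac gM)) //; lin.
  transitivity (\sw_(z, x' <- hc X x) \sw_(v, x'' <- bc X x') \sw_(y, m' <- bc M m) \sw_(y', m'' <- bc M m') 
     pure (hmul hB (pure v y)) (pure (ha M (pure z m'')) (ba X (pure (SbB y') x'')))); last first.
    transitivity (\sw_(v, x' <- bc X x) \sw_(z, x'' <- hc X x') \sw_(y, m' <- bc M m) \sw_(y', m'' <- bc M m') 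
     pure (hmul hB (pure v y)) (pure (ha M (pure z m'')) (ba X (pure (SbB y') x'')))).
      by rewrite (ccX _ (fun z v x'' => \sw_(y, m' <- bc M m) \sw_(y', m'' <- bc M m') 
     pure (hmul hB (pure v y)) (pure (ha M (pure z m'')) (ba X (pure (SbB y') x''))))) //; lin.
    apply: sw_ext => v x'; rewrite sw_C; apply: sw_ext => y m'.
    rewrite (PsiE hopfH bijH _ coactB _ _ HMa HXc (gac gM)) sw_purer; apply: sw_ext => z x''.
    by rewrite sw_purer.
  apply: sw_ext => z x'.
  rewrite -(BMcA _ (fun y y' m'' => \sw_(v, x'' <- bc X (ba X (pure (SbB y) x')))
     pure (hmul hB (pure y' v)) (pure (ha M (pure z m'')) x''))); last by lin.
  transitivity (\sw_(y, m' <- bc M m) \sw_(v, x'' <- bc X x') \sw_(y1, y2 <- D y)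
     pure (hmul hB (pure v y1)) (pure (ha M (pure z m')) (ba X (pure (SbB y2) x'')))); last first.
    rewrite sw_C; apply: sw_ext => v x''.
    by rewrite (BMcA _ (fun y y' m'' => pure (hmul hB (pure v y)) (pure (ha M (pure z m'')) (ba X (pure (SbB y') x''))))) //; lin.
  apply: sw_ext => y m'; rewrite [RHS]sw_C.
  by apply: (isYD_Sbr hopfB bijB (F := fun v x'' => pure v (pure (ha M (pure z m')) x'')) _ _ _ _ _ _ (gBy gX)) => //; lin.
Qed.
End PsiMorphism.

Lemma tensA_mulE (k : fieldType) (A C : lmodType k) (P : wmap [:: C; A] [:: A; C])
    (mA : wmap [:: A; A] [:: A]) (mC : wmap [:: C; C] [:: C]) a c a' c' :
  (grp A C \oc (mA \ox mC) \oc (idm A \ox P \ox idm C) \oc (ungrp A C \ox ungrp A C))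
    (pure (pure a c) (pure a' c')) =
  \sw_(a1, c1 <- P (pure c a')) pure (mA (pure a a1)) (mC (pure c1 c')).
Proof. wev; swx (P (pure c a')) => a1 c1; by wev. Qed.

(** * Algebras over B *)

Section BraidedAlgebras.
Variables (k : fieldType) (H : lmodType k) (hH : hopf H).
Hypothesis hopfH : is_hopf (flip H H) hH.
Hypothesis bijH : bijective (antip hH).
Variables (B : ydobj H) (hB : hopf B).
Hypothesis hopfB : is_hopf (flip B B) hB.
Hypothesis bijB : bijective (antip hB).
Hypothesis actB : forall x b, ha B (pure x b) = (hcou hH x : k) *: b.
Hypothesis coactB : forall b, hc B b = pure (hone hH) b.
Implicit Types M N P Q : bydobj H B.
Local Notation gyd := (gyd hH hB).
Local Notation byd := (gyd (lid B) (lid B)).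
Local Notation Psi := (Psi hH hB).
Local Notation tensB := (tensB hH hB).

Lemma pull_id M : pull (lid B) M = M.
Proof.
case: M => M mu la; rewrite /pull; congr (BYDObj _ la).
apply: lin_ext; apply: tens_ext => b m.
by rewrite lcompE tmap_pure.
Qed.

Lemma morK_comp M N P (f : {linear M -> N}) (g : {linear N -> P}) :
  morK f -> morK g -> morK (lcomp g f : {linear M -> P}).
Proof.
move=> [f1 f2 f3 f4] [g1 g2 g3 g4]; split.
- exact: islin_comp f1 g1.
- exact: iscol_comp f2 g2.
- exact: islin_comp f3 g3.
- exact: iscol_comp f4 g4.
Qed.
Lemma morK_id M : morK (M := M) (N := M) (lid M).
Proof. by split=> // m; rewrite -[LHS]sw_id. Qed.
Lemma morK_can M N (f : {linear M -> N}) (g : {linear N -> M}) :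
  cancel f g -> cancel g f -> morK f -> morK g.
Proof.
move=> fg gf [f1 f2 f3 f4]; split.
- exact: islin_can fg gf f1.
- exact: iscol_can fg gf f2.
- exact: islin_can fg gf f3.
- exact: iscol_can fg gf f4.
Qed.

(** The part of [gyd] under which the braidings with [B] are flips, whatever the twists are. *)
Definition good M : Prop := isact hH (ha M) /\ iscoact hH (hc M).
Lemma gyd_good a b M : gyd a b M -> good M.
Proof. by move=> gM; split; [exact: gHa gM | exact: gHc gM]. Qed.
Lemma tensB_good M N : good M -> good N -> good (tensB M N).
Proof.
move=> [? ?] [? ?]; split; rewrite ?ha_tensB ?hc_tensB.
  exact: (tact_isact hopfH).
exact: (tcoact_iscoact hopfH).
Qed.
Lemma pull_good be M : good M -> good (pull be M). Proof. by []. Qed.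

Lemma morK_tmap M N M' N' (f : {linear M -> M'}) (g : {linear N -> N'}) :
  good M -> good M' -> morK f -> morK g ->
  morK (M := tensB M N) (N := tensB M' N') (tmap f g).
Proof.
move=> [Ma Mc] [Ma' Mc'] [f1 f2 f3 f4] [g1 g2 g3 g4]; split.
- exact: tmap_islin f1 g1.
- exact: tmap_iscol f2 g2.
- by rewrite !(ba_tensB hopfH bijH _ actB) //; exact: tmap_islin f3 g3.
- by rewrite !(bc_tensB hopfH bijH _ coactB) //; exact: tmap_iscol f4 g4.
Qed.
Lemma morK_assoc M N P : good M -> good N ->
  morK (M := tensB (tensB M N) P) (N := tensB M (tensB N P)) (assoc M N P).
Proof.
move=> gM gN; have [Ma Mc] := gM; have [Na Nc] := gN; have [Ta Tc] := tensB_good gM gN.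
split.
- exact: (assoc_islin hopfH).
- exact: (assoc_iscol hopfH).
- rewrite !(ba_tensB hopfH bijH _ actB) //; exact: (assoc_islin hopfB).
- rewrite !(bc_tensB hopfH bijH _ coactB) //; exact: (assoc_iscol hopfB).
Qed.
Lemma morK_assocV M N P : good M -> good N ->
  morK (M := tensB M (tensB N P)) (N := tensB (tensB M N) P) (assocV M N P).
Proof.
move=> gM gN; apply: (@morK_can (tensB (tensB M N) P) (tensB M (tensB N P)) (assoc M N P) (assocV M N P)).
- exact: assocK.
- exact: assocVK.
- exact: morK_assoc.
Qed.

Lemma Psi_natl M M' N a b a' b' c d (f : {linear M -> M'}) (W : lmodType k) (F : N -> M' -> W) m n :
  gyd a b M -> gyd a' b' M' -> gyd c d N -> morK f -> bilin F ->
  teval F (Psi M' N (pure (f m) n)) = \sw_(n1, m1 <- Psi M N (pure m n)) F n1 (f m1).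
Proof.
move=> gM gM' gN [f1 f2 f3 f4] Fb.
have il : iscol (bc N) (bc N) (lid N) by move=> x; rewrite -[LHS]sw_id.
have E := @Psi_nat _ _ _ hopfH bijH _ _ coactB _ _ _ _ _ _ _ _ M N M' N f (lid N) m n gM gN gM' gN f2 f3 (fun _ _ => erefl) il.
by rewrite E sw_tmap.
Qed.
Lemma Psi_natr M N N' a b c d c' d' (g : {linear N -> N'}) (W : lmodType k) (F : N' -> M -> W) m n :
  gyd a b M -> gyd c d N -> gyd c' d' N' -> morK g -> bilin F ->
  teval F (Psi M N' (pure m (g n))) = \sw_(n1, m1 <- Psi M N (pure m n)) F (g n1) m1.
Proof.
move=> gM gN gN' [g1 g2 g3 g4] Fb.
have il : iscol (hc M) (hc M) (lid M) by move=> x; rewrite -[LHS]sw_id.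
have E := @Psi_nat _ _ _ hopfH bijH _ _ coactB _ _ _ _ _ _ _ _ M N M N' (lid M) g m n gM gN gM gN' il (fun _ _ => erefl) g1 g4.
by rewrite E sw_tmap.
Qed.

Definition mid (A C V V' C' W : lmodType k) (psi : {linear tens C V -> tens V' C'}) :
  {linear tens (tens A C) (tens V W) -> tens (tens A V') (tens C' W)} :=
  lcomp (assocV A V' (tens C' W)) (lcomp (tmap (lid A) (lcomp (assoc V' C' W)
    (lcomp (tmap psi (lid W)) (assocV C V W)))) (assoc A C (tens V W))).
Lemma midE (A C V V' C' W : lmodType k) (psi : {linear tens C V -> tens V' C'}) a c v w :
  mid A W psi (pure (pure a c) (pure v w)) =
  \sw_(v', c' <- psi (pure c v)) pure (pure a v') (pure c' w).
Proof.
rewrite -[LHS]/(assocV A V' (tens C' W) (tmap (lid A) (lcomp (assoc V' C' W)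
    (lcomp (tmap psi (lid W)) (assocV C V W))) (assoc A C (tens V W) (pure (pure a c) (pure v w))))).
rewrite assoc_pure tmap_pure.
rewrite -[lcomp _ _ (pure c _)]/(assoc V' C' W (tmap psi (lid W) (assocV C V W (pure c (pure v w))))).
rewrite assocV_pure tmap_pure -[lid A a]/a -[lid W w]/w.
rewrite -[psi _ in LHS]sw_id sw_purel sw_lin sw_purer sw_lin; apply: sw_ext => v' c'.
by rewrite assoc_pure assocV_pure.
Qed.
Lemma morK_mid M N Q Q' N' P (psi : {linear tens N Q -> tens Q' N'}) :
  good M -> good N -> good Q -> good Q' -> good N' ->
  morK (M := tensB N Q) (N := tensB Q' N') psi ->
  morK (M := tensB (tensB M N) (tensB Q P)) (N := tensB (tensB M Q') (tensB N' P)) (mid M P psi).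
Proof.
move=> gM gN gQ gQ' gN' pm.
have m1 : morK (M := tensB (tensB N Q) P) (N := tensB (tensB Q' N') P) (tmap psi (lid P)).
  exact: (@morK_tmap (tensB N Q) P (tensB Q' N') P psi (lid P) (tensB_good gN gQ)
    (tensB_good gQ' gN') pm (morK_id P)).
have m2 := @morK_comp (tensB N (tensB Q P)) (tensB (tensB N Q) P) _ _ _ (morK_assocV P gN gQ) m1.
have m3 := @morK_comp _ (tensB (tensB Q' N') P) (tensB Q' (tensB N' P)) _ _ m2 (morK_assoc P gQ' gN').
have m4 := @morK_tmap M _ M _ (lid M) _ gM gM (morK_id M) m3.
have m5 := @morK_comp _ _ _ _ _ (@morK_assoc M N (tensB Q P) gM gN) m4.
exact: (@morK_comp _ _ _ _ _ m5 (@morK_assocV M Q' (tensB N' P) gM gQ')).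
Qed.

Implicit Types A C : algB H B.
Definition mulL A : {linear tens A A -> A} := amul A.
Definition one1 A : A := aone A (1 : k^o).
Local Notation "x *[ A ] y" := (mulL A (pure x y)) (at level 40, format "x  *[ A ]  y").

Record kalg A : Prop := Kalg {
  kbyd : byd A;
  kA : forall a b c : A, (a *[A] b) *[A] c = a *[A] (b *[A] c);
  k1l : forall a : A, one1 A *[A] a = a;
  k1r : forall a : A, a *[A] one1 A = a;
  kmul : morK (M := tensB A A) (N := A) (mulL A);
  kha1 : forall x, ha A (pure x (one1 A)) = (hcou hH x : k) *: one1 A;
  khc1 : hc A (one1 A) = pure (hone hH) (one1 A);
  kba1 : forall x, ba A (pure x (one1 A)) = (hcou hB x : k) *: one1 A;
  kbc1 : bc A (one1 A) = pure (hone hB) (one1 A) }.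

Lemma algP A : is_algB hH hB A <-> kalg A.
Proof.
have unitP : is_morB (M := unitB hH hB) (N := A) (aone A) <->
  [/\ forall x, ha A (pure x (one1 A)) = (hcou hH x : k) *: one1 A,
      hc A (one1 A) = pure (hone hH) (one1 A),
      forall x, ba A (pure x (one1 A)) = (hcou hB x : k) *: one1 A &
      bc A (one1 A) = pure (hone hB) (one1 A)].
  have o1 (c : k^o) : aone A c = (c : k) *: one1 A.
    by rewrite -linearZ /GRing.scale /= mulr1.
  have sc (U : lmodType k) (g : wmap [:: U] [::]) (u : U) (c : k^o) :
      (g \ox idm k^o) (pure u c) = (g u : k) * c.
    by wev.
  have sc1 (U : lmodType k) (g : wmap [::] [:: U]) (c : k^o) :
      (g \ox idm k^o) c = pure (g 1) c.
    by rewrite hox0l; wev.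
  split.
    move=> [[E1 E2] E3 E4]; split.
    - move=> x; have E : aone A ((bcounit hH \ox idm k^o) (pure x (1 : k^o))) = yact A ((idm H \ox (aone A : wmap [:: k^o] [:: ycar A])) (pure x (1 : k^o))) := E1 (pure x (1 : k^o)).
      by move: E; rewrite sc o1 mulr1; wev.
    - have E : ycoact A (aone A (1 : k^o)) = (idm H \ox (aone A : wmap [:: k^o] [:: ycar A])) ((bone hH \ox idm k^o) (1 : k^o)) := E2 (1 : k^o).
      by apply: etrans E _; rewrite sc1; wev.
    - move=> x; have E : aone A ((bcounit hB \ox idm k^o) (pure x (1 : k^o))) = bact A ((idm B \ox (aone A : wmap [:: k^o] [:: ycar A])) (pure x (1 : k^o))) := E3 (pure x (1 : k^o)).
      by move: E; rewrite sc o1 mulr1; wev.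
    - have E : bcoact A (aone A (1 : k^o)) = (idm B \ox (aone A : wmap [:: k^o] [:: ycar A])) ((bone hB \ox idm k^o) (1 : k^o)) := E4 (1 : k^o).
      by apply: etrans E _; rewrite sc1; wev.
  move=> [h1 h2 h3 h4]; split; first split.
  - apply: tens_ext => x c; rewrite -[LHS]/(aone A ((bcounit hH \ox idm k^o) (pure x c))) sc.
    rewrite -[RHS]/(yact A ((idm H \ox (aone A : wmap [:: k^o] [:: ycar A])) (pure x c))); wev.
    rewrite !o1 pureZr linearZ /= -[yact A _]/(ha A _) h1 scalerA mulrC.
    by [].
  - move=> c; rewrite -[LHS]/(hc A (aone A c)) -[RHS]/((idm H \ox (aone A : wmap [:: k^o] [:: ycar A])) ((bone hH \ox idm k^o) c)) sc1.
    by wev; rewrite !o1 linearZ /= h2 pureZr.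
  - apply: tens_ext => x c; rewrite -[LHS]/(aone A ((bcounit hB \ox idm k^o) (pure x c))) sc.
    rewrite -[RHS]/(bact A ((idm B \ox (aone A : wmap [:: k^o] [:: ycar A])) (pure x c))); wev.
    rewrite !o1 pureZr linearZ /= -[bact A _]/(ba A _) h3 scalerA mulrC.
    by [].
  - move=> c; rewrite -[LHS]/(bc A (aone A c)) -[RHS]/((idm B \ox (aone A : wmap [:: k^o] [:: ycar A])) ((bone hB \ox idm k^o) c)) sc1.
    by wev; rewrite !o1 linearZ /= h4 pureZr.
have algE : is_algebra (amul A) (aone A) <-> [/\ forall a b c : A, (a *[A] b) *[A] c = a *[A] (b *[A] c),
  forall a : A, one1 A *[A] a = a & forall a : A, a *[A] one1 A = a].
  split=> [[E1 E2 E3]|[E1 E2 E3]]; split.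
  - by move=> a b c; have := E1 (pure a (pure b c)); wev; exact.
  - by move=> a; have := E2 a; rewrite hcompE hox0l; wev; exact.
  - by move=> a; have := E3 a; wev; exact.
  - by apply: tens_ext3 => a b c; wev; exact: E1.
  - by move=> a; rewrite hcompE hox0l; wev; exact: E2.
  - by move=> a; wev; exact: E3.
split.
  move=> [/(bydP hopfH bijH hB actB coactB) yA /algE[a1 a2 a3] /morBP mA /unitP[? ? ? ?]].
  by split.
case=> yA a1 a2 a3 mA ? ? ? ?; split.
- exact/(bydP hopfH bijH hB actB coactB).
- exact/algE.
- exact/morBP.
- exact/unitP.
Qed.

Lemma morK_pull1 C (cW : {linear tens C C -> C}) : good C ->
  morK (M := tensB C C) (N := C) cW -> morK (M := tensB (pull (lid B) C) C) (N := C) cW.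
Proof.
move=> gC [c1 c2 c3 c4].
have bE : ba (pull (lid B) C) = ba C.
  by apply: lin_ext; apply: tens_ext => b m; rewrite pullE.
split.
+ have E : islin (tact hH (ha C) (ha C)) (ha C) cW := c1.
  exact E.
+ have E : iscol (tcoact hH (hc C) (hc C)) (hc C) cW := c2.
  exact E.
+ have E : islin (tact hB (ba C) (ba C)) (ba C) cW.
    by rewrite -(ba_tensB hopfH bijH hB actB C (proj2 gC)).
  rewrite (@ba_tensB _ _ _ hopfH bijH _ hB actB (pull (lid B) C) C (proj2 gC)) bE.
  exact E.
+ have E : iscol (tcoact hB (bc C) (bc C)) (bc C) cW.
    by rewrite -(bc_tensB hopfH bijH hB coactB C (proj1 gC)).
  rewrite (@bc_tensB _ _ _ hopfH bijH _ hB coactB (pull (lid B) C) C (proj1 gC)).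
  exact E.
Qed.

(** * Actions of a braided tensor product algebra *)

Section TensorAction.
Variables (be : {linear B -> B}).
Hypothesis beM : forall x y, be (hmul hB (pure x y)) = hmul hB (pure (be x) (be y)).
Hypothesis be1 : be (hone hB) = hone hB.
Hypothesis beSb : forall x, be (hantV hB x) = hantV hB (be x).
Hypothesis becom : forall (W : lmodType k) (F : B -> B -> W) x, bilin F ->
  teval F (hcom hB (be x)) = \sw_(a, b <- hcom hB x) F (be a) (be b).
Lemma morK_pull C (W : bydobj H B) (cW : {linear tens C W -> W}) : good C ->
  morK (M := tensB C W) (N := W) cW ->
  morK (M := tensB (pull be C) (pull be W)) (N := pull be W) cW.
Proof.
move=> gC cWm.
have [c1 c2 c3 c4] := cWm; split.
+ have E : islin (tact hH (ha C) (ha W)) (ha W) cW := c1.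
  exact E.
+ have E : iscol (tcoact hH (hc C) (hc W)) (hc W) cW := c2.
  exact E.
+ have E : islin (tact hB (ba C) (ba W)) (ba W) cW.
    by rewrite -(ba_tensB hopfH bijH hB actB W (proj2 gC)).
  rewrite (@ba_tensB _ _ _ hopfH bijH _ hB actB (pull be C) (pull be W) (proj2 gC)).
  move=> b t.
  tens_elim t => c w.
  rewrite pullE.
  rewrite -[RHS]E.
  congr (cW _).
  have E1 := tactE hB (ba (pull be C)) (ba (pull be W)) b c w.
  have E2 := tactE hB (ba C) (ba W) (be b) c w.
  apply: (etrans E1).
  symmetry; apply: (etrans E2).
  rewrite becom; last by lin.
  apply: sw_ext => b1 b2.
  rewrite pullE.
  by rewrite pullE.
+ have E : iscol (tcoact hB (bc C) (bc W)) (bc W) cW.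
    by rewrite -(bc_tensB hopfH bijH hB coactB W (proj1 gC)).
  rewrite (@bc_tensB _ _ _ hopfH bijH _ hB coactB (pull be C) (pull be W) (proj1 gC)).
  exact E.
Qed.
Variables (A C : algB H B) (V W : bydobj H B).
Hypotheses (hA : kalg A) (hC : kalg C) (gV : gyd (lid B) be V) (gW : good W).
Variables (aV : {linear tens A V -> V}) (cW : {linear tens C W -> W}).
Hypotheses (aVm : morK (M := tensB A V) (N := V) aV) (cWm : morK (M := tensB (pull be C) W) (N := W) cW).
Hypotheses (aVA : forall a b v, aV (pure (a *[A] b) v) = aV (pure a (aV (pure b v))))
  (aV1 : forall v, aV (pure (one1 A) v) = v).
Hypotheses (cWA : forall a b v, cW (pure (a *[C] b) v) = cW (pure a (cW (pure b v))))
  (cW1 : forall v, cW (pure (one1 C) v) = v).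

(** The action of A # C on V (x) W, where c is braided past v before it acts; this twists [C] by
    [be], whence the pullback in [cWm]. For the regular modules it is the product of [tensA]; for
    endomorphism algebras it leads to the endomorphisms of a tensor product. *)
Definition tmod : {linear tens (tens A C) (tens V W) -> tens V W} :=
  lcomp (tmap aV cW) (mid A W (Psi C V : {linear tens C V -> tens V C})).
Lemma tmodE a c v w : tmod (pure (pure a c) (pure v w)) =
  \sw_(v', c' <- Psi C V (pure c v)) pure (aV (pure a v')) (cW (pure c' w)).
Proof. by rewrite /tmod lcompE midE sw_lin; apply: sw_ext => v' c'; rewrite tmap_pure. Qed.

Lemma tmod_morK : morK (M := tensB (tensB A C) (tensB V W)) (N := tensB V W) tmod.
Proof.
have [gA gC] := (gyd_good (kbyd hA), gyd_good (kbyd hC)).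
have gVg := gyd_good gV.
have pm := Psi_morK hopfH bijH hopfB bijB actB coactB beM be1 beSb (kbyd hC) gV.
have m1 := @morK_mid A C V V (pull be C) W _ gA gC gVg gVg (pull_good be gC) pm.
have m3 := @morK_tmap (tensB A V) (tensB (pull be C) W) V W aV cW
  (tensB_good gA gVg) gVg aVm cWm.
exact: (@morK_comp _ _ _ _ _ m1 m3).
Qed.

Lemma Psi_mull (U : bydobj H B) d (Z : lmodType k) (F : U -> C -> Z) c c' (u : U) : gyd (lid B) d U -> bilin F ->
  teval F (Psi C U (pure (c *[C] c') u)) =
  \sw_(u1, c1' <- Psi C U (pure c' u)) \sw_(u2, c1 <- Psi C U (pure c u1)) F u2 (c1 *[C] c1').
Proof.
move=> gU Fb; have gC := kbyd hC.
have gT := tensB_gyd hopfH bijH hopfB actB coactB gC gC.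
have E := @Psi_natl (tensB C C) C U _ _ _ _ _ _ (mulL C) _ _ (pure c c') u gT gC gU (kmul hC) Fb.
apply: (etrans E).
by rewrite (Psi_tensl hopfH bijH hopfB bijB actB coactB (F := fun u2 t => F u2 (mulL C t)) _ _ _ gC gC gU) //; lin.
Qed.
Lemma Psi_actr (Z : lmodType k) (F : V -> C -> Z) c a v : bilin F ->
  teval F (Psi C V (pure c (aV (pure a v)))) =
  \sw_(a1, c1 <- Psi C A (pure c a)) \sw_(v1, c2 <- Psi C V (pure c1 v)) F (aV (pure a1 v1)) c2.
Proof.
move=> Fb; have gC := kbyd hC; have gA := kbyd hA.
have gT := tensB_gyd hopfH bijH hopfB actB coactB gA gV.
have E := @Psi_natr C (tensB A V) V _ _ _ _ _ _ aV _ _ c (pure a v) gC gT gV aVm Fb.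
apply: (etrans E).
by rewrite (Psi_tensr hopfH bijH hopfB bijB actB coactB (F := fun t c2 => F (aV t) c2) _ _ _ gC gA gV) //; lin.
Qed.

(** [Psi_mull] takes the braiding through the product of [C], and [Psi_actr] takes it through the
    action of [A]; both sides then consist of the same three braidings. *)
Lemma tmodA a c a' c' t :
  tmod (pure (\sw_(a1, c1 <- Psi C A (pure c a')) pure (a *[A] a1) (c1 *[C] c')) t) =
  tmod (pure (pure a c) (tmod (pure (pure a' c') t))).
Proof.
tens_elim t => v w.
rewrite tmodE sw_purel sw_lin.
transitivity (\sw_(a1, c1 <- Psi C A (pure c a')) \sw_(v1, c1' <- Psi C V (pure c' v)) \sw_(v2, c2 <- Psi C V (pure c1 v1))
   pure (aV (pure a (aV (pure a1 v2)))) (cW (pure c2 (cW (pure c1' w))))).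
  apply: sw_ext => a1 c1; rewrite tmodE (Psi_mull _ _ _ gV); last by lin.
  by apply: sw_ext => v1 c1'; apply: sw_ext => v2 c2; rewrite aVA cWA.
rewrite sw_C sw_purer sw_lin; apply: sw_ext => v1 c1'.
by rewrite tmodE Psi_actr //; lin.
Qed.
Lemma Psi_1l (U : bydobj H B) d (u : U) : gyd (lid B) d U ->
  Psi C U (pure (one1 C) u) = pure u (one1 C).
Proof.
move=> gU; have [HA HH1] := gHa gU; have [BA BB1] := gBc gU.
rewrite (PsiE hopfH bijH _ coactB _ _ (gHa gU) (gHc (kbyd hC)) (gac gU)) khc1 // sw_pure; last by lin.
rewrite -[RHS](BB1 _ (fun u => pure u (one1 C))); last by lin.
by apply: sw_ext => y u'; rewrite HH1 kba1 // (hcouSb hopfB bijB) pureZr.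
Qed.
Lemma tmod1 t : tmod (pure (pure (one1 A) (one1 C)) t) = t.
Proof.
tens_elim t => v w.
by rewrite tmodE (Psi_1l _ gV) sw_pure ?aV1 ?cW1 //; lin.
Qed.
End TensorAction.

Lemma Psi_1r C M a b (m : M) : kalg C -> gyd a b M -> Psi M C (pure m (one1 C)) = pure (one1 C) m.
Proof.
move=> hC gM; have [HA HH1] := gHc gM; have [BA BB1] := gBa gM.
rewrite (PsiE hopfH bijH _ coactB _ _ (gHa (kbyd hC)) (gHc gM) (gac (kbyd hC))).
rewrite -[RHS](HH1 _ (fun m => pure (one1 C) m)); last by lin.
apply: sw_ext => x m'; rewrite kbc1 // sw_pure; last by lin.
by rewrite kha1 // (hantV1 hopfB bijB) BB1 pureZl.
Qed.

Local Notation tensA := (tensA hH hB).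
Lemma mul_tensA A C a c a' c' : (pure a c) *[tensA A C] (pure a' c') =
  \sw_(a1, c1 <- Psi C A (pure c a')) pure (a *[A] a1) (c1 *[C] c').
Proof.
exact: tensA_mulE.
Qed.
Lemma one_tensA A C : one1 (tensA A C) = pure (one1 A) (one1 C).
Proof. by rewrite -[LHS]/((grp A C \oc (aone A \ox aone C)) 1) hcompE hox0l; wev. Qed.

(** The product of A # C is [tmod] for the two regular modules, so associativity and compatibility
    with all structures are instances of the statements on [tmod]. *)
Lemma tensA_kalg A C : kalg A -> kalg C -> kalg (tensA A C).
Proof.
move=> hA hC.
have gA := kbyd hA; have gC := kbyd hC; have [Ad Cd] := (gyd_good gA, gyd_good gC).
have mulE : mulL (tensA A C) = tmod (mulL A) (mulL C).
  apply: lin_ext; apply: tens_ext => t u; tens_elim t => a c; tens_elim u => a' c'.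
  by apply: etrans (mul_tensA _ _ _ _) _; rewrite tmodE.
have idS : forall x : B, lid B (hantV hB x) = hantV hB (lid B x) by [].
have idM : forall x y : B, lid B (hmul hB (pure x y)) = hmul hB (pure (lid B x) (lid B y)) by [].
have id1 : lid B (hone hB) = hone hB by [].
split.
- exact: (tensB_gyd hopfH bijH hopfB actB coactB gA gC).
- move=> t u v; tens_elim t => a c; tens_elim u => a' c'.
  rewrite mul_tensA mulE.
  apply: (tmodA hA hC gA (kmul hA) (kA hA) (kA hC)).
- move=> t; rewrite one_tensA mulE; apply: (tmod1 hC gA (k1l hA) (k1l hC)).
- move=> t; tens_elim t => a c; rewrite one_tensA mul_tensA (Psi_1r _ hA gC).
  rewrite sw_pure; last by lin.
  by rewrite (k1r hA) (k1r hC).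
- have m := tmod_morK idM id1 idS hA hC gA (kmul hA) (morK_pull1 Cd (kmul hC)).
  rewrite -mulE in m.
  exact m.
- move=> x; rewrite one_tensA ha_tensB tactE -[RHS](hcou1l hopfH (F := fun y => (hcou hH y : k) *: pure (one1 A) (one1 C))); last by lin.
  by apply: sw_ext => y z; rewrite (kha1 hA) (kha1 hC) pureZl pureZr.
- rewrite one_tensA hc_tensB tcoactE (khc1 hA) (khc1 hC) sw_pure; last by lin.
  rewrite sw_pure; last by lin.
  by rewrite (hmul1l hopfH).
- move=> x; rewrite one_tensA (ba_tensB hopfH bijH _ actB _ (proj2 Ad)).
  rewrite tactE -[RHS](hcou1l hopfB (F := fun y => (hcou hB y : k) *: pure (one1 A) (one1 C))); last by lin.
  by apply: sw_ext => y z; rewrite (kba1 hA) (kba1 hC) pureZl pureZr.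
- rewrite one_tensA (bc_tensB hopfH bijH _ coactB _ (proj1 Ad)).
  rewrite tcoactE (kbc1 hA) (kbc1 hC) sw_pure; last by lin.
  rewrite sw_pure; last by lin.
  by rewrite (hmul1l hopfB).
Qed.
End BraidedAlgebras.

Section Transparent.
Variables (k : fieldType) (H : lmodType k) (hH : hopf H).
Hypothesis hopfH : is_hopf (flip H H) hH.
Hypothesis bijH : bijective (antip hH).
Variables (B : ydobj H) (hB : hopf B).
Hypothesis hopfB : is_hopf (flip B B) hB.
Hypothesis bijB : bijective (antip hB).
Hypothesis actB : forall x b, ha B (pure x b) = (hcou hH x : k) *: b.
Hypothesis coactB : forall b, hc B b = pure (hone hH) b.
Implicit Types M N P Q : bydobj H B.
Local Notation Psi := (Psi hH hB).
Local Notation tensB := (tensB hH hB).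
Local Notation gyd := (gyd hH hB).
Local Notation Phi_BM := (Phi_BM hopfH bijH actB).
Local Notation Phi_MB := (Phi_MB hopfH bijH coactB).
Local Notation Phi_BB := (Phi_BB hopfH bijH actB coactB).
Local Notation ha_tensB := (ha_tensB hH hB).
Local Notation hc_tensB := (hc_tensB hH hB).
Local Notation ba_tensB := (ba_tensB hopfH bijH hB actB).
Local Notation bc_tensB := (bc_tensB hopfH bijH hB coactB).
Local Notation bydP := (bydP hopfH bijH hB actB coactB).
Local Notation tensB_gyd := (tensB_gyd hopfH bijH hopfB actB coactB).
Local Notation PsiV := (PsiV hH).
Local Notation PsiVE := (PsiVE hH).
Local Notation PsiK := (PsiK hopfH bijH hopfB bijB coactB).
Local Notation PsiVK := (PsiVK hopfH bijH hopfB bijB coactB).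
Local Notation sw_Psi := (sw_Psi hopfH bijH coactB).
Local Notation Psi_nat := (Psi_nat hopfH bijH coactB).
Local Notation Psi_tensl := (Psi_tensl hopfH bijH hopfB bijB actB coactB).
Local Notation Psi_tensr := (Psi_tensr hopfH bijH hopfB bijB actB coactB).
Local Notation Psi_morK := (Psi_morK hopfH bijH hopfB bijB actB coactB).
Local Notation good := (good hH).
Local Notation tensB_good := (tensB_good hopfH hB).
Local Notation morK_tmap := (morK_tmap hopfH bijH hB actB coactB).
Local Notation morK_assoc := (morK_assoc hopfH bijH hopfB actB coactB).
Local Notation morK_assocV := (morK_assocV hopfH bijH hopfB actB coactB).
Local Notation Psi_natl := (Psi_natl hopfH bijH coactB).
Local Notation Psi_natr := (Psi_natr hopfH bijH coactB).
Local Notation kalg := (kalg hH hB).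
Local Notation algP := (algP hopfH bijH hB actB coactB).
Local Notation morK_pull := (morK_pull hopfH bijH actB coactB).
Local Notation tmod := (tmod hH hB).
Local Notation tmodE := (tmodE hH hB).
Local Notation tmod_morK := (tmod_morK hopfH bijH hopfB bijB actB coactB).
Local Notation Psi_mull := (Psi_mull hopfH bijH hopfB bijB actB coactB).
Local Notation tmodA := (tmodA hopfH bijH hopfB bijB actB coactB).
Local Notation Psi_1l := (Psi_1l hopfH bijH hopfB bijB coactB).
Local Notation tmod1 := (tmod1 hopfH bijH hopfB bijB coactB).
Local Notation Psi_1r := (Psi_1r hopfH bijH hopfB bijB coactB).
Local Notation mul_tensA := (mul_tensA hH hB).
Local Notation one_tensA := (one_tensA hH hB).
Local Notation tensA_kalg := (tensA_kalg hopfH bijH hopfB bijB actB coactB).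
Local Notation byd := (gyd (lid B) (lid B)).
Implicit Types A C : algB H B.
Local Notation tensA := (tensA hH hB).
Local Notation endA := (endA hH hB).
Local Notation "x *[ A ] y" := (@mulL _ _ _ A (pure x y)) (at level 40, format "x  *[ A ]  y").

(** * Endomorphism algebras of twisted modules *)

Section EndomorphismAlgebras.
Lemma homC_ha (M N : ydobj H) : is_homact hH (ha M) (ha N) (ha (homC hH M N)).
Proof.
move=> x f m.
rewrite -[LHS]/((yact (homC hH M N) (pure x f) : LinMap M N) m) curryE.
wev; swx (bcomul hH x) => a b; by wev.
Qed.

(** The braiding enters as a variable [P] equal to a flip, so that it is replaced before the words
    are evaluated. The outcome is the usual action f -> b1 f(S(b2) -). *)
Lemma endA_actE M (mu : wmap [:: ycar B; ycar M] [:: ycar M])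
    (P : wmap [:: ycar B; LinMap M M] [:: LinMap M M; ycar B]) b (f : LinMap M M) m :
  P = flip B (LinMap M M) ->
  let E : lmodType k := LinMap M M in
  let mulE : wmap [:: E; E] [:: E] := curry [:: E; E] (ev M M \oc (idm E \ox ev M M)) in
  let theta : wmap [:: ycar B] [:: E] := curry [:: ycar B] mu in
  ((mulE \oc (mulE \ox idm E) \oc (theta \ox idm E \ox theta) \oc (idm B \ox P)
    \oc (idm B \ox antip hB \ox idm E) \oc (bcomul hB \ox idm E)) (pure b f) : LinMap M M) m =
  \sw_(a, c <- hcom hB b) mu (pure a (f (mu (pure (hant hB c) m)))).
Proof.
move=> PE E mulE theta; rewrite PE.
have mE (g g' : LinMap M M) : mulE (pure g g') = lcomp g g'.
  by apply: lin_ext => u; rewrite curryE; wev.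
have tE (c : B) u : (theta c : LinMap M M) u = mu (pure c u) by rewrite curryE; wev.
wev; swx (bcomul hB b) => a c; wev; rewrite !mE !lcompE !tE.
by [].
Qed.

Lemma endA_mulE M (f g : LinMap M M) : mulL (endA M) (pure f g) = lcomp f g.
Proof.
apply: lin_ext => m.
rewrite -[LHS]/((curry [:: LinMap M M; LinMap M M] (ev M M \oc (idm _ \ox ev M M)) (pure f g) : LinMap M M) m).
by rewrite curryE; wev.
Qed.
Lemma endA_oneE M : one1 (endA M) = lid M :> LinMap M M.
Proof.
apply: lin_ext => m.
rewrite -[LHS]/((curry [::] (idm M) (1 : k^o) : LinMap M M) m) curryE.
by rewrite tjoin0l scale1r idmE.
Qed.

Lemma endA_ha M : is_homact hH (ha M) (ha M) (ha (endA M)).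
Proof. exact (@homC_ha M M). Qed.

Section EndObject.
Variables (n0 : nat) (M : bydobj H B) (al be : {linear B -> B}).
Hypotheses (gM : gyd al be M) (fdM : hasdim n0 M).
Hypothesis alS : forall x, al (hant hB x) = hant hB (al x).
Hypothesis beS : forall x, be (hant hB x) = hant hB (be x).

Lemma endA_hc : is_homcoact hH (hc M) (hc M) (hc (endA M)).
Proof. exact (hom_coactP hH (hc M) (hc M) fdM). Qed.
Lemma endA_good : good (endA M).
Proof.
split; first exact (homact_isact hopfH (@endA_ha M) (gHa gM) (gHa gM)).
exact (homcoact_iscoact hopfH bijH fdM endA_hc (gHc gM) (gHc gM)).
Qed.
Lemma endA_ba : is_homact hB (ba M) (ba M) (ba (endA M)).
Proof.
move=> b f m.
exact (@endA_actE M (bact M) (Phi hH B (homC hH M M)) b f m (@Phi_BM (endA M) (proj2 endA_good))).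
Qed.
Lemma endA_bc : is_homcoact hB (bc M) (bc M) (bc (endA M)).
Proof.
have G (P : wmap [:: ycar B; ycar B] [:: ycar B; ycar B])
    (Q : wmap [:: LinMap M M; ycar B] [:: ycar B; LinMap M M]) : P = flip B B -> Q = flip _ _ ->
    is_homcoact hB (bc M) (bc M) (hom_coact P hB Q (bcoact M) (bcoact M)).
  by move=> -> ->; exact (hom_coactP hB (bc M) (bc M) fdM).
exact (G _ _ Phi_BB (@Phi_MB (endA M) (proj1 endA_good))).
Qed.
Lemma endA_gyd : gyd al al (endA M).
Proof.
have [hA hC bA bC] := And4 (@endA_ha M) endA_hc endA_ba endA_bc.
have idH x : lid H (hant hH x) = hant hH (lid H x) by [].
split.
- exact (proj1 endA_good).
- exact (proj2 endA_good).
- exact (hom_isYD hopfH bijH fdM idH idH (gHy gM) (gHy gM) hA hC).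
- exact (homact_isact hopfB bA (gBa gM) (gBa gM)).
- exact (homcoact_iscoact hopfB bijB fdM bC (gBc gM) (gBc gM)).
- exact (hom_isYD hopfB bijB fdM beS alS (gBy gM) (gBy gM) bA bC).
- exact (hom_comm_aa hA bA (gaa gM) (gaa gM)).
- exact (hom_comm_ac fdM hA bC (gac gM) (gac gM)).
- exact (hom_comm_ac fdM bA hC (gca gM) (gca gM)).
- exact (hom_comm_cc fdM hC bC (gcc gM) (gcc gM)).
Qed.

Lemma endA_ev : morK (M := tensB (endA M) M) (N := M) (evm M).
Proof.
have [hA hC bA bC] := And4 (@endA_ha M) endA_hc endA_ba endA_bc.
split.
- exact (evm_islin hopfH (gHa gM) hA).
- exact (evm_iscol hopfH bijH (gHc gM) hC).
- rewrite (ba_tensB _ (proj2 endA_good)); exact (evm_islin hopfB (gBa gM) bA).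
- rewrite (bc_tensB _ (proj1 endA_good)); exact (evm_iscol hopfB bijB (gBc gM) bC).
Qed.

Lemma morK_detect (Y Z W : bydobj H B) (kap : {linear tens Y M -> W}) (F : {linear tens Z M -> W})
    (T : {linear Z -> Y}) (L : {linear LinMap M W -> Y}) :
  (forall y, L (mkLin (curry1_lin kap y)) = y) ->
  (forall z m, kap (pure (T z) m) = F (pure z m)) ->
  good Y -> good Z ->
  morK (M := tensB Y M) (N := W) kap -> morK (M := tensB Z M) (N := W) F -> morK T.
Proof.
move=> kL TE gY gZ [k1 k2 k3 k4] [f1 f2 f3 f4].
have k3' : islin (tact hB (ba Y) (ba M)) (ba W) kap by rewrite -(ba_tensB _ (proj2 gY)).
have f3' : islin (tact hB (ba Z) (ba M)) (ba W) F by rewrite -(ba_tensB _ (proj2 gZ)).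
have k4' : iscol (tcoact hB (bc Y) (bc M)) (bc W) kap by rewrite -(bc_tensB _ (proj1 gY)).
have f4' : iscol (tcoact hB (bc Z) (bc M)) (bc W) F by rewrite -(bc_tensB _ (proj1 gZ)).
split.
- exact (detect_islin hopfH kL TE (gHa gM) k1 f1).
- exact (detect_iscol hopfH bijH fdM kL TE (gHc gM) k2 f2).
- exact (detect_islin hopfB kL TE (gBa gM) k3' f3').
- exact (detect_iscol hopfB bijB fdM kL TE (gBc gM) k4' f4').
Qed.
Lemma endA_detect (Z : bydobj H B) (F : {linear tens Z M -> M}) (T : {linear Z -> endA M}) :
  (forall z m, (T z : LinMap M M) m = F (pure z m)) -> good Z ->
  morK (M := tensB Z M) (N := M) F -> morK T.
Proof.
move=> TE gZ fm.
have kE z m : evm M (pure (T z) m) = F (pure z m) by rewrite evmE TE.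
exact (@morK_detect (endA M) Z M (evm M) F T (lid _) (@evm_nondeg k M) kE endA_good gZ endA_ev fm).
Qed.
End EndObject.

(** The twist [be] of [M] cancels in [endA_gyd], so End(M) is an honest algebra. For this reason the
    twisted modules B_al define classes in the Brauer group. *)
Lemma endA_kalg n0 M be : gyd (lid B) be M -> hasdim n0 M ->
  (forall x, be (hant hB x) = hant hB (be x)) -> kalg (endA M).
Proof.
move=> gM fdM beS.
have idS x : lid B (hant hB x) = hant hB (lid B x) by [].
have gE := endA_gyd gM fdM idS beS.
have [hA hC bA bC] := And4 (@endA_ha M) (endA_hc fdM) (endA_ba gM fdM) (endA_bc gM fdM).
have gd := endA_good gM fdM.
have mE := @endA_mulE M.
split; rewrite ?endA_oneE.
- exact gE.
- by move=> a b c; rewrite !mE; apply: lin_ext.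
- by move=> a; rewrite mE; apply: lin_ext.
- by move=> a; rewrite mE; apply: lin_ext.
- split.
  + exact (comp_islin hopfH (gHa gM) hA mE).
  + exact (comp_iscol hopfH bijH fdM (gHc gM) hC mE).
  + rewrite (ba_tensB _ (proj2 gd)); exact (comp_islin hopfB (gBa gM) bA mE).
  + rewrite (bc_tensB _ (proj1 gd)); exact (comp_iscol hopfB bijB fdM (gBc gM) bC mE).
- exact (unit_islin hopfH (gHa gM) hA).
- exact (unit_iscol hopfH bijH fdM (gHc gM) hC).
- exact (unit_islin hopfB (gBa gM) bA).
- exact (unit_iscol hopfB bijB fdM (gBc gM) bC).
Qed.
End EndomorphismAlgebras.

(** * Isomorphisms of algebras and their tensor products *)

Section AlgebraIsomorphisms.
Lemma one1E A (c : k^o) : aone A c = (c : k) *: one1 A.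
Proof. by rewrite -linearZ /GRing.scale /= mulr1. Qed.

Lemma kisoP A A' : alg_iso A A' <-> exists f : {linear A -> A'},
  [/\ bijective f, morK f, forall a b, f (a *[A] b) = f a *[A'] f b & f (one1 A) = one1 A'].
Proof.
split=> [[f [fb /morBP fm E1 E2]]|[f [fb fm E1 E2]]]; exists f; split.
- exact: fb.
- exact: fm.
- by move=> a b; have := E1 (pure a b); wev; exact.
- exact: (E2 (1 : k^o)).
- exact: fb.
- exact/morBP.
- by apply: tens_ext => a b; wev; exact: E1.
- by move=> c; rewrite hcompE !one1E linearZ E2.
Qed.

Lemma iso_refl A : alg_iso A A.
Proof.
apply/kisoP; exists (lid A); split=> //; first by exists (lid A).
exact: morK_id.
Qed.
Lemma iso_sym A A' : alg_iso A A' -> alg_iso A' A.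
Proof.
move=> /kisoP[f [fb fm fM f1]]; have [fK Kf] := linvP fb.
apply/kisoP; exists (linv f); split.
- by exists f.
- exact: morK_can fK Kf fm.
- by move=> a b; apply: (can_inj fK); rewrite fM !Kf.
- by apply: (can_inj fK); rewrite Kf f1.
Qed.
Lemma iso_trans A C D : alg_iso A C -> alg_iso C D -> alg_iso A D.
Proof.
move=> /kisoP[f [fb fm fM f1]] /kisoP[g [gb gm gM g1]].
apply/kisoP; exists (lcomp g f); split.
- exact: bij_comp gb fb.
- exact: morK_comp fm gm.
- by move=> a b; rewrite !lcompE fM gM.
- by rewrite lcompE f1 g1.
Qed.

Lemma tmap_bij (U V U' V' : lmodType k) (f : {linear U -> U'}) (g : {linear V -> V'}) :
  bijective f -> bijective g -> bijective (tmap f g).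
Proof.
move=> /linvP[fK Kf] /linvP[gK Kg]; exists (tmap (linv f) (linv g)) => t; tens_elim t => u v.
  by rewrite !tmap_pure fK gK.
by rewrite !tmap_pure Kf Kg.
Qed.

Lemma tensA_iso A C A' C' : kalg A -> kalg C -> kalg A' -> kalg C' ->
  alg_iso A A' -> alg_iso C C' -> alg_iso (tensA A C) (tensA A' C').
Proof.
move=> hA hC hA' hC' /kisoP[f [fb fm fM f1]] /kisoP[g [gb gm gM g1]].
apply/kisoP; exists (tmap f g); split.
- exact: tmap_bij.
- exact (@morK_tmap A C A' C' f g (gyd_good (kbyd hA)) (gyd_good (kbyd hA')) fm gm).
- move=> t u; tens_elim t => a c; tens_elim u => a' c'.
  rewrite !tmap_pure !mul_tensA sw_lin.
  rewrite (@Psi_natl C C' A' _ _ _ _ _ _ g _ (fun a1 c1 => pure (f a *[A'] a1) (c1 *[C'] g c')) c (f a') (kbyd hC) (kbyd hC') (kbyd hA') gm); last by lin.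
  rewrite (@Psi_natr C A A' _ _ _ _ _ _ f _ (fun a1 c1 => pure (f a *[A'] a1) (g c1 *[C'] g c')) c a' (kbyd hC) (kbyd hA) (kbyd hA') fm); last by lin.
  by apply: sw_ext => a1 c1; rewrite tmap_pure fM gM.
- by rewrite !one_tensA tmap_pure f1 g1.
Qed.

Lemma tensA_assoc A C D : kalg A -> kalg C -> kalg D ->
  alg_iso (tensA (tensA A C) D) (tensA A (tensA C D)).
Proof.
move=> hA hC hD; have [gA gC gD] := And3 (kbyd hA) (kbyd hC) (kbyd hD).
apply/kisoP; exists (assoc A C D); split.
- by exists (assocV A C D); [exact: assocK | exact: assocVK].
- exact (@morK_assoc A C D (gyd_good gA) (gyd_good gC)).
- move=> t u; tens_elim t => t d; tens_elim t => a c; tens_elim u => u d'; tens_elim u => a' c'.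
  rewrite !assoc_pure !mul_tensA sw_lin.
  rewrite (@Psi_tensr _ _ _ _ _ D A C _ (fun t d1 => assoc A C D (pure (pure a c *[tensA A C] t) (d1 *[D] d'))) d a' c' gD gA gC); last by lin.
  rewrite (@Psi_tensl _ _ _ _ _ C D A _ (fun a1 t => pure (a *[A] a1) (t *[tensA C D] pure c' d')) c d a' gC gD gA); last by lin.
  apply: sw_ext => a1 d1.
  transitivity (\sw_(c1', d2 <- Psi D C (pure d1 c')) \sw_(a2, c1 <- Psi C A (pure c a1))
     pure (a *[A] a2) (pure (c1 *[C] c1') (d2 *[D] d'))).
    apply: sw_ext => c1' d2; rewrite mul_tensA sw_purel sw_lin; apply: sw_ext => a2 c1.
    by rewrite assoc_pure.
  rewrite sw_C; apply: sw_ext => a2 c1; rewrite mul_tensA sw_purer.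
  by [].
- by rewrite !one_tensA assoc_pure.
Qed.

Lemma Psi_morK1 M N : byd M -> byd N -> morK (M := tensB M N) (N := tensB N M) (Psi M N).
Proof.
move=> gM gN; have [dM dN] := (gyd_good gM, gyd_good gN).
have idS : forall x : B, lid B (hantV hB x) = hantV hB (lid B x) by [].
have idM : forall x y : B, lid B (hmul hB (pure x y)) = hmul hB (pure (lid B x) (lid B y)) by [].
have id1 : lid B (hone hB) = hone hB by [].
have [m1 m2 m3 m4] := Psi_morK idM id1 idS gM gN.
have bE : ba (pull (lid B) M) = ba M.
  by apply: lin_ext; apply: tens_ext => b m; rewrite pullE.
split.
+ have E : islin (tact hH (ha M) (ha N)) (tact hH (ha N) (ha M)) (Psi M N) := m1.
  exact E.
+ have E : iscol (tcoact hH (hc M) (hc N)) (tcoact hH (hc N) (hc M)) (Psi M N) := m2.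
  exact E.
+ have E : islin (tact hB (ba M) (ba N)) (tact hB (ba N) (ba M)) (Psi M N).
    move: m3; rewrite (ba_tensB (pull (lid B) M) (proj2 dN)) bE (ba_tensB N (proj2 dM)); exact.
  rewrite (ba_tensB N (proj2 dM)) (ba_tensB M (proj2 dN)).
  exact E.
+ have bcE : bc (pull (lid B) M) = bc M := erefl.
  have E : iscol (tcoact hB (bc M) (bc N)) (tcoact hB (bc N) (bc M)) (Psi M N).
    move: m4; rewrite (bc_tensB (pull (lid B) M) (proj1 dN)) bcE (bc_tensB N (proj1 dM)); exact.
  rewrite (bc_tensB N (proj1 dM)) (bc_tensB M (proj1 dN)).
  exact E.
Qed.
Lemma PsiV_morK1 M N : byd M -> byd N -> morK (M := tensB N M) (N := tensB M N) (PsiV M N).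
Proof.
move=> gM gN.
exact (@morK_can _ _ _ (tensB M N) (tensB N M) _ _ (PsiK gM gN) (PsiVK gM gN) (Psi_morK1 gM gN)).
Qed.
End AlgebraIsomorphisms.

(** * Endomorphism algebras and braided tensor products *)

Section EndTensors.
Lemma evm_act M (f g : LinMap M M) m :
  evm M (pure (mulL (endA M) (pure f g)) m) = evm M (pure f (evm M (pure g m))).
Proof. by rewrite endA_mulE !evmE. Qed.
Lemma evm_one M m : evm M (pure (one1 (endA M)) m) = m.
Proof. by rewrite endA_oneE evmE. Qed.

Lemma lid_S x : lid B (hant hB x) = hant hB (lid B x). Proof. by []. Qed.

Section ModuleSurjectivity.
Variables (be : {linear B -> B}) (V : bydobj H B) (n0 : nat).
Hypothesis beS : forall x, be (hant hB x) = hant hB (be x).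
Hypotheses (gV : gyd (lid B) be V) (fdV : hasdim n0 V).
Variables (C : algB H B) (hC : kalg C) (W : bydobj H B) (cW : {linear tens C W -> W}).
Hypotheses (cWA : forall a b v, cW (pure (a *[C] b) v) = cW (pure a (cW (pure b v))))
  (cW1 : forall v, cW (pure (one1 C) v) = v).
Local Notation tm := (@tmod (endA V) C V W (evm V) cW).

(* The inverse of the braiding turns [h] into a combination of products
   (1 # c)(f # 1), whose action does not involve the braiding of f. *)
Lemma tmod_surj (h : {linear V -> tens V C}) : exists t : tens (endA V) C,
  forall v w, tm (pure t (pure v w)) = \sw_(v', c <- h v) pure v' (cW (pure c w)).
Proof.
have hE := endA_kalg gV fdV beS.
have [e [c eb]] := findim_basis fdV.
pose u i := PsiV C V (h (e i)).
exists (\sum_i \sw_(x, y <- u i) (pure (one1 (endA V)) x *[tensA (endA V) C] pure (rank1 (c i) y : endA V) (one1 C))).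
move=> v w.
pose G (v' : V) (c' : C) : tens V W := pure v' (cW (pure c' w)).
have Gb : bilin G by rewrite /G; lin.
have aE i x y : tm (pure (pure (one1 (endA V)) x *[tensA (endA V) C] pure (rank1 (c i) y : endA V) (one1 C)) (pure v w)) =
    (c i v : k) *: teval G (Psi C V (pure x y)).
  rewrite mul_tensA (tmodA hE hC gV (endA_ev gV fdV) (@evm_act V) cWA).
  rewrite tmodE (Psi_1l hC _ gV) sw_pure; last by lin.
  rewrite cW1 evmE rank1E tmodE.
  rewrite -(linZ (f := fun y => teval G (Psi C V (pure x y)))); last by lin.
  by apply: sw_ext => v' c'; rewrite evm_one.
rewrite pureSl linear_sum (basis_lin (F := fun v => teval G (h v)) v eb); last by lin.
apply: eq_bigr => i _; rewrite sw_purel sw_lin -(PsiVK (kbyd hC) gV (h (e i))) -/(u i).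
rewrite (sw_exp (g := fun t => teval G (Psi C V t))); last by lin.
by rewrite sw_scale; apply: sw_ext => x y; rewrite aE.
Qed.
End ModuleSurjectivity.

Section EndTensor.
Variables (be de : {linear B -> B}) (M N : bydobj H B) (m0 n0 : nat).
Hypothesis beM : forall x y, be (hmul hB (pure x y)) = hmul hB (pure (be x) (be y)).
Hypothesis be1 : be (hone hB) = hone hB.
Hypothesis beSb : forall x, be (hantV hB x) = hantV hB (be x).
Hypothesis beS : forall x, be (hant hB x) = hant hB (be x).
Hypothesis deS : forall x, de (hant hB x) = hant hB (de x).
Hypothesis becom : forall (W : lmodType k) (F : B -> B -> W) x, bilin F ->
  teval F (hcom hB (be x)) = \sw_(a, b <- hcom hB x) F (be a) (be b).
Hypothesis becou : forall x, hcou hB (be x) = hcou hB x.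
Hypotheses (gM : gyd (lid B) be M) (gN : gyd (lid B) de N).
Hypotheses (fdM : hasdim m0 M) (fdN : hasdim n0 N).
Local Notation P := (tensB M (pull be N)).
Local Notation tm := (@tmod (endA M) (endA N) M (pull be N) (evm M) (evm N)).

Lemma endA_tens_gyd : gyd (lid B) (lcomp de be) P.
Proof. exact (tensB_gyd gM (pull_gyd beM be1 becom gN (fun _ => erefl))). Qed.

(** The isomorphism is the action [tmod] on the tensor product of [M] with the pullback of [N]. It
    is surjective by [tmod_surj], and the dimensions agree. *)
Lemma endA_tens : alg_iso (tensA (endA M) (endA N)) (endA P).
Proof.
have gP := endA_tens_gyd.
have fdP : hasdim (m0 * n0) P := hasdim_tens fdM fdN.
have hEM := endA_kalg gM fdM beS; have hEN := endA_kalg gN fdN deS.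
have gdM := gyd_good (kbyd hEM); have gdN := gyd_good (kbyd hEN).
have cWm : morK (M := tensB (pull be (endA N)) (pull be N)) (N := pull be N) (evm N).
  exact (@morK_pull _ becom (endA N) N (evm N) gdN (endA_ev gN fdN)).
pose T : {linear tensA (endA M) (endA N) -> endA P} := mkLin (curry_lin tm).
have TE t p : (T t : LinMap P P) p = tm (pure t p) by [].
have Tm : morK T.
  exact (@endA_detect _ P _ _ gP fdP (tensB (endA M) (endA N)) tm T TE (tensB_good gdM gdN)
    (tmod_morK beM be1 beSb hEM hEN gM (endA_ev gM fdM) cWm)).
apply/kisoP; exists T; split.
- apply: (surj_bij (n := (m0 * m0) * (n0 * n0))).
  + exact (hasdim_tens (hasdim_hom fdM fdM) (hasdim_hom fdN fdN)).
  + rewrite mulnACA; exact (hasdim_hom fdP fdP).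
  move=> phi; have [e [c eb]] := findim_basis fdN.
  have [f fE] : exists f : {linear tens M N -> tens M N}, phi = f :> LinMap (tens M N) (tens M N) by exists phi.
  rewrite {}fE {phi}.
  (* [h0] is the given endomorphism read as a map from [M] to M (x) End(N), through the basis [e] of
     [N]. *)
  pose h0 (m : M) : tens M (endA N) := \sum_j \sw_(m', n' <- f (pure m (e j))) pure m' (rank1 (c j) n' : LinMap N N).
  have hl : linear h0.
    rewrite /h0; apply: lin_sum => j; apply: lin_swt.
      split=> [n'|m']; first by apply: lin_purel; exact: lin_id.
      by apply: lin_purer; apply: lin_rank1; exact: lin_id.
    by apply: lin_app; lin.
  have [t tE] := tmod_surj beS gM fdM hEN (@evm_act N) (@evm_one N) (mkLin hl).
  exists t; apply: lin_ext => p; rewrite TE; tens_elim p => m n; rewrite tE.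
  rewrite -[mkLin hl m]/(h0 m) /h0 (linS (f := fun s : tens M (endA N) => \sw_(v', c0 <- s) pure v' (evm N (pure c0 n)))); last by lin.
  rewrite (basis_lin (F := fun n => f (pure m n)) n eb); last by lin.
  apply: eq_bigr => j _; rewrite sw_sw; last by lin.
  rewrite -[in RHS](sw_id (f (pure m (e j)))) sw_scale; apply: sw_ext => m' n'.
  rewrite sw_pure; last by lin.
  by rewrite evmE rank1E pureZr.
- exact: Tm.
- move=> t u; apply: lin_ext => p; rewrite (endA_mulE (T t) (T u)) lcompE !TE.
  tens_elim t => a c; tens_elim u => a' c'; rewrite mul_tensA.
  exact (tmodA hEM hEN gM (endA_ev gM fdM) (@evm_act M) (@evm_act N) _ _ _ _ _).
- apply: lin_ext => p; rewrite TE endA_oneE one_tensA.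
  exact (@tmod1 be (endA M) (endA N) M (pull be N) hEN gM (evm M) (evm N) (@evm_one M) (@evm_one N) p).
Qed.
End EndTensor.

Section EndSwap.
Variables (A : algB H B) (M : bydobj H B) (m0 a0 : nat).
Hypotheses (hA : kalg A) (gM : byd M) (fdM : hasdim m0 M) (fdA : hasdim a0 A).
Local Notation E := (endA M).
Let hE : kalg E := endA_kalg gM fdM lid_S.
Let gA := kbyd hA.
Let gE := kbyd hE.
Local Notation tm := (@tmod E A M A (evm M) (mulL A)).

(** Both algebras consist of operators from [M] to M (x) A: E # A by braiding a past m and then
    applying f, A # E by applying f and then the inverse braiding. Either way all such operators are
    obtained, and both products become the same composition law; comparing gives the isomorphism. *)
Let kap : {linear tens (tens E A) M -> tens M A} :=
  lcomp (tmap (evm M) (lid A)) (lcomp (assocV E M A)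
    (lcomp (tmap (lid E) (Psi A M)) (assoc E A M))).
Let kap' : {linear tens (tens A E) M -> tens M A} :=
  lcomp (PsiV M A) (lcomp (tmap (lid A) (evm M)) (assoc A E M)).
Let kapE f a m : kap (pure (pure f a) m) = \sw_(m1, a1 <- Psi A M (pure a m)) pure ((f : LinMap M M) m1) a1.
Proof.
rewrite -[LHS]/(tmap (evm M) (lid A) (assocV E M A (tmap (lid E) (Psi A M) (assoc E A M (pure (pure f a) m))))).
have G s : tmap (evm M) (lid A) (assocV E M A (pure f s)) = \sw_(m1, a1 <- s) pure ((f : LinMap M M) m1) a1.
  tens_elim s => m1 a1; rewrite assocV_pure tmap_pure evmE sw_pure //; lin.
rewrite assoc_pure tmap_pure; exact: G.
Qed.
Let kap'E a f m : kap' (pure (pure a f) m) = PsiV M A (pure a ((f : LinMap M M) m)).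
Proof.
rewrite -[LHS]/(PsiV M A (tmap (lid A) (evm M) (assoc A E M (pure (pure a f) m)))).
by rewrite assoc_pure tmap_pure evmE.
Qed.
Let kapm : morK (M := tensB (tensB E A) M) (N := tensB M A) kap.
Proof.
have [dE dA dM] := And3 (gyd_good gE) (gyd_good gA) (gyd_good gM).
have m1 := @morK_assoc E A M dE dA.
have m2 := @morK_tmap E (tensB A M) E (tensB M A) (lid E) (Psi A M) dE dE (morK_id E) (Psi_morK1 gA gM).
have m3 := @morK_assocV E M A dE dM.
have m4 := @morK_tmap (tensB E M) A M A (evm M) (lid A) (tensB_good dE dM) dM (endA_ev gM fdM) (morK_id A).
exact (@morK_comp _ _ _ _ _ _ _ _ (@morK_comp _ _ _ _ _ _ _ _ (@morK_comp _ _ _ _ _ _ _ _ m1 m2) m3) m4).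
Qed.
Let kap'm : morK (M := tensB (tensB A E) M) (N := tensB M A) kap'.
Proof.
have [dE dA dM] := And3 (gyd_good gE) (gyd_good gA) (gyd_good gM).
have m1 := @morK_assoc A E M dA dE.
have m2 := @morK_tmap A (tensB E M) A M (lid A) (evm M) dA dA (morK_id A) (endA_ev gM fdM).
exact (@morK_comp _ _ _ _ _ _ _ _ (@morK_comp _ _ _ _ _ _ _ _ m1 m2) (PsiV_morK1 gM gA)).
Qed.

Let J (t : tens E A) : LinMap M (tens M A) := mkLin (curry1_lin kap t).
Let K (t : tens A E) : LinMap M (tens M A) := mkLin (curry1_lin kap' t).
Let Jl : linear J := curry_lin kap.
Let Kl : linear K := curry_lin kap'.
Let JE t m : J t m = kap (pure t m). Proof. by []. Qed.
Let KE t m : K t m = kap' (pure t m). Proof. by []. Qed.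

Let J_tm t m a : tm (pure t (pure m a)) = \sw_(m1, a1 <- J t m) pure m1 (a1 *[A] a).
Proof.
rewrite JE; tens_elim t => f b; rewrite tmodE kapE sw_sw; last by lin.
by apply: sw_ext => m1 a1; rewrite sw_pure ?evmE //; lin.
Qed.
(** J t m is the action of t on m (x) 1, so the composition law is associativity of [tmod]. *)
Let Jmul t u m : J (t *[tensA E A] u) m = \sw_(m1, a1 <- J u m) \sw_(m2, a2 <- J t m1) pure m2 (a2 *[A] a1).
Proof.
have J1 s n : J s n = tm (pure s (pure n (one1 A))).
  by rewrite J_tm -[LHS]sw_id; apply: sw_ext => x y; rewrite (k1r hA).
transitivity (tm (pure t (J u m))).
  rewrite !J1; tens_elim t => f a; tens_elim u => g b; rewrite mul_tensA.
  exact (tmodA hE hA gM (endA_ev gM fdM) (@evm_act M) (kA hA) _ _ _ _ _).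
rewrite (sw_exp (g := fun s => tm (pure t s))); last by lin.
by apply: sw_ext => m1 a1; rewrite J_tm.
Qed.
Let Psi_ev f m a (Z : lmodType k) (F : A -> M -> Z) : bilin F ->
  teval F (Psi M A (pure ((f : LinMap M M) m) a)) =
  \sw_(a1, m1 <- Psi M A (pure m a)) \sw_(a2, f1 <- Psi E A (pure f a1)) F a2 ((f1 : LinMap M M) m1).
Proof.
move=> Fb; have gT := tensB_gyd gE gM.
have E1 := @Psi_natl (tensB E M) M A _ _ _ _ _ _ (evm M) _ F (pure (f : E) m) a gT gM gA (endA_ev gM fdM) Fb.
rewrite evmE in E1; apply: etrans E1 _.
rewrite (@Psi_tensl _ _ _ _ _ E M A _ (fun a2 t => F a2 (evm M t)) f m a gE gM gA); last by lin.
by apply: sw_ext => a1 m1; apply: sw_ext => a2 f1; rewrite evmE.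
Qed.
Let Kmul t u m : K (t *[tensA A E] u) m = \sw_(m1, a1 <- K u m) \sw_(m2, a2 <- K t m1) pure m2 (a2 *[A] a1).
Proof.
(* The comparison is made after [Psi], which undoes the inverse braiding contained in [kap']. *)
apply: (can_inj (PsiK gM gA)); rewrite !KE.
tens_elim t => a f; tens_elim u => b g.
have Gl : linear (fun t : tens A E => Psi M A (kap' (pure t m))) by lin.
rewrite mul_tensA (sw_linear _ _ Gl) kap'E.
transitivity (\sw_(a1, f1 <- Psi E A (pure f b)) pure (a *[A] a1) ((f1 : LinMap M M) ((g : LinMap M M) m))).
  by apply: sw_ext => a1 f1; rewrite kap'E (PsiVK gM gA) endA_mulE.
transitivity (\sw_(m1, a1 <- PsiV M A (pure b ((g : LinMap M M) m))) \sw_(a3, m3 <- Psi M A (pure ((f : LinMap M M) m1) a1)) pure (a *[A] a3) m3).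
  transitivity (\sw_(a4, m4 <- Psi M A (PsiV M A (pure b ((g : LinMap M M) m)))) \sw_(a5, f5 <- Psi E A (pure f a4)) pure (a *[A] a5) ((f5 : LinMap M M) m4)).
    by rewrite (PsiVK gM gA) sw_pure //; lin.
  rewrite (sw_exp (g := fun s => \sw_(a4, m4 <- Psi M A s) \sw_(a5, f5 <- Psi E A (pure f a4)) pure (a *[A] a5) ((f5 : LinMap M M) m4))); last by lin.
  apply: sw_ext => m1 a1; rewrite (@Psi_ev f m1 a1 _ (fun a3 m3 => pure (a *[A] a3) m3)) //; lin.
rewrite [RHS]sw_lin; apply: sw_ext => m1 a1; rewrite KE kap'E [RHS]sw_lin.
pose G (a3 : A) (m3 : M) := pure (a *[A] a3) m3.
transitivity (\sw_(m2, a2 <- PsiV M A (pure a ((f : LinMap M M) m1))) \sw_(a3, m3 <- Psi M A (pure m2 a2)) \sw_(a4, m4 <- Psi M A (pure m3 a1)) pure (a3 *[A] a4) m4); last first.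
  apply: sw_ext => m2 a2.
  have gT := tensB_gyd gA gA.
  have pb : bilin (fun (x : A) (y : M) => pure x y) by lin.
  have E1 := @Psi_natr M (tensB A A) A _ _ _ _ _ _ (mulL A) _ (fun x y => pure x y) m2 (pure a2 a1) gM gT gA (kmul hA) pb.
  rewrite sw_id in E1; rewrite E1.
  by rewrite (@Psi_tensr _ _ _ _ _ M A A _ (fun t y => pure (mulL A t) y) m2 a2 a1 gM gA gA) //; lin.
rewrite -(sw_exp (g := fun s => \sw_(a3, m3 <- Psi M A s) \sw_(a4, m4 <- Psi M A (pure m3 a1)) pure (a3 *[A] a4) m4)); last by lin.
by rewrite (PsiVK gM gA) sw_pure //; lin.
Qed.

Let Jbij : bijective (mkLin Jl).
Proof.
apply: (surj_bij (n := m0 * m0 * a0)).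
- exact (hasdim_tens (hasdim_hom fdM fdM) fdA).
- rewrite -mulnA; exact (hasdim_hom fdM (hasdim_tens fdM fdA)).
move=> h; have [t tE] := tmod_surj lid_S gM fdM hA (kA hA) (k1l hA) h.
exists t; apply: lin_ext => m; have := tE m (one1 A); rewrite J_tm => E1.
rewrite -[LHS]/(J t m) -[J t m]sw_id -[h m]sw_id.
transitivity (\sw_(m1, a1 <- J t m) pure m1 (a1 *[A] one1 A)).
  by apply: sw_ext => x y; rewrite (k1r hA).
by rewrite E1; apply: sw_ext => x y; rewrite (k1r hA).
Qed.
Let Kbij : bijective (mkLin Kl).
Proof.
apply: (surj_bij (n := m0 * m0 * a0)).
- rewrite mulnC; exact (hasdim_tens fdA (hasdim_hom fdM fdM)).
- rewrite -mulnA; exact (hasdim_hom fdM (hasdim_tens fdM fdA)).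
move=> h; have [e [c eb]] := findim_basis fdM.
exists (\sum_i \sw_(a, m <- Psi M A (h (e i))) pure a (rank1 (c i) m : LinMap M M)).
apply: lin_ext => m; rewrite -[LHS]/(kap' (pure _ m)) pureSl linear_sum.
rewrite [RHS](basis_lin (F := fun m => h m) m eb); last by lin.
apply: eq_bigr => i _; rewrite sw_purel sw_lin -[in RHS](PsiK gM gA (h (e i))).
rewrite [in RHS](sw_exp (g := fun t => PsiV M A t)); last by lin.
by rewrite sw_scale; apply: sw_ext => a m1; rewrite kap'E rank1E pureZr linearZ.
Qed.

(** Endomorphism algebras may thus be moved past any finite-dimensional algebra, as transitivity of
    [beq] and the product of classes require. *)
Lemma endA_swap : alg_iso (tensA A E) (tensA E A).
Proof.
have [JK KJ] := linvP Jbij.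
pose Z : {linear tens A E -> tens E A} := lcomp (linv (mkLin Jl)) (mkLin Kl).
have JZ t : J (Z t) = K t by apply: KJ.
have Jinj : injective J by exact: can_inj JK.
apply/kisoP; exists Z; split.
- apply: bij_comp; last exact: Kbij.
  by exists (mkLin Jl).
- have TE z m : kap (pure (Z z) m) = kap' (pure z m) by rewrite -JE JZ.
  have [dE dA] := (gyd_good gE, gyd_good gA).
  exact (@morK_detect _ M _ _ gM fdM (tensB E A) (tensB A E) (tensB M A) kap kap' Z (linv (mkLin Jl)) JK TE
    (tensB_good dE dA) (tensB_good dA dE) kapm kap'm).
- move=> t u; apply: Jinj; rewrite JZ; apply: lin_ext => m.
  by rewrite Jmul Kmul (JZ u) (JZ t).
- apply: Jinj; rewrite JZ; apply: lin_ext => m; rewrite JE KE !one_tensA kapE kap'E.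
  rewrite (Psi_1l hA _ gM) sw_pure; last by lin.
  have oE : (one1 E : LinMap M M) = lid M := endA_oneE M.
  by rewrite oE; apply: (can_inj (PsiK gM gA)); rewrite (PsiVK gM gA) (Psi_1r _ hA gM).
Qed.
End EndSwap.
End EndTensors.

(** * Surjectivity of two twisting operators on endomorphisms *)

Section TwistSurjectivity.
Section DrinfeldElement.
Variables (X : lmodType k) (h : hopf X).
Hypothesis hopfX : is_hopf (flip X X) h.
Hypothesis bijS : bijective (antip h).
Local Notation "x ∙ y" := (hmul h (pure x y)) (at level 40, left associativity).
Local Notation one := (hone h).
Local Notation D := (hcom h).
Local Notation e := (hcou h).
Local Notation S := (hant h).
Local Notation Sb := (hantV h).
Variables (V : lmodType k) (n0 : nat).
Hypothesis fdV : hasdim n0 V.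
Variables (mu : {linear tens X V -> V}) (la : {linear V -> tens X V}).
Hypotheses (Va : isact h mu) (Vc : iscoact h la).
Variable ga gaV : {linear X -> X}.
Hypothesis gaVK : cancel gaV ga.
Hypothesis gaM : forall x y, ga (x ∙ y) = ga x ∙ ga y.
Hypothesis ga1 : ga one = one.
Hypothesis gaS : forall x, ga (S x) = S (ga x).
Hypothesis Vy : isYD h (lid X) ga mu la.

Fact drin_lin : linear (fun m => \sw_(y, n <- la m) mu (pure (S y) n)).
Proof. by lin. Qed.
(** The action of the Drinfel'd element of the double of [h], written without the double. Up to the
    twist it implements the square of the antipode. *)
Definition drin : {linear V -> V} := mkLin drin_lin.
Lemma drinE m : drin m = \sw_(y, n <- la m) mu (pure (S y) n).
Proof. by []. Qed.

(** Inserting ga(S(b2 S(b3))) makes the twisted condition applicable to b1 and b2; the factor S(b1)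
    b2 that it leaves then contracts. *)
Lemma drin_act b m : drin (mu (pure b m)) = mu (pure (ga (S (S b))) (drin m)).
Proof.
case: Va => mA m1; rewrite !drinE.
transitivity (\sw_(a, b3 <- D b) \sw_(b1, b2 <- D a) \sw_(y, n <- la (mu (pure b1 m)))
    mu (pure (ga (S (S b3)) ∙ S (y ∙ ga b2)) n)).
  rewrite (hcomA hopfX (F := fun b1 b2 b3 => \sw_(y, n <- la (mu (pure b1 m)))
    mu (pure (ga (S (S b3)) ∙ S (y ∙ ga b2)) n))); last by lin.
  rewrite -[LHS](hcou1r hopfX (F := fun b => \sw_(y, n <- la (mu (pure b m))) mu (pure (S y) n))); last by lin.
  apply: sw_ext => b1 b2.
  transitivity (\sw_(c, d <- D b2) (\sw_(y, n <- la (mu (pure b1 m))) mu (pure (ga (S (c ∙ S d)) ∙ S y) n))); last first.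
    apply: sw_ext => c d; apply: sw_ext => y n.
    by rewrite !(hantM hopfX) gaM -gaS (hmulA hopfX).
  rewrite (hantr hopfX (F := fun w => \sw_(y, n <- la (mu (pure b1 m))) mu (pure (ga (S w) ∙ S y) n))); last by lin.
  by congr (_ *: _); apply: sw_ext => y n; rewrite (hant1 hopfX) ga1 (hmul1l hopfX).
transitivity (\sw_(a, b3 <- D b) \sw_(b1, b2 <- D a) \sw_(y, n <- la m)
    mu (pure (ga (S (S b3)) ∙ S (b1 ∙ y)) (mu (pure b2 n)))).
  apply: sw_ext => a b3.
  by rewrite (Vy (F := fun y n => mu (pure (ga (S (S b3)) ∙ S y) n))) //; lin.
transitivity (\sw_(a, b3 <- D b) (e a : k) *: \sw_(y, n <- la m) mu (pure (ga (S (S b3)) ∙ S y) n)).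
  apply: sw_ext => a b3.
  transitivity (\sw_(b1, b2 <- D a) (\sw_(y, n <- la m) mu (pure (ga (S (S b3)) ∙ (S y ∙ (S b1 ∙ b2))) n))).
    apply: sw_ext => b1 b2; apply: sw_ext => y n.
    by rewrite -mA (hantM hopfX) !(hmulA hopfX).
  rewrite (hantl hopfX (F := fun w => \sw_(y, n <- la m) mu (pure (ga (S (S b3)) ∙ (S y ∙ w)) n))); last by lin.
  by congr (_ *: _); apply: sw_ext => y n; rewrite (hmul1r hopfX).
rewrite (hcou1l hopfX (F := fun b => \sw_(y, n <- la m) mu (pure (ga (S (S b)) ∙ S y) n))); last by lin.
rewrite sw_purer sw_lin; apply: sw_ext => y n.
by rewrite mA.
Qed.

Lemma coact_ant (W : lmodType k) (F : V -> W) m : linear F ->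
  \sw_(y, n <- la m) \sw_(z, n' <- la n) F (mu (pure (y ∙ S z) n')) = F m.
Proof.
case: Va => mA m1; case: Vc => cA c1 Fl.
rewrite -(cA _ (fun y z n => F (mu (pure (y ∙ S z) n)))); last by lin.
rewrite -[RHS]c1 //; apply: sw_ext => y n.
by rewrite (hantr hopfX (F := fun w => F (mu (pure w n)))) ?m1 //; lin.
Qed.

(** The preimage is Sb(Sb(gaV(m_(-1)))) m_(0): by [drin_act] it is sent to m_(-1) drin(m_(0)), which
    [coact_ant] collapses to m. *)
Lemma drin_surj m : exists n, drin n = m.
Proof.
case: (Va) => mA m1.
exists (\sw_(y, n <- la m) mu (pure (Sb (Sb (gaV y))) n)).
rewrite [LHS]sw_lin.
transitivity (\sw_(y, n <- la m) \sw_(z, n' <- la n) mu (pure (y ∙ S z) n')).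
  apply: sw_ext => y n; rewrite drin_act !(hantVK bijS) gaVK drinE sw_purer sw_lin.
  by apply: sw_ext => z n'; rewrite mA.
exact: (@coact_ant _ (fun m => m)).
Qed.

(* [v] below is a section of [drin]; the inverse of
   [f |-> (m |-> m_(-1) f (m_0))] uses the antipode. *)
Lemma twist_surj (f : LinMap V V) : exists g : LinMap V V,
  forall m, \sw_(x, m' <- la m) \sw_(a, b <- D x) mu (pure a (g (mu (pure (S b) m')))) = f m.
Proof.
case: (Va) => mA m1; case: (Vc) => cA c1.
have [dK Kd] := linvP (surj_bij fdV fdV drin_surj).
pose g0 (m : V) : V := \sw_(y, n <- la (linv drin m)) mu (pure (S y) (f n)).
have gl : linear g0 by rewrite /g0; lin.
exists (mkLin gl) => m.
transitivity (\sw_(x, m' <- la m) mu (pure x (g0 (drin m')))).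
  rewrite (cA _ (fun a b m' => mu (pure a (mkLin gl (mu (pure (S b) m')))))); last by lin.
  apply: sw_ext => x m'; rewrite drinE -[g0 _]/(mkLin gl _) sw_lin sw_purer sw_lin.
  by [].
transitivity (\sw_(x, m' <- la m) \sw_(y, n <- la m') mu (pure (x ∙ S y) (f n))).
  apply: sw_ext => x m'; rewrite /g0 dK sw_purer sw_lin; apply: sw_ext => y n.
  by rewrite mA.
rewrite -(cA _ (fun x y n => mu (pure (x ∙ S y) (f n)))); last by lin.
rewrite -[RHS](c1 _ f); last by lin.
apply: sw_ext => x n; rewrite (hantr hopfX (F := fun w => mu (pure w (f n)))); last by lin.
by rewrite m1.
Qed.
End DrinfeldElement.

Section RightHom.
Variables (X : lmodType k) (h : hopf X).
Hypothesis hopfX : is_hopf (flip X X) h.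
Hypothesis bijS : bijective (antip h).
Local Notation "x ∙ y" := (hmul h (pure x y)) (at level 40, left associativity).
Local Notation D := (hcom h).
Local Notation e := (hcou h).
Local Notation S := (hant h).
Local Notation Sb := (hantV h).
Variables (V : lmodType k) (n0 : nat).
Hypothesis fdV : hasdim n0 V.
Variables (mu : {linear tens X V -> V}) (la : {linear V -> tens X V}).
Hypotheses (Va : isact h mu) (Vc : iscoact h la) (Vy : isYD h (lid X) (lid X) mu la).
Variable rho : {linear LinMap V V -> tens X (LinMap V V)}.
Hypothesis rhoE : is_homcoact h la la rho.

(* The coaction f |-> f_<-1> (x) f_<0> with
   f_<-1> (x) f_<0>(m) = S(m_(-1)) f(m_0)_(-1) (x) f(m_0)_0. *)
Let rco : exists r : {linear LinMap V V -> tens X (LinMap V V)},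
  forall (W : lmodType k) (F : X -> V -> W) (f : LinMap V V) m, bilin F ->
  \sw_(x, g : LinMap V V <- r f) F x (g m) = \sw_(y, m' <- la m) \sw_(z, n <- la (f m')) F (S y ∙ z) n.
Proof.
have [b [c bc]] := findim_basis fdV.
pose r (f : LinMap V V) : tens X (LinMap V V) := \sum_i \sw_(y, m' <- la (b i)) \sw_(z, n <- la (f m'))
  pure (S y ∙ z) (rank1 (c i) n : LinMap V V).
have rl : linear r.
  rewrite /r; apply: lin_sum => i; apply: lin_swF => y m'; apply: lin_swt; last by lin.
  split=> [n|z]; first by lin.
  by apply: lin_purer; apply: lin_rank1; exact: lin_id.
exists (mkLin rl) => W F f m Fb; have [Fl Fr] := Fb.
pose G (x : X) (g : LinMap V V) := F x (g m).
have Gb : bilin G by rewrite /G; split=> [g|x]; [lin | by move=> a s t; apply: Fr].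
rewrite -[LHS]/(teval G (r f)) /r (linS (f := teval G)); last by apply: lin_swt.
rewrite [RHS](basis_lin (F := fun m => \sw_(y, m' <- la m) \sw_(z, n <- la (f m')) F (S y ∙ z) n) m bc); last by lin.
apply: eq_bigr => i _; rewrite sw_sw // sw_scale; apply: sw_ext => y m'.
rewrite sw_sw // sw_scale; apply: sw_ext => z n; rewrite sw_pure // /G rank1E.
by rewrite (linZ _ _ (Fr _)).
Qed.

(** The operator g(m) = f_<0>(f_<-1> m), formed with the other coaction, is a preimage of f. By the
    Yetter-Drinfel'd condition its coaction is x1 (x) f_<0>(x2 -) for x = f_<-1>, and x2 Sb(x1)
    contracts. *)
Lemma coact_twist_surj (f : LinMap V V) : exists g : LinMap V V,
  forall m, \sw_(y, g' : LinMap V V <- rho g) g' (mu (pure (Sb y) m)) = f m.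
Proof.
case: (Va) => mA m1; case: (Vc) => cA c1.
have [r rE] := rco; have [b [c bc]] := findim_basis fdV.
have rcom (W : lmodType k) (F : X -> X -> LinMap V V -> W) : trilin F ->
    \sw_(x, p : LinMap V V <- r f) \sw_(y, q : LinMap V V <- r p) F x y q =
    \sw_(x, p : LinMap V V <- r f) \sw_(y, z <- D x) F y z p.
  move=> [F1 F2 F3].
  have Fi (x y : X) (q : LinMap V V) : F x y q = \sum_i F x y (rank1 (c i) (q (b i))) by exact: basis_linexp.
  have Ri i (x y : X) : linear (fun v => F x y (rank1 (c i) v)).
    by apply: lin_comp => //; apply: lin_rank1; exact: lin_id.
  transitivity (\sum_i \sw_(x, p : LinMap V V <- r f) \sw_(y, q : LinMap V V <- r p) F x y (rank1 (c i) (q (b i)))).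
    rewrite -sw_sum; apply: sw_ext => x p; rewrite -sw_sum; apply: sw_ext => y q; exact: Fi.
  transitivity (\sum_i \sw_(x, p : LinMap V V <- r f) \sw_(y, z <- D x) F y z (rank1 (c i) (p (b i)))); last first.
    rewrite -sw_sum; apply: sw_ext => x p; rewrite -sw_sum; apply: sw_ext => y z; exact/esym/Fi.
  apply: eq_bigr => i _.
  transitivity (\sw_(x, p : LinMap V V <- r f) \sw_(u, m' <- la (b i)) \sw_(z, n <- la (p m')) F x (S u ∙ z) (rank1 (c i) n)).
    by apply: sw_ext => x p; rewrite (rE _ (fun y v => F x y (rank1 (c i) v))) //; split.
  rewrite sw_C.
  transitivity (\sw_(u, m' <- la (b i)) \sw_(u', m'' <- la m') \sw_(w, v <- la (f m'')) \sw_(z, n <- la v)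
     F (S u' ∙ w) (S u ∙ z) (rank1 (c i) n)).
    apply: sw_ext => u m'.
    rewrite (rE _ (fun x v => \sw_(z, n <- la v) F x (S u ∙ z) (rank1 (c i) n))) //; lin.
  rewrite (rE _ (fun x v => \sw_(y, z <- D x) F y z (rank1 (c i) v))); last by lin.
  rewrite -(cA _ (fun u u' m'' => \sw_(w, v <- la (f m'')) \sw_(z, n <- la v)
     F (S u' ∙ w) (S u ∙ z) (rank1 (c i) n))); last by lin.
  apply: sw_ext => u m'.
  transitivity (\sw_(a, a' <- D u) \sw_(w, v <- la (f m')) \sw_(w1, w2 <- D w) F (S a' ∙ w1) (S a ∙ w2) (rank1 (c i) v)).
    by apply: sw_ext => a a'; rewrite (cA _ (fun w z n => F (S a' ∙ w) (S a ∙ z) (rank1 (c i) n))) //; lin.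
  rewrite sw_C; apply: sw_ext => w v.
  rewrite (hcomM hopfX); last by lin.
  rewrite (hcomS hopfX (F := fun p q => \sw_(w1, w2 <- D w) F (p ∙ w1) (q ∙ w2) (rank1 (c i) v))) //; lin.
pose g0 (m : V) : V := \sw_(x, p : LinMap V V <- r f) p (mu (pure x m)).
have gl : linear g0 by rewrite /g0; lin.
(* [r] is made so that the coaction of p(m) factors as m_(-1) p_<-1> (x) p_<0>(m_(0)). *)
have cact (p : LinMap V V) (W : lmodType k) (F : X -> V -> W) m : bilin F ->
    \sw_(z, n <- la (p m)) F z n = \sw_(u, m' <- la m) \sw_(x, q : LinMap V V <- r p) F (u ∙ x) (q m').
  move=> Fb; transitivity (\sw_(u, m' <- la m) \sw_(y, m'' <- la m') \sw_(z, n <- la (p m'')) F (u ∙ (S y ∙ z)) n).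
    rewrite -(cA _ (fun u y m'' => \sw_(z, n <- la (p m'')) F (u ∙ (S y ∙ z)) n)); last by lin.
    rewrite -(c1 _ (fun m => \sw_(z, n <- la (p m)) F z n)); last by lin.
    apply: sw_ext => u m'.
    transitivity (\sw_(a, a' <- D u) (\sw_(z, n <- la (p m')) F ((a ∙ S a') ∙ z) n)).
      rewrite (hantr hopfX (F := fun w => \sw_(z, n <- la (p m')) F (w ∙ z) n)); last by lin.
      by congr (_ *: _); apply: sw_ext => z n; rewrite (hmul1l hopfX).
    by apply: sw_ext => a a'; apply: sw_ext => z n; rewrite (hmulA hopfX).
  apply: sw_ext => u m'.
  by rewrite (rE _ (fun x v => F (u ∙ x) v)) //; lin.
have rhog : rho (mkLin gl) = \sw_(x, p : LinMap V V <- r f) \sw_(y, z <- D x)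
    pure y (lcomp p (mkLin (curry1_lin mu z)) : LinMap V V).
  apply: (hom_uniq fdV) => m.
  rewrite (rhoE _ _ (F := fun x v => pure x v)); last by lin.
  transitivity (\sw_(x, p : LinMap V V <- r f) \sw_(y, z <- D x) pure y (p (mu (pure z m)))); last first.
    rewrite sw_sw; last by split=> [q|x]; [lin | apply: lin_purer; move=> a s t].
    apply: sw_ext => x p; rewrite sw_sw; last by split=> [q|y]; [lin | apply: lin_purer; move=> a s t].
    apply: sw_ext => y z; rewrite sw_pure //.
    by split=> [q|w]; [lin | apply: lin_purer; move=> a s t].
  transitivity (\sw_(u, m' <- la m) \sw_(x, p : LinMap V V <- r f) \sw_(x1, x2 <- D x)
     \sw_(u', m'' <- la m') pure (x1 ∙ u' ∙ Sb u) (p (mu (pure x2 m'')))).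
    apply: sw_ext => u m'.
    transitivity (\sw_(x, p : LinMap V V <- r f) \sw_(z, n <- la (p (mu (pure x m')))) pure (z ∙ Sb u) n).
      rewrite -[mkLin gl m']/(g0 m') /g0 (linS (f := fun v => \sw_(z, n <- la v) pure (z ∙ Sb u) n)); last by lin.
      by [].
    transitivity (\sw_(x, p : LinMap V V <- r f) \sw_(x', q : LinMap V V <- r p) \sw_(u', m'' <- la (mu (pure x m'))) pure (u' ∙ x' ∙ Sb u) (q m'')).
      apply: sw_ext => x p; rewrite (cact p _ (fun z n => pure (z ∙ Sb u) n)); last by lin.
      by rewrite sw_C.
    rewrite (rcom _ (fun x x' q => \sw_(u', m'' <- la (mu (pure x m'))) pure (u' ∙ x' ∙ Sb u) (q m''))); last first.
      split=> [y q|x q|x y]; [by lin|by lin|].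
      by apply: (@lin_swF _ _ _ _ _ _ (fun (q : LinMap V V) w v => pure (w ∙ y ∙ Sb u) (q v))) => w v; apply: lin_purer => a s t.
    apply: sw_ext => x p.
    by rewrite (Vy (F := fun w v => pure (w ∙ Sb u) (p v))) //; lin.
  rewrite sw_C; apply: sw_ext => x p; rewrite sw_C; apply: sw_ext => x1 x2.
  rewrite -(cA _ (fun u u' m'' => pure (x1 ∙ u' ∙ Sb u) (p (mu (pure x2 m''))))); last by lin.
  rewrite -[RHS](c1 _ (fun m => pure x1 (p (mu (pure x2 m))))); last by lin.
  apply: sw_ext => u m'.
  transitivity (\sw_(a, a' <- D u) pure (x1 ∙ (a' ∙ Sb a)) (p (mu (pure x2 m')))).
    by apply: sw_ext => a a'; rewrite (hmulA hopfX).
  rewrite (hantVr hopfX bijS (F := fun w => pure (x1 ∙ w) (p (mu (pure x2 m'))))); last by lin.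
  by rewrite (hmul1r hopfX).
exists (mkLin gl) => m; rewrite rhog.
have Kb : bilin (fun (y : X) (g' : LinMap V V) => g' (mu (pure (Sb y) m))).
  by split=> [g'|y]; [lin | move=> a s t].
rewrite sw_sw //.
transitivity (\sw_(x, p : LinMap V V <- r f) (e x : k) *: p m).
  apply: sw_ext => x p; rewrite sw_sw //.
  transitivity (\sw_(y, z <- D x) p (mu (pure (z ∙ Sb y) m))).
    by apply: sw_ext => y z; rewrite sw_pure // mA.
  by rewrite (hantVr hopfX bijS (F := fun w => p (mu (pure w m)))) ?m1 //; lin.
rewrite (rE _ (fun x v => (e x : k) *: v)); last by lin.
rewrite -[RHS](c1 _ (fun m => f m)); last by lin.
apply: sw_ext => y m'; rewrite -[f m' in RHS](c1 _ (fun m => m)); last by lin.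
rewrite sw_scale; apply: sw_ext => z n.
by rewrite (hcouM hopfX) (hcouS hopfX) scalerA.
Qed.
End RightHom.
End TwistSurjectivity.

(** * The inverse braiding and opposite algebras *)

Section InverseBraiding.
Lemma Psi_tmap M N M' N' a b c d a' b' c' d' (f : {linear M -> M'}) (g : {linear N -> N'}) s :
  gyd a b M -> gyd c d N -> gyd a' b' M' -> gyd c' d' N' -> morK f -> morK g ->
  Psi M' N' (tmap f g s) = tmap g f (Psi M N s).
Proof.
move=> gM gN gM' gN' [_ f2 f3 _] [g1 _ _ g4]; tens_elim s => m n; rewrite tmap_pure.
exact (Psi_nat m n gM gN gM' gN' f2 f3 g1 g4).
Qed.
Lemma PsiV_tmap M N M' N' a b c d a' b' c' d' (f : {linear M -> M'}) (g : {linear N -> N'}) t :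
  gyd a b M -> gyd c d N -> gyd a' b' M' -> gyd c' d' N' -> morK f -> morK g ->
  PsiV M' N' (tmap g f t) = tmap f g (PsiV M N t).
Proof.
move=> gM gN gM' gN' fm gm; apply: (can_inj (PsiK gM' gN')).
by rewrite (PsiVK gM' gN') (Psi_tmap _ gM gN gM' gN' fm gm) (PsiVK gM gN).
Qed.
Lemma PsiV_natl M M' N a b a' b' c d (f : {linear M -> M'}) (W : lmodType k) (F : M' -> N -> W) m n :
  gyd a b M -> gyd a' b' M' -> gyd c d N -> morK f -> bilin F ->
  teval F (PsiV M' N (pure n (f m))) = \sw_(m1, n1 <- PsiV M N (pure n m)) F (f m1) n1.
Proof.
move=> gM gM' gN fm Fb.
have E := PsiV_tmap (pure n m) gM gN gM' gN fm (morK_id N).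
by rewrite tmap_pure in E; rewrite E sw_tmap.
Qed.
Lemma PsiV_natr M N N' a b c d c' d' (g : {linear N -> N'}) (W : lmodType k) (F : M -> N' -> W) m n :
  gyd a b M -> gyd c d N -> gyd c' d' N' -> morK g -> bilin F ->
  teval F (PsiV M N' (pure (g n) m)) = \sw_(m1, n1 <- PsiV M N (pure n m)) F m1 (g n1).
Proof.
move=> gM gN gN' gm Fb.
have E := PsiV_tmap (pure n m) gM gN gM gN' (morK_id M) gm.
by rewrite tmap_pure in E; rewrite E sw_tmap.
Qed.
(** The hexagon for the inverse follows by applying [Psi] and cancelling one braiding at a time. *)
Lemma PsiV_tensl a b b' c d M M' N (W : lmodType k) (F : tens M M' -> N -> W) m m' n :
  gyd a b M -> gyd b b' M' -> gyd c d N -> bilin F ->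
  teval F (PsiV (tensB M M') N (pure n (pure m m'))) =
  \sw_(m1, n1 <- PsiV M N (pure n m)) \sw_(m1', n2 <- PsiV M' N (pure n1 m')) F (pure m1 m1') n2.
Proof.
move=> gM gM' gN Fb; have gT := tensB_gyd gM gM'.
pose s := \sw_(m1, n1 <- PsiV M N (pure n m)) \sw_(m1', n2 <- PsiV M' N (pure n1 m')) pure (pure m1 m1') n2.
suff -> : PsiV (tensB M M') N (pure n (pure m m')) = s.
  rewrite /s sw_sw //; apply: sw_ext => m1 n1; rewrite sw_sw //; apply: sw_ext => m1' n2.
  by rewrite sw_pure.
apply: (can_inj (PsiK gT gN)); rewrite (PsiVK gT gN).
have PT x y z : Psi (tensB M M') N (pure (pure x y) z) =
    \sw_(n1, m1' <- Psi M' N (pure y z)) \sw_(n2, m1 <- Psi M N (pure x n1)) pure n2 (pure m1 m1').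
  rewrite -[LHS]sw_id.
  by rewrite (@Psi_tensl _ _ _ _ _ M M' N _ (fun u v => pure u v) x y z gM gM' gN) //; lin.
symmetry; rewrite /s [LHS]sw_lin.
transitivity (\sw_(m1, n1 <- PsiV M N (pure n m)) \sw_(n2, m2 <- Psi M N (pure m1 n1)) pure n2 (pure m2 m')).
  apply: sw_ext => m1 n1; rewrite [LHS]sw_lin.
  transitivity (\sw_(m1', n2 <- PsiV M' N (pure n1 m')) \sw_(n3, m2' <- Psi M' N (pure m1' n2))
      \sw_(n4, m2 <- Psi M N (pure m1 n3)) pure n4 (pure m2 m2')).
    by apply: sw_ext => m1' n2; rewrite PT.
  rewrite -(sw_exp (g := fun w => \sw_(n3, m2' <- Psi M' N w) \sw_(n4, m2 <- Psi M N (pure m1 n3)) pure n4 (pure m2 m2'))); last by lin.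
  by rewrite (PsiVK gM' gN) sw_pure //; lin.
rewrite -(sw_exp (g := fun w => \sw_(n4, m2 <- Psi M N w) pure n4 (pure m2 m'))); last by lin.
by rewrite (PsiVK gM gN) sw_pure //; lin.
Qed.
Lemma PsiV_tensr a b c d d' M N N' (W : lmodType k) (F : M -> tens N N' -> W) m n n' :
  gyd a b M -> gyd c d N -> gyd d d' N' -> bilin F ->
  teval F (PsiV M (tensB N N') (pure (pure n n') m)) =
  \sw_(m1, n1' <- PsiV M N' (pure n' m)) \sw_(m2, n1 <- PsiV M N (pure n m1)) F m2 (pure n1 n1').
Proof.
move=> gM gN gN' Fb; have gT := tensB_gyd gN gN'.
pose s := \sw_(m1, n1' <- PsiV M N' (pure n' m)) \sw_(m2, n1 <- PsiV M N (pure n m1)) pure m2 (pure n1 n1').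
suff -> : PsiV M (tensB N N') (pure (pure n n') m) = s.
  rewrite /s sw_sw //; apply: sw_ext => m1 n1; rewrite sw_sw //; apply: sw_ext => m1' n2.
  by rewrite sw_pure.
apply: (can_inj (PsiK gM gT)); rewrite (PsiVK gM gT).
have PT x y z : Psi M (tensB N N') (pure x (pure y z)) =
    \sw_(n1, m1 <- Psi M N (pure x y)) \sw_(n2, m2 <- Psi M N' (pure m1 z)) pure (pure n1 n2) m2.
  rewrite -[LHS]sw_id.
  by rewrite (@Psi_tensr _ _ _ _ _ M N N' _ (fun u v => pure u v) x y z gM gN gN') //; lin.
symmetry; rewrite /s [LHS]sw_lin.
transitivity (\sw_(m1, n1' <- PsiV M N' (pure n' m)) \sw_(n2, m2 <- Psi M N' (pure m1 n1')) pure (pure n n2) m2).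
  apply: sw_ext => m1 n1'; rewrite [LHS]sw_lin.
  transitivity (\sw_(m2, n1 <- PsiV M N (pure n m1)) \sw_(n3, m3 <- Psi M N (pure m2 n1))
      \sw_(n4, m4 <- Psi M N' (pure m3 n1')) pure (pure n3 n4) m4).
    by apply: sw_ext => m2 n1; rewrite PT.
  rewrite -(sw_exp (g := fun w => \sw_(n3, m3 <- Psi M N w) \sw_(n4, m4 <- Psi M N' (pure m3 n1')) pure (pure n3 n4) m4)); last by lin.
  by rewrite (PsiVK gM gN) sw_pure //; lin.
rewrite -(sw_exp (g := fun w => \sw_(n2, m2 <- Psi M N' w) pure (pure n n2) m2)); last by lin.
by rewrite (PsiVK gM gN') sw_pure //; lin.
Qed.

Lemma Psi_mulr A (U : bydobj H B) c d (Z : lmodType k) (F : A -> U -> Z) u x y :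
  kalg A -> gyd c d U -> bilin F ->
  teval F (Psi U A (pure u (x *[A] y))) =
  \sw_(x1, u1 <- Psi U A (pure u x)) \sw_(y1, u2 <- Psi U A (pure u1 y)) F (x1 *[A] y1) u2.
Proof.
move=> hA gU Fb; have gA := kbyd hA; have gT := tensB_gyd gA gA.
have E := @Psi_natr U (tensB A A) A _ _ _ _ _ _ (mulL A) _ F u (pure x y) gU gT gA (kmul hA) Fb.
apply: (etrans E).
by rewrite (@Psi_tensr _ _ _ _ _ U A A _ (fun t v => F (mulL A t) v) u x y gU gA gA) //; lin.
Qed.

Local Notation oppA := (oppA hH hB).
Lemma mul_oppA A t : mulL (oppA A) t = mulL A (Psi A A t).
Proof. by []. Qed.

(** Naturality of the braiding of [A] with A (x) A, applied to the morphism [Psi A A] itself. *)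
Lemma yang_baxter A (Z : lmodType k) (F : tens A A -> A -> Z) a b c : byd A -> bilin F ->
  \sw_(c1, b1 <- Psi A A (pure b c)) \sw_(c2, a1 <- Psi A A (pure a c1)) \sw_(b2, a2 <- Psi A A (pure a1 b1)) F (pure c2 b2) a2 =
  \sw_(b1, a1 <- Psi A A (pure a b)) \sw_(c1, a2 <- Psi A A (pure a1 c)) F (Psi A A (pure b1 c1)) a2.
Proof.
move=> gA Fb; have gT := tensB_gyd gA gA.
have E := @Psi_natr A (tensB A A) (tensB A A) _ _ _ _ _ _ (Psi A A) _ F a (pure b c) gA gT gT (Psi_morK1 gA gA) Fb.
rewrite (@Psi_tensr _ _ _ _ _ A A A _ (fun t v => F (Psi A A t) v) a b c gA gA gA) in E; last by lin.
have E2 := @sw_exp k A A Z (fun s => teval F (Psi A (tensB A A) (pure a s))) (Psi A A (pure b c)).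
apply: etrans E; symmetry; apply: etrans (E2 _) _; first by lin.
apply: sw_ext => c1 b1.
exact (@Psi_tensr _ _ _ _ _ A A A _ F a c1 b1 gA gA gA Fb).
Qed.

(** Once the braiding has been moved past the inner products, associativity of the opposite product
    is the Yang-Baxter equation. *)
Lemma oppA_kalg A : kalg A -> kalg (oppA A).
Proof.
move=> hA; have gA := kbyd hA; have dA := gyd_good gA.
have mE t : mulL (oppA A) t = mulL A (Psi A A t) := erefl.
split; [exact gA | | | | | exact (kha1 hA) | exact (khc1 hA) | exact (kba1 hA) | exact (kbc1 hA)].
- move=> a b c; rewrite (mE (pure a b)) (mE (pure b c)) (mE (pure _ c)) (mE (pure a _)).
  transitivity (\sw_(b1, a1 <- Psi A A (pure a b)) \sw_(c1, a2 <- Psi A A (pure a1 c))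
      mulL A (Psi A A (pure b1 c1)) *[A] a2).
    rewrite (sw_exp (g := fun s => mulL A (Psi A A (pure (mulL A s) c)))); last by lin.
    apply: sw_ext => b1 a1; rewrite (sw_exp (g := mulL A)); last by lin.
    rewrite (Psi_mull hA (F := fun u v => u *[A] v) _ _ _ gA); last by lin.
    apply: sw_ext => c1 a2; rewrite (sw_exp (g := fun s => mulL A s *[A] a2)); last by lin.
    by apply: sw_ext => c2 b2; rewrite (kA hA).
  rewrite -(yang_baxter (F := fun s a2 => mulL A s *[A] a2) _ _ _ gA); last by lin.
  rewrite [RHS](sw_exp (g := fun s => mulL A (Psi A A (pure a (mulL A s))))); last by lin.
  apply: sw_ext => c1 b1; rewrite [RHS](sw_exp (g := mulL A)); last by lin.
  by rewrite (Psi_mulr (F := fun u v => u *[A] v) _ _ _ hA gA) //; lin.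
- by move=> a; rewrite mE; rewrite (Psi_1l hA _ gA) (k1r hA).
- by move=> a; rewrite mE; rewrite (Psi_1r _ hA gA) (k1l hA).
- exact (@morK_comp _ _ _ _ _ _ _ _ (Psi_morK1 gA gA) (kmul hA)).
Qed.
End InverseBraiding.

(** * Azumaya algebras and the Brauer group *)

Section AzumayaCriterion.
Local Notation oppA := (oppA hH hB).
Lemma azF_eval (U : lmodType k) (m : wmap [:: U; U] [:: U]) (P : wmap [:: U; U] [:: U; U]) a b c :
  (curry [:: tens U U] (m \oc (idm U \ox (m \oc P)) \oc (ungrp U U \ox idm U)) (pure a b) : LinMap U U) c =
  m (pure a (m (P (pure b c)))).
Proof. by rewrite curryE; wev. Qed.
Lemma azG_eval (U : lmodType k) (m : wmap [:: U; U] [:: U]) (P : wmap [:: U; U] [:: U; U]) a b c :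
  (curry [:: tens U U] (m \oc ((m \oc P) \ox idm U) \oc (flip U U \ox idm U)
     \oc (idm U \ox flip U U) \oc (ungrp U U \ox idm U)) (pure a b) : LinMap U U) c =
  m (pure (m (P (pure c a))) b).
Proof. by rewrite curryE; wev. Qed.

Lemma sw_mul A t : mulL A t = \sw_(a, b <- t) a *[A] b.
Proof. by apply: sw_exp; lin. Qed.

Definition lop A (p : {linear tens A A -> A}) : {linear tens A A -> LinMap A A} :=
  mkLin (curry_lin (lcomp (mulL A) (lcomp (tmap (lid A) p) (assoc A A A)))).
Lemma lopE A p a b c : @lop A p (pure a b) c = a *[A] p (pure b c).
Proof.
rewrite -[LHS]/(mulL A (tmap (lid A) p (assoc A A A (pure (pure a b) c)))).
by rewrite assoc_pure tmap_pure.
Qed.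
Lemma sw_lop A p t c : @lop A p t c = \sw_(a, b <- t) a *[A] p (pure b c).
Proof.
rewrite (sw_exp (g := fun t => lop p t c)); last by lin.
by apply: sw_ext => a b; rewrite lopE.
Qed.

Local Notation azF := (azF hH hB).
Local Notation azG := (azG hH hB).
Definition psi2 A : {linear tens A A -> A} := lcomp (mulL A) (Psi A A).
Definition psi2V A : {linear tens A A -> A} := lcomp (mulL A) (PsiV A A).
Lemma psi2E A t : psi2 A t = mulL A (Psi A A t). Proof. by []. Qed.
Lemma psi2VE A t : psi2V A t = mulL A (PsiV A A t). Proof. by []. Qed.
Lemma azFE A : azF A = lop (psi2 A) :> {linear tens A A -> LinMap A A}.
Proof.
apply: lin_ext; apply: tens_ext => a b; apply: lin_ext => c; rewrite lopE.
exact (azF_eval (amul A) (Psi A A) a b c).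
Qed.
Lemma azGE A a b c : (azG A (pure a b) : LinMap A A) c = psi2 A (pure c a) *[A] b.
Proof. exact (azG_eval (amul A) (Psi A A) a b c). Qed.

Definition F1surj A := forall f : LinMap A A, exists t, forall c, \sw_(a, b <- t) (psi2V A (pure c a) *[A] b) = f c.
Definition F2surj A := forall f : LinMap A A, exists t, forall c, lop (psi2V A) t c = f c.

Section Criterion.
Variables (A : algB H B) (n0 : nat).
Hypotheses (hA : kalg A) (fdA : hasdim n0 A).
Local Notation E := (endA A).
Let gA := kbyd hA.
Let hE : kalg E := endA_kalg gA fdA lid_S.
Let gE := kbyd hE.

Lemma lop_morK (p : {linear tens A A -> A}) : morK (M := tensB A A) (N := A) p ->
  morK (M := tensB A A) (N := E) (lop p).
Proof.
move=> Pm; have dA := gyd_good gA.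
have m1 := @morK_assoc A A A dA dA.
have m2 := @morK_tmap A (tensB A A) A A (lid A) p dA dA (morK_id A) Pm.
have m3 := @morK_comp _ _ _ _ _ _ _ _ (@morK_comp _ _ _ _ _ _ _ _ m1 m2) (kmul hA).
exact (@endA_detect _ A _ _ gA fdA (tensB A A) _ (lop p) (fun _ _ => erefl) (tensB_good dA dA) m3).
Qed.
Lemma psi2_morK : morK (M := tensB A A) (N := A) (psi2 A).
Proof. exact (@morK_comp _ _ _ _ _ _ _ _ (Psi_morK1 gA gA) (kmul hA)). Qed.
Lemma psi2V_morK : morK (M := tensB A A) (N := A) (psi2V A).
Proof. exact (@morK_comp _ _ _ _ _ _ _ _ (PsiV_morK1 gA gA) (kmul hA)). Qed.

(** [T] and [Tb] carry the argument of an operator across it, by the braiding and by its inverse.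
    Both are bijective on End(A); [T] turns [lop (psi2V A)] into [azG A], and [Tb] turns [azF A]
    into the operator of [F1surj]. This converts the Azumaya conditions into the criteria. *)
Let T (f : LinMap A A) c := teval (fun (g : LinMap A A) (d : A) => g d) (Psi A E (pure c f)).
Let Tb (f : LinMap A A) c := teval (fun (g : LinMap A A) (d : A) => g d) (PsiV E A (pure c f)).
Let evb : bilin (fun (g : LinMap A A) (d : A) => g d).
Proof. by split=> [v|u] a x y //; rewrite linearP. Qed.

(** In [T] the H-part comes from the coaction of the argument and the B-part from the coaction of
    the operator. The two parts commute, and each is surjective by one of the twisting lemmas. *)
Let T_surj (f : LinMap A A) : exists g : LinMap A A, forall c, T g c = f c.
Proof.
have i1 : cancel (lid H) (lid H) by [].
have i2 x y : lid H (hmul hH (pure x y)) = hmul hH (pure (lid H x) (lid H y)) by [].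
have i3 : lid H (hone hH) = hone hH by [].
have i4 x : lid H (hant hH x) = hant hH (lid H x) by [].
have [g gP] := twist_surj hopfH bijH fdA (gHa gA) (gHc gA) i1 i2 i3 i4 (gHy gA) f.
have [g' gP'] := coact_twist_surj hopfB bijB fdA (gBa gA) (gBc gA) (gBy gA) (endA_bc gA fdA) g.
exists g' => c; rewrite -gP /T (@sw_Psi _ _ _ _ A E _ (fun (g : LinMap A A) (d : A) => g d) c g' gA gE evb).
apply: sw_ext => x c'.
transitivity (\sw_(y, n' : LinMap A A <- bc E g') \sw_(a, b <- hcom hH x) ha A (pure a (n' (ba A (pure (hantV hB y) (ha A (pure (hant hH b) c'))))))).
  apply: sw_ext => y n'; apply: etrans (@endA_ha A x n' _) _; apply: sw_ext => a b.
  by rewrite (gaa gA).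
rewrite sw_C; apply: sw_ext => a b; rewrite -gP' sw_purer sw_lin.
by [].
Qed.
Let Tb_surj (f : LinMap A A) : exists g : LinMap A A, forall c, Tb g c = f c.
Proof.
have i1 : cancel (lid B) (lid B) by [].
have i2 x y : lid B (hmul hB (pure x y)) = hmul hB (pure (lid B x) (lid B y)) by [].
have i3 : lid B (hone hB) = hone hB by [].
have i4 x : lid B (hant hB x) = hant hB (lid B x) by [].
have [g gP] := twist_surj hopfB bijB fdA (gBa gA) (gBc gA) i1 i2 i3 i4 (gBy gA) f.
have [g' gP'] := coact_twist_surj hopfH bijH fdA (gHa gA) (gHc gA) (gHy gA) (endA_hc fdA) g.
exists g' => c; rewrite -gP /Tb (@PsiVE B E A g' c).
rewrite sw_sw //.
transitivity (\sw_(x, n' : LinMap A A <- hc E g') \sw_(y, c' <- bc A c) \sw_(a, b <- hcom hB y)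
   ba A (pure a (n' (ha A (pure (hantV hH x) (ba A (pure (hant hB b) c'))))))).
  apply: sw_ext => x n'; rewrite sw_sw //; apply: sw_ext => y c'; rewrite sw_pure //.
  apply: etrans (@endA_ba _ A _ _ gA fdA y n' _) _; apply: sw_ext => a b.
  by rewrite (gaa gA).
rewrite sw_C; apply: sw_ext => y c'; rewrite sw_C; apply: sw_ext => a b; rewrite -gP' sw_purer sw_lin.
by [].
Qed.
Let Tl f : linear (T f). Proof. by rewrite /T; lin. Qed.
Let Tll : linear (fun f => mkLin (Tl f) : LinMap A A).
Proof. by apply: lin_mk => c; rewrite /T; lin. Qed.
Let Tbl f : linear (Tb f). Proof. by rewrite /Tb; lin. Qed.
Let Tbll : linear (fun f => mkLin (Tbl f) : LinMap A A).
Proof. by apply: lin_mk => c; rewrite /Tb; lin. Qed.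
Let TK : bijective (mkLin Tll).
Proof.
apply: (surj_bij (hasdim_hom fdA fdA) (hasdim_hom fdA fdA)) => f.
by have [g gP] := T_surj f; exists g; apply: lin_ext => c; exact: gP.
Qed.
Let TbK : bijective (mkLin Tbll).
Proof.
apply: (surj_bij (hasdim_hom fdA fdA) (hasdim_hom fdA fdA)) => f.
by have [g gP] := Tb_surj f; exists g; apply: lin_ext => c; exact: gP.
Qed.

Let T_F2 t c : T (lop (psi2V A) t) c = (azG A t : LinMap A A) c.
Proof.
move: t; apply: (tens_lin_eq (f := fun t => T (lop (psi2V A) t) c) (g := fun t => (azG A t : LinMap A A) c)).
- by rewrite /T; lin.
- by move=> x y z; rewrite linearP.
move=> a b; rewrite azGE psi2E /T.
have gT := tensB_gyd gA gA.
have E1 := @Psi_natr A (tensB A A) E _ _ _ _ _ _ (lop (psi2V A)) _ (fun (g : LinMap A A) (d : A) => g d) c (pure a b) gA gT gE (lop_morK psi2V_morK) evb.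
apply: (etrans E1).
rewrite (@Psi_tensr _ _ _ _ _ A A A _ (fun t d => lop (psi2V A) t d) c a b gA gA gA); last by lin.
rewrite (sw_mul (Psi A A (pure c a))) sw_purel sw_lin; apply: sw_ext => a1 c1; rewrite (kA hA).
transitivity (a1 *[A] psi2V A (Psi A A (pure c1 b))).
  rewrite [RHS](sw_exp (g := fun t => a1 *[A] psi2V A t)); last by lin.
  by apply: sw_ext => b1 c2; rewrite lopE.
by rewrite psi2VE (PsiK gA gA).
Qed.
Let Tb_azF t c : Tb (azF A t) c = \sw_(a, b <- t) (psi2V A (pure c a) *[A] b).
Proof.
rewrite azFE /Tb; tens_elim t => a b; rewrite [RHS]sw_pure; last by lin.
rewrite psi2VE.
have gT := tensB_gyd gA gA.
have E1 := @PsiV_natl (tensB A A) E A _ _ _ _ _ _ (lop (psi2 A)) _ (fun (g : LinMap A A) (d : A) => g d) (pure a b) c gT gE gA (lop_morK psi2_morK) evb.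
apply: (etrans E1).
rewrite (@PsiV_tensl _ _ _ _ _ A A A _ (fun t d => lop (psi2 A) t d) a b c gA gA gA); last by lin.
rewrite (sw_mul (PsiV A A (pure c a))) sw_purel sw_lin; apply: sw_ext => a1 c1; rewrite (kA hA).
transitivity (a1 *[A] psi2 A (PsiV A A (pure c1 b))).
  rewrite [RHS](sw_exp (g := fun t => a1 *[A] psi2 A t)); last by lin.
  by apply: sw_ext => b1 c2; rewrite lopE.
by rewrite psi2E (PsiVK gA gA).
Qed.

Lemma azF_bij : bijective (azF A) <-> F1surj A.
Proof.
split=> [[G aG Ga] f|F1].
  have [g gP] := Tb_surj f; exists (G g) => c.
  by rewrite -Tb_azF Ga.
have [K1 K2] := linvP TbK.
apply: (@surj_bij k (n0 * n0) (tens A A) (LinMap A A) (azF A) (hasdim_tens fdA fdA) (hasdim_hom fdA fdA)) => f.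
have [t tP] := F1 (mkLin (Tbl f)); exists t.
by apply: (can_inj K1); apply: lin_ext => c; apply: etrans (tP c); apply: Tb_azF.
Qed.
Lemma azG_bij : bijective (azG A) <-> F2surj A.
Proof.
split=> [[G aG Ga] f|F2].
  have [K1 K2] := linvP TK.
  exists (G (mkLin (Tl f))) => c.
  congr ((_ : LinMap A A) c); apply: (can_inj K1); apply: lin_ext => d.
  by apply: etrans (T_F2 _ d) _; rewrite Ga.
apply: (@surj_bij k (n0 * n0) (tens A A) (LinMap A A) (azG A) (hasdim_tens fdA fdA) (hasdim_hom fdA fdA)) => f.
have [g gP] := T_surj f; have [t tP] := F2 g; exists t.
apply: lin_ext => c; rewrite -T_F2 -gP.
by congr (T _ c); apply: lin_ext.
Qed.
End Criterion.

Local Notation azumaya := (azumaya hH hB).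
Lemma azumayaP A : azumaya A <-> [/\ kalg A, nonzero A, findim A, F1surj A & F2surj A].
Proof.
split=> [[/algP hA nA /[dup] fA /findimP[n fdA] /(azF_bij hA fdA) ? /(azG_bij hA fdA) ?]|].
  by split.
move=> [hA nA /[dup] fA /findimP[n fdA] /(azF_bij hA fdA) ? /(azG_bij hA fdA) ?].
by split; [apply/algP | exact nA | exact fA | |].
Qed.

(** This makes the class of the opposite algebra a right inverse. Multiplicativity combines
    associativity of the opposite product with [Psi_mulr]. *)
Lemma azF_iso A : azumaya A -> alg_iso (tensA A (oppA A)) (endA A).
Proof.
move=> [/algP hA nA /findimP[n fdA] Fb _]; have gA := kbyd hA; have hO := oppA_kalg hA.
have azE := azFE A.
apply/kisoP; exists (azF A); split.
- exact: Fb.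
- have m := lop_morK hA fdA (psi2_morK hA); rewrite -azE in m; exact m.
- move=> t u; apply: lin_ext => x; rewrite (endA_mulE (azF A t) (azF A u)) lcompE azE.
  tens_elim t => a c; tens_elim u => a' c'; rewrite mul_tensA !lopE (sw_exp (g := fun s => lop (psi2 A) s x)); last by lin.
  rewrite sw_sw; last by lin.
  rewrite psi2E (sw_mul (Psi A A (pure c _))) (Psi_mulr (F := fun u v => u *[A] v) _ _ _ hA gA); last by lin.
  rewrite sw_purer sw_lin; apply: sw_ext => a1 c1; rewrite sw_pure; last by lin.
  rewrite lopE (kA hA); congr (a *[A] _).
  have E : psi2 A (pure (c1 *[oppA A] c') x) = psi2 A (pure c1 (psi2 A (pure c' x))) := kA hO c1 c' x.
  rewrite E [in LHS]psi2E (sw_mul (Psi A A (pure c1 _))) sw_purer sw_lin.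
  by apply: sw_ext => y1 u2; rewrite (kA hA).
- apply: lin_ext => x; rewrite azE endA_oneE one_tensA lopE psi2E.
  by rewrite (Psi_1l hA _ gA) (k1l hA) (k1r hA).
Qed.

(** For the opposite algebra, the inverse braiding in the criteria cancels the braiding of the
    product. What remains is [azG], respectively [azF], of [A] composed with [Psi]. *)
Lemma oppA_azumaya A : azumaya A -> azumaya (oppA A).
Proof.
move=> [/algP hA nA fA Fb Gb]; have gA := kbyd hA; have hO := oppA_kalg hA.
apply/azumayaP; split=> // f.
  case: Gb => G aG Ga; exists (PsiV A A (G f)) => c.
  transitivity ((azG A (Psi A A (PsiV A A (G f))) : LinMap A A) c); last by rewrite (PsiVK gA gA) Ga.
  move: (PsiV _ _ _) => t; tens_elim t => a b; rewrite sw_pure; last by lin.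
  have -> : psi2V (oppA A) (pure c a) = c *[A] a.
    by rewrite psi2VE mul_oppA -[PsiV _ _ _]/(PsiV A A (pure c a)) (PsiVK gA gA).
  rewrite mul_oppA (sw_exp (g := mulL A)); last by lin.
  rewrite (Psi_mull hA (F := fun u v => u *[A] v) _ _ _ gA); last by lin.
  rewrite [RHS](sw_exp (g := fun t => (azG A t : LinMap A A) c)); last by move=> x y z; rewrite linearP.
  apply: sw_ext => b1 a1; rewrite azGE psi2E (sw_mul (Psi A A (pure c b1))).
  by rewrite sw_purel sw_lin; apply: sw_ext => b2 c1; rewrite (kA hA).
case: Fb => G aG Ga; exists (PsiV A A (G f)) => c.
transitivity ((azF A (Psi A A (PsiV A A (G f))) : LinMap A A) c); last by rewrite (PsiVK gA gA) Ga.
rewrite azFE; move: (PsiV _ _ _) => t.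
rewrite sw_lop; tens_elim t => a b; rewrite sw_pure; last by lin.
have -> : psi2V (oppA A) (pure b c) = b *[A] c.
  by rewrite psi2VE mul_oppA -[PsiV _ _ _]/(PsiV A A (pure b c)) (PsiVK gA gA).
rewrite mul_oppA (sw_exp (g := mulL A)); last by lin.
rewrite (Psi_mulr (F := fun u v => u *[A] v) _ _ _ hA gA); last by lin.
rewrite sw_lop; apply: sw_ext => b1 a1; rewrite psi2E (sw_mul (Psi A A (pure a1 c))).
by rewrite sw_purer sw_lin; apply: sw_ext => c1 a2; rewrite (kA hA).
Qed.
End AzumayaCriterion.

(** * Tensor products of Azumaya algebras *)

Section AzumayaTensors.
Lemma sw_ind (U V W : lmodType k) (Pr : W -> Prop) (F : U -> V -> W) t :
  Pr 0 -> (forall x y, Pr x -> Pr y -> Pr (x + y)) -> (forall a b, Pr (F a b)) -> Pr (teval F t).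
Proof. by move=> P0 PD PF; rewrite /teval /fsum; apply: (big_ind Pr) => // p _. Qed.

Lemma PsiV_1l C (U : bydobj H B) d (u : U) : kalg C -> gyd (lid B) d U ->
  PsiV C U (pure u (one1 C)) = pure (one1 C) u.
Proof. by move=> hC gU; apply: (can_inj (PsiK (kbyd hC) gU)); rewrite (PsiVK (kbyd hC) gU) (Psi_1l hC _ gU). Qed.
Lemma PsiV_1r C M a b (m : M) : kalg C -> gyd a b M -> PsiV M C (pure (one1 C) m) = pure m (one1 C).
Proof. by move=> hC gM; apply: (can_inj (PsiK gM (kbyd hC))); rewrite (PsiVK gM (kbyd hC)) (Psi_1r _ hC gM). Qed.

(** The unit of [C] is invariant and coinvariant for both Hopf algebras, so this inclusion is a
    morphism, and naturality applies to braidings with elements coming from [A]. *)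
Lemma inl_morK A C : kalg A -> kalg C -> exists i : {linear A -> tensA A C},
  (forall a, i a = pure a (one1 C)) /\ morK (M := A) (N := tensB A C) i.
Proof.
move=> hA hC; have [dA dC] := (gyd_good (kbyd hA), gyd_good (kbyd hC)).
pose i : {linear A -> tens A C} := mkLin (@lin_purel _ _ _ _ id (one1 C) (@lin_id _ _)).
have iE a : i a = pure a (one1 C) by [].
exists i; split; first exact: iE.
split.
- move=> x a; rewrite !iE ha_tensB tactE -(hcou1r hopfH (F := fun x => pure (ha A (pure x a)) (one1 C))); last by lin.
  by apply: sw_ext => y z; rewrite (kha1 hC) pureZr.
- move=> a; rewrite iE hc_tensB tcoactE; apply: sw_ext => x a'.
  by rewrite (khc1 hC) sw_pure ?(hmul1r hopfH) //; lin.
- rewrite (ba_tensB C (proj2 dA)) => x a; rewrite !iE tactE -(hcou1r hopfB (F := fun x => pure (ba A (pure x a)) (one1 C))); last by lin.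
  by apply: sw_ext => y z; rewrite (kba1 hC) pureZr.
- rewrite (bc_tensB C (proj1 dA)) => a; rewrite iE tcoactE; apply: sw_ext => x a'.
  by rewrite (kbc1 hC) sw_pure ?(hmul1r hopfB) //; lin.
Qed.
Lemma inr_morK A C : kalg A -> kalg C -> exists i : {linear C -> tensA A C},
  (forall c, i c = pure (one1 A) c) /\ morK (M := C) (N := tensB A C) i.
Proof.
move=> hA hC; have [dA dC] := (gyd_good (kbyd hA), gyd_good (kbyd hC)).
pose i : {linear C -> tens A C} := mkLin (@lin_purer _ _ _ _ id (one1 A) (@lin_id _ _)).
have iE a : i a = pure (one1 A) a by [].
exists i; split; first exact: iE.
split.
- move=> x a; rewrite !iE ha_tensB tactE -(hcou1l hopfH (F := fun x => pure (one1 A) (ha C (pure x a)))); last by lin.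
  by apply: sw_ext => y z; rewrite (kha1 hA) pureZl.
- move=> a; rewrite iE hc_tensB tcoactE (khc1 hA) sw_pure; last by lin.
  by apply: sw_ext => x a'; rewrite (hmul1l hopfH).
- rewrite (ba_tensB C (proj2 dA)) => x a; rewrite !iE tactE -(hcou1l hopfB (F := fun x => pure (one1 A) (ba C (pure x a)))); last by lin.
  by apply: sw_ext => y z; rewrite (kba1 hA) pureZl.
- rewrite (bc_tensB C (proj1 dA)) => a; rewrite iE tcoactE (kbc1 hA) sw_pure; last by lin.
  by apply: sw_ext => x a'; rewrite (hmul1l hopfB).
Qed.

Lemma psi2VS A t : psi2V A t = \sw_(a, b <- PsiV A A t) a *[A] b.
Proof. by rewrite psi2VE sw_mul. Qed.

Section InverseOpposite.
Variables (A : algB H B) (hA : kalg A).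
Let gA := kbyd hA.

Lemma PsiV_mulr (U : bydobj H B) (Z : lmodType k) (F : A -> U -> Z) u x y c d : gyd c d U -> bilin F ->
  teval F (PsiV A U (pure u (x *[A] y))) =
  \sw_(x1, u1 <- PsiV A U (pure u x)) \sw_(y1, u2 <- PsiV A U (pure u1 y)) F (x1 *[A] y1) u2.
Proof.
move=> gU Fb; have gT := tensB_gyd gA gA.
have E := @PsiV_natl (tensB A A) A U _ _ _ _ _ _ (mulL A) _ F (pure x y) u gT gA gU (kmul hA) Fb.
apply: (etrans E).
by rewrite (@PsiV_tensl _ _ _ _ _ A A U _ (fun t v => F (mulL A t) v) x y u gA gA gU) //; lin.
Qed.
Lemma PsiV_mull (U : bydobj H B) (Z : lmodType k) (F : U -> A -> Z) u x y c d : gyd c d U -> bilin F ->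
  teval F (PsiV U A (pure (x *[A] y) u)) =
  \sw_(u1, y1 <- PsiV U A (pure y u)) \sw_(u2, x1 <- PsiV U A (pure x u1)) F u2 (x1 *[A] y1).
Proof.
move=> gU Fb; have gT := tensB_gyd gA gA.
have E := @PsiV_natr U (tensB A A) A _ _ _ _ _ _ (mulL A) _ F u (pure x y) gU gT gA (kmul hA) Fb.
apply: (etrans E).
by rewrite (@PsiV_tensr _ _ _ _ _ U A A _ (fun v t => F v (mulL A t)) u x y gU gA gA) //; lin.
Qed.
Lemma psi2V_mulr u x y : psi2V A (pure u (x *[A] y)) = \sw_(x1, u1 <- PsiV A A (pure u x)) x1 *[A] psi2V A (pure u1 y).
Proof.
rewrite psi2VE sw_mul (PsiV_mulr (F := fun a b => a *[A] b) _ _ _ gA); last by lin.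
apply: sw_ext => x1 u1; rewrite (psi2VS (pure u1 y)) sw_purer sw_lin.
by apply: sw_ext => y1 u2; rewrite (kA hA).
Qed.
Lemma psi2V_mull u x y : psi2V A (pure (x *[A] y) u) = \sw_(u1, y1 <- PsiV A A (pure y u)) psi2V A (pure x u1) *[A] y1.
Proof.
rewrite psi2VE sw_mul (PsiV_mull (F := fun a b => a *[A] b) _ _ _ gA); last by lin.
apply: sw_ext => u1 y1; rewrite (psi2VS (pure x u1)) sw_purel sw_lin.
by apply: sw_ext => y2 u2; rewrite (kA hA).
Qed.
(** The inverse braiding also defines an opposite product. Its associativity follows as in
    [oppA_kalg], from naturality of the inverse braiding with respect to itself. *)
Lemma psi2V_assoc a b c : psi2V A (pure (psi2V A (pure a b)) c) = psi2V A (pure a (psi2V A (pure b c))).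
Proof.
have gT := tensB_gyd gA gA.
have Ll : linear (fun t => psi2V A (pure (mulL A t) c)) by lin.
have Rl : linear (fun t => psi2V A (pure a (mulL A t))) by lin.
rewrite [psi2V A (pure a b)]psi2VE (sw_exp _ Ll) [psi2V A (pure b c)]psi2VE (sw_exp _ Rl).
transitivity (\sw_(b1, a1 <- PsiV A A (pure a b)) \sw_(c1, a2 <- PsiV A A (pure a1 c))
      \sw_(c2, b2 <- PsiV A A (pure b1 c1)) (c2 *[A] b2) *[A] a2).
  apply: sw_ext => b1 a1; rewrite psi2V_mull; apply: sw_ext => c1 a2.
  by rewrite (psi2VS (pure b1 c1)) sw_purel sw_lin.
transitivity (\sw_(t, a2 <- PsiV (tensB A A) A (pure a (PsiV A A (pure b c)))) mulL A t *[A] a2).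
  have Fb : bilin (fun (t : tens A A) a2 => mulL A t *[A] a2) by lin.
  have E := @PsiV_natl (tensB A A) (tensB A A) A _ _ _ _ _ _ (PsiV A A) _ (fun t a2 => mulL A t *[A] a2) (pure b c) a gT gT gA (PsiV_morK1 gA gA) Fb.
  apply: etrans (esym E).
  rewrite (@PsiV_tensl _ _ _ _ _ A A A _ (fun t a2 => mulL A (PsiV A A t) *[A] a2) b c a gA gA gA); last by lin.
  apply: sw_ext => b1 a1; apply: sw_ext => c1 a2.
  by rewrite (sw_mul (PsiV A A (pure b1 c1))) sw_purel sw_lin.
have Ql : linear (fun s => \sw_(t, a2 <- PsiV (tensB A A) A (pure a s)) mulL A t *[A] a2) by lin.
rewrite (sw_exp _ Ql); apply: sw_ext => c1 b1.
rewrite (@PsiV_tensl _ _ _ _ _ A A A _ (fun t a2 => mulL A t *[A] a2) c1 b1 a gA gA gA); last by lin.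
rewrite psi2V_mulr; apply: sw_ext => c2 a1; rewrite (psi2VS (pure a1 b1)) sw_purer sw_lin.
by apply: sw_ext => b2 a2; rewrite (kA hA).
Qed.
Lemma psi2V1l a : psi2V A (pure (one1 A) a) = a.
Proof. by rewrite psi2VE (PsiV_1r _ hA gA) (k1r hA). Qed.
Lemma psi2V1r a : psi2V A (pure a (one1 A)) = a.
Proof. by rewrite psi2VE (PsiV_1l _ hA gA) (k1l hA). Qed.

Local Notation lopA := (lop (psi2V A)).
(** The images of the two operators of the criteria are closed under sums and compositions, so
    surjectivity needs to be checked only on generators of the endomorphism algebra. *)
Definition im2 (f : LinMap A A) := exists t, lopA t = f.
Lemma im2_add f g : im2 f -> im2 g -> im2 (f + g).
Proof. by move=> [s <-] [t <-]; exists (s + t); rewrite linearD. Qed.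
Lemma im2_0 : im2 0.
Proof. by exists 0; rewrite linear0. Qed.
Lemma im2_comp f g : im2 f -> im2 g -> im2 (lcomp f g).
Proof.
move=> [s <-] [t <-].
exists (\sw_(a, b <- s) \sw_(a', b' <- t) \sw_(a1, b1 <- PsiV A A (pure b a')) pure (a *[A] a1) (psi2V A (pure b1 b'))).
apply: lin_ext => x; rewrite lcompE; tens_elim s => a b; tens_elim t => a' b'.
rewrite sw_pure; last by lin.
rewrite sw_pure; last by lin.
have Gl : linear (fun t => lopA t x) by lin.
rewrite (sw_linear _ _ Gl) !lopE psi2V_mulr sw_purer sw_lin.
by apply: sw_ext => a1 b1; rewrite lopE psi2V_assoc (kA hA).
Qed.

Fact rop_lin1 (t : tens A A) : linear (fun c => \sw_(a, b <- t) (psi2V A (pure c a) *[A] b)).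
Proof. by lin. Qed.
Fact rop_lin : linear (fun t => mkLin (rop_lin1 t) : LinMap A A).
Proof. by apply: lin_mk => c; lin. Qed.
Definition rop : {linear tens A A -> LinMap A A} := mkLin rop_lin.
Lemma ropE a b x : rop (pure a b) x = psi2V A (pure x a) *[A] b.
Proof. by rewrite -[LHS]/(\sw_(a0, b0 <- pure a b) (psi2V A (pure x a0) *[A] b0)) sw_pure //; lin. Qed.
Definition im1 (f : LinMap A A) := exists t, rop t = f.
Lemma im1_add f g : im1 f -> im1 g -> im1 (f + g).
Proof. by move=> [s <-] [t <-]; exists (s + t); rewrite linearD. Qed.
Lemma im1_0 : im1 0.
Proof. by exists 0; rewrite linear0. Qed.
Lemma im1_comp f g : im1 f -> im1 g -> im1 (lcomp f g).
Proof.
move=> [s <-] [t <-].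
exists (\sw_(a, b <- s) \sw_(a', b' <- t) \sw_(a1, b1 <- PsiV A A (pure b' a)) pure (psi2V A (pure a' a1)) (b1 *[A] b)).
apply: lin_ext => x; rewrite lcompE; tens_elim s => a b; tens_elim t => a' b'.
rewrite sw_pure; last by lin.
rewrite sw_pure; last by lin.
have Gl : linear (fun t => rop t x) by lin.
rewrite (sw_linear _ _ Gl) !ropE psi2V_mull sw_purel sw_lin.
by apply: sw_ext => a1 b1; rewrite ropE psi2V_assoc (kA hA).
Qed.
End InverseOpposite.

Lemma tmap_span (A C : lmodType k) n m (Pr : LinMap (tens A C) (tens A C) -> Prop) :
  hasdim n A -> hasdim m C -> Pr 0 -> (forall f g, Pr f -> Pr g -> Pr (f + g)) ->
  (forall (f : LinMap A A) (g : LinMap C C), Pr (tmap f g)) -> forall h, Pr h.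
Proof.
move=> fdA fdC P0 PD Pt h.
have [e [c eb]] := findim_basis fdA; have [e' [c' eb']] := findim_basis fdC.
have -> : h = \sum_i \sum_j \sw_(a, d <- h (pure (e i) (e' j)))
    (tmap (rank1 (c i) a) (rank1 (c' j) d) : LinMap (tens A C) (tens A C)).
  apply: lin_ext; apply: tens_ext => a d; rewrite LinMap_sum.
  rewrite (basis_lin (F := fun a => h (pure a d)) a eb); last by lin.
  apply: eq_bigr => i _; rewrite LinMap_sum.
  rewrite (basis_lin (F := fun d => h (pure (e i) d)) d eb') ?scaler_sumr; last by lin.
  apply: eq_bigr => j _; rewrite sw_app -[h (pure _ _) in LHS]sw_id !sw_scale.
  by apply: sw_ext => a' d'; rewrite tmap_pure !rank1E pureZl pureZr.
apply: (big_ind Pr) => // i _; apply: (big_ind Pr) => // j _.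
by apply: sw_ind.
Qed.
Lemma tmap_comp (A C : lmodType k) (f : LinMap A A) (g : LinMap C C) :
  (tmap f g : LinMap (tens A C) (tens A C)) = lcomp (tmap f (lid C)) (tmap (lid A) g).
Proof. by apply: lin_ext; apply: tens_ext => a c; rewrite lcompE !tmap_pure. Qed.

Lemma tmap_tmap (U V U' V' U2 V2 : lmodType k) (f : {linear U' -> U2}) (g : {linear V' -> V2})
    (f' : {linear U -> U'}) (g' : {linear V -> V'}) u v :
  lcomp (tmap f g) (tmap f' g') (pure u v) = pure (f (f' u)) (g (g' v)).
Proof. by rewrite -[LHS]/(tmap f g (tmap f' g' (pure u v))) !tmap_pure. Qed.

Section TensorAzumaya.
Variables (A C : algB H B) (n0 m0 : nat).
Hypotheses (hA : kalg A) (hC : kalg C) (fdA : hasdim n0 A) (fdC : hasdim m0 C).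
Local Notation D := (tensA A C).
Let gA := kbyd hA.
Let gC := kbyd hC.
Let hD : kalg D := tensA_kalg hA hC.
Let gD : byd (tensB A C) := kbyd hD.
Local Notation LD := (LinMap (tens A C) (tens A C)).
Local Notation iA a := (pure a (one1 C)).
Local Notation iC c := (pure (one1 A) c).

Let mul_iAl a y z : iA a *[D] pure y z = pure (a *[A] y) z.
Proof. by rewrite mul_tensA (Psi_1l hC _ gA) sw_pure ?(k1l hC) //; lin. Qed.
Let mul_iCr y z c : pure y z *[D] iC c = pure y (z *[C] c).
Proof. by rewrite mul_tensA (Psi_1r _ hA gC) sw_pure ?(k1r hA) //; lin. Qed.
Let mul_iCl c y z : iC c *[D] pure y z = \sw_(y1, c1 <- Psi C A (pure c y)) pure y1 (c1 *[C] z).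
Proof. by rewrite mul_tensA; apply: sw_ext => y1 c1; rewrite (k1l hA). Qed.
Let mul_iAr y z b : pure y z *[D] iA b = \sw_(b1, z1 <- Psi C A (pure z b)) pure (y *[A] b1) z1.
Proof. by rewrite mul_tensA; apply: sw_ext => y1 c1; rewrite (k1r hC). Qed.

(** In the products of an included element with a general one, the inverse braiding cancels the
    braiding of A # C in [psiA] and [psiC'], while a single braiding survives in [psiC] and
    [psiA']. *)
Let psiA b y z : psi2V D (pure (iA b) (pure y z)) = pure (psi2V A (pure b y)) z.
Proof.
have [i [iE im]] := inl_morK hA hC.
rewrite -iE psi2VE sw_mul.
have Fb : bilin (fun x1 u => x1 *[D] u) by lin.
have E := @PsiV_natr (tensB A C) A (tensB A C) _ _ _ _ _ _ i _ (fun x1 u => x1 *[D] u) (pure y z) b gD gA gD im Fb.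
apply: etrans E _.
rewrite (@PsiV_tensl _ _ _ _ _ A C A _ (fun t n => t *[D] i n) y z b gA gC gA); last by lin.
rewrite psi2VE sw_mul sw_purel; apply: sw_ext => y1 b1.
transitivity (\sw_(b3, z2 <- Psi C A (PsiV C A (pure b1 z))) pure (y1 *[A] b3) z2).
  rewrite [RHS](sw_exp (g := fun s => \sw_(b3, z2 <- Psi C A s) pure (y1 *[A] b3) z2)); last by lin.
  by apply: sw_ext => z1 b2; rewrite iE mul_iAr.
by rewrite (PsiVK gC gA) sw_pure //; lin.
Qed.
Let psiC d y z : psi2V D (pure (iC d) (pure y z)) = \sw_(y1, d1 <- PsiV A C (pure d y)) pure y1 (psi2V C (pure d1 z)).
Proof.
have [i [iE im]] := inr_morK hA hC.
rewrite -iE psi2VE sw_mul.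
have Fb : bilin (fun x1 u => x1 *[D] u) by lin.
have E := @PsiV_natr (tensB A C) C (tensB A C) _ _ _ _ _ _ i _ (fun x1 u => x1 *[D] u) (pure y z) d gD gC gD im Fb.
apply: etrans E _.
rewrite (@PsiV_tensl _ _ _ _ _ A C C _ (fun t n => t *[D] i n) y z d gA gC gC); last by lin.
apply: sw_ext => y1 d1; rewrite psi2VE sw_mul sw_purer; apply: sw_ext => z1 d2.
by rewrite iE mul_iCr.
Qed.
Let psiC' c y z : psi2V D (pure (pure y z) (iC c)) = pure y (psi2V C (pure z c)).
Proof.
have [i [iE im]] := inr_morK hA hC.
rewrite -iE psi2VE sw_mul.
have Fb : bilin (fun x1 u => x1 *[D] u) by lin.
have E := @PsiV_natl C (tensB A C) (tensB A C) _ _ _ _ _ _ i _ (fun x1 u => x1 *[D] u) c (pure y z) gC gD gD im Fb.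
apply: etrans E _.
rewrite (@PsiV_tensr _ _ _ _ _ C A C _ (fun n t => i n *[D] t) c y z gC gA gC); last by lin.
rewrite psi2VE sw_mul sw_purer; apply: sw_ext => c1 z1.
transitivity (\sw_(y2, c3 <- Psi C A (PsiV C A (pure y c1))) pure y2 (c3 *[C] z1)).
  rewrite [RHS](sw_exp (g := fun s => \sw_(y2, c3 <- Psi C A s) pure y2 (c3 *[C] z1))); last by lin.
  by apply: sw_ext => c2 y1; rewrite iE mul_iCl.
by rewrite (PsiVK gC gA) sw_pure //; lin.
Qed.
Let psiA' a y z : psi2V D (pure (pure y z) (iA a)) = \sw_(a1, z1 <- PsiV A C (pure z a)) pure (psi2V A (pure y a1)) z1.
Proof.
have [i [iE im]] := inl_morK hA hC.
rewrite -iE psi2VE sw_mul.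
have Fb : bilin (fun x1 u => x1 *[D] u) by lin.
have E := @PsiV_natl A (tensB A C) (tensB A C) _ _ _ _ _ _ i _ (fun x1 u => x1 *[D] u) a (pure y z) gA gD gD im Fb.
apply: etrans E _.
rewrite (@PsiV_tensr _ _ _ _ _ A A C _ (fun n t => i n *[D] t) a y z gA gA gC); last by lin.
apply: sw_ext => a1 z1; rewrite psi2VE sw_mul sw_purel; apply: sw_ext => a2 y1.
by rewrite iE mul_iAl.
Qed.

(** Operators f (x) id come directly from [A]. Elements of [C] act only after crossing the factor in
    [A]; rank one operators of [A], already available, fix the vector to be crossed, and suitably
    braided coefficients undo the crossing. Compositions then give all f (x) g. *)
Lemma tensA_F2 : F2surj A -> F2surj C -> F2surj D.
Proof.
move=> FA FC.
have im2D := im2_add (A := D); have im20 := im2_0 D.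
have [e [c eb]] := findim_basis fdA.
have i1 (f : LinMap A A) : im2 (A := D) (tmap f (lid C) : LD).
  have [t tE] := FA f; have -> : f = lop (psi2V A) t by apply: lin_ext => x; rewrite tE.
  exists (\sw_(a, b <- t) pure (iA a) (iA b)).
  apply: lin_ext; apply: tens_ext => y z; rewrite tmap_pure.
  have Gl : linear (fun s => lop (psi2V D) s (pure y z)) by lin.
  rewrite (sw_linear _ _ Gl).
  have E := sw_lop (psi2V A) t y.
  rewrite -[lid C z]/z E sw_purel; apply: sw_ext => a b.
  have E1 := lopE (psi2V D) (iA a) (iA b) (pure y z).
  refine (etrans E1 _).
  refine (etrans (congr1 (fun w => iA a *[D] w) (psiA b y z)) _).
  exact (mul_iAl a (psi2V A (pure b y)) z).
(* Left multiplication by d. A rank one operator puts y1 in the first factor, past which c1 is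
   braided; taking c1 (x) y1 from the inverse braiding of e_i (x) d makes the outcome e_i (x) d
   z. *)
have i2 (d : C) : im2 (A := D) (tmap (lid A) (mkLin (curry1_lin (mulL C) d)) : LD).
  have -> : (tmap (lid A) (mkLin (curry1_lin (mulL C) d)) : LD) =
    \sum_i \sw_(c1, y1 <- PsiV C A (pure (e i) d)) (lcomp (lop (psi2V D) (pure (iC c1) (one1 D))) (tmap (rank1 (c i) y1) (lid C)) : LD).
    apply: lin_ext; apply: tens_ext => y z; rewrite LinMap_sum tmap_pure.
    rewrite [LHS](basis_lin (F := fun y => pure y (d *[C] z)) y eb); last by lin.
    apply: eq_bigr => i _; rewrite sw_app.
    transitivity ((c i y : k) *: \sw_(y1, c1 <- Psi C A (PsiV C A (pure (e i) d))) pure y1 (c1 *[C] z)).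
      by rewrite (PsiVK gC gA) sw_pure //; lin.
    rewrite (sw_exp (g := fun s => \sw_(y1, c1 <- Psi C A s) pure y1 (c1 *[C] z))); last by lin.
    rewrite sw_scale; apply: sw_ext => c1 y1.
    have E1 : (lcomp (lop (psi2V D) (pure (iC c1) (one1 D))) (tmap (rank1 (c i) y1) (lid C)) : LD) (pure y z) =
      iC c1 *[D] psi2V D (pure (one1 D) (tmap (rank1 (c i) y1) (lid C) (pure y z))) := lopE (psi2V D) (iC c1) (one1 D) (tmap (rank1 (c i) y1) (lid C) (pure y z)).
    have E2 : tmap (rank1 (c i) y1) (lid C) (pure y z) = (c i y : k) *: pure y1 z.
      by rewrite tmap_pure rank1E pureZl.
    have E3 := psi2V1l hD (tmap (rank1 (c i) y1) (lid C) (pure y z)).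
    symmetry; refine (etrans E1 _).
    refine (etrans (congr1 (fun w => iC c1 *[D] w) (etrans E3 E2)) _).
    refine (etrans (linZ (f := fun w => iC c1 *[D] w) (c i y) (pure y1 z) _) _); first by lin.
    by congr (_ *: _); exact (mul_iCl c1 y1 z).
  apply: (big_ind (im2 (A := D))) => // i _; apply: sw_ind => // c1 y1.
  by apply: (im2_comp hD) => //; exists (pure (iC c1) (one1 D)).
have i3 (d : C) : im2 (A := D) (tmap (lid A) (mkLin (curry1_lin (psi2V C) d)) : LD).
  have -> : (tmap (lid A) (mkLin (curry1_lin (psi2V C) d)) : LD) =
    \sum_i \sw_(d1, y1 <- Psi A C (pure (e i) d)) (lcomp (lop (psi2V D) (pure (one1 D) (iC d1))) (tmap (rank1 (c i) y1) (lid C)) : LD).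
    apply: lin_ext; apply: tens_ext => y z; rewrite LinMap_sum tmap_pure.
    rewrite [LHS](basis_lin (F := fun y => pure y (psi2V C (pure d z))) y eb); last by lin.
    apply: eq_bigr => i _; rewrite sw_app.
    transitivity ((c i y : k) *: \sw_(y1, d1 <- PsiV A C (Psi A C (pure (e i) d))) pure y1 (psi2V C (pure d1 z))).
      by rewrite (PsiK gA gC) sw_pure //; lin.
    rewrite (sw_exp (g := fun s => \sw_(y1, c1 <- PsiV A C s) pure y1 (psi2V C (pure c1 z)))); last by lin.
    rewrite sw_scale; apply: sw_ext => d1 y1; rewrite lcompE tmap_pure lopE (k1l hD) rank1E pureZl pureZr linearZ.
    exact (congr1 (fun w => (c i y : k) *: w) (esym (psiC d1 y1 z))).
  apply: (big_ind (im2 (A := D))) => // i _; apply: sw_ind => // d1 y1.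
  by apply: (im2_comp hD) => //; exists (pure (one1 D) (iC d1)).
have i4 (g : LinMap C C) : im2 (A := D) (tmap (lid A) g : LD).
  have [t tE] := FC g.
  have -> : (tmap (lid A) g : LD) = \sw_(a, b <- t)
      (lcomp (tmap (lid A) (mkLin (curry1_lin (mulL C) a))) (tmap (lid A) (mkLin (curry1_lin (psi2V C) b))) : LD).
    apply: lin_ext; apply: tens_ext => y z; rewrite sw_app tmap_pure -tE sw_lop sw_purer.
    by apply: sw_ext => a b; rewrite tmap_tmap.
  by apply: sw_ind => // a b; apply: (im2_comp hD).
move=> f; have [t tE] : im2 (A := D) f; last by exists t => x; rewrite tE.
apply: (tmap_span fdA fdC (Pr := fun f : LD => im2 (A := D) f) im20 im2D) => p q.
by rewrite tmap_comp; apply: (im2_comp hD).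
Qed.

(** The mirror image of [tensA_F2]: the operators id (x) g come directly from [C], and rank one
    operators of [C] correct the crossings of elements of [A]. *)
Lemma tensA_F1 : F1surj A -> F1surj C -> F1surj D.
Proof.
move=> FA FC.
have im1D := im1_add (A := D); have im10 := im1_0 D.
have [e [c eb]] := findim_basis fdC.
have ropF (X : algB H B) t x : rop X t x = \sw_(a, b <- t) (psi2V X (pure x a) *[X] b) by [].
have i1 (f : LinMap C C) : im1 (A := D) (tmap (lid A) f : LD).
  have [t tE] := FC f; have -> : f = rop C t by apply: lin_ext => x; rewrite -tE.
  exists (\sw_(a, b <- t) pure (iC a) (iC b)).
  apply: lin_ext; apply: tens_ext => y z; rewrite tmap_pure.
  have Gl : linear (fun s => rop D s (pure y z)) by lin.
  rewrite (sw_linear _ _ Gl).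
  rewrite -[lid A y]/y [rop C t z]ropF sw_purer; apply: sw_ext => a b.
  have E1 := @ropE D (iC a) (iC b) (pure y z).
  refine (etrans E1 _).
  refine (etrans (congr1 (fun w => w *[D] iC b) (psiC' a y z)) _).
  exact (mul_iCr y (psi2V C (pure z a)) b).
have i2 (b : A) : im1 (A := D) (tmap (mkLin (curry1_lin (lcomp (mulL A) (tflip A A)) b)) (lid C) : LD).
  have -> : (tmap (mkLin (curry1_lin (lcomp (mulL A) (tflip A A)) b)) (lid C) : LD) =
    \sum_j \sw_(z1, b1 <- PsiV C A (pure b (e j))) (lcomp (rop D (pure (one1 D) (iA b1))) (tmap (lid A) (rank1 (c j) z1)) : LD).
    apply: lin_ext; apply: tens_ext => y z; rewrite LinMap_sum tmap_pure.
    have -> : mkLin (curry1_lin (lcomp (mulL A) (tflip A A)) b) y = y *[A] b.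
      by rewrite -[LHS]/(mulL A (tflip A A (pure b y))) tflip_pure.
    rewrite [LHS](basis_lin (F := fun z => pure (y *[A] b) z) z eb); last by lin.
    apply: eq_bigr => j _; rewrite sw_app.
    transitivity ((c j z : k) *: \sw_(b1, z1 <- Psi C A (PsiV C A (pure b (e j)))) pure (y *[A] b1) z1).
      by rewrite (PsiVK gC gA) sw_pure //; lin.
    rewrite (sw_exp (g := fun s => \sw_(b1, z1 <- Psi C A s) pure (y *[A] b1) z1)); last by lin.
    rewrite sw_scale; apply: sw_ext => z1 b1.
    have E1 : (lcomp (rop D (pure (one1 D) (iA b1))) (tmap (lid A) (rank1 (c j) z1)) : LD) (pure y z) =
      psi2V D (pure (tmap (lid A) (rank1 (c j) z1) (pure y z)) (one1 D)) *[D] iA b1 := @ropE D (one1 D) (iA b1) (tmap (lid A) (rank1 (c j) z1) (pure y z)).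
    have E2 : tmap (lid A) (rank1 (c j) z1) (pure y z) = (c j z : k) *: pure y z1.
      by rewrite tmap_pure rank1E pureZr.
    have E3 := psi2V1r hD (tmap (lid A) (rank1 (c j) z1) (pure y z)).
    symmetry; refine (etrans E1 _).
    refine (etrans (congr1 (fun w => w *[D] iA b1) (etrans E3 E2)) _).
    refine (etrans (linZ (f := fun w => w *[D] iA b1) (c j z) (pure y z1) _) _); first by lin.
    by congr (_ *: _); exact (mul_iAr y z1 b1).
  apply: (big_ind (im1 (A := D))) => // j _; apply: sw_ind => // z1 b1.
  by apply: (im1_comp hD) => //; exists (pure (one1 D) (iA b1)).
have i3 (a : A) : im1 (A := D) (tmap (mkLin (curry1_lin (lcomp (psi2V A) (tflip A A)) a)) (lid C) : LD).
  have -> : (tmap (mkLin (curry1_lin (lcomp (psi2V A) (tflip A A)) a)) (lid C) : LD) =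
    \sum_j \sw_(z1, a1 <- Psi A C (pure a (e j))) (lcomp (rop D (pure (iA a1) (one1 D))) (tmap (lid A) (rank1 (c j) z1)) : LD).
    apply: lin_ext; apply: tens_ext => y z; rewrite LinMap_sum tmap_pure.
    have -> : mkLin (curry1_lin (lcomp (psi2V A) (tflip A A)) a) y = psi2V A (pure y a).
      by rewrite -[LHS]/(psi2V A (tflip A A (pure a y))) tflip_pure.
    rewrite [LHS](basis_lin (F := fun z => pure (psi2V A (pure y a)) z) z eb); last by lin.
    apply: eq_bigr => j _; rewrite sw_app.
    transitivity ((c j z : k) *: \sw_(a1, z1 <- PsiV A C (Psi A C (pure a (e j)))) pure (psi2V A (pure y a1)) z1).
      by rewrite (PsiK gA gC) sw_pure //; lin.
    rewrite (sw_exp (g := fun s => \sw_(a1, z1 <- PsiV A C s) pure (psi2V A (pure y a1)) z1)); last by lin.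
    rewrite sw_scale; apply: sw_ext => z1 a1; rewrite lcompE tmap_pure ropE (k1r hD) rank1E pureZr pureZl linearZ.
    exact (congr1 (fun w => (c j z : k) *: w) (esym (psiA' a1 y z1))).
  apply: (big_ind (im1 (A := D))) => // j _; apply: sw_ind => // z1 a1.
  by apply: (im1_comp hD) => //; exists (pure (iA a1) (one1 D)).
have i4 (f : LinMap A A) : im1 (A := D) (tmap f (lid C) : LD).
  have [t tE] := FA f.
  have -> : (tmap f (lid C) : LD) = \sw_(a, b <- t)
      (lcomp (tmap (mkLin (curry1_lin (lcomp (mulL A) (tflip A A)) b)) (lid C)) (tmap (mkLin (curry1_lin (lcomp (psi2V A) (tflip A A)) a)) (lid C)) : LD).
    apply: lin_ext; apply: tens_ext => y z; rewrite sw_app tmap_pure -tE sw_purel.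
    apply: sw_ext => a b; rewrite tmap_tmap.
    rewrite -[mkLin (curry1_lin (lcomp (psi2V A) _) a) y]/(psi2V A (tflip A A (pure a y))) tflip_pure.
    by rewrite -[mkLin (curry1_lin (lcomp (mulL A) _) b) _]/(mulL A (tflip A A (pure b _))) tflip_pure.
  by apply: sw_ind => // a b; apply: (im1_comp hD).
move=> f; have [t tE] : im1 (A := D) f; last by exists t => x; rewrite -ropF tE.
apply: (tmap_span fdA fdC (Pr := fun f : LD => im1 (A := D) f) im10 im1D) => p q.
by rewrite tmap_comp; apply: (im1_comp hD).
Qed.
End TensorAzumaya.

Local Notation azumaya := (azumaya hH hB).
Lemma nonzero_tens (U V : lmodType k) n m : hasdim n U -> hasdim m V -> nonzero U -> nonzero V -> nonzero (tens U V).
Proof.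
move=> fdU fdV [u u0] [v v0]; exists (pure u v); apply/eqP => uv0.
have [e [c [eE ce]]] := findim_basis fdU; have [e' [c' [eE' ce']]] := findim_basis fdV.
have [i ci] : exists i, (c i u : k) != 0.
  apply/existsP; apply: contra_neqT u0; rewrite negb_exists => /forallP c0.
  by rewrite (eE u) big1 // => i _; have /negPn/eqP -> := c0 i; rewrite scale0r.
have [j cj] : exists j, (c' j v : k) != 0.
  apply/existsP; apply: contra_neqT v0; rewrite negb_exists => /forallP c0.
  by rewrite (eE' v) big1 // => j _; have /negPn/eqP -> := c0 j; rewrite scale0r.
have Fb : bilin (fun x y => (c i x : k) *: c' j y) by lin.
have := sw_pure u v Fb; rewrite uv0 (lin0 (f := teval _)); last by apply: lin_swt.
move=> /esym/eqP; rewrite -[_ *: _]/((c i u : k) * (c' j v : k)) mulf_eq0.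
by rewrite (negbTE ci) (negbTE cj).
Qed.

Lemma tensA_azumaya A C : azumaya A -> azumaya C -> azumaya (tensA A C).
Proof.
move=> /azumayaP[hA nA [n fdA] A1 A2] /azumayaP[hC nC [m fdC] C1 C2].
apply/azumayaP; split.
- exact (tensA_kalg hA hC).
- exact (nonzero_tens fdA fdC nA nC).
- by exists (n * m); exact (hasdim_tens fdA fdC).
- exact (tensA_F1 hA hC fdA fdC A1 C1).
- exact (tensA_F2 hA hC fdA fdC A2 C2).
Qed.
End AzumayaTensors.

(** * Endomorphism algebras of H-trivial twisted modules are Azumaya *)

Section AzumayaEnd.
Section TrivialModule.
Variables (X : lmodType k) (h : hopf X) (hopfX : is_hopf (flip X X) h).
Variables (M : lmodType k) (mu : {linear tens X M -> M}) (la : {linear M -> tens X M}).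
Hypotheses (muE : forall x m, mu (pure x m) = (hcou h x : k) *: m) (laE : forall m, la m = pure (hone h) m).
Lemma triv_isact : isact h mu.
Proof.
split=> [x y m|m]; rewrite !muE; last by rewrite (hcou1 hopfX) scale1r.
by rewrite (hcouM hopfX) scalerA.
Qed.
Lemma triv_iscoact : iscoact h la.
Proof.
split=> [W F m [F1 F2 F3]|W F m Fl]; rewrite !laE sw_pure; try by lin.
  rewrite (hcom1 hopfX) // sw_pure; last by lin.
  rewrite [RHS]sw_pure; last by lin.
  by rewrite laE sw_pure //; lin.
by rewrite (hcou1 hopfX) scale1r.
Qed.
Lemma triv_isYD : isYD h (lid X) (lid X) mu la.
Proof.
move=> W F x m Fb; have [Fl Fr] := Fb.
transitivity (F x m).
  rewrite -(hcou1l hopfX (F := fun y => F y m)) //.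
  apply: sw_ext => a b; rewrite muE laE.
  rewrite sw_pure; last by lin.
  by rewrite (hmul1l hopfX) (linZ _ _ (Fr _)).
rewrite -[LHS](hcou1r hopfX (F := fun y => F y m)) //.
apply: sw_ext => a b; rewrite laE sw_pure; last by lin.
by rewrite muE (hmul1r hopfX) (linZ _ _ (Fr _)).
Qed.
End TrivialModule.

(** Covers the modules whose endomorphism algebras are shown to be Azumaya: the unit object, for the
    unit of the Brauer group, and the modules B_al, for the values of Pi. *)
Definition trivH M : Prop :=
  (forall x m, ha M (pure x m) = (hcou hH x : k) *: m) /\ (forall m, hc M m = pure (hone hH) m).

Lemma trivH_gyd al be M : trivH M -> isact hB (ba M) -> iscoact hB (bc M) ->
  isYD hB al be (ba M) (bc M) -> gyd al be M.
Proof.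
move=> [aM cM] Ba Bc By; split=> //.
- exact (triv_isact hopfH aM).
- exact (triv_iscoact hopfH cM).
- exact (triv_isYD hopfH aM cM).
- by move=> x y m; rewrite !aM pureZr linearZ.
- move=> x m; rewrite aM linearZ /= -[bc M m in LHS]sw_id sw_scale; apply: sw_ext => y n.
  by rewrite aM pureZr.
- by move=> y m; rewrite !cM sw_pure //; lin.
- move=> W F m [F1 F2 F3]; rewrite cM sw_pure; last by lin.
  by apply: sw_ext => y n; rewrite cM sw_pure //; lin.
Qed.

Section EndAzumaya.
Variables (ga gaV : {linear B -> B}) (M : bydobj H B) (n0 : nat).
Hypothesis gaVK : cancel gaV ga.
Hypothesis gaM : forall x y, ga (hmul hB (pure x y)) = hmul hB (pure (ga x) (ga y)).
Hypothesis ga1 : ga (hone hB) = hone hB.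
Hypothesis gaS : forall x, ga (hant hB x) = hant hB (ga x).
Hypotheses (gM : gyd (lid B) ga M) (tM : trivH M) (fdM : hasdim n0 M).
Local Notation E := (endA M).
Local Notation la := (bc M).
Local Notation mu := (ba M).
Local Notation D := (hcom hB).
Local Notation S := (hant hB).
Local Notation Sb := (hantV hB).
Let hE : kalg E := endA_kalg gM fdM gaS.
Let bA := endA_ba gM fdM.
Let bC := endA_bc gM fdM.

Lemma endA_trivH : trivH E.
Proof.
have [aM cM] := tM; split=> [x f|f].
  apply: lin_ext => m; rewrite (@endA_ha M).
  transitivity (\sw_(a, b <- hcom hH x) (hcou hH a : k) *: ((hcou hH b : k) *: (f : LinMap M M) m)).
    by apply: sw_ext => a b; rewrite !aM (hcouS hopfH) linearZ.
  by rewrite (hcou1l hopfH (F := fun b => (hcou hH b : k) *: (f : LinMap M M) m)) //; lin.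
apply: (hom_uniq fdM) => m; rewrite (endA_hc fdM); last by lin.
rewrite cM sw_pure; last by lin.
rewrite cM sw_pure; last by lin.
rewrite (hantV1 hopfH bijH) (hmul1l hopfH) sw_pure //.
by split=> [f'|x]; [lin | apply: lin_purer; move=> a s t].
Qed.

Lemma psi2V_endA (f g : LinMap M M) : psi2V E (pure f g) =
  \sw_(y, f' : LinMap M M <- bc E f) (lcomp (ba E (pure y g)) f' : LinMap M M).
Proof.
have [aE cE] := endA_trivH.
rewrite psi2VE (@PsiVE B E E g f) cE.
rewrite sw_pure; last by lin.
rewrite [LHS]sw_lin; apply: sw_ext => y f'.
by rewrite aE (hcouSb hopfH bijH) (hcou1 hopfH) scale1r endA_mulE.
Qed.

(** The maps x -> P x Q with P and Q of rank one span the endomorphisms of a matrix algebra, by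
    expansion in matrix units. *)
Lemma end_span (Pr : LinMap E E -> Prop) : Pr 0 -> (forall f g, Pr f -> Pr g -> Pr (f + g)) ->
  (forall (P Q : LinMap M M) (f : LinMap E E), (forall x : LinMap M M, f x = lcomp P (lcomp x Q)) -> Pr f) ->
  forall f, Pr f.
Proof.
move=> P0 PD PP f; have [e [c eb]] := findim_basis fdM.
pose V := LinMap M M.
have gl i j l : linear (fun x : V => (lcomp (rank1 (c j) ((f (rank1 (c i) (e j)) : V) (e l))) (lcomp x (rank1 (c l) (e i))) : V)).
  move=> a x y; apply: lin_ext => m /=.
  by rewrite linearP scalerDl; congr (_ + _); exact/esym/scalerA.
have -> : f = \sum_i \sum_j \sum_l (mkLin (gl i j l) : LinMap E E).
  apply: lin_ext => x.
  rewrite [x in LHS](basis_exp (x : V) eb) linear_sum LinMap_sum; apply: eq_bigr => i _.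
  rewrite LinMap_sum.
  transitivity (\sum_j (c j ((x : V) (e i)) : k) *: f (rank1 (c i) (e j))).
    apply: (basis_lin (F := fun m => f (rank1 (c i) m)) _ eb).
    by apply: lin_app; apply: lin_rank1; exact: lin_id.
  apply: eq_bigr => j _; rewrite LinMap_sum.
  have E1 := basis_exp (f (rank1 (c i) (e j)) : V) eb.
  rewrite [X in _ *: X = _]E1 scaler_sumr; apply: eq_bigr => l _.
  apply: lin_ext => m.
  rewrite -[LHS]/((c j ((x : V) (e i)) : k) *: ((c l m : k) *: (f (rank1 (c i) (e j)) : V) (e l))).
  rewrite -[RHS]/((c j ((x : V) ((c l m : k) *: e i)) : k) *: (f (rank1 (c i) (e j)) : V) (e l)).
  rewrite scalerA linearZ linearZ; congr (_ *: _); exact: mulrC.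
apply: (big_ind Pr) => // i _; apply: (big_ind Pr) => // j _; apply: (big_ind Pr) => // l _.
by apply: PP.
Qed.

(** It suffices to reach x -> P x Q. Multiplying p and x with the inverse braiding gives (p_(-1) .
    x) p_(0), so the tensor P S(p_(-1)) (x) p_(0) yields P x S(p_(-1)) p_(0), and [vsurj] chooses p
    with S(p_(-1)) p_(0) = Q. *)
Lemma endA_F2 : F2surj E.
Proof.
have [mA m1] := gBa gM; have [cA c1] := gBc gM; have [rA r1] := gBc (kbyd hE).
have [dK Kd] := linvP (surj_bij fdM fdM (drin_surj hopfB bijB (gBa gM) (gBc gM) gaVK gaM ga1 gaS (gBy gM))).
pose dr := drin hB mu la.
have vsurj (Q : LinMap M M) : exists p : LinMap M M, forall m,
    \sw_(y, p' : LinMap M M <- bc E p) mu (pure (S y) (p' m)) = Q m.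
  (* By [bC] the requirement on p reads m_(-1) dr(p(m_(0))) = Q(m). It is solved by removing the
     coaction with the antipode and then inverting [dr]. *)
  pose p0 (m : M) : M := linv dr (\sw_(u, m' <- la m) mu (pure (S u) (Q m'))).
  have pl : linear p0 by rewrite /p0; lin.
  exists (mkLin pl) => m; rewrite (bC (F := fun y n => mu (pure (S y) n))); last by lin.
  transitivity (\sw_(u, m' <- la m) mu (pure u (dr (p0 m')))).
    apply: sw_ext => u m'; rewrite [dr _]drinE sw_purer sw_lin; apply: sw_ext => z n.
    by rewrite (hantM hopfB) (hantVK bijB) mA.
  transitivity (\sw_(u, m' <- la m) \sw_(u', m'' <- la m') mu (pure (hmul hB (pure u (S u'))) (Q m''))).
    by apply: sw_ext => u m'; rewrite /p0 Kd sw_purer sw_lin; apply: sw_ext => u' m''; rewrite mA.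
  rewrite -(cA _ (fun u u' m'' => mu (pure (hmul hB (pure u (S u'))) (Q m'')))); last by lin.
  rewrite -[RHS](c1 _ (fun m => Q m)); last by lin.
  apply: sw_ext => u m'; rewrite (hantr hopfB (F := fun w => mu (pure w (Q m')))); last by lin.
  by rewrite m1.
pose V := LinMap M M; pose th (b : B) : V := mkLin (curry1_lin mu b).
have thl : linear th by exact: (curry_lin mu).
apply: (end_span (Pr := fun f => exists t, forall x, lop (psi2V E) t x = f x)).
- by exists 0 => x; rewrite linear0.
- move=> f g [s sE] [t tE]; exists (s + t) => x.
  have -> : lop (psi2V E) (s + t) x = lop (psi2V E) s x + lop (psi2V E) t x by rewrite linearD.
  by rewrite sE tE.
move=> P Q f fE; have [p pE] := vsurj Q.
have tb : bilin (fun (y : B) (p' : V) => pure (lcomp P (th (S y)) : V) p').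
  split=> [p'|y]; last by apply: lin_purer; exact: lin_id.
  by apply: lin_purel; apply: lin_compr; lin.
exists (\sw_(y, p' : V <- bc E p) pure (lcomp P (th (S y)) : V) p') => x; rewrite fE.
have Gl : linear (fun t => lop (psi2V E) t x) by lin.
rewrite (sw_linear _ _ Gl); apply: lin_ext => m; rewrite sw_app.
transitivity (\sw_(y, p' : V <- bc E p) \sw_(z, p'' : V <- bc E p') \sw_(a, b <- D z)
    P (mu (pure (hmul hB (pure (S y) a)) ((x : V) (mu (pure (S b) (p'' m))))))).
  apply: sw_ext => y p'; rewrite lopE endA_mulE psi2V_endA.
  rewrite -[LHS]/(P (mu (pure (S y) ((\sw_(z, p'' : V <- bc E p') (lcomp (ba E (pure z x)) p'' : V) : V) m)))).
  rewrite sw_app sw_purer (sw_lin _ mu) (sw_lin _ P); apply: sw_ext => z p''.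
  have E1 : lcomp (ba E (pure z x)) p'' m = \sw_(a, b <- D z) mu (pure a ((x : V) (mu (pure (S b) (p'' m))))) := bA z x (p'' m).
  rewrite E1 sw_purer (sw_lin _ mu) (sw_lin _ P); apply: sw_ext => a b.
  by rewrite mA.
rewrite -(rA _ (fun y z (p'' : V) => \sw_(a, b <- D z)
    P (mu (pure (hmul hB (pure (S y) a)) ((x : V) (mu (pure (S b) (p'' m)))))))); last first.
  by split=> [z p''|y p''|y z]; [lin|lin|apply: lin_swF => a b; do 6?apply: lin_app; apply: lin_purer; do 2?apply: lin_app; apply: lin_purer => c s t].
transitivity (\sw_(y, p' : V <- bc E p) P ((x : V) (mu (pure (S y) (p' m))))); last first.
  by rewrite -(sw_lin _ P) -(sw_lin _ x) pE.
apply: sw_ext => y p'.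
transitivity (\sw_(z, b <- D y) \sw_(c, a <- D z) P (mu (pure (hmul hB (pure (S c) a)) ((x : V) (mu (pure (S b) (p' m))))))).
  rewrite (hcomA hopfB (F := fun c a b => P (mu (pure (hmul hB (pure (S c) a)) ((x : V) (mu (pure (S b) (p' m)))))))) //; lin.
rewrite -(hcou1l hopfB (F := fun y => P ((x : V) (mu (pure (S y) (p' m)))))); last by lin.
apply: sw_ext => z b.
rewrite (hantl hopfB (F := fun w => P (mu (pure w ((x : V) (mu (pure (S b) (p' m)))))))); last by lin.
by rewrite m1.
Qed.

(** For x -> P x Q, [twist_surj] gives p such that (m_(-1) . p)(m_(0)) = P(m). The coactions of the
    vectors Q(e_i) supply the coefficients of the tensor, and the factors Sb(u') u contract. *)
Lemma endA_F1 : F1surj E.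
Proof.
have [mA m1] := gBa gM; have [cA c1] := gBc gM; have [aA a1] := gBa (kbyd hE).
have [e [c eb]] := findim_basis fdM.
pose V := LinMap M M.
apply: (end_span (Pr := fun f => exists t, forall x, rop E t x = f x)).
- by exists 0 => x; rewrite linear0.
- move=> f g [s sE] [t tE]; exists (s + t) => x.
  have -> : rop E (s + t) x = rop E s x + rop E t x by rewrite linearD.
  by rewrite sE tE.
move=> P Q f fE.
have [p pE] := twist_surj hopfB bijB fdM (gBa gM) (gBc gM) gaVK gaM ga1 gaS (gBy gM) P.
have [T1 T1E] : exists T1 : V -> M -> M, forall q n, T1 q n = \sw_(x, n' <- la n) (ba E (pure x q) : V) n'.
  by exists (fun q n => \sw_(x, n' <- la n) (ba E (pure x q) : V) n').
have T1b : bilin T1.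
  have L1 n : linear (fun q : V => \sw_(x, n' <- la n) (ba E (pure x q) : V) n') by lin.
  have L2 (q : V) : linear (fun n => \sw_(x, n' <- la n) (ba E (pure x q) : V) n') by lin.
  by split=> [n|q] a x y; rewrite !T1E; [exact: L1 | exact: L2].
have T1p n : T1 p n = P n.
  by rewrite -pE T1E; apply: sw_ext => x n'; rewrite bA.
have psiT (x q : V) m : (psi2V E (pure x q) : V) m = \sw_(u, m' <- la m) T1 (ba E (pure (Sb u) q)) (x m').
  rewrite psi2V_endA sw_app.
  transitivity (\sw_(y, x' : V <- bc E x) (ba E (pure y q) : V) (x' m)); first by [].
  rewrite (bC (F := fun y n => (ba E (pure y q) : V) n)); last by lin.
  by apply: sw_ext => u m'; rewrite T1E; apply: sw_ext => z n; rewrite aA.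
exists (\sum_i \sw_(u, m' <- la (Q (e i))) pure (ba E (pure u p)) (rank1 (c i) m' : V)) => x; rewrite fE.
apply: lin_ext => m.
have lZ i (G : V) m' : (lcomp G (rank1 (c i) m') : V) m = (c i m : k) *: G m'.
  by rewrite -[LHS]/(G ((c i m : k) *: m')) linearZ.
have Gl : linear (fun t => (rop E t x : V) m) by lin.
rewrite (linS _ _ _ Gl) [RHS](basis_lin (F := fun m => P ((x : V) (Q m))) m eb); last by lin.
apply: eq_bigr => i _; rewrite (sw_linear _ _ Gl).
transitivity (\sw_(u, m' <- la (Q (e i))) (c i m : k) *: \sw_(u', m'' <- la m') T1 (ba E (pure (hmul hB (pure (Sb u') u)) p)) ((x : V) m'')).
  apply: sw_ext => u m'; rewrite ropE endA_mulE.
  rewrite lZ psiT.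
  refine (congr1 (fun w => (c i m : k) *: w) _); apply: sw_ext => u' m''.
  exact (congr1 (fun w => T1 w ((x : V) m'')) (esym (aA (Sb u') u p))).
rewrite -sw_scale; congr (_ *: _).
rewrite -(cA _ (fun u u' m'' => T1 (ba E (pure (hmul hB (pure (Sb u') u)) p)) ((x : V) m''))); last by lin.
rewrite -(c1 _ (fun m => P ((x : V) m))); last by lin.
apply: sw_ext => u m'.
rewrite (hantVl hopfB bijB (F := fun w => T1 (ba E (pure w p)) ((x : V) m'))); last by lin.
by rewrite a1 T1p.
Qed.

Local Notation azumaya := (azumaya hH hB).
Lemma endA_azumaya : nonzero M -> azumaya E.
Proof.
move=> [m m0]; apply/azumayaP; split.
- exact: hE.
- exists (lid M : LinMap M M); apply: contra_neq m0 => l0.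
  by rewrite -[m]/((lid M : LinMap M M) m) l0.
- by exists (n0 * n0); exact (hasdim_hom fdM fdM).
- exact: endA_F1.
- exact: endA_F2.
Qed.
End EndAzumaya.
End AzumayaEnd.

(** * The Brauer group *)

Section BrauerGroup.
Local Notation U1 := (unitB hH hB).
Lemma unit_actE (X : lmodType k) (h : hopf X) x (c : k^o) :
  (bcounit h \ox idm k^o) (pure x c) = (hcou h x : k) *: c :> k^o.
Proof. by wev. Qed.
Lemma unit_coactE (X : lmodType k) (h : hopf X) (c : k^o) :
  (bone h \ox idm k^o) c = pure (hone h) c.
Proof. by rewrite hox0l; wev. Qed.
Lemma unitB_trivH : trivH U1.
Proof. by split=> [x m|m]; [exact (unit_actE hH x m) | exact (unit_coactE hH m)]. Qed.
Lemma unitB_byd : byd U1.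
Proof.
have bE x m : ba U1 (pure x m) = (hcou hB x : k) *: m by exact (unit_actE hB x m).
have cE m : bc U1 m = pure (hone hB) m by exact (unit_coactE hB m).
apply: (trivH_gyd unitB_trivH).
- exact (triv_isact hopfB bE).
- exact (triv_iscoact hopfB cE).
- exact (triv_isYD hopfB bE cE).
Qed.
Lemma unitB_dim : hasdim 1 U1.
Proof.
constructor; exists (fun c : k^o => \row_(_ < 1) (c : k)) => [a x y|].
  by apply/rowP => i; rewrite !mxE.
by exists (fun r : 'rV[k]_1 => (r 0 0 : k^o)) => [c|r]; [rewrite mxE | apply/rowP => i; rewrite mxE ord1].
Qed.
Lemma unitB_nz : nonzero U1.
Proof. by exists (1 : k^o); exact: oner_neq0. Qed.

Lemma endA_byd_kalg n M : byd M -> hasdim n M -> kalg (endA M).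
Proof. by move=> gM fdM; exact (endA_kalg gM fdM lid_S). Qed.

Lemma endA_tens1 n m M N : byd M -> byd N -> hasdim n M -> hasdim m N ->
  alg_iso (tensA (endA M) (endA N)) (endA (tensB M N)).
Proof.
move=> gM gN fdM fdN.
have idSb x : lid B (hantV hB x) = hantV hB (lid B x) by [].
have idM x y : lid B (hmul hB (pure x y)) = hmul hB (pure (lid B x) (lid B y)) by [].
have idc (W : lmodType k) (F : B -> B -> W) x : bilin F ->
  teval F (hcom hB (lid B x)) = \sw_(a, b <- hcom hB x) F (lid B a) (lid B b) by [].
have := endA_tens idM erefl idSb lid_S lid_S idc gM gN fdM fdN.
by rewrite pull_id.
Qed.

Local Notation beq := (beq hH hB).
Local Notation azumaya := (azumaya hH hB).
Definition fkalg A : Prop := kalg A /\ exists n, hasdim n A.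
Definition fobj M : Prop := [/\ byd M, nonzero M & exists n, hasdim n M].

Lemma fkalg_tens A C : fkalg A -> fkalg C -> fkalg (tensA A C).
Proof.
move=> [hA [n fA]] [hC [m fC]]; split; first exact (tensA_kalg hA hC).
by exists (n * m); exact (hasdim_tens fA fC).
Qed.
Lemma fkalg_end M : fobj M -> fkalg (endA M).
Proof.
move=> [gM _ [n fM]]; split; first exact (endA_byd_kalg gM fM).
by exists (n * n); exact (hasdim_hom fM fM).
Qed.
Lemma fobj_tens M N : fobj M -> fobj N -> fobj (tensB M N).
Proof.
move=> [gM nM [n fM]] [gN nN [m fN]]; split.
- exact (tensB_gyd gM gN).
- exact (nonzero_tens fM fN nM nN).
- by exists (n * m); exact (hasdim_tens fM fN).
Qed.
Lemma fobj1 : fobj U1.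
Proof. split; [exact: unitB_byd | exact: unitB_nz | by exists 1%N; exact: unitB_dim]. Qed.
Lemma azumaya_fkalg A : azumaya A -> fkalg A.
Proof. by move=> [/algP hA _ fA _ _]. Qed.

Lemma beqP A A' : beq A A' <-> exists M N, [/\ fobj M, fobj N &
  alg_iso (tensA A (endA M)) (tensA A' (endA N))].
Proof.
split=> [[M [N [[/bydP gM /bydP gN] [nM nN] [fM fN] i]]]|[M [N [[gM nM fM] [gN nN fN] i]]]]; exists M, N.
  by split.
by split; [split; apply/bydP | split | split | ].
Qed.

Lemma end_end M N : fobj M -> fobj N -> alg_iso (tensA (endA M) (endA N)) (endA (tensB M N)).
Proof. by move=> [gM _ [n fM]] [gN _ [m fN]]; exact (endA_tens1 gM gN fM fN). Qed.
Lemma end_swap A M : fkalg A -> fobj M -> alg_iso (tensA A (endA M)) (tensA (endA M) A).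
Proof. by move=> [hA [n fA]] [gM _ [m fM]]; exact (endA_swap hA gM fM fA). Qed.
Lemma tensA_isol A A' C : fkalg A -> fkalg A' -> fkalg C -> alg_iso A A' -> alg_iso (tensA A C) (tensA A' C).
Proof. by move=> [hA _] [hA' _] [hC _] i; exact (tensA_iso hA hC hA' hC i (iso_refl C)). Qed.
Lemma tensA_isor A C C' : fkalg A -> fkalg C -> fkalg C' -> alg_iso C C' -> alg_iso (tensA A C) (tensA A C').
Proof. by move=> [hA _] [hC _] [hC' _] i; exact (tensA_iso hA hC hA hC' (iso_refl A) i). Qed.
Lemma tensA_ass A C D : fkalg A -> fkalg C -> fkalg D -> alg_iso (tensA (tensA A C) D) (tensA A (tensA C D)).
Proof. by move=> [hA _] [hC _] [hD _]; exact (tensA_assoc hA hC hD). Qed.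

Lemma tens_end_end A M N : fkalg A -> fobj M -> fobj N ->
  alg_iso (tensA (tensA A (endA M)) (endA N)) (tensA A (endA (tensB M N))).
Proof.
move=> hA oM oN; have [hM hN hT] := And3 (fkalg_end oM) (fkalg_end oN) (fkalg_end (fobj_tens oM oN)).
apply: (iso_trans (tensA_ass hA hM hN)).
exact: (tensA_isor hA (fkalg_tens hM hN) hT (end_end oM oN)).
Qed.

Lemma iso_beq A A' : fkalg A -> fkalg A' -> alg_iso A A' -> beq A A'.
Proof.
move=> hA hA' i; apply/beqP; exists U1, U1; split; try exact: fobj1.
exact: (tensA_isol hA hA' (fkalg_end fobj1) i).
Qed.
Lemma beq_refl A : fkalg A -> beq A A.
Proof. by move=> hA; apply: iso_beq => //; apply: iso_refl. Qed.
Lemma beq_sym A A' : beq A A' -> beq A' A.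
Proof. by move=> /beqP[M [N [oM oN i]]]; apply/beqP; exists N, M; split=> //; apply: iso_sym. Qed.
(** The two stabilising endomorphism algebras at [A'] are exchanged by [end_swap]; pairs of them at
    the ends are merged by [end_end]. *)
Lemma beq_trans A A' A2 : fkalg A -> fkalg A' -> fkalg A2 -> beq A A' -> beq A' A2 -> beq A A2.
Proof.
move=> hA hA' hA2 /beqP[M [N [oM oN i]]] /beqP[M' [N' [oM' oN' i']]].
have [hM hN hM' hN'] := And4 (fkalg_end oM) (fkalg_end oN) (fkalg_end oM') (fkalg_end oN').
apply/beqP; exists (tensB M M'), (tensB N' N); split; try exact: fobj_tens.
apply: (iso_trans (iso_sym (tens_end_end hA oM oM'))).
apply: (iso_trans (tensA_isol (fkalg_tens hA hM) (fkalg_tens hA' hN) hM' i)).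
apply: (iso_trans (tensA_ass hA' hN hM')).
apply: (iso_trans (tensA_isor hA' (fkalg_tens hN hM') (fkalg_tens hM' hN) (end_swap hN oM'))).
apply: (iso_trans (iso_sym (tensA_ass hA' hM' hN))).
apply: (iso_trans (tensA_isol (fkalg_tens hA' hM') (fkalg_tens hA2 hN') hN i')).
exact: tens_end_end.
Qed.

Lemma tens_shuffle A C M N : fkalg A -> fkalg C -> fobj M -> fobj N ->
  alg_iso (tensA (tensA A C) (endA (tensB M N))) (tensA (tensA A (endA M)) (tensA C (endA N))).
Proof.
move=> hA hC oM oN; have [hM hN] := (fkalg_end oM, fkalg_end oN).
have [hAC hAM hCM hMC] := And4 (fkalg_tens hA hC) (fkalg_tens hA hM) (fkalg_tens hC hM) (fkalg_tens hM hC).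
apply: (iso_trans (iso_sym (tens_end_end hAC oM oN))).
apply: (iso_trans (tensA_isol (fkalg_tens hAC hM) (fkalg_tens hA hCM) hN (tensA_ass hA hC hM))).
apply: (iso_trans (tensA_isol (fkalg_tens hA hCM) (fkalg_tens hA hMC) hN (tensA_isor hA hCM hMC (end_swap hC oM)))).
apply: (iso_trans (tensA_isol (fkalg_tens hA hMC) (fkalg_tens hAM hC) hN (iso_sym (tensA_ass hA hM hC)))).
exact: tensA_ass.
Qed.
Lemma beq_tens A A' C C' : fkalg A -> fkalg A' -> fkalg C -> fkalg C' ->
  beq A A' -> beq C C' -> beq (tensA A C) (tensA A' C').
Proof.
move=> hA hA' hC hC' /beqP[M [N [oM oN i]]] /beqP[M' [N' [oM' oN' i']]].
have [hM hN hM' hN'] := And4 (fkalg_end oM) (fkalg_end oN) (fkalg_end oM') (fkalg_end oN').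
apply/beqP; exists (tensB M M'), (tensB N N'); split; try exact: fobj_tens.
apply: (iso_trans (tens_shuffle hA hC oM oM')); apply: iso_sym.
apply: (iso_trans (tens_shuffle hA' hC' oN oN')); apply: iso_sym.
exact (tensA_iso (proj1 (fkalg_tens hA hM)) (proj1 (fkalg_tens hC hM')) (proj1 (fkalg_tens hA' hN))
  (proj1 (fkalg_tens hC' hN')) i i').
Qed.
(** Each of the two algebras is stabilised by the other one, and [end_swap] compares the results. *)
Lemma beq_end M N : fobj M -> fobj N -> beq (endA M) (endA N).
Proof.
move=> oM oN; apply/beqP; exists N, M; split=> //.
exact: (end_swap (fkalg_end oM) oN).
Qed.
Lemma beq_tens1 A : fkalg A -> beq (tensA A (endA U1)) A.
Proof.
move=> hA; apply/beqP; exists U1, (tensB U1 U1); split; [exact: fobj1 | exact: (fobj_tens fobj1 fobj1) |].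
exact: (tens_end_end hA fobj1 fobj1).
Qed.
Lemma beq_1tens A : fkalg A -> beq (tensA (endA U1) A) A.
Proof.
move=> hA; have h1 := fkalg_end fobj1.
apply: (beq_trans (fkalg_tens h1 hA) (fkalg_tens hA h1) hA); last exact: beq_tens1.
apply: (iso_beq (fkalg_tens h1 hA) (fkalg_tens hA h1)); exact: (iso_sym (end_swap hA fobj1)).
Qed.

Lemma end1_azumaya : azumaya (endA U1).
Proof.
have i1 : cancel (lid B) (lid B) by [].
have i2 x y : lid B (hmul hB (pure x y)) = hmul hB (pure (lid B x) (lid B y)) by [].
have i3 : lid B (hone hB) = hone hB by [].
exact (endA_azumaya i1 i2 i3 lid_S unitB_byd unitB_trivH unitB_dim unitB_nz).
Qed.

Local Notation brclass := (brclass hH hB).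
Local Notation BQ := (BQ hH hB).
Lemma brclass_eq A A' : azumaya A -> azumaya A' -> (brclass A = brclass A' <-> beq A A').
Proof.
move=> aA aA'; have [hA hA'] := (azumaya_fkalg aA, azumaya_fkalg aA').
split=> [E|b].
  have : brclass A A by split=> //; exact: beq_refl.
  by rewrite E => -[].
apply: funext => X; apply: propext; split=> -[aX bX]; split=> //; have hX := azumaya_fkalg aX.
  exact: (beq_trans hX hA hA').
by apply: (beq_trans hX hA' hA) => //; exact: beq_sym.
Qed.
Lemma BQ_mulE A A' : azumaya A -> azumaya A' -> gmul BQ (brclass A) (brclass A') = brclass (tensA A A').
Proof.
move=> aA aA'; have [hA hA'] := (azumaya_fkalg aA, azumaya_fkalg aA').
apply: funext => X; apply: propext; split=> [[C [C' [[aC bC] [aC' bC'] [aX bX]]]]|bX].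
  split; first exact aX.
  have [hC hC' hX] := And3 (azumaya_fkalg aC) (azumaya_fkalg aC') (azumaya_fkalg aX).
  apply: (beq_trans hX (fkalg_tens hC hC') (fkalg_tens hA hA') bX).
  exact: beq_tens.
by exists A, A'; split=> //; split=> //; exact: beq_refl.
Qed.
Lemma BQ_oneE : gone BQ = brclass (endA U1).
Proof.
apply: funext => X; apply: propext; split=> [[M [/bydP gM nM fM [aX bX]]]|bX].
  split=> //; have hX := azumaya_fkalg aX; have oM : fobj M by split.
  apply: (beq_trans hX (fkalg_end oM) (fkalg_end fobj1) bX).
  exact: beq_end oM fobj1.
exists U1; split; [exact/bydP/unitB_byd | exact unitB_nz | by exists 1%N; exact unitB_dim | exact bX].
Qed.
Lemma BQ_group : is_group BQ.
Proof.
have h1 := fkalg_end fobj1; have a1 := end1_azumaya.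
have mA A C D : azumaya A -> azumaya C -> azumaya D ->
    gmul BQ (brclass A) (gmul BQ (brclass C) (brclass D)) = gmul BQ (gmul BQ (brclass A) (brclass C)) (brclass D).
  move=> aA aC aD; have [hA hC hD] := And3 (azumaya_fkalg aA) (azumaya_fkalg aC) (azumaya_fkalg aD).
  have [aAC aCD] := (tensA_azumaya aA aC, tensA_azumaya aC aD).
  rewrite (BQ_mulE aC aD) (BQ_mulE aA aCD) (BQ_mulE aA aC) (BQ_mulE aAC aD).
  apply/(brclass_eq (tensA_azumaya aA aCD) (tensA_azumaya aAC aD)); apply: beq_sym.
  exact (iso_beq (fkalg_tens (fkalg_tens hA hC) hD) (fkalg_tens hA (fkalg_tens hC hD)) (tensA_ass hA hC hD)).
have mI A : azumaya A -> gmul BQ (brclass A) (brclass (oppA hH hB A)) = gone BQ.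
  move=> aA; have aO := oppA_azumaya aA; have [hA hO] := (azumaya_fkalg aA, azumaya_fkalg aO).
  rewrite (BQ_mulE aA aO) BQ_oneE; apply/(brclass_eq (tensA_azumaya aA aO) a1).
  have oA : fobj A by case: aA => /algP[gA _ _ _ _ _ _ _ _] nA fA _ _; split.
  apply: (beq_trans (fkalg_tens hA hO) (fkalg_end oA) h1); last exact: beq_end oA fobj1.
  exact: (iso_beq (fkalg_tens hA hO) (fkalg_end oA) (azF_iso aA)).
have m1 A : azumaya A -> gmul BQ (gone BQ) (brclass A) = brclass A /\ gmul BQ (brclass A) (gone BQ) = brclass A.
  move=> aA; have hA := azumaya_fkalg aA; rewrite BQ_oneE (BQ_mulE a1 aA) (BQ_mulE aA a1); split.
    by apply/(brclass_eq (tensA_azumaya a1 aA) aA); exact (beq_1tens hA).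
  by apply/(brclass_eq (tensA_azumaya aA a1) aA); exact (beq_tens1 hA).
split.
- move=> x y [A aA ->] [C aC ->]; rewrite (BQ_mulE aA aC).
  by exists (tensA A C); [exact (tensA_azumaya aA aC) |].
- by move=> x y z [A aA ->] [C aC ->] [D aD ->]; exact (mA A C D aA aC aD).
- by exists (endA U1); [exact a1 | exact BQ_oneE].
- by move=> x [A aA ->]; exact (m1 A aA).
move=> x [A aA ->]; have aO := oppA_azumaya aA; have aOO := oppA_azumaya aO.
exists (brclass (oppA hH hB A)); first by exists (oppA hH hB A); [exact aO |].
split; first exact (mI A aA).
(* Only right inverses are available so far. The double opposite is a right inverse of the opposite
   of [A], hence has the same class as [A], and the right inverse becomes two-sided. *)
have -> : brclass A = brclass (oppA hH hB (oppA hH hB A)).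
  have E := mA _ _ _ aA aO aOO.
  have e1 := congr1 (gmul BQ (brclass A)) (mI _ aO).
  have e2 := congr1 (fun w => gmul BQ w (brclass (oppA hH hB (oppA hH hB A)))) (mI _ aA).
  exact (etrans (esym (m1 _ aA).2) (etrans (esym e1) (etrans E (etrans e2 (m1 _ aOO).1)))).
exact (mI _ aO).
Qed.
End BrauerGroup.

(** * The map Pi *)

Section TwistUniqueness.
Section Twists.
Variables (X : lmodType k) (h : hopf X).
Hypothesis hopfX : is_hopf (flip X X) h.
Hypothesis bijS : bijective (antip h).
Local Notation "x ∙ y" := (hmul h (pure x y)) (at level 40, left associativity).
Local Notation one := (hone h).
Local Notation D := (hcom h).
Local Notation e := (hcou h).
Local Notation S := (hant h).
Local Notation Sb := (hantV h).

(** Schur's lemma with coefficients in [W]: a map commuting with all rank one operators is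
    determined by its value at one basis vector. *)
Lemma scalar_of_central (V : lmodType k) n (W : lmodType k) (G : {linear V -> tens W V}) :
  hasdim n V -> nonzero V -> (forall (p : LinMap V V) m, G (p m) = \sw_(w, v <- G m) pure w (p v)) ->
  exists w, forall m, G m = pure w m.
Proof.
move=> fdV [v v0] Gc; have [b [c [bE cE]]] := findim_basis fdV.
have [i ci] : exists i, (c i v : k) != 0.
  apply/existsP; apply: contra_neqT v0; rewrite negb_exists => /forallP c0.
  by rewrite (bE v) big1 // => i _; have /negPn/eqP -> := c0 i; rewrite scale0r.
exists (\sw_(w, u <- G (b i)) (c i u : k) *: w) => m.
have {1}-> : m = rank1 (c i) m (b i) by rewrite rank1E cE eqxx scale1r.
rewrite Gc sw_purel; apply: sw_ext => w u.
by rewrite rank1E pureZl pureZr.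
Qed.

Lemma pure_inj (V W : lmodType k) n (v : V) (w w' : W) : hasdim n V -> v != 0 -> pure w v = pure w' v -> w = w'.
Proof.
move=> fdV v0 E; have [b [c [bE cE]]] := findim_basis fdV.
have [i ci] : exists i, (c i v : k) != 0.
  apply/existsP; apply: contra_neqT v0; rewrite negb_exists => /forallP c0.
  by rewrite (bE v) big1 // => i _; have /negPn/eqP -> := c0 i; rewrite scale0r.
have Fb : bilin (fun (w : W) (v : V) => (c i v : k) *: w) by lin.
have : (c i v : k) *: w = (c i v : k) *: w' by rewrite -(sw_pure w v Fb) E sw_pure.
by move/(congr1 (fun x => (c i v : k)^-1 *: x)); rewrite !scalerA mulVf // !scale1r.
Qed.

Variables (V : lmodType k) (n0 : nat).
Hypothesis fdV : hasdim n0 V.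
Hypothesis nzV : nonzero V.
Variables (mu mu' : {linear tens X V -> V}) (la la' : {linear V -> tens X V}).
Variable ga : {linear X -> X}.
Variable act : {linear tens X (LinMap V V) -> LinMap V V}.
Variable rho : {linear LinMap V V -> tens X (LinMap V V)}.
Hypotheses (Va : isact h mu) (Vc : iscoact h la) (Vy : isYD h (lid X) ga mu la).
Hypotheses (Va' : isact h mu') (Vc' : iscoact h la') (Vy' : isYD h (lid X) (lid X) mu' la').
Hypotheses (aE : is_homact h mu mu act) (aE' : is_homact h mu' mu' act).
Hypotheses (rE : is_homcoact h la la rho) (rE' : is_homcoact h la' la' rho) (rc : iscoact h rho).

Lemma yd_cancel (W : lmodType k) (F : X -> V -> W) (K : {linear X -> X}) c m : bilin F ->
  \sw_(b', b <- D c) \sw_(b1, b2 <- D b) \sw_(y, n <- la (mu (pure b1 (mu (pure (Sb b') m))))) F (y ∙ K b2) n =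
  \sw_(y, n <- la m) F (y ∙ K c) n.
Proof.
move=> Fb; have [mA m1] := Va.
rewrite -(hcomA hopfX (F := fun b' b1 b2 => \sw_(y, n <- la (mu (pure b1 (mu (pure (Sb b') m))))) F (y ∙ K b2) n)); last by lin.
rewrite -[RHS](hcou1l hopfX (F := fun c => \sw_(y, n <- la m) F (y ∙ K c) n)); last by lin.
apply: sw_ext => b b2.
transitivity (\sw_(b', b1 <- D b) \sw_(y, n <- la (mu (pure (b1 ∙ Sb b') m))) F (y ∙ K b2) n).
  by apply: sw_ext => b' b1; rewrite mA.
rewrite (hantVr hopfX bijS (F := fun w => \sw_(y, n <- la (mu (pure w m))) F (y ∙ K b2) n)); last by lin.
by rewrite m1.
Qed.
Lemma coact_antl (W : lmodType k) (F : X -> V -> W) c m : bilin F ->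
  \sw_(u, m' <- la m) \sw_(y, n <- la m') F (S u ∙ (y ∙ c)) n = F c m.
Proof.
move=> Fb; have [Fl Fr] := Fb; have [lA l1] := Vc.
rewrite -(lA _ (fun u y n => F (S u ∙ (y ∙ c)) n)); last by lin.
rewrite -[RHS](l1 _ (fun m => F c m)) //; apply: sw_ext => u n.
transitivity (\sw_(a, b <- D u) F ((S a ∙ b) ∙ c) n).
  by apply: sw_ext => a b; rewrite (hmulA hopfX).
by rewrite (hantl hopfX (F := fun w => F (w ∙ c) n)) ?(hmul1l hopfX) //; lin.
Qed.
(** Letting Sb(b') act first and multiplying by S(u) isolates K(c) (x) v, with v nonzero. So a map
    entering the condition as a twist is determined by the module. *)
Lemma yd_unique (K K' : {linear X -> X}) :
  (forall (W : lmodType k) (F : X -> V -> W) b m, bilin F ->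
    \sw_(b1, b2 <- D b) \sw_(y, n <- la (mu (pure b1 m))) F (y ∙ K b2) n =
    \sw_(b1, b2 <- D b) \sw_(y, n <- la (mu (pure b1 m))) F (y ∙ K' b2) n) -> K =1 K'.
Proof.
move=> KE c; have [v v0] := nzV.
apply: (pure_inj fdV v0).
have E (Q : {linear X -> X}) : pure (Q c) v = \sw_(u, m' <- la v) \sw_(b', b <- D c) \sw_(b1, b2 <- D b)
    \sw_(y, n <- la (mu (pure b1 (mu (pure (Sb b') m'))))) pure (S u ∙ (y ∙ Q b2)) n.
  rewrite -(coact_antl (F := fun w n => pure w n)); last by lin.
  apply: sw_ext => u m'.
  by rewrite (yd_cancel (F := fun w n => pure (S u ∙ w) n)) //; lin.
rewrite (E K) (E K'); apply: sw_ext => u m'; apply: sw_ext => b' b.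
by apply: (KE _ (fun w n => pure (S u ∙ w) n)); lin.
Qed.

(** Measures the difference of the two actions. Since both induce the same action on End(V), z b
    commutes with every operator and is a scalar; this scalar is the character lam. *)
Let z b m := \sw_(b1, b2 <- D b) mu (pure (S b1) (mu' (pure b2 m))).
Let z_central b (p : LinMap V V) m : z b (p m) = p (z b m).
Proof.
have [mA m1] := Va; have [mA' m1'] := Va'.
(* Both expressions use four components of b. The middle pair is the action on the operator p, which
   may be computed with [mu] or with [mu']; the outer pair is z before, respectively after, p. *)
pose G b1 b2 b3 b4 := mu (pure (S b1) (mu (pure b2 (p (mu (pure (S b3) (mu' (pure b4 m)))))))).
pose G' b1 b2 b3 b4 := mu (pure (S b1) (mu' (pure b2 (p (mu' (pure (S b3) (mu' (pure b4 m)))))))).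
have mid q : \sw_(b2, b3 <- D q) mu (pure b2 (p (mu (pure (S b3) m)))) = \sw_(b2, b3 <- D q) mu' (pure b2 (p (mu' (pure (S b3) m)))).
  by rewrite -aE aE'.
have E1 : \sw_(b1, r <- D b) \sw_(q, b4 <- D r) \sw_(b2, b3 <- D q) G b1 b2 b3 b4 = p (z b m).
  transitivity (\sw_(b1, r <- D b) \sw_(b2, r' <- D r) \sw_(b3, b4 <- D r') G b1 b2 b3 b4).
    by apply: sw_ext => b1 r; rewrite (hcomA hopfX (F := fun b2 b3 b4 => G b1 b2 b3 b4)) //; rewrite /G; lin.
  rewrite -(hcomA hopfX (F := fun b1 b2 r' => \sw_(b3, b4 <- D r') G b1 b2 b3 b4)); last by rewrite /G; lin.
  transitivity (\sw_(a, r' <- D b) (e a : k) *: p (z r' m)).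
    apply: sw_ext => a r'; rewrite sw_C.
    rewrite /z sw_lin sw_scale; apply: sw_ext => b3 b4.
    transitivity (\sw_(b1, b2 <- D a) mu (pure (S b1 ∙ b2) (p (mu (pure (S b3) (mu' (pure b4 m))))))).
      by apply: sw_ext => b1 b2; rewrite mA.
    by rewrite (hantl hopfX (F := fun w => mu (pure w (p (mu (pure (S b3) (mu' (pure b4 m)))))))) ?m1 //; lin.
  by rewrite (hcou1l hopfX (F := fun b => p (z b m))) // /z; lin.
have E2 : \sw_(b1, r <- D b) \sw_(q, b4 <- D r) \sw_(b2, b3 <- D q) G' b1 b2 b3 b4 = z b (p m).
  rewrite /z; apply: sw_ext => b1 r.
  rewrite (hcomA hopfX (F := fun b2 b3 b4 => G' b1 b2 b3 b4)); last by rewrite /G'; lin.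
  rewrite -[RHS](hcou1r hopfX (F := fun b2 => mu (pure (S b1) (mu' (pure b2 (p m)))))); last by lin.
  apply: sw_ext => b2 r'.
  transitivity (\sw_(b3, b4 <- D r') mu (pure (S b1) (mu' (pure b2 (p (mu' (pure (S b3 ∙ b4) m))))))).
    by apply: sw_ext => b3 b4; rewrite mA'.
  by rewrite (hantl hopfX (F := fun w => mu (pure (S b1) (mu' (pure b2 (p (mu' (pure w m)))))))) ?m1' //; lin.
rewrite -E1 -E2; apply: sw_ext => b1 r; apply: sw_ext => q b4.
have mid' m' : \sw_(b2, b3 <- D q) mu (pure b2 (p (mu (pure (S b3) m')))) = \sw_(b2, b3 <- D q) mu' (pure b2 (p (mu' (pure (S b3) m')))).
  by rewrite -aE aE'.
have := congr1 (fun w => mu (pure (S b1) w)) (mid' (mu' (pure b4 m))).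
by rewrite !sw_purer !sw_lin => ->.
Qed.

Lemma twist_character : exists lam : {linear X -> k^o},
  [/\ forall x y, lam (x ∙ y) = (lam x : k) * lam y, lam one = (1 : k) &
      forall b m, mu' (pure b m) = \sw_(b1, b2 <- D b) (lam b2 : k) *: mu (pure b1 m)].
Proof.
have [mA m1] := Va; have [mA' m1'] := Va'; have [v v0] := nzV.
have zl m : linear (fun b => z b m) by rewrite /z; lin.
have zl' b : linear (z b) by rewrite /z; lin.
have [b [c [bE cE]]] := findim_basis fdV.
have [i ci] : exists i, (c i v : k) != 0.
  apply/existsP; apply: contra_neqT v0; rewrite negb_exists => /forallP c0.
  by rewrite (bE v) big1 // => i _; have /negPn/eqP -> := c0 i; rewrite scale0r.
have ll : linear (fun x => c i (z x (b i)) : k^o) by lin.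
pose lam : {linear X -> k^o} := mkLin ll.
have zE x m : z x m = (lam x : k) *: m.
  have {1}-> : m = rank1 (c i) m (b i) by rewrite rank1E cE eqxx scale1r.
  by rewrite z_central rank1E.
have vE (s t : k) : s *: v = t *: v -> s = t.
  move=> E; apply/eqP; rewrite -subr_eq0; apply/eqP.
  have : (s - t) *: v = 0 by rewrite scalerBl E subrr.
  by move/eqP; rewrite scaler_eq0 (negbTE v0) orbF => /eqP.
exists lam; split.
- move=> x y; apply: vE; rewrite -zE /z (hcomM hopfX); last by lin.
  transitivity (\sw_(a, b0 <- D x) \sw_(c0, d <- D y) mu (pure (S c0) (mu (pure (S a) (mu' (pure b0 (mu' (pure d v)))))))).
    by apply: sw_ext => a b0; apply: sw_ext => c0 d; rewrite (hantM hopfX) mA mA'.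
  rewrite sw_C.
  transitivity (\sw_(c0, d <- D y) mu (pure (S c0) (z x (mu' (pure d v))))).
    by apply: sw_ext => c0 d; rewrite /z sw_purer sw_lin.
  transitivity ((lam x : k) *: z y v); last by rewrite zE scalerA.
  rewrite [z y v]/z sw_scale; apply: sw_ext => c0 d.
  by have := zE x (mu' (pure d v)) => ->; rewrite pureZr linearZ.
- apply: vE; rewrite -zE scale1r /z (hcom1 hopfX) sw_pure; last by lin.
  by rewrite (hant1 hopfX) m1' m1.
move=> x m.
transitivity (\sw_(b1, b2 <- D x) mu (pure b1 (z b2 m))); last first.
  by apply: sw_ext => b1 b2; rewrite zE pureZr linearZ.
transitivity (\sw_(b1, r <- D x) \sw_(b2, b3 <- D r) mu (pure (b1 ∙ S b2) (mu' (pure b3 m)))); last first.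
  by apply: sw_ext => b1 r; rewrite /z sw_purer sw_lin; apply: sw_ext => b2 b3; rewrite mA.
rewrite -(hcomA hopfX (F := fun b1 b2 b3 => mu (pure (b1 ∙ S b2) (mu' (pure b3 m))))); last by lin.
rewrite -[LHS](hcou1l hopfX (F := fun b => mu' (pure b m))); last by lin.
apply: sw_ext => a b3.
by rewrite (hantr hopfX (F := fun w => mu (pure w (mu' (pure b3 m))))) ?m1 //; lin.
Qed.

(** The same comparison for coactions: S(m_(-1)) times the second coaction of m_(0) commutes with
    every operator, so it is g (x) m for a fixed g. Coassociativity and counitality of the second
    coaction make g group-like. *)
Lemma twist_grouplike : exists g : X, [/\ D g = pure g g, e g = (1 : k) &
  forall (W : lmodType k) (F : X -> V -> W) m, bilin F -> teval F (la' m) = \sw_(y, n <- la m) F (y ∙ g) n].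
Proof.
have [lA l1] := Vc; have [lA' l1'] := Vc'; have [rA r1] := rc; have [v v0] := nzV.
have Gl : linear (fun m => \sw_(u, m' <- la m) \sw_(y, n <- la' m') pure (S u ∙ y) n) by lin.
pose G : {linear V -> tens X V} := mkLin Gl.
have GE m : G m = \sw_(u, m' <- la m) \sw_(y, n <- la' m') pure (S u ∙ y) n by [].
have Gc (p : LinMap V V) m : G (p m) = \sw_(w, v <- G m) pure w (p v).
  rewrite !GE -(homcoact_cancel hopfX bijS (F := fun u m' => \sw_(y, n <- la' m') pure (S u ∙ y) n) p m rE Vc); last by lin.
  transitivity (\sw_(x, p' : LinMap V V <- rho p) \sw_(x', q : LinMap V V <- rho p') \sw_(u, m' <- la m)
      \sw_(y, n <- la' m') pure (S u ∙ ((S x ∙ x') ∙ y)) (q n)).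
    apply: sw_ext => x p'; rewrite [RHS]sw_C; apply: sw_ext => u m'.
    rewrite -(homcoact_cancel hopfX bijS (F := fun y n => pure (S (x ∙ u) ∙ y) n) p' m' rE' Vc'); last by lin.
    apply: sw_ext => x' q; apply: sw_ext => y n.
    by rewrite (hantM hopfX) !(hmulA hopfX).
  rewrite -(rA _ (fun x x' (q : LinMap V V) => \sw_(u, m' <- la m)
      \sw_(y, n <- la' m') pure (S u ∙ ((S x ∙ x') ∙ y)) (q n))); last first.
    split=> [x' q|x q|x x']; [by lin|by lin|].
    apply: (@lin_swF _ _ _ _ _ _ (fun (q : LinMap V V) u m' => \sw_(y, n <- la' m') pure (S u ∙ ((S x ∙ x') ∙ y)) (q n))) => u m'.
    apply: (@lin_swF _ _ _ _ _ _ (fun (q : LinMap V V) y n => pure (S u ∙ ((S x ∙ x') ∙ y)) (q n))) => y n.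
    by apply: lin_purer => a s t.
  transitivity (\sw_(x, q : LinMap V V <- rho p) (e x : k) *: \sw_(u, m' <- la m) \sw_(y, n <- la' m') pure (S u ∙ y) (q n)).
    apply: sw_ext => x q.
    rewrite (hantl hopfX (F := fun w => \sw_(u, m' <- la m) \sw_(y, n <- la' m') pure (S u ∙ (w ∙ y)) (q n))); last by lin.
    by congr (_ *: _); apply: sw_ext => u m'; apply: sw_ext => y n; rewrite (hmul1l hopfX).
  rewrite (r1 _ (fun q : LinMap V V => \sw_(u, m' <- la m) \sw_(y, n <- la' m') pure (S u ∙ y) (q n))); last first.
    apply: (@lin_swF _ _ _ _ _ _ (fun (q : LinMap V V) u m' => \sw_(y, n <- la' m') pure (S u ∙ y) (q n))) => u m'.
    apply: (@lin_swF _ _ _ _ _ _ (fun (q : LinMap V V) y n => pure (S u ∙ y) (q n))) => y n.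
    by apply: lin_purer => a s t.
  rewrite sw_sw; last by lin.
  by apply: sw_ext => u m'; rewrite sw_sw; [apply: sw_ext => y n; rewrite sw_pure //; lin | lin].
have [g gE] := scalar_of_central fdV nzV Gc.
have laE (W : lmodType k) (F : X -> V -> W) m : bilin F -> teval F (la' m) = \sw_(y, n <- la m) F (y ∙ g) n.
  move=> Fb; have [Fl Fr] := Fb.
  transitivity (\sw_(u, m' <- la m) \sw_(x, n <- G m') F (u ∙ x) n); last first.
    by apply: sw_ext => u m'; rewrite gE sw_pure //; lin.
  transitivity (\sw_(u, m' <- la m) \sw_(u', m'' <- la m') \sw_(y, n <- la' m'') F ((u ∙ S u') ∙ y) n); last first.
    apply: sw_ext => u m'; rewrite GE sw_sw; last by lin.
    apply: sw_ext => u' m''; rewrite sw_sw; last by lin.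
    by apply: sw_ext => y n; rewrite sw_pure ?(hmulA hopfX) //; lin.
  rewrite -(lA _ (fun u u' m'' => \sw_(y, n <- la' m'') F ((u ∙ S u') ∙ y) n)); last by lin.
  rewrite -[LHS](l1 _ (fun m => teval F (la' m))); last by lin.
  apply: sw_ext => u m'.
  rewrite (hantr hopfX (F := fun w => \sw_(y, n <- la' m') F (w ∙ y) n)); last by lin.
  by congr (_ *: _); apply: sw_ext => y n; rewrite (hmul1l hopfX).
exists g; split=> //.
- apply: (pure_inj fdV v0).
  pose T x y n : tens (tens X X) V := pure (pure x y) n.
  have E1 : \sw_(y, n <- la' v) \sw_(a, b <- D y) T a b n = \sw_(y, n <- la' v) \sw_(z, n' <- la' n) T y z n'.
    by apply: lA'; rewrite /T; lin.
  (* Multiplication by the coproduct of S(u) isolates a tensor s in front of v, so that the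
     coproduct of g and g (x) g can be compared inside the coaction. *)
  have E2 (s : tens X X) : pure s v = \sw_(u, m' <- la v) \sw_(y, n <- la m') \sw_(a, b <- D (S u ∙ y))
     \sw_(p, q <- s) T (a ∙ p) (b ∙ q) n.
    rewrite -(lA _ (fun u y n => \sw_(a, b <- D (S u ∙ y)) \sw_(p, q <- s) T (a ∙ p) (b ∙ q) n)); last by rewrite /T; lin.
    rewrite -[LHS](l1 _ (fun m => pure s m)); last by lin.
    apply: sw_ext => u m'.
    rewrite (hantl hopfX (F := fun w => \sw_(a, b <- D w) \sw_(p, q <- s) T (a ∙ p) (b ∙ q) m')); last by rewrite /T; lin.
    rewrite (hcom1 hopfX) sw_pure; last by rewrite /T; lin.
    congr (_ *: _); rewrite -[s in LHS]sw_id sw_purel; apply: sw_ext => p q.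
    by rewrite !(hmul1l hopfX).
  have E3 (s : tens X X) u m' : \sw_(y, n <- la m') \sw_(a, b <- D (S u ∙ y)) \sw_(p, q <- s) T (a ∙ p) (b ∙ q) n =
     \sw_(c, d <- D (S u)) \sw_(y, n <- la m') \sw_(a, b <- D y) \sw_(p, q <- s) T (c ∙ (a ∙ p)) (d ∙ (b ∙ q)) n.
    rewrite [RHS]sw_C; apply: sw_ext => y n; rewrite (hcomM hopfX); last by rewrite /T; lin.
    by apply: sw_ext => c d; apply: sw_ext => a b; apply: sw_ext => p q; rewrite !(hmulA hopfX).
  rewrite (E2 (D g)) (E2 (pure g g)); apply: sw_ext => u m'; rewrite !E3; apply: sw_ext => c d.
  transitivity (\sw_(y, n <- la' m') \sw_(a, b <- D y) T (c ∙ a) (d ∙ b) n).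
    rewrite laE; last by rewrite /T; lin.
    by apply: sw_ext => y n; rewrite (hcomM hopfX) //; rewrite /T; lin.
  rewrite (lA' _ (fun a b n => T (c ∙ a) (d ∙ b) n)); last by rewrite /T; lin.
  rewrite laE; last by rewrite /T; lin.
  transitivity (\sw_(y, n <- la m') \sw_(z, n' <- la n) T (c ∙ (y ∙ g)) (d ∙ (z ∙ g)) n').
    by apply: sw_ext => y n; rewrite laE //; rewrite /T; lin.
  rewrite -(lA _ (fun y z n' => T (c ∙ (y ∙ g)) (d ∙ (z ∙ g)) n')); last by rewrite /T; lin.
  by apply: sw_ext => y n; apply: sw_ext => a b; rewrite sw_pure //; rewrite /T; lin.
- have E := l1' _ (fun m => m) v (@lin_id _ _).
  rewrite laE in E; last by lin.
  have E2 : (e g : k) *: v = v.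
    rewrite -[RHS]E -[v in LHS](l1 _ (fun m => m) v (@lin_id _ _)) sw_scale.
    by apply: sw_ext => y n; rewrite (hcouM hopfX) scalerA mulrC.
  apply/eqP; rewrite -subr_eq0; apply/eqP.
  have : ((e g : k) - 1) *: v = 0 by rewrite scalerBl E2 scale1r subrr.
  by move/eqP; rewrite scaler_eq0 (negbTE v0) orbF => /eqP.
Qed.

(** The second structure, expressed through the first, is inserted into its untwisted condition and
    compared with the [ga]-twisted condition of the first; [yd_unique] then removes the module. *)
Lemma twist_extract : exists (lam : {linear X -> k^o}) (g : X),
  [/\ (forall x y, lam (x ∙ y) = (lam x : k) * lam y) /\ lam one = (1 : k),
      D g = pure g g /\ e g = (1 : k) &
      forall b, \sw_(b1, b2 <- D b) (lam b1 : k) *: (g ∙ b2) = \sw_(b1, b2 <- D b) (lam b2 : k) *: (ga b1 ∙ g)].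
Proof.
have [lam [lamM lam1 muE]] := twist_character; have [g [gD ge laE]] := twist_grouplike.
exists lam, g; split=> //.
have K1l : linear (fun b => \sw_(b1, b2 <- D b) (lam b1 : k) *: (g ∙ b2)) by lin.
have K2l : linear (fun b => \sw_(b1, b2 <- D b) (lam b2 : k) *: (ga b1 ∙ g)) by lin.
suff E : mkLin K1l =1 mkLin K2l by move=> b; exact: E b.
apply: yd_unique => W F b m Fb; have [Fl Fr] := Fb.
transitivity (\sw_(b1, b2 <- D b) \sw_(y, n <- la' (mu' (pure b1 m))) F (y ∙ b2) n).
  transitivity (\sw_(a, b3 <- D b) \sw_(b1, b2 <- D a) (lam b2 : k) *: \sw_(y, n <- la (mu (pure b1 m))) F (y ∙ (g ∙ b3)) n).
    rewrite (hcomA hopfX (F := fun b1 b2 b3 => (lam b2 : k) *: \sw_(y, n <- la (mu (pure b1 m))) F (y ∙ (g ∙ b3)) n)); last by lin.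
    apply: sw_ext => b1 b2; rewrite [RHS](_ : _ = \sw_(y, n <- la (mu (pure b1 m))) F (y ∙ (mkLin K1l b2)) n) //.
    rewrite -[mkLin K1l b2]/(\sw_(b1, b2 <- D b2) (lam b1 : k) *: (g ∙ b2)).
    transitivity (\sw_(y, n <- la (mu (pure b1 m))) \sw_(c, d <- D b2) (lam c : k) *: F (y ∙ (g ∙ d)) n).
      by rewrite sw_C; apply: sw_ext => c d; rewrite -sw_scale.
    apply: sw_ext => y n; have Gl : linear (fun w => F (y ∙ w) n) by lin.
    by rewrite (sw_linear _ _ Gl); apply: sw_ext => c d; rewrite (linZ _ _ Gl).
  apply: sw_ext => a b3; rewrite muE.
  have Gl : linear (fun w => \sw_(y, n <- la' w) F (y ∙ b3) n) by lin.
  rewrite (sw_linear _ _ Gl); apply: sw_ext => b1 b2.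
  rewrite (linZ _ _ Gl).
  congr (_ *: _); rewrite (laE _ (fun y n => F (y ∙ b3) n)); last by lin.
  by apply: sw_ext => y n; rewrite (hmulA hopfX).
rewrite (Vy' (F := F)) //.
transitivity (\sw_(b1, r <- D b) \sw_(b2, b3 <- D r) (lam b3 : k) *: \sw_(y, n <- la m) F (b1 ∙ y ∙ g) (mu (pure b2 n))).
  apply: sw_ext => b1 r; rewrite (laE _ (fun y n => F (b1 ∙ y) (mu' (pure r n)))); last by lin.
  transitivity (\sw_(y, n <- la m) \sw_(b2, b3 <- D r) (lam b3 : k) *: F (b1 ∙ y ∙ g) (mu (pure b2 n))).
    apply: sw_ext => y n; rewrite muE (sw_linear _ _ (Fr _)); apply: sw_ext => b2 b3.
    by rewrite (linZ _ _ (Fr _)) (hmulA hopfX).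
  by rewrite sw_C; apply: sw_ext => b2 b3; rewrite sw_scale.
rewrite -(hcomA hopfX (F := fun b1 b2 b3 => (lam b3 : k) *: \sw_(y, n <- la m) F (b1 ∙ y ∙ g) (mu (pure b2 n)))); last by lin.
transitivity (\sw_(a, b3 <- D b) \sw_(b1, b2 <- D a) (lam b3 : k) *: \sw_(y, n <- la (mu (pure b1 m))) F (y ∙ ga b2 ∙ g) n).
  apply: sw_ext => a b3; rewrite -!sw_scale; congr (_ *: _).
  by rewrite (Vy (F := fun w n => F (w ∙ g) n)) //; lin.
rewrite (hcomA hopfX (F := fun b1 b2 b3 => (lam b3 : k) *: \sw_(y, n <- la (mu (pure b1 m))) F (y ∙ ga b2 ∙ g) n)); last by lin.
apply: sw_ext => b1 b2.
rewrite -[mkLin K2l]/(mkLin K2l) -[RHS](_ : \sw_(y, n <- la (mu (pure b1 m))) \sw_(c, d <- D b2) (lam d : k) *: F (y ∙ (ga c ∙ g)) n = _).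
  by rewrite sw_C; apply: sw_ext => c d; rewrite sw_scale; apply: sw_ext => y n; rewrite (hmulA hopfX).
apply: sw_ext => y n; rewrite -[mkLin K2l b2]/(\sw_(b1, b2 <- D b2) (lam b2 : k) *: (ga b1 ∙ g)).
have Gl : linear (fun w => F (y ∙ w) n) by lin.
by rewrite (sw_linear _ _ Gl); apply: sw_ext => c d; rewrite (linZ _ _ Gl).
Qed.
End Twists.

Lemma dual_hit (V : lmodType k) n (x : V) : hasdim n V -> x != 0 -> exists d : {linear V -> k^o}, (d x : k) = 1.
Proof.
move=> fdV x0; have [e [c [eE cE]]] := findim_basis fdV.
have [i ci] : exists i, (c i x : k) != 0.
  apply/existsP; apply: contra_neqT x0; rewrite negb_exists => /forallP c0.
  by rewrite (eE x) big1 // => i _; have /negPn/eqP -> := c0 i; rewrite scale0r.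
have dl : linear (fun y => (c i x : k)^-1 *: c i y : k^o) by lin.
by exists (mkLin dl); rewrite -[LHS]/((c i x : k)^-1 * (c i x : k)) mulVf.
Qed.

(** A rank one idempotent p, built from v and d with d(v) = 1, has nonzero image, say f(p) w
    nonzero. Then u(x) = f(rank1 d x) w intertwines the two actions, and bijectivity follows by
    testing u against rank one operators. *)
Lemma skolem_noether (P Q : lmodType k) n m (f : {linear LinMap P P -> LinMap Q Q}) :
  hasdim n P -> hasdim m Q -> nonzero P -> bijective f ->
  (forall p q : LinMap P P, f (lcomp p q) = lcomp (f p) (f q)) ->
  exists u : {linear P -> Q}, bijective u /\ forall (p : LinMap P P) v, f p (u v) = u (p v).
Proof.
move=> fdP fdQ [v v0] fb fM; have [fK Kf] := linvP fb.
have [d dv] := dual_hit fdP v0.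
pose p : LinMap P P := rank1 d v.
have [w pw] : exists w, f p w != 0.
  apply/not_existsP => nw; have : f p = f 0.
    by rewrite linear0; apply: lin_ext => w; apply/eqP/negPn/negP; exact: nw.
  move/(can_inj fK) /(congr1 (fun q : LinMap P P => q v)).
  by rewrite /p rank1E dv scale1r => /eqP; rewrite (negbTE v0).
have ul : linear (fun x => f (rank1 d x) w).
  by apply: lin_ev; apply: lin_app; apply: lin_rank1; exact: lin_id.
pose u : {linear P -> Q} := mkLin ul.
have uE (q : LinMap P P) x : f q (u x) = u (q x).
  rewrite -[LHS]/(lcomp (f q) (f (rank1 d x)) w) -fM -[RHS]/(f (rank1 d (q x)) w).
  congr ((f _ : LinMap Q Q) w); apply: lin_ext => y.
  by rewrite -[LHS]/(q ((d y : k) *: x)) linearZ.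
exists u; split=> //.
have ui : injective u.
  apply: raddf_inj => x ux; apply/eqP/negPn/negP => x0; have [d' d'x] := dual_hit fdP x0.
  have := uE (rank1 d' v) x; rewrite ux linear0 rank1E d'x scale1r => /esym/eqP.
  by rewrite (negbTE pw).
have us y : exists x, u x = y.
  have [dd ddE] := dual_hit fdQ pw.
  exists (linv f (rank1 dd y) v); rewrite -uE Kf.
  by rewrite -[u v]/(f p w) rank1E ddE scale1r.
have [uV uVK] := choice us.
by exists uV => // x; apply: ui; rewrite uVK.
Qed.
End TwistUniqueness.

(** * Automorphisms, the modules B_al and multiplicativity of Pi *)

Section PiMorphism.
Local Notation "x ∙ y" := (hmul hB (pure x y)) (at level 40, left associativity).
Local Notation one := (hone hB).
Local Notation D := (hcom hB).
Local Notation e := (hcou hB).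
Local Notation S := (hant hB).
Local Notation Sb := (hantV hB).
Local Notation AutC := (AutC hB).
Local Notation BQ := (BQ hH hB).
Local Notation azumaya := (azumaya hH hB).
Local Notation beq := (beq hH hB).
Local Notation Balpha := (Balpha hH hB).

Record hauto (f : {linear B -> B}) : Prop := Hauto {
  au_bij : bijective f;
  au_M : forall x y, f (x ∙ y) = f x ∙ f y;
  au_1 : f one = one;
  au_com : forall (W : lmodType k) (F : B -> B -> W) x, bilin F ->
    teval F (D (f x)) = \sw_(a, b <- D x) F (f a) (f b);
  au_cou : forall x, e (f x) = e x;
  au_S : forall x, f (S x) = S (f x) }.

Lemma autP (f : wmap [:: ycar B] [:: ycar B]) : is_autC hB f <-> hauto (f : {linear B -> B}).
Proof.
split=> [[fb fm [E1 E2] [E3 E4] E5]|[fb fM f1 fcom fcou fS]].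
  split.
  - exact: fb.
  - by move=> x y; have := E1 (pure x y); wev; exact.
  - by have := E2 (1 : k^o); rewrite hcompE.
  - move=> W F x Fb; have E := E3 x; rewrite !hcompE in E.
    transitivity (teval F (bcomul hB (f x))); first by [].
    by rewrite E; swx (bcomul hB x) => a b; wev; rewrite sw_pure.
  - by move=> x; have := E4 x; rewrite hcompE.
  - by move=> x; have := E5 x; rewrite !hcompE.
split=> //.
- split; first by apply: tens_ext => x b; wev; rewrite -[yact B]/(ha B) !actB linearZ.
  move=> b; rewrite !hcompE -[ycoact B]/(hc B) !coactB.
  by wev.
- split; first by apply: tens_ext => x y; wev; exact: fM.
  by move=> c; rewrite !hcompE -[c]mulr1 -[c * 1]/(c *: (1 : k^o)) !linearZ; congr (_ *: _); exact: f1.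
- split; last by move=> x; rewrite hcompE; exact: fcou.
  move=> x; rewrite !hcompE; apply: teval_ext => W F [F1 F2].
  have Fb : bilin F by split=> [v|u]; [exact (F1 v) | exact (F2 u)].
  transitivity (\sw_(a, b <- D x) F (f a) (f b)); first exact (fcom W F x Fb).
  by symmetry; swx (bcomul hB x) => a b; wev; rewrite sw_pure.
Qed.

Lemma hauto_id : hauto (lid B).
Proof. by split=> //; exists (lid B). Qed.
Lemma hauto_comp f g : hauto f -> hauto g -> hauto (lcomp f g).
Proof.
move=> hf hg; split.
- exact (bij_comp (au_bij hf) (au_bij hg)).
- by move=> x y; rewrite /= (au_M hg) (au_M hf).
- by rewrite /= (au_1 hg) (au_1 hf).
- move=> W F x Fb; have [Fl Fr] := Fb; rewrite -[lcomp f g x]/(f (g x)) (au_com hf) // (au_com hg) //.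
  by lin.
- by move=> x; rewrite /= (au_cou hf) (au_cou hg).
- by move=> x; rewrite /= (au_S hg) (au_S hf).
Qed.
Lemma hauto_inv f : hauto f -> hauto (linv f).
Proof.
move=> hf; have [fK Kf] := linvP (au_bij hf); split.
- by exists f.
- by move=> x y; apply: (can_inj fK); rewrite (au_M hf) !Kf.
- by apply: (can_inj fK); rewrite (au_1 hf) !Kf.
- move=> W F x Fb; have [Fl Fr] := Fb; rewrite -{2}[x]Kf (au_com hf); last by lin.
  by apply: sw_ext => a b; rewrite !fK.
- by move=> x; rewrite -{2}[x]Kf (au_cou hf).
- by move=> x; apply: (can_inj fK); rewrite (au_S hf) !Kf.
Qed.
Lemma hauto_Sb f x : hauto f -> f (Sb x) = Sb (f x).
Proof.
move=> hf; apply: (can_inj (hantK bijB)).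
by rewrite -(au_S hf) !(hantVK bijB).
Qed.
Lemma linv_comp (f g : {linear B -> B}) : hauto f -> hauto g -> linv (lcomp f g) = lcomp (linv g) (linv f).
Proof.
move=> hf hg; have [fK Kf] := linvP (au_bij hf); have [gK Kg] := linvP (au_bij hg).
by apply: linv_uniq => x /=; rewrite ?fK ?gK ?Kg ?Kf.
Qed.

Lemma AutC_group : is_group AutC.
Proof.
split.
- by move=> f g /autP hf /autP hg; apply/autP; exact: hauto_comp.
- by move=> f g h _ _ _; exact: lin_ext.
- by apply/autP; exact: hauto_id.
- by move=> f _; split; exact: lin_ext.
move=> f /autP hf; have [fK Kf] := linvP (au_bij hf).
exists (linv f); first by apply/autP; exact: hauto_inv.
by split; exact: lin_ext.
Qed.

Lemma Balpha_act al b x : ba (Balpha al) (pure b x) = \sw_(b1, b2 <- D b) ((al : {linear B -> B}) b2 ∙ x) ∙ Sb b1.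
Proof.
rewrite -[LHS]/((bmul hB \oc Phi hH B B \oc (linv (antip hB) \ox (bmul hB \oc (al \ox idm B)))
  \oc (bcomul hB \ox idm B)) (pure b x)) Phi_BB.
transitivity (bmul hB (flip B B ((linv (antip hB) \ox (bmul hB \oc ((al : wmap [:: ycar B] [:: ycar B]) \ox idm B)))
  ((bcomul hB \ox idm B) (pure b x))))); first by [].
rewrite hox1.
by swx (bcomul hB b) => b1 b2; wev.
Qed.
Lemma Balpha_coact al x : bc (Balpha al) x = \sw_(a, b <- D x) pure (S b) a.
Proof.
rewrite -[LHS]/(((antip hB \ox idm B) \oc linv (Phi hH B B) \oc bcomul hB) x) Phi_BB linv_flip.
by rewrite !hcompE; swx (bcomul hB x) => a b; wev.
Qed.

(** In the coaction of b x, the antipode turns al(b2) on the left of x into S(al(d)) on the right of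
    S(m2), where it contracts with al(b); the factor Sb(b1) on the right of x becomes the s that is
    left over in front. *)
Lemma Balpha_gyd al : hauto (al : {linear B -> B}) -> gyd (lid B) al (Balpha al).
Proof.
move=> hal; have [_ aM a_1 acom acou aS] := hal.
apply: trivH_gyd.
- by split=> [x m|m]; [exact: actB | exact: coactB].
- split=> [x y m|m]; last first.
    by rewrite Balpha_act (hcom1 hopfB) sw_pure ?a_1 ?(hantV1 hopfB bijB) ?(hmul1l hopfB) ?(hmul1r hopfB) //; lin.
  rewrite !Balpha_act (hcomM hopfB); last by lin.
  apply: sw_ext => a b; rewrite sw_purer sw_lin sw_purel sw_lin; apply: sw_ext => c d.
  by rewrite aM (hantVM hopfB bijB) !(hmulA hopfB).
- split=> [W F m [F1 F2 F3]|W F m Fl]; rewrite Balpha_coact sw_sw; try by lin.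
    rewrite [RHS]sw_sw; last by lin.
    transitivity (\sw_(a, b <- D m) \sw_(c, d <- D b) F (S d) (S c) a).
      by apply: sw_ext => a b; rewrite sw_pure ?(hcomS hopfB) //; lin.
    rewrite -(hcomA hopfB (F := fun a c d => F (S d) (S c) a)); last by lin.
    apply: sw_ext => a b; rewrite sw_pure; last by lin.
    rewrite Balpha_coact sw_sw; last by lin.
    by apply: sw_ext => c d; rewrite sw_pure.
  rewrite -[RHS](hcou1r hopfB (F := F)) //.
  by apply: sw_ext => a b; rewrite sw_pure ?(hcouS hopfB) //; lin.
move=> W F x m Fb; have [Fl Fr] := Fb.
have cE (G : B -> B -> W) u : bilin G -> \sw_(y, n <- bc (Balpha al) u) G y n = \sw_(p, q <- D u) G (S q) p.
  move=> Gb; rewrite Balpha_coact sw_sw; last by lin.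
  by apply: sw_ext => p q; rewrite sw_pure.
pose T m1 m2 a1 c : W := \sw_(s, t <- D a1) F (s ∙ S m2) ((al c ∙ m1) ∙ Sb t).
transitivity (\sw_(m1, m2 <- D m) \sw_(a, b <- D x) F (a ∙ S m2) (ba (Balpha al) (pure b m1))); last first.
  by rewrite sw_C; apply: sw_ext => a b; rewrite cE //; lin.
transitivity (\sw_(m1, m2 <- D m) \sw_(a, b <- D x) \sw_(a1, a2 <- D a) \sw_(c, d <- D a2) \sw_(s, t <- D a1)
    F (s ∙ S m2 ∙ (S (al d) ∙ al b)) ((al c ∙ m1) ∙ Sb t)).
  rewrite [RHS]sw_C; apply: sw_ext => a b.
  rewrite cE; last by lin.
  rewrite Balpha_act [RHS]sw_C.
  have Gl : linear (fun w => \sw_(p, q <- D w) F (S q ∙ al b) p) by lin.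
  rewrite (sw_linear _ _ Gl); apply: sw_ext => a1 a2.
  rewrite (hcomM hopfB) ?(hcomM hopfB); try by lin.
  rewrite acom; last by lin.
  rewrite [RHS]sw_C; apply: sw_ext => c d; apply: sw_ext => m1 m2.
  rewrite (hcomSb hopfB bijB); last by lin.
  apply: sw_ext => s t.
  by rewrite !(hantM hopfB) (hantVK bijB) !(hmulA hopfB).
apply: sw_ext => m1 m2.
transitivity (\sw_(a1, r <- D x) \sw_(a2, b <- D r) \sw_(c, d <- D a2) \sw_(s, t <- D a1)
    F (s ∙ S m2 ∙ (S (al d) ∙ al b)) ((al c ∙ m1) ∙ Sb t)).
  by rewrite -(hcomA hopfB (F := fun a1 a2 b => \sw_(c, d <- D a2) \sw_(s, t <- D a1)
    F (s ∙ S m2 ∙ (S (al d) ∙ al b)) ((al c ∙ m1) ∙ Sb t))) //; lin.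
transitivity (\sw_(a1, r <- D x) T m1 m2 a1 r).
  apply: sw_ext => a1 r.
  rewrite (hcomA hopfB (F := fun c d b => \sw_(s, t <- D a1)
    F (s ∙ S m2 ∙ (S (al d) ∙ al b)) ((al c ∙ m1) ∙ Sb t))); last by lin.
  rewrite -[RHS](hcou1r hopfB (F := fun r => T m1 m2 a1 r)); last by rewrite /T; lin.
  apply: sw_ext => c r'; rewrite sw_C /T sw_scale; apply: sw_ext => s t.
  transitivity (\sw_(d, b <- D r') F (s ∙ S m2 ∙ al (S d ∙ b)) ((al c ∙ m1) ∙ Sb t)).
    by apply: sw_ext => d b; rewrite aM aS.
  by rewrite (hantl hopfB (F := fun w => F (s ∙ S m2 ∙ al w) ((al c ∙ m1) ∙ Sb t))) ?a_1 ?(hmul1r hopfB) //; lin.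
rewrite /T (hcomA hopfB (F := fun s t r => F (s ∙ S m2) ((al r ∙ m1) ∙ Sb t))); last by lin.
apply: sw_ext => s r; rewrite Balpha_act.
by rewrite (sw_linear _ _ (Fr _)).
Qed.

Section PiMap.
Variables (nB : nat) (fdB : hasdim nB B).

Lemma B_nonzero : nonzero B.
Proof.
exists one; apply/eqP => o0; have := hcou1 hopfB; rewrite o0 linear0 => /esym/eqP.
by rewrite (negbTE (oner_neq0 _)).
Qed.
Lemma Balpha_azumaya al : hauto al -> azumaya (endA (Balpha al)).
Proof.
move=> hal; have [fK Kf] := linvP (au_bij hal).
apply: (endA_azumaya Kf (au_M hal) (au_1 hal) (au_S hal) (Balpha_gyd hal)).
- by split=> [x m|m]; [exact: actB | exact: coactB].
- exact: fdB.
- exact: B_nonzero.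
Qed.

Lemma beq_absorb A C P : fkalg A -> fkalg C -> fobj P -> alg_iso C (endA P) -> beq (tensA A C) A.
Proof.
move=> hA hC oP i; have hP := fkalg_end oP; have h1 := fkalg_end fobj1.
apply: (beq_trans (fkalg_tens hA hC) (fkalg_tens hA h1) hA); last exact: beq_tens1.
apply: (beq_tens hA hA hC h1 (beq_refl hA)).
exact: (beq_trans hC hP h1 (iso_beq hC hP i) (beq_end oP fobj1)).
Qed.
Lemma beq_absorbl A C P : fkalg A -> fkalg C -> fobj P -> alg_iso C (endA P) -> beq (tensA C A) A.
Proof.
move=> hA hC oP i; have hP := fkalg_end oP; have h1 := fkalg_end fobj1.
apply: (beq_trans (fkalg_tens hC hA) (fkalg_tens h1 hA) hA); last exact: beq_1tens.
apply: (beq_tens hC h1 hA hA _ (beq_refl hA)).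
exact: (beq_trans hC hP h1 (iso_beq hC hP i) (beq_end oP fobj1)).
Qed.

Lemma end_gyd_tens be de M N m n : hauto be -> hauto de -> gyd (lid B) be M -> gyd (lid B) de N ->
  hasdim m M -> hasdim n N ->
  gyd (lid B) (lcomp de be) (tensB M (pull be N)) /\
  alg_iso (tensA (endA M) (endA N)) (endA (tensB M (pull be N))).
Proof.
move=> hb hd gM gN fdM fdN; split.
  apply: (tensB_gyd gM); apply: (pull_gyd (au_M hb) (au_1 hb) (au_com hb) gN) => x.
  by [].
exact (endA_tens (au_M hb) (au_1 hb) (fun x => hauto_Sb x hb) (au_S hb) (au_S hd) (au_com hb) gM gN fdM fdN).
Qed.
Lemma fkalg_gyd ga M m : hauto ga -> gyd (lid B) ga M -> hasdim m M -> fkalg (endA M).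
Proof.
move=> hg gM fdM; split; first exact (endA_kalg gM fdM (au_S hg)).
by exists (m * m); exact (hasdim_hom fdM fdM).
Qed.

(** Put R = B of ga^-1. Both End(M) # End(R) and End(R) # End(N) are endomorphism algebras of
    untwisted modules, so either can be absorbed in End(M) # End(R) # End(N). *)
Lemma beq_gyd ga M N m n : hauto ga -> gyd (lid B) ga M -> gyd (lid B) ga N ->
  hasdim m M -> hasdim n N -> nonzero M -> nonzero N -> beq (endA M) (endA N).
Proof.
move=> hg gM gN fdM fdN nM nN.
have hi := hauto_inv hg; have [gK Kg] := linvP (au_bij hg).
pose R := Balpha (linv ga); have gR := Balpha_gyd hi.
have [hM hN hR] := And3 (fkalg_gyd hg gM fdM) (fkalg_gyd hg gN fdN) (fkalg_gyd hi gR fdB).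
have [g1 i1] := end_gyd_tens hg hi gM gR fdM fdB.
have [g2 i2] := end_gyd_tens hi hg gR gN fdB fdN.
have E1 : lcomp (linv ga) ga = lid B by apply: lin_ext.
have E2 : lcomp ga (linv ga) = lid B by apply: lin_ext.
rewrite E1 in g1; rewrite E2 in g2.
have o1 : fobj (tensB M (pull ga R)).
  by split=> //; [exact (nonzero_tens fdM fdB nM B_nonzero) | exists (m * nB); exact (hasdim_tens fdM fdB)].
have o2 : fobj (tensB R (pull (linv ga) N)).
  by split=> //; [exact (nonzero_tens fdB fdN B_nonzero nN) | exists (nB * n); exact (hasdim_tens fdB fdN)].
have hMR := fkalg_tens hM hR; have hRN := fkalg_tens hR hN.
apply: (beq_trans hM (fkalg_tens hM hRN) hN); first exact: (beq_sym (beq_absorb hM hRN o2 i2)).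
apply: (beq_trans (fkalg_tens hM hRN) (fkalg_tens hMR hN) hN); last exact: (beq_absorbl hN hMR o1 i1).
apply: (iso_beq (fkalg_tens hM hRN) (fkalg_tens hMR hN)); apply: iso_sym.
exact: (tensA_ass hM hR hN).
Qed.

(** Modules with twists f^-1 and g^-1 have a tensor product with twist g^-1 f^-1, the inverse of f
    g. The inverse in the definition of Pi thus compensates the reversal of twists. *)
Lemma Pi_hom : is_hom (G := AutC) (K := BQ) (Pi hH hB).
Proof.
split=> [f /autP hf|f g /autP hf /autP hg].
  by exists (endA (Balpha (linv f))); [exact (Balpha_azumaya (hauto_inv hf)) | exact erefl].
have [hf' hg'] := (hauto_inv hf, hauto_inv hg).
have hh := hauto_inv (hauto_comp hf hg).
have [af ag ah] := And3 (Balpha_azumaya hf') (Balpha_azumaya hg') (Balpha_azumaya hh).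
rewrite (BQ_mulE af ag); apply/(brclass_eq ah (tensA_azumaya af ag)).
have [gg ii] := end_gyd_tens hf' hg' (Balpha_gyd hf') (Balpha_gyd hg') fdB fdB.
have [hkf hkg] := (azumaya_fkalg af, azumaya_fkalg ag).
rewrite -(linv_comp hf hg) in gg.
have fdT := hasdim_tens fdB fdB; have nT := nonzero_tens fdB fdB B_nonzero B_nonzero.
have hT := fkalg_gyd hh gg fdT.
apply: (beq_trans (azumaya_fkalg ah) hT (fkalg_tens hkf hkg)).
  exact: (beq_gyd hh (Balpha_gyd hh) gg fdB fdT B_nonzero nT).
exact: (beq_sym (iso_beq (fkalg_tens hkf hkg) hT ii)).
Qed.
End PiMap.
End PiMorphism.

(** * Twisting by a character and a group-like, and the kernel of Pi *)

Section KernelOfPi.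
Local Notation "x ∙ y" := (hmul hB (pure x y)) (at level 40, left associativity).
Local Notation one := (hone hB).
Local Notation D := (hcom hB).
Local Notation e := (hcou hB).
Local Notation S := (hant hB).
Local Notation Sb := (hantV hB).
Local Notation BQ := (BQ hH hB).
Local Notation Balpha := (Balpha hH hB).
Local Notation U1 := (unitB hH hB).

Definition ischar (lam : {linear B -> k^o}) : Prop :=
  (forall x y, lam (x ∙ y) = (lam x : k) * lam y) /\ lam one = (1 : k).
Definition isgrp (g : B) : Prop := D g = pure g g /\ e g = (1 : k).

Section TwistObject.
Variables (lam : {linear B -> k^o}) (g : B) (ga : {linear B -> B}) (M : bydobj H B) (n0 : nat).
Hypotheses (hlam : ischar lam) (hg : isgrp g) (gM : gyd (lid B) ga M) (fdM : hasdim n0 M).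
Hypothesis lgE : forall b, \sw_(b1, b2 <- D b) (lam b1 : k) *: (g ∙ b2) = \sw_(b1, b2 <- D b) (lam b2 : k) *: (ga b1 ∙ g).

Fact winding_lin : linear (fun b => \sw_(b1, b2 <- D b) (lam b2 : k) *: b1). Proof. lin. Qed.
Definition winding : {linear B -> B} := mkLin winding_lin.
Fact mulr_lin : linear (fun y => y ∙ g). Proof. lin. Qed.
(** The action is wound by [lam] and the coaction multiplied by [g] on the right; [lgE] is precisely
    what turns the [ga]-twisted condition of [M] into the untwisted one. *)
Definition twist : bydobj H B :=
  @BYDObj k H B M (bact (pull winding M)) (lcomp (tmap (mkLin mulr_lin) (lid M)) (bc M)).

Lemma windingE b : winding b = \sw_(b1, b2 <- D b) (lam b2 : k) *: b1. Proof. by []. Qed.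
Lemma twist_act b m : ba twist (pure b m) = ba M (pure (winding b) m).
Proof. exact: pullE. Qed.
Lemma twist_coact (W : lmodType k) (F : B -> M -> W) m : bilin F ->
  teval F (bc twist m) = \sw_(y, n <- bc M m) F (y ∙ g) n.
Proof.
move=> Fb; transitivity (teval F (tmap (mkLin mulr_lin) (lid M) (bc M m))); first by [].
by rewrite -[bc M m in LHS]sw_id sw_lin sw_sw; [apply: sw_ext => y n; rewrite tmap_pure sw_pure | lin].
Qed.
Lemma sw_winding (W : lmodType k) (F : B -> W) b : linear F -> F (winding b) = \sw_(b1, b2 <- D b) (lam b2 : k) *: F b1.
Proof. by move=> Fl; rewrite windingE (sw_linear _ _ Fl); apply: sw_ext => b1 b2; rewrite (linZ _ _ Fl). Qed.
Lemma winding_com (W : lmodType k) (F : B -> B -> W) b : bilin F ->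
  teval F (D (winding b)) = \sw_(b1, b2 <- D b) F b1 (winding b2).
Proof.
move=> Fb; have [Fl Fr] := Fb.
rewrite (sw_winding (F := fun w => teval F (D w))); last by lin.
transitivity (\sw_(a, b3 <- D b) \sw_(b1, b2 <- D a) (lam b3 : k) *: F b1 b2); first by apply: sw_ext => a b3; rewrite sw_scale.
rewrite (hcomA hopfB (F := fun b1 b2 b3 => (lam b3 : k) *: F b1 b2)); last by lin.
by apply: sw_ext => b1 r; rewrite (sw_winding (F := F b1)).
Qed.
Lemma windingM x y : winding (x ∙ y) = winding x ∙ winding y.
Proof.
rewrite windingE (hcomM hopfB); last by lin.
rewrite (sw_winding (F := fun w => w ∙ winding y)); last by lin.
apply: sw_ext => a b; rewrite (sw_winding (F := fun w => a ∙ w)) ?sw_scale; last by lin.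
by apply: sw_ext => c d; rewrite hlam.1 scalerA.
Qed.
Lemma winding1 : winding one = one.
Proof. by rewrite windingE (hcom1 hopfB) sw_pure ?hlam.2 ?scale1r //; lin. Qed.

Lemma twist_byd : byd twist.
Proof.
have [gD ge] := hg; have [A1 A2] := gBa gM; have [C1 C2] := gBc gM.
split; try by case: gM.
- by split=> [x y n|n]; rewrite !twist_act ?windingM ?winding1 ?A1 ?A2.
- split=> [W F m Fb|W F m Fl]; last first.
    rewrite twist_coact; last by lin.
    rewrite -[RHS]C2 //; apply: sw_ext => y n.
    by rewrite (hcouM hopfB) ge mulr1.
  have [F1 F2 F3] := Fb.
  rewrite twist_coact; last by lin.
  transitivity (\sw_(y, n <- bc M m) \sw_(a, b <- D y) F (a ∙ g) (b ∙ g) n).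
    apply: sw_ext => y n; rewrite (hcomM hopfB); last by lin.
    by apply: sw_ext => a b; rewrite gD sw_pure //; lin.
  rewrite (C1 _ (fun a b n => F (a ∙ g) (b ∙ g) n)); last by lin.
  rewrite twist_coact; last by lin.
  by apply: sw_ext => y n; rewrite twist_coact //; lin.
- move=> W F b m Fb; have [Fl Fr] := Fb.
  have E1 c : \sw_(y, n <- bc M (ba M (pure c m))) F (y ∙ g) n = teval F (bc twist (ba M (pure c m))).
    by rewrite twist_coact.
  transitivity (\sw_(b1, b2 <- D b) \sw_(y, n <- bc M (ba M (pure b1 m))) F (y ∙ (\sw_(c, d <- D b2) (lam c : k) *: (g ∙ d))) n).
    transitivity (\sw_(a, b3 <- D b) \sw_(b1, b2 <- D a) (lam b2 : k) *: \sw_(y, n <- bc M (ba M (pure b1 m))) F (y ∙ (g ∙ b3)) n).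
      apply: sw_ext => a b3; rewrite twist_act.
      rewrite (sw_winding (F := fun w => \sw_(y, n <- bc twist (ba M (pure w m))) F (y ∙ lid B b3) n)); last by lin.
      apply: sw_ext => b1 b2; congr (_ *: _); rewrite (@twist_coact W (fun y n => F (y ∙ lid B b3) n)); last by lin.
      by apply: sw_ext => y n; rewrite (hmulA hopfB).
    rewrite (hcomA hopfB (F := fun b1 b2 b3 => (lam b2 : k) *: \sw_(y, n <- bc M (ba M (pure b1 m))) F (y ∙ (g ∙ b3)) n)); last by lin.
    apply: sw_ext => b1 b2.
    transitivity (\sw_(y, n <- bc M (ba M (pure b1 m))) \sw_(c, d <- D b2) (lam c : k) *: F (y ∙ (g ∙ d)) n).
      by rewrite sw_C; apply: sw_ext => c d; rewrite -sw_scale.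
    apply: sw_ext => y n; have Gl : linear (fun w => F (y ∙ w) n) by lin.
    by rewrite (sw_linear _ _ Gl); apply: sw_ext => c d; rewrite (linZ _ _ Gl).
  transitivity (\sw_(b1, b2 <- D b) \sw_(y, n <- bc M (ba M (pure b1 m))) F (y ∙ (\sw_(c, d <- D b2) (lam d : k) *: (ga c ∙ g))) n).
    by apply: sw_ext => b1 b2; rewrite lgE.
  transitivity (\sw_(a, b3 <- D b) \sw_(b1, b2 <- D a) (lam b3 : k) *: \sw_(y, n <- bc M (ba M (pure b1 m))) F (y ∙ ga b2 ∙ g) n).
    rewrite (hcomA hopfB (F := fun b1 b2 b3 => (lam b3 : k) *: \sw_(y, n <- bc M (ba M (pure b1 m))) F (y ∙ ga b2 ∙ g) n)); last by lin.
    apply: sw_ext => b1 b2.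
    transitivity (\sw_(y, n <- bc M (ba M (pure b1 m))) \sw_(c, d <- D b2) (lam d : k) *: F (y ∙ ga c ∙ g) n).
      apply: sw_ext => y n; have Gl : linear (fun w => F (y ∙ w) n) by lin.
      rewrite (sw_linear _ _ Gl); apply: sw_ext => c d.
      by rewrite (linZ _ _ Gl) (hmulA hopfB).
    by rewrite sw_C; apply: sw_ext => c d; rewrite -sw_scale.
  transitivity (\sw_(a, b3 <- D b) \sw_(b1, b2 <- D a) (lam b3 : k) *: \sw_(y, n <- bc M m) F (b1 ∙ y ∙ g) (ba M (pure b2 n))).
    apply: sw_ext => a b3; rewrite -!sw_scale; congr (_ *: _).
    by have yM := gBy gM; rewrite (yM _ (fun w n => F (w ∙ g) n)) //; lin.
  rewrite (hcomA hopfB (F := fun b1 b2 b3 => (lam b3 : k) *: \sw_(y, n <- bc M m) F (b1 ∙ y ∙ g) (ba M (pure b2 n)))); last by lin.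
  apply: sw_ext => b1 r.
  rewrite (@twist_coact W (fun y n => F (lid B b1 ∙ y) (ba twist (pure r n)))); last by lin.
  transitivity (\sw_(y, n <- bc M m) \sw_(b2, b3 <- D r) (lam b3 : k) *: F (b1 ∙ y ∙ g) (ba M (pure b2 n))).
    by rewrite sw_C; apply: sw_ext => b2 b3; rewrite -sw_scale.
  apply: sw_ext => y n; rewrite twist_act -(hmulA hopfB).
  by rewrite (sw_winding (F := fun w => F (b1 ∙ y ∙ g) (ba M (pure w n)))) //; lin.
- by move=> x b m; rewrite !twist_act; exact: (gaa gM).
- move=> x m; have E := gac gM x m.
  transitivity (tmap (mkLin mulr_lin) (lid M) (bc M (ha M (pure x m)))); first by [].
  rewrite E sw_lin.
  rewrite twist_coact; last by lin.
  by apply: sw_ext => y n; rewrite tmap_pure.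
- by move=> b m; rewrite twist_act; apply: etrans (gca gM _ _) _; apply: sw_ext => x n; rewrite twist_act.
- move=> W F m Fb; have [F1 F2 F3] := Fb.
  rewrite twist_coact; last by lin.
  have cc := gcc gM; rewrite -(cc _ (fun x y n => F x (y ∙ g) n)); last by lin.
  by apply: sw_ext => x n; rewrite twist_coact //; lin.
Qed.

(** On End(M) the factors lam(a2) lam(S(b1)) contract in the action and g Sb(g) contracts in the
    coaction, so the two algebras are equal, not merely isomorphic. *)
Lemma endA_twist : endA twist = endA M.
Proof.
have [gD ge] := hg.
have gSb : g ∙ Sb g = one.
  have := hantVr hopfB bijB (F := id) g (@lin_id _ _).
  by rewrite gD sw_pure ?ge ?scale1r //; lin.
pose ta1 : {linear tens B (LinMap M M) -> LinMap M M} := bact (endA twist).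
pose ta2 : {linear tens B (LinMap M M) -> LinMap M M} := bact (endA M).
pose tc1 : {linear LinMap M M -> tens B (LinMap M M)} := bcoact (endA twist).
pose tc2 : {linear LinMap M M -> tens B (LinMap M M)} := bcoact (endA M).
have a1E : is_homact hB (ba twist) (ba twist) ta1 := endA_ba twist_byd fdM.
have a2E : is_homact hB (ba M) (ba M) ta2 := endA_ba gM fdM.
have c1E : is_homcoact hB (bc twist) (bc twist) tc1 := endA_bc twist_byd fdM.
have c2E : is_homcoact hB (bc M) (bc M) tc2 := endA_bc gM fdM.
have aE : ta1 = ta2.
  apply: lin_ext; apply: tens_ext => x f; symmetry.
  apply: (homact_unique a2E) => m; rewrite (a1E x f m).
  transitivity (\sw_(a, b <- D x) \sw_(a1, a2 <- D a) \sw_(b1, b2 <- D b) (lam a2 : k) *: ((lam (S b1) : k) *: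
    ba M (pure a1 ((f : LinMap M M) (ba M (pure (S b2) m)))))).
    apply: sw_ext => a b; rewrite !twist_act.
    rewrite (sw_winding (F := fun w => ba M (pure w ((f : LinMap M M) (ba M (pure (winding (S b)) m)))))); last by lin.
    apply: sw_ext => a1 a2; rewrite windingE (hcomS hopfB); last by lin.
    have Gl : linear (fun w => ba M (pure a1 ((f : LinMap M M) (ba M (pure w m))))) by lin.
    rewrite (sw_linear _ _ Gl) sw_scale; apply: sw_ext => b1 b2.
    by rewrite (linZ _ _ Gl).
  rewrite (hcomA hopfB (F := fun a1 a2 b => \sw_(b1, b2 <- D b) (lam a2 : k) *: ((lam (S b1) : k) *:
    ba M (pure a1 ((f : LinMap M M) (ba M (pure (S b2) m))))))); last by lin.
  apply: sw_ext => a1 r.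
  rewrite -(hcomA hopfB (F := fun a2 b1 b2 => (lam a2 : k) *: ((lam (S b1) : k) *:
    ba M (pure a1 ((f : LinMap M M) (ba M (pure (S b2) m))))))); last by lin.
  rewrite -[RHS](hcou1l hopfB (F := fun r => ba M (pure a1 ((f : LinMap M M) (ba M (pure (S r) m)))))); last by lin.
  apply: sw_ext => q b2.
  transitivity (\sw_(a2, b1 <- D q) (lam (a2 ∙ S b1) : k) *: ba M (pure a1 ((f : LinMap M M) (ba M (pure (S b2) m))))).
    by apply: sw_ext => a2 b1; rewrite hlam.1 scalerA.
  by rewrite (hantr hopfB (F := fun w => (lam w : k) *: ba M (pure a1 ((f : LinMap M M) (ba M (pure (S b2) m)))))) ?hlam.2 ?scale1r //; lin.
have cE : tc1 = tc2.
  apply: lin_ext; apply: (homcoact_unique fdM _ c2E) => W F f m Fb.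
  have [Fl Fr] := Fb; rewrite (c1E _ _ _ _ Fb).
  rewrite twist_coact; last by lin.
  apply: sw_ext => y m'; rewrite (@twist_coact W (fun z n => F (z ∙ Sb (y ∙ g)) n)); last by lin.
  apply: sw_ext => z n.
  by rewrite (hantVM hopfB bijB) (hmulA hopfB) -[g ∙ _](hmulA hopfB) gSb (hmul1l hopfB).
pose mk (a : {linear tens B (LinMap M M) -> LinMap M M}) (c : {linear LinMap M M -> tens B (LinMap M M)}) : algB H B :=
  @AlgB k H B (@BYDObj k H B (homC hH M M) a c) (amul (endA M)) (aone (endA M)).
transitivity (mk ta1 tc1); first exact erefl.
by rewrite aE cE; exact erefl.
Qed.
End TwistObject.

Section Transport.
Variables (X : lmodType k) (h : hopf X) (V Q : lmodType k) (u : {linear V -> Q}).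
Hypothesis ub : bijective u.
Variables (mu : {linear tens X Q -> Q}) (la : {linear Q -> tens X Q}).
Local Notation v := (linv u).
Let uK : cancel u v. Proof. by case: (linvP ub). Qed.
Let vK : cancel v u. Proof. by case: (linvP ub). Qed.
Definition act_along : {linear tens X V -> V} := lcomp v (lcomp mu (tmap (lid X) u)).
Definition coact_along : {linear V -> tens X V} := lcomp (tmap (lid X) v) (lcomp la u).
Lemma act_alongE x m : act_along (pure x m) = v (mu (pure x (u m))).
Proof. by rewrite -[LHS]/(v (mu (tmap (lid X) u (pure x m)))) tmap_pure. Qed.
Lemma coact_alongE (W : lmodType k) (F : X -> V -> W) m : bilin F ->
  teval F (coact_along m) = \sw_(y, n <- la (u m)) F y (v n).
Proof.
move=> Fb; transitivity (teval F (tmap (lid X) v (la (u m)))); first by [].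
by rewrite -[la _ in LHS]sw_id sw_lin sw_sw; [apply: sw_ext => y n; rewrite tmap_pure sw_pure | lin].
Qed.
Lemma along_isact : isact h mu -> isact h act_along.
Proof. by move=> [A1 A2]; split=> [x y m|m]; rewrite !act_alongE ?vK ?A1 ?A2 ?uK. Qed.
Lemma along_iscoact : iscoact h la -> iscoact h coact_along.
Proof.
move=> [C1 C2]; split=> [W F m [F1 F2 F3]|W F m Fl]; rewrite coact_alongE; try by lin.
  rewrite (C1 _ (fun a b n => F a b (v n))); last by lin.
  rewrite coact_alongE; last by lin.
  by apply: sw_ext => y n; rewrite coact_alongE ?vK //; lin.
by rewrite (C2 _ (fun n => F (v n))) ?uK //; lin.
Qed.
Lemma along_isYD gl ga : isYD h gl ga mu la -> isYD h gl ga act_along coact_along.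
Proof.
move=> y W F x m Fb; have [Fl Fr] := Fb.
transitivity (\sw_(a, b <- hcom h x) \sw_(y, n <- la (mu (pure a (u m)))) F (hmul h (pure y (ga b))) (v n)).
  by apply: sw_ext => a b; rewrite coact_alongE ?act_alongE ?vK //; lin.
rewrite (y _ (fun w n => F w (v n))); last by lin.
apply: sw_ext => a b; rewrite coact_alongE; last by lin.
by apply: sw_ext => z n; rewrite act_alongE vK.
Qed.
Variables (f : {linear LinMap V V -> LinMap Q Q}).
Hypothesis fu : forall (p : LinMap V V) m, f p (u m) = u (p m).
Variables (act : {linear tens X (LinMap V V) -> LinMap V V}) (actQ : {linear tens X (LinMap Q Q) -> LinMap Q Q}).
Variables (rho : {linear LinMap V V -> tens X (LinMap V V)}) (rhoQ : {linear LinMap Q Q -> tens X (LinMap Q Q)}).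
Lemma along_homact : islin act actQ f -> is_homact h mu mu actQ -> is_homact h act_along act_along act.
Proof.
move=> fl aQ x p m; apply: (can_inj uK); rewrite -fu fl aQ sw_lin.
by apply: sw_ext => a b; rewrite !act_alongE vK -fu vK.
Qed.
Lemma along_homcoact : iscol rho rhoQ f -> is_homcoact h la la rhoQ -> is_homcoact h coact_along coact_along rho.
Proof.
move=> fc rQ W F p m Fb; have [Fl Fr] := Fb.
transitivity (teval (fun x (q : LinMap Q Q) => F x (v (q (u m)))) (rhoQ (f p))).
  rewrite (sw_col _ fc (F := fun x (q : LinMap Q Q) => F x (v (q (u m))))); last first.
    split=> [q|x]; first by lin.
    by move=> a s t; rewrite -[(_ + t) _]/(a *: s (u m) + t (u m)) linearP (Fr x).
  by apply: sw_ext => x q; rewrite fu uK.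
rewrite (rQ _ (fun x n => F x (v n))); last by lin.
rewrite coact_alongE; last by lin.
apply: sw_ext => y m'; rewrite coact_alongE; last by lin.
by rewrite -fu vK.
Qed.
End Transport.

Section PiKernel.
Variables (nB : nat) (fdB : hasdim nB B).

Lemma Pi_kernel al : hauto al -> Pi hH hB al = gone BQ <->
  exists lam g, [/\ ischar lam, isgrp g & forall b,
    \sw_(b1, b2 <- D b) (lam b1 : k) *: (g ∙ b2) = \sw_(b1, b2 <- D b) (lam b2 : k) *: (linv al b1 ∙ g)].
Proof.
move=> ha; have hi := hauto_inv ha; set ga := linv al in hi *.
have gR := Balpha_gyd hi; have aR := Balpha_azumaya fdB hi; have a1 := end1_azumaya.
have nB0 : nonzero B := B_nonzero.
have fdR : hasdim nB (Balpha ga) := fdB.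
rewrite BQ_oneE -[Pi hH hB al]/(brclass hH hB (endA (Balpha ga))) (brclass_eq aR a1).
split=> [/beqP [M [N [oM oN i]]]|[lam [g [hl hg E]]]]; last first.
  have tB := twist_byd hl hg gR E.
  have Ee := endA_twist hl hg gR fdR E; rewrite -Ee.
  by apply: (beq_end _ fobj1); split; [exact tB | exact nB0 | exists nB; exact fdB].
have [gM nM [m fdM]] := oM; have [gN nN [n fdN]] := oN.
have [gP iP] := end_gyd_tens hi hauto_id gR gM fdR fdM.
have iQ := end_end fobj1 oN.
set P := tensB (Balpha ga) (pull ga M) in gP iP; set Q := tensB U1 N in iQ.
have fdP : hasdim (nB * m) P := hasdim_tens fdR fdM.
have fdQ : hasdim (1 * n) Q := hasdim_tens unitB_dim fdN.
have nP : nonzero P := nonzero_tens fdR fdM nB0 nM.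
have gQ : byd Q := tensB_gyd unitB_byd gN.
have gP' : gyd (lid B) ga P by have <- : lcomp (lid B) ga = ga by apply: lin_ext.
have [f [fb [_ _ fl fc] fM _]] := (kisoP _ _).1 (iso_trans (iso_sym iP) (iso_trans i iQ)).
have fM' (p q : LinMap P P) : f (lcomp p q) = lcomp (f p) (f q).
  have := fM p q; rewrite !endA_mulE; exact.
have [u [ub uE]] := skolem_noether fdP fdQ nP fb fM'.
have kP := fkalg_gyd hi gP' fdP.
have rc : iscoact hB (bc (endA P)) by have gE := kbyd kP.1; exact (gBc gE).
(* The structures of [Q] are transported to [P] along [u]. They are untwisted, those of [P] are
   twisted by [ga], and both induce the same action and coaction on End(P) because [f] respects
   them. *)
have [lam [g [hl hg E]]] := twist_extract hopfB bijB fdP nP (gBa gP') (gBc gP') (gBy gP')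
  (along_isact ub (gBa gQ)) (along_iscoact ub (gBc gQ)) (along_isYD ub (gBy gQ))
  (endA_ba gP' fdP) (along_homact ub uE fl (endA_ba gQ fdQ))
  (endA_bc gP' fdP) (along_homcoact ub uE fc (endA_bc gQ fdQ)) rc.
by exists lam, g.
Qed.
End PiKernel.
End KernelOfPi.

(** * Characters, group-likes and the Drinfel'd double *)

Section CharactersGrouplikes.
Local Notation "x ∙ y" := (hmul hB (pure x y)) (at level 40, left associativity).
Local Notation one := (hone hB).
Local Notation D := (hcom hB).
Local Notation e := (hcou hB).
Local Notation S := (hant hB).
Implicit Types (lam mu nu : {linear B -> k^o}) (g h : B).

(** f S and S f are both convolution inverses of f. *)
Lemma bialg_ant (f : {linear B -> B}) : (forall x y, f (x ∙ y) = f x ∙ f y) -> f one = one ->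
  (forall (W : lmodType k) (F : B -> B -> W) x, bilin F -> teval F (D (f x)) = \sw_(a, b <- D x) F (f a) (f b)) ->
  (forall x, e (f x) = e x) -> forall x, f (S x) = S (f x).
Proof.
move=> fM f1 fcom fcou x.
transitivity (\sw_(a, r <- D x) \sw_(b, c <- D r) f (S a) ∙ (f b ∙ S (f c))).
  rewrite -[LHS](hcou1r hopfB (F := fun a => f (S a))); last by lin.
  apply: sw_ext => a r; rewrite -(fcou r).
  transitivity (\sw_(b, c <- D (f r)) f (S a) ∙ (b ∙ S c)); last by rewrite fcom //; lin.
  by rewrite (hantr hopfB (F := fun w => f (S a) ∙ w)) ?(hmul1r hopfB) //; lin.
rewrite -(hcomA hopfB (F := fun a b c => f (S a) ∙ (f b ∙ S (f c)))); last by lin.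
rewrite -[RHS](hcou1l hopfB (F := fun c => S (f c))); last by lin.
apply: sw_ext => q c.
transitivity (\sw_(a, b <- D q) f (S a ∙ b) ∙ S (f c)).
  by apply: sw_ext => a b; rewrite fM (hmulA hopfB).
by rewrite (hantl hopfB (F := fun w => f w ∙ S (f c))) ?f1 ?(hmul1l hopfB) //; lin.
Qed.

Section Grouplikes.
Variables (g : B) (hg : isgrp g).
Lemma grp_invr : g ∙ S g = one.
Proof.
have [gD ge] := hg; have := hantr hopfB (F := id) g (@lin_id _ _).
by rewrite gD sw_pure ?ge ?scale1r //; lin.
Qed.
Lemma grp_invl : S g ∙ g = one.
Proof.
have [gD ge] := hg; have := hantl hopfB (F := id) g (@lin_id _ _).
by rewrite gD sw_pure ?ge ?scale1r //; lin.
Qed.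
Lemma sw_grp (W : lmodType k) (F : B -> B -> W) : bilin F -> teval F (D g) = F g g.
Proof. by move=> Fb; rewrite hg.1 sw_pure. Qed.
Lemma com_eqP x (t : tens B B) : (forall (W : lmodType k) (F : B -> B -> W), bilin F -> teval F (D x) = teval F t) -> D x = t.
Proof. by move=> E; rewrite -[LHS]sw_id -[RHS]sw_id; apply: E; lin. Qed.
Lemma grp_inv : isgrp (S g).
Proof.
split; last by rewrite (hcouS hopfB) hg.2.
by apply: com_eqP => W F Fb; have [Fl Fr] := Fb; rewrite (hcomS hopfB) // sw_grp ?sw_pure //; lin.
Qed.
Fact cg_lin : linear (fun b => (g ∙ b) ∙ S g). Proof. lin. Qed.
End Grouplikes.
Lemma grp_one : isgrp one.
Proof. by split; [exact: (hcom1 hopfB) | exact: (hcou1 hopfB)]. Qed.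
Lemma grp_mul g h : isgrp g -> isgrp h -> isgrp (g ∙ h).
Proof.
move=> hg hh; split; last by rewrite (hcouM hopfB) hg.2 hh.2 mulr1.
apply: com_eqP => W F Fb; have [Fl Fr] := Fb; rewrite (hcomM hopfB) // sw_grp //; last by lin.
by rewrite sw_grp ?sw_pure //; lin.
Qed.

Definition cg g : {linear B -> B} := mkLin (cg_lin g).
Lemma cgE g b : cg g b = (g ∙ b) ∙ S g. Proof. by []. Qed.
Lemma cg_mul g h b : cg (g ∙ h) b = cg g (cg h b).
Proof. by rewrite !cgE (hantM hopfB) !(hmulA hopfB). Qed.
Lemma cgK g : isgrp g -> cancel (cg g) (cg (S g)).
Proof.
move=> hg b; rewrite !cgE -!(hmulA hopfB) (grp_invl hg) (hmul1l hopfB) (hmulA hopfB).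
by rewrite (grp_invr (grp_inv hg)) (hmul1r hopfB).
Qed.
Lemma cgVK g : isgrp g -> cancel (cg (S g)) (cg g).
Proof.
move=> hg b; rewrite !cgE -!(hmulA hopfB) (grp_invr hg) (hmul1l hopfB) (hmulA hopfB).
by rewrite (grp_invl (grp_inv hg)) (hmul1r hopfB).
Qed.
Lemma cg_hauto g : isgrp g -> hauto (cg g).
Proof.
move=> hg.
have cM x y : cg g (x ∙ y) = cg g x ∙ cg g y.
  by rewrite !cgE !(hmulA hopfB) -[S g ∙ _](hmulA hopfB) (grp_invl hg) (hmul1l hopfB).
have c1 : cg g one = one by rewrite cgE (hmul1r hopfB) (grp_invr hg).
have cc (W : lmodType k) (F : B -> B -> W) x : bilin F -> teval F (D (cg g x)) = \sw_(a, b <- D x) F (cg g a) (cg g b).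
  move=> Fb; have [Fl Fr] := Fb; rewrite cgE (hcomM hopfB) // (hcomM hopfB); last by lin.
  rewrite (sw_grp hg); last by lin.
  apply: sw_ext => a b; rewrite (sw_grp (grp_inv hg)) //; lin.
have ce x : e (cg g x) = e x.
  by rewrite cgE !(hcouM hopfB) (hcouS hopfB) hg.2 mul1r mulr1.
by split=> //; [exists (cg (S g)); [exact: cgK | exact: cgVK] | exact: bialg_ant].
Qed.

Fact windl_lin lam : linear (fun b => \sw_(b1, b2 <- D b) (lam b1 : k) *: b2). Proof. lin. Qed.
Definition windl lam : {linear B -> B} := mkLin (windl_lin lam).
Lemma sw_windl lam (W : lmodType k) (F : B -> W) b : linear F -> F (windl lam b) = \sw_(b1, b2 <- D b) (lam b1 : k) *: F b2.
Proof.
move=> Fl; rewrite -[windl lam b]/(\sw_(b1, b2 <- D b) (lam b1 : k) *: b2) (sw_linear _ _ Fl).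
by apply: sw_ext => b1 b2; rewrite (linZ _ _ Fl).
Qed.
Fact conv_lin lam mu : linear (fun b => \sw_(a, c <- D b) (lam a : k) *: (mu c : k^o)). Proof. lin. Qed.
Definition conv lam mu : {linear B -> k^o} := mkLin (conv_lin lam mu).
Lemma convE lam mu b : conv lam mu b = \sw_(a, c <- D b) (lam a : k) *: (mu c : k^o). Proof. by []. Qed.
Lemma conv_scale lam mu b (W : lmodType k) (w : W) :
  (conv lam mu b : k) *: w = \sw_(a, c <- D b) (lam a : k) *: ((mu c : k) *: w).
Proof.
have Gl : linear (fun c : k^o => (c : k) *: w) by move=> a x y; rewrite scalerDl -scalerA.
by rewrite convE (sw_linear _ _ Gl); apply: sw_ext => a c; rewrite scalerA.
Qed.
Lemma conv_assoc lam mu nu : conv lam (conv mu nu) = conv (conv lam mu) nu.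
Proof.
apply: lin_ext => b; rewrite !convE.
transitivity (\sw_(a, r <- D b) \sw_(c, d <- D r) (lam a : k) *: ((mu c : k) *: (nu d : k^o))).
  by apply: sw_ext => a r; rewrite convE sw_scale.
rewrite -(hcomA hopfB (F := fun a c d => (lam a : k) *: ((mu c : k) *: (nu d : k^o)))); last by lin.
by apply: sw_ext => q d; rewrite conv_scale.
Qed.
Lemma conv_el lam : conv (hcou hB) lam = lam.
Proof. by apply: lin_ext => b; rewrite convE (hcou1l hopfB (F := lam)) //; lin. Qed.
Lemma conv_er lam : conv lam (hcou hB) = lam.
Proof.
apply: lin_ext => b; rewrite convE -[RHS](hcou1r hopfB (F := lam)); last by lin.
by apply: sw_ext => a c; exact: mulrC.
Qed.
Lemma windl_windl lam mu b : windl lam (windl mu b) = windl (conv mu lam) b.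
Proof.
rewrite (sw_windl _ (F := (windl lam))); last by lin.
transitivity (\sw_(a, r <- D b) \sw_(c, d <- D r) (mu a : k) *: ((lam c : k) *: d)).
  by apply: sw_ext => a r; rewrite sw_scale.
rewrite -(hcomA hopfB (F := fun a c d => (mu a : k) *: ((lam c : k) *: d))); last by lin.
by apply: sw_ext => q d; rewrite conv_scale.
Qed.
Lemma winding_winding lam mu b : winding lam (winding mu b) = winding (conv lam mu) b.
Proof.
rewrite (sw_winding _ (F := (winding lam))); last by lin.
transitivity (\sw_(q, d <- D b) \sw_(a, c <- D q) (lam c : k) *: ((mu d : k) *: a)).
  apply: sw_ext => q d; rewrite windingE sw_scale; apply: sw_ext => a c.
  by rewrite !scalerA mulrC.
rewrite (hcomA hopfB (F := fun a c d => (lam c : k) *: ((mu d : k) *: a))); last by lin.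
by apply: sw_ext => a r; rewrite conv_scale.
Qed.
Lemma windl_winding lam mu b : windl lam (winding mu b) = winding mu (windl lam b).
Proof.
rewrite (sw_winding _ (F := (windl lam))) ?(sw_windl _ (F := (winding mu))); try by lin.
transitivity (\sw_(q, d <- D b) \sw_(a, c <- D q) (lam a : k) *: ((mu d : k) *: c)).
  apply: sw_ext => q d; rewrite sw_scale; apply: sw_ext => a c.
  by rewrite !scalerA mulrC.
rewrite (hcomA hopfB (F := fun a c d => (lam a : k) *: ((mu d : k) *: c))); last by lin.
by apply: sw_ext => a r; rewrite windingE sw_scale.
Qed.
Lemma windl_e b : windl (hcou hB) b = b.
Proof. exact: (hcou1l hopfB (F := id) b (@lin_id _ _)). Qed.
Lemma winding_e b : winding (hcou hB) b = b.
Proof. exact: (hcou1r hopfB (F := id) b (@lin_id _ _)). Qed.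
Lemma windl_com lam (W : lmodType k) (F : B -> B -> W) b : bilin F ->
  teval F (D (windl lam b)) = \sw_(b1, b2 <- D b) F (windl lam b1) b2.
Proof.
move=> Fb; have [Fl Fr] := Fb.
rewrite (sw_windl _ (F := (fun w => teval F (D w)))); last by lin.
transitivity (\sw_(b1, r <- D b) \sw_(b2, b3 <- D r) (lam b1 : k) *: F b2 b3); first by apply: sw_ext => b1 r; rewrite sw_scale.
rewrite -(hcomA hopfB (F := fun b1 b2 b3 => (lam b1 : k) *: F b2 b3)); last by lin.
by apply: sw_ext => a b3; rewrite (sw_windl _ (F := (fun w => F w b3))).
Qed.

Definition charV lam : {linear B -> k^o} := lcomp lam S.
Lemma charVE lam b : charV lam b = lam (S b). Proof. by []. Qed.
Lemma char_e : ischar (hcou hB).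
Proof. by split; [exact: (hcouM hopfB) | exact: (hcou1 hopfB)]. Qed.
Lemma char_conv lam mu : ischar lam -> ischar mu -> ischar (conv lam mu).
Proof.
move=> hl hm; split; last by rewrite convE (hcom1 hopfB) sw_pure ?hl.2 ?hm.2 ?scale1r //; lin.
move=> x y; rewrite convE (hcomM hopfB); last by lin.
transitivity ((conv lam mu x : k) *: (conv lam mu y : k^o)); last by [].
rewrite conv_scale; apply: sw_ext => a b; rewrite convE !sw_scale; apply: sw_ext => c d.
by rewrite hl.1 hm.1 -[LHS]/(lam a * lam c * (mu b * mu d) : k) -[RHS]/(lam a * (mu b * (lam c * mu d)) : k) mulrACA !mulrA.
Qed.
Section Characters.
Variables (lam : {linear B -> k^o}) (hl : ischar lam).
Lemma char_inv : ischar (charV lam).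
Proof.
split=> [x y|]; first by rewrite !charVE (hantM hopfB) hl.1 mulrC.
by rewrite charVE (hant1 hopfB) hl.2.
Qed.
Lemma conv_invr : conv lam (charV lam) = hcou hB.
Proof.
apply: lin_ext => b; transitivity (\sw_(x, y <- D b) lam (x ∙ S y)).
  by apply: sw_ext => x y; rewrite hl.1.
rewrite (hantr hopfB (F := fun w => lam w)); last by lin.
by rewrite hl.2 -[LHS]/((e b : k) * 1) mulr1.
Qed.
Lemma conv_invl : conv (charV lam) lam = hcou hB.
Proof.
apply: lin_ext => b; transitivity (\sw_(x, y <- D b) lam (S x ∙ y)).
  by apply: sw_ext => x y; rewrite hl.1.
rewrite (hantl hopfB (F := fun w => lam w)); last by lin.
by rewrite hl.2 -[LHS]/((e b : k) * 1) mulr1.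
Qed.
Lemma windlM x y : windl lam (x ∙ y) = windl lam x ∙ windl lam y.
Proof.
transitivity (\sw_(a, b <- D (x ∙ y)) (lam a : k) *: b); first by [].
rewrite (hcomM hopfB); last by lin.
rewrite (sw_windl _ (F := (fun w => w ∙ windl lam y))); last by lin.
apply: sw_ext => a b; rewrite (sw_windl _ (F := (fun w => b ∙ w))) ?sw_scale; last by lin.
by apply: sw_ext => c d; rewrite hl.1 scalerA.
Qed.
Lemma windl1 : windl lam one = one.
Proof.
transitivity (\sw_(a, b <- D one) (lam a : k) *: b); first by [].
by rewrite (hcom1 hopfB) sw_pure ?hl.2 ?scale1r //; lin.
Qed.
End Characters.
Lemma charV_conv lam mu : charV (conv lam mu) = conv (charV mu) (charV lam).
Proof.
apply: lin_ext => b; rewrite charVE convE (hcomS hopfB); last by lin.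
by apply: sw_ext => x y; exact: mulrC.
Qed.

(** This is b -> lam(b1) b2 lam(S(b3)), dual to conjugation by a group-like. *)
Definition cl lam : {linear B -> B} := lcomp (winding (charV lam)) (windl lam).
Lemma clE lam b : cl lam b = winding (charV lam) (windl lam b). Proof. by []. Qed.
Lemma cl_conv lam mu b : cl lam (cl mu b) = cl (conv mu lam) b.
Proof. by rewrite !clE windl_winding windl_windl winding_winding charV_conv. Qed.
Lemma cl_e b : cl (hcou hB) b = b.
Proof.
rewrite clE windl_e; have -> : charV (hcou hB) = hcou hB by apply: lin_ext => x; exact: (hcouS hopfB).
exact: winding_e.
Qed.
Lemma clK lam : ischar lam -> cancel (cl lam) (cl (charV lam)).
Proof. by move=> hl b; rewrite cl_conv (conv_invr hl) cl_e. Qed.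
Lemma clVK lam : ischar lam -> cancel (cl (charV lam)) (cl lam).
Proof. by move=> hl b; rewrite cl_conv (conv_invl hl) cl_e. Qed.
(** Across the coproduct, winding by the inverse of lam on one side meets winding by lam on the
    other and cancels. This makes [cl lam] comultiplicative. *)
Lemma winding_windl (W : lmodType k) lam (F : B -> B -> W) b : ischar lam -> bilin F ->
  \sw_(a, c <- D b) F (winding (charV lam) a) (windl lam c) = teval F (D b).
Proof.
move=> hl Fb; have [Fl Fr] := Fb.
transitivity (\sw_(a, c <- D b) \sw_(a1, a2 <- D a) F a1 ((lam (S a2) : k) *: windl lam c)).
  apply: sw_ext => a c; rewrite (sw_winding _ (F := (fun w => F w (windl lam c)))); last by lin.
  by apply: sw_ext => a1 a2; rewrite (linZ _ _ (Fr _)).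
rewrite (hcomA hopfB (F := fun a1 a2 c => F a1 ((lam (S a2) : k) *: windl lam c))); last by lin.
apply: sw_ext => a r; rewrite -(sw_linear _ _ (Fr a)); congr (F a).
rewrite -{2}[r]windl_e -(conv_invl hl) -windl_windl.
by rewrite (sw_windl _ (F := (windl lam))); last by lin.
Qed.
Lemma cl_hauto lam : ischar lam -> hauto (cl lam).
Proof.
move=> hl; have hi := char_inv hl.
have cM x y : cl lam (x ∙ y) = cl lam x ∙ cl lam y by rewrite !clE (windlM hl) (windingM hi).
have c1 : cl lam one = one by rewrite clE (windl1 hl) (winding1 hi).
have cc (W : lmodType k) (F : B -> B -> W) x : bilin F -> teval F (D (cl lam x)) = \sw_(a, b <- D x) F (cl lam a) (cl lam b).
  move=> Fb; have [Fl Fr] := Fb; rewrite clE winding_com // windl_com; last by lin.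
  rewrite -(winding_windl (F := fun a b => F (windl lam a) (winding (charV lam) b)) _ hl); last by lin.
  by apply: sw_ext => a b; rewrite windl_winding.
have ce x : e (cl lam x) = e x.
  transitivity (conv lam (charV lam) x); last by rewrite (conv_invr hl).
  rewrite clE (sw_winding _ (F := (hcou hB))); last by lin.
  rewrite windl_com; last by lin.
  rewrite convE; transitivity (\sw_(a, c <- D x) \sw_(a1, a2 <- D a) (lam a1 : k) *: ((lam (S c) : k) *: (e a2 : k^o))).
    apply: sw_ext => a c.
    by rewrite (sw_windl _ (F := (fun w => (charV lam c : k) *: (e w : k^o)))) //; lin.
  apply: sw_ext => a c; rewrite -[RHS]/((lam a : k) *: (lam (S c) : k^o)).
  have Gl : linear (fun a => (lam a : k) *: (lam (S c) : k^o)) by lin.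
  rewrite -[RHS](hcou1r hopfB (F := fun a => (lam a : k) *: (lam (S c) : k^o))) //.
  by apply: sw_ext => a1 a2; rewrite !scalerA -[LHS]/(lam a1 * lam (S c) * e a2 : k) -[RHS]/(e a2 * lam a1 * lam (S c) : k) mulrC mulrA.
by split=> //; [exists (cl (charV lam)); [exact: clK | exact: clVK] | exact: bialg_ant].
Qed.
Lemma cl_grp lam g : ischar lam -> isgrp g -> cl lam g = g.
Proof.
move=> hl hg; rewrite clE.
have -> : windl lam g = (lam g : k) *: g by rewrite (sw_windl _ (F := id)) ?(sw_grp hg) //; lin.
transitivity ((lam g : k) *: winding (charV lam) g); first exact: linearZ.
have -> : winding (charV lam) g = (charV lam g : k) *: g by rewrite (sw_winding _ (F := id)) ?(sw_grp hg) //; lin.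
rewrite scalerA charVE -hl.1 (grp_invr hg) hl.2.
exact: scale1r.
Qed.
Lemma cl_cg lam g b : ischar lam -> isgrp g -> cl lam (cg g b) = cg g (cl lam b).
Proof.
by move=> hl hg; rewrite !cgE !(au_M (cl_hauto hl)) (cl_grp hl hg) (cl_grp hl (grp_inv hg)).
Qed.

(** The condition reads g times the left winding of b equals f of the right winding times g. Winding
    by a character is invertible, and [cl lam] sends the right winding of b to the left one. *)
Lemma cg_clP lam g (f : {linear B -> B}) : ischar lam -> isgrp g ->
  (forall b, \sw_(b1, b2 <- D b) (lam b1 : k) *: (g ∙ b2) = \sw_(b1, b2 <- D b) (lam b2 : k) *: (f b1 ∙ g)) <->
  f =1 lcomp (cg g) (cl lam).
Proof.
move=> hl hg; have hi := char_inv hl.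
have WK b : winding (charV lam) (winding lam b) = b by rewrite winding_winding (conv_invl hl) winding_e.
have WK' b : winding lam (winding (charV lam) b) = b by rewrite winding_winding (conv_invr hl) winding_e.
have -> : (forall b, \sw_(b1, b2 <- D b) (lam b1 : k) *: (g ∙ b2) = \sw_(b1, b2 <- D b) (lam b2 : k) *: (f b1 ∙ g)) <->
  (forall b, g ∙ windl lam b = f (winding lam b) ∙ g).
  by split=> E b; have := E b; rewrite (sw_windl _ (F := (fun w => g ∙ w))) ?(sw_winding _ (F := (fun w => f w ∙ g))) //; lin.
have clW b : cl lam (winding lam b) = windl lam b by rewrite clE windl_winding WK.
split=> E b; last by rewrite E -[lcomp _ _ _]/(cg g (cl lam (winding lam b))) clW cgE (hmulA hopfB) (grp_invl hg) (hmul1r hopfB).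
rewrite -[b]WK'; set c := winding (charV lam) b.
rewrite -[RHS]/(cg g (cl lam (winding lam c))) clW cgE E (hmulA hopfB) (grp_invr hg).
by rewrite (hmul1r hopfB).
Qed.
End CharactersGrouplikes.

(** * Dual bialgebras and H-trivial objects *)

Section Duals.
Lemma lin1_eq (V : lmodType k) (f g : {linear k^o -> V}) : f (1 : k^o) = g (1 : k^o) -> f =1 g.
Proof.
move=> E c; have cE : c = (c : k) *: (1 : k^o) by rewrite -[RHS]/((c : k) * 1) mulr1.
by rewrite cE !linearZ E.
Qed.
Lemma tsplit5 (U U' U2 U3 U4 V : lmodType k) c u u' u2 u3 u4 (t : tword (V :: c)) :
  tsplit [:: U; U'; U2; U3; U4] (V :: c) (pure u (pure u' (pure u2 (pure u3 (pure u4 t))))) =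
  pure (pure u (pure u' (pure u2 (pure u3 u4)))) t.
Proof.
rewrite -[LHS]/(assocV _ _ _ (tmap (lid U) (tsplit [:: U'; U2; U3; U4] (V :: c)) (pure u _))).
by rewrite tmap_pure tsplit4 assocV_pure.
Qed.
Lemma hox5 (U U' U2 U3 U4 V : lmodType k) b c d (f : wmap [:: U; U'; U2; U3; U4] b) (g : wmap (V :: c) d) u u' u2 u3 u4
    (t : tword (V :: c)) :
  hox f g (pure u (pure u' (pure u2 (pure u3 (pure u4 t))))) =
  tjoin b d (pure (f (pure u (pure u' (pure u2 (pure u3 u4))))) (g t)).
Proof. by rewrite hoxE tsplit5 tmap_pure. Qed.
Lemma tjoin5 (U U' U2 U3 U4 V : lmodType k) d u u' u2 u3 u4 (t : tword (V :: d)) :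
  tjoin [:: U; U'; U2; U3; U4] (V :: d) (pure (pure u (pure u' (pure u2 (pure u3 u4)))) t) =
  pure u (pure u' (pure u2 (pure u3 (pure u4 t)))).
Proof.
rewrite -[LHS]/(tmap (lid U) (tjoin [:: U'; U2; U3; U4] (V :: d)) (assoc _ _ _ (pure (pure u _) _))).
by rewrite assoc_pure tmap_pure tjoin4.
Qed.

Section BialgOps.
Variables (X : lmodType k) (b : bialg X).
Definition xm : {linear tens X X -> X} := bmul b.
Definition xo : X := bone b (1 : k^o).
Definition xd : {linear X -> tens X X} := bcomul b.
Definition xe : {linear X -> k^o} := bcounit b.
End BialgOps.

Section DualTens.
Variables (X : lmodType k) (n : nat).
Hypothesis fdX : hasdim n X.
Local Notation Xd := (LinMap X k^o).
Lemma dual_tens_eq (t t' : tens Xd Xd) :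
  (forall x y, teval (fun p q : Xd => (p x : k) *: (q y : k^o)) (t) = teval (fun p q : Xd => (p x : k) *: (q y : k^o)) (t')) -> t = t'.
Proof.
have [a [c bc]] := findim_basis fdX; have [aE cE] := bc.
have pE (f : Xd) : f = \sum_i (f (a i) : k) *: (c i : Xd).
  apply: lin_ext => x; rewrite LinMap_sum {1}[x]aE linear_sum; apply: eq_bigr => i _.
  rewrite linearZ; exact: mulrC.
have E (s : tens Xd Xd) : s = \sum_i \sum_j (teval (fun p q : Xd => (p (a i) : k) *: (q (a j) : k^o)) (s) : k) *: pure (c i : Xd) (c j : Xd).
  rewrite -{1}[s]sw_id; transitivity (\sum_i \sum_j teval (fun p q : Xd => ((p (a i) : k) * q (a j) : k) *: pure (c i : Xd) (c j : Xd)) (s)).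
    rewrite (eq_bigr (fun i => teval (fun p q : Xd => \sum_j ((p (a i) : k) * q (a j) : k) *: pure (c i : Xd) (c j : Xd)) (s))); last first.
      by move=> i _; rewrite sw_sum.
    rewrite -sw_sum; apply: sw_ext => p q.
    rewrite {1}[p]pE {1}[q]pE pureSl; apply: eq_bigr => i _; rewrite pureSr; apply: eq_bigr => j _.
    by rewrite pureZl pureZr scalerA.
  by apply: eq_bigr => i _; apply: eq_bigr => j _; rewrite -sw_scal.
move=> tt; rewrite (E t) (E t'); apply: eq_bigr => i _; apply: eq_bigr => j _.
by rewrite tt.
Qed.
Lemma tens_sep (t t' : tens X X) :
  (forall f f' : Xd, \sw_(x, y <- t) (f x : k) *: (f' y : k^o) = \sw_(x, y <- t') (f x : k) *: (f' y : k^o)) -> t = t'.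
Proof.
have [a [c bc]] := findim_basis fdX; have [aE cE] := bc.
have E (s : tens X X) : s = \sum_i \sum_j (\sw_(x, y <- s) (c i x : k) *: (c j y : k^o) : k) *: pure (a i) (a j).
  rewrite -{1}[s]sw_id; transitivity (\sum_i \sum_j \sw_(x, y <- s) ((c i x : k) * c j y : k) *: pure (a i) (a j)).
    rewrite (eq_bigr (fun i => \sw_(x, y <- s) \sum_j ((c i x : k) * c j y : k) *: pure (a i) (a j))); last first.
      by move=> i _; rewrite sw_sum.
    rewrite -sw_sum; apply: sw_ext => x y.
    rewrite {1}[x]aE {1}[y]aE pureSl; apply: eq_bigr => i _; rewrite pureSr; apply: eq_bigr => j _.
    by rewrite pureZl pureZr scalerA.
  by apply: eq_bigr => i _; apply: eq_bigr => j _; rewrite -sw_scal.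
move=> tt; rewrite (E t) (E t'); apply: eq_bigr => i _; apply: eq_bigr => j _.
by rewrite (tt (c i) (c j)).
Qed.
Lemma dual_dual (r : {linear Xd -> k^o}) : exists x : X, forall f : Xd, r f = f x.
Proof.
have [a [c bc]] := findim_basis fdX.
exists (\sum_i (r (c i) : k) *: a i) => f.
rewrite (basis_linexp (F := r) f bc); last by lin.
rewrite linear_sum; apply: eq_bigr => i _.
have -> : rank1 (c i) (f (a i)) = (f (a i) : k) *: (c i : Xd).
  by apply: lin_ext => x; rewrite rank1E; exact: mulrC.
by rewrite !linearZ; exact: mulrC.
Qed.
Lemma dual_sep (x y : X) : (forall f : Xd, f x = f y) -> x = y.
Proof.
have [a [c [aE cE]]] := findim_basis fdX => E; rewrite [x]aE [y]aE.
by apply: eq_bigr => i _; rewrite (E (c i)).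
Qed.
End DualTens.

(** B, its dual and the double are trivial over H, so every braiding in the construction of the
    double is a flip. *)
Definition trivC (X : ydobj H) : Prop :=
  (forall x m, ha X (pure x m) = (hcou hH x : k) *: m) /\ (forall m, hc X m = pure (hone hH) m).
Lemma trivC_B : trivC B. Proof. by split. Qed.
Lemma trivC_unit : trivC (unitC hH).
Proof. by split=> [x m|m]; [exact (unit_actE hH x m) | exact (unit_coactE hH m)]. Qed.
Lemma Phi_triv X Y : trivC X -> trivC Y -> Phi hH X Y = flip X Y.
Proof.
move=> [aX cX] [aY cY]; apply: lin_ext; apply: tens_ext => x y; rewrite flip_pure.
apply: etrans (PhiE hH _ _) _; rewrite cY sw_pure; last by lin.
by rewrite aX (hcouSb hopfH bijH) (hcou1 hopfH) scale1r.
Qed.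
Lemma trivC_tens X Y : trivC X -> trivC Y -> trivC (tensC hH X Y).
Proof.
move=> [aX cX] [aY cY].
split=> [h|].
  have E (t : tens X Y) : tact hH (ha X) (ha Y) (pure h t) = (hcou hH h : k) *: t.
    have F1 : linear (fun t : tens X Y => tact hH (ha X) (ha Y) (pure h t)) by lin.
    have F2 : linear (fun t : tens X Y => (hcou hH h : k) *: t) by lin.
    move: t; apply: (tens_lin_eq F1 F2) => x y; rewrite tactE -[RHS](hcou1l hopfH (F := fun h => (hcou hH h : k) *: pure x y)); last by lin.
    by apply: sw_ext => a b; rewrite aX aY pureZl pureZr.
  exact E.
have E (t : tens X Y) : tcoact hH (hc X) (hc Y) t = pure (hone hH) t.
  tens_elim t => x y; rewrite tcoactE cX cY sw_pure; last by lin.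
  by rewrite sw_pure ?(hmul1l hopfH) //; lin.
exact E.
Qed.
Lemma trivC_dual n X : trivC X -> hasdim n X -> trivC (dualC hH X).
Proof.
move=> [aX cX] fdX; have [aU cU] := trivC_unit; split=> [h f|f].
  apply: lin_ext => m; rewrite (homC_ha h (f : LinMap X k^o) m).
  transitivity ((hcou hH h : k) *: (f : LinMap X k^o) m); last by [].
  rewrite -[RHS](hcou1l hopfH (F := fun h => (hcou hH h : k) *: (f : LinMap X k^o) m)); last by lin.
  apply: sw_ext => a b; rewrite aU aX (hcouS hopfH); congr (_ *: _).
  have fl : linear (f : LinMap X k^o) by lin.
  exact (linZ _ _ fl).
pose r : {linear LinMap X k^o -> tens H (LinMap X k^o)} := mkLin (lin_purer (hone hH) (@lin_id _ (LinMap X k^o))).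
rewrite -[RHS]/(r f).
apply: (homcoact_unique fdX (h := hH) (la := hc X) (ka := hc (unitC hH))); first exact (hom_coactP hH (hc X) (hc (unitC hH)) fdX).
move=> W F g m Fb; have [Fl Fr] := Fb; rewrite -[r g]/(pure (hone hH) g) sw_pure; last first.
  by split=> [q|x]; [lin | move=> a s t; exact: (Fr x a (s m) (t m))].
rewrite cX sw_pure; last by lin.
rewrite cU sw_pure; last by lin.
by rewrite (hantV1 hopfH bijH) (hmul1r hopfH).
Qed.
Lemma trivC_mor (X : ydobj H) (g : wmap [::] [:: ycar X]) : trivC X -> @is_morC k H (unitC hH) X g.
Proof.
move=> [aX cX]; have [aU cU] := trivC_unit; split.
  apply: tens_ext => h c; rewrite !hcompE.
  transitivity (g (ha (unitC hH) (pure h c))); first by [].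
  by rewrite aU linearZ; wev; symmetry; exact: aX.
move=> c; rewrite !hcompE; transitivity (hc X (g c)); first by [].
rewrite cX; transitivity ((idm H \ox (g : wmap [:: ycar (unitC hH)] [:: ycar X])) (hc (unitC hH) c)); last by [].
by rewrite cU; wev.
Qed.
Lemma grouplikeP (X : ydobj H) (b : bialg X) (g : wmap [::] [:: ycar X]) : trivC X ->
  grouplike hH b g <-> xd b (g (1 : k^o)) = pure (g (1 : k^o)) (g (1 : k^o)) /\ xe b (g (1 : k^o)) = (1 : k).
Proof.
move=> tX; split=> [[_ E1 E2]|[E1 E2]].
  split; last by have := E2 (1 : k^o); rewrite hcompE.
  by have := E1 (1 : k^o); rewrite hcompE hox0l tjoin1.
split; first exact: trivC_mor.
  apply: lin1_eq; rewrite hcompE hox0l tjoin1; exact: E1.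
by apply: lin1_eq; rewrite hcompE; exact: E2.
Qed.

Section DualBialg.
Variables (X : ydobj H) (b : bialg X) (n : nat).
Hypotheses (tX : trivC X) (fdX : hasdim n X).
Local Notation Xd := (LinMap X k^o).
Local Notation hXd := (dual_bialg hH b).
Let tXd : trivC (dualC hH X) := trivC_dual tX fdX.

Let ev0 : wmap [:: Xd; ycar X] [::] := ev X k^o.
Let ev0E (f : Xd) x : ev0 (pure f x) = f x. Proof. exact: ev_pure. Qed.
Lemma dual_mulE (f f' : Xd) x : (xm hXd (pure f f') : Xd) x = \sw_(x1, x2 <- xd b x) (f x1 : k) *: (f' x2 : k^o).
Proof.
have L (P : wmap [:: Xd; ycar X] [:: ycar X; Xd]) : P = flip Xd X ->
  (curry [:: Xd; Xd] ((ev0 \ox ev0) \oc (idm Xd \ox P \ox idm X)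
        \oc (idm Xd \ox idm Xd \ox bcomul b)) (pure f f') : Xd) x =
  \sw_(x1, x2 <- xd b x) (f x1 : k) *: (f' x2 : k^o).
  by move=> ->; rewrite curryE; wev; swx (bcomul b x) => x1 x2; wev; rewrite ?ev0E.
exact (L _ (Phi_triv tXd tX)).
Qed.
Lemma dual_oneE (x : X) : (xo hXd : Xd) x = xe b x.
Proof.
rewrite -[LHS]/((curry [::] (bcounit b) (1 : k^o) : Xd) x) curryE tjoin0l.
by rewrite scale1r.
Qed.
Lemma dual_couE (f : Xd) : xe hXd f = f (xo b).
Proof. by rewrite -[LHS]/((ev0 \oc (idm Xd \ox bone b)) f); wev; rewrite ?ev0E. Qed.
(** The coproduct of the dual is given by a description. A finite basis provides the explicit
    solution [r], so the defining equation holds and may be evaluated. *)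
Lemma dual_comE (f : Xd) x y :
  teval (fun p q : Xd => (p x : k) *: (q y : k^o)) (xd hXd f) = f (xm b (pure x y)).
Proof.
have L (P : wmap [:: Xd; ycar X] [:: ycar X; Xd]) (d : wmap [:: Xd] [:: Xd; Xd]) (g : Xd) u v : P = flip Xd X ->
    ((ev0 \ox ev0) \oc (idm Xd \ox P \ox idm X) \oc (d \ox idm X \ox idm X)) (pure g (pure u v)) =
    teval (fun p q : Xd => (p u : k) *: (q v : k^o)) (d g).
  by move=> ->; wev; swx (d g) => p q; wev; rewrite ?ev0E.
have R (g : Xd) u v : (ev0 \oc (idm Xd \ox bmul b)) (pure g (pure u v)) = g (xm b (pure u v)) by wev; rewrite ?ev0E.
have [a [c bc]] := findim_basis fdX; have [aE cE] := bc.
pose r (g : Xd) : tens Xd Xd := \sum_i \sum_j (g (xm b (pure (a i) (a j))) : k) *: pure (c i : Xd) (c j : Xd).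
have rl : linear r.
  by apply: lin_sum => i; apply: lin_sum => j; lin.
have rE (g : Xd) u v : teval (fun p q : Xd => (p u : k) *: (q v : k^o)) (r g) = g (xm b (pure u v)).
  have Fb : bilin (fun p q : Xd => (p u : k) *: (q v : k^o)) by lin.
  have Fl : linear (teval (fun p q : Xd => (p u : k) *: (q v : k^o))) by lin.
  transitivity (\sum_i \sum_j (g (xm b (pure (a i) (a j))) : k) *: ((c i u : k) *: (c j v : k^o))).
    rewrite /r (linS _ _ _ Fl); apply: eq_bigr => i _; rewrite (linS _ _ _ Fl); apply: eq_bigr => j _.
    by rewrite (linZ _ _ Fl) sw_pure.
  have Gl w : linear (fun x => g (xm b (pure x w))) by lin.
  have Gr w : linear (fun x => g (xm b (pure w x))) by lin.
  have Er : g (xm b (pure u v)) = \sum_i (c i u : k) *: g (xm b (pure (a i) v)).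
    by rewrite {1}[u]aE (linS _ _ _ (Gl v)); apply: eq_bigr => i _; rewrite (linZ _ _ (Gl v)).
  rewrite Er; apply: eq_bigr => i _.
  have -> : g (xm b (pure (a i) v)) = \sum_j (c j v : k) *: g (xm b (pure (a i) (a j))).
    by rewrite {1}[v]aE (linS _ _ _ (Gr (a i))); apply: eq_bigr => j _; rewrite (linZ _ _ (Gr (a i))).
  rewrite scaler_sumr; apply: eq_bigr => j _.
  by rewrite -[LHS]/(g (xm b (pure (a i) (a j))) * (c i u * c j v) : k) mulrC -mulrA.
have S (d : wmap [:: Xd] [:: Xd; Xd]) : ((ev0 \ox ev0) \oc (idm Xd \ox Phi hH (dualC hH X) X \ox idm X) \oc (d \ox idm X \ox idm X)
    =1 ev0 \oc (idm Xd \ox bmul b)) <-> (forall (g : Xd) u v, teval (fun p q : Xd => (p u : k) *: (q v : k^o)) (d g) = g (xm b (pure u v))).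
  split=> E; first by move=> g u v; have := E (pure g (pure u v)); rewrite R (L _ _ _ _ _ (Phi_triv tXd tX)).
  by apply: tens_ext3 => g u v; rewrite R (L _ _ _ _ _ (Phi_triv tXd tX)).
have /S := rE : forall g u v, teval (fun p q : Xd => (p u : k) *: (q v : k^o)) ((mkLin rl : wmap [:: Xd] [:: Xd; Xd]) g) = g (xm b (pure u v)).
move=> Er; suff : forall (g : Xd) u v, teval (fun p q : Xd => (p u : k) *: (q v : k^o)) (bcomul hXd g) = g (xm b (pure u v)) by apply.
apply/S; rewrite -[bcomul hXd]/(the _) /the; case: xgetP => [d _ //|/(_ (mkLin rl))[]].
exact: Er.
Qed.
Lemma dual_grouplike (g : wmap [::] [:: Xd]) : grouplike hH hXd g <->
  (forall x y, (g (1 : k^o) : Xd) (xm b (pure x y)) = ((g (1 : k^o) : Xd) x : k) * (g (1 : k^o) : Xd) y) /\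
  (g (1 : k^o) : Xd) (xo b) = (1 : k).
Proof.
set f := (g (1 : k^o) : Xd).
have Fb x y : bilin (fun p q : Xd => (p x : k) *: (q y : k^o)) by lin.
apply: (iff_trans (grouplikeP hXd g tXd)); rewrite -[g 1]/f; split=> -[E1 E2].
  split; last by rewrite -dual_couE.
  by move=> x y; rewrite -dual_comE E1 sw_pure.
split; last by rewrite dual_couE.
by apply: (dual_tens_eq fdX) => x y; rewrite dual_comE sw_pure; [exact: E1 | exact: Fb].
Qed.
End DualBialg.
End Duals.

(** * Explicit structure of the Drinfel'd double *)

Section DoubleStructure.
Local Notation "x ∙ y" := (hmul hB (pure x y)) (at level 40, left associativity).
Local Notation one := (hone hB).
Local Notation D := (hcom hB).
Local Notation e := (hcou hB).
Local Notation Sb := (hantV hB).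
Local Notation Bd := (LinMap B k^o).
Local Notation dB := (dualC hH B).
Local Notation DB := (DB hH B).
Local Notation hBd := (dual_bialg hH hB).
Local Notation hD := (hDB hH hB).
Implicit Types (lam mu : {linear B -> k^o}) (f : Bd) (g h a b x y : B).

Section Double.
Variables (nB : nat) (fdB : hasdim nB B).
Let tB : trivC B := trivC_B.
Let tBd : trivC dB := trivC_dual tB fdB.
Let tDB : trivC DB := trivC_tens tBd tB.

Definition tr : {linear tens B Bd -> Bd} := trr hH hB.
Definition tl : {linear tens B Bd -> B} := trl hH hB.
Definition Dd : {linear Bd -> tens Bd Bd} := xd hBd.
Definition dmul : {linear tens Bd Bd -> Bd} := xm hBd.

Lemma dmulE (f f' : Bd) x : dmul (pure f f') x = \sw_(x1, x2 <- D x) (f x1 : k) *: (f' x2 : k^o).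
Proof. exact (dual_mulE hB tB fdB f f' x). Qed.
Lemma DdE f x y : teval (fun p q : Bd => (p x : k) *: (q y : k^o)) (Dd f) = f (x ∙ y).
Proof. exact (dual_comE hB tB fdB f x y). Qed.
Lemma Dd_eq f (t : tens Bd Bd) : (forall x y, f (x ∙ y) = teval (fun p q : Bd => (p x : k) *: (q y : k^o)) t) -> Dd f = t.
Proof. by move=> E; apply: (dual_tens_eq fdB) => x y; rewrite DdE E. Qed.

Let Phi_dB : Phi hH dB B = flip Bd B := Phi_triv tBd tB.
Let Phi_Bd : Phi hH B dB = flip B Bd := Phi_triv tB tBd.
Let Phi_dd : Phi hH dB dB = flip Bd Bd := Phi_triv tBd tBd.
Let Phi_bb : Phi hH B B = flip B B := Phi_triv tB tB.

(** [p] and [q] occur in reversed order because the coproduct on the dual of the opposite algebra is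
    flipped. *)
Lemma DB_comE (W : lmodType k) (F : tens Bd B -> tens Bd B -> W) f b : bilin F ->
  teval F (xd hD (pure f b)) = teval (fun p q : Bd => \sw_(b1, b2 <- D b) F (pure q b1) (pure p b2)) (Dd f).
Proof.
move=> Fb; have [Fl Fr] := Fb.
have L (P1 : wmap [:: Bd; ycar B] [:: ycar B; Bd]) (P2 : wmap [:: Bd; Bd] [:: Bd; Bd]) (d : wmap [:: Bd] [:: Bd; Bd]) :
    P1 = flip Bd B -> P2 = flip Bd Bd ->
  ((grp Bd B \ox grp Bd B) \oc ((idm Bd \ox P1 \ox idm B) \oc ((P2 \oc d) \ox bcomul hB)) \oc ungrp Bd B) (pure f b) =
  teval (fun p q : Bd => \sw_(b1, b2 <- D b) pure (pure q b1) (pure p b2)) (d f).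
  by move=> -> ->; wev; swx (d f) => p q; wev; swx (bcomul hB b) => b1 b2; wev.
have P2E : linv (Phi hH dB dB) = flip Bd Bd by rewrite Phi_dd linv_flip.
have E := L _ _ (bcomul hBd) Phi_dB P2E.
transitivity (teval F (teval (fun p q : Bd => \sw_(b1, b2 <- D b) pure (pure q b1) (pure p b2)) (Dd f))).
  by rewrite -[Dd f]/(bcomul hBd f) -E.
rewrite sw_sw; last by lin.
by apply: sw_ext => p q; rewrite sw_sw; [apply: sw_ext => b1 b2; rewrite sw_pure | lin].
Qed.
Lemma DB_couE f b : xe hD (pure f b) = (f one : k) *: (e b : k^o).
Proof.
have cE : (bcounit hBd : {linear Bd -> k^o}) f = f one by exact (dual_couE hB f).
have L (c1 : wmap [:: Bd] [::]) (c2 : wmap [:: ycar B] [::]) :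
  ((c1 \ox c2) \oc ungrp Bd B) (pure f b) = (c1 f : k) *: (c2 b : k^o) by wev.
by rewrite -cE; exact (L (bcounit hBd) (bcounit hB)).
Qed.
Lemma hBd_one : xo hBd = (e : Bd) :> Bd.
Proof. by apply: lin_ext => x; exact (dual_oneE hB x). Qed.
Lemma DB_oneE : xo hD = pure (e : Bd) one.
Proof.
have L (o1 : wmap [::] [:: Bd]) (o2 : wmap [::] [:: ycar B]) :
  (grp Bd B \oc (o1 \ox o2)) (1 : k^o) = pure (o1 (1 : k^o)) (o2 (1 : k^o)) by rewrite hcompE hox0l tjoin1.
by rewrite -hBd_one; exact (L (bone hBd) (bone hB)).
Qed.

Lemma evbarE b f : evbar hH B (pure b f) = f b.
Proof.
have L (P : wmap [:: ycar B; Bd] [:: Bd; ycar B]) : P = flip B Bd -> (ev B k^o \oc P) (pure b f) = f b.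
  by move=> ->; wev.
exact (L _ Phi_Bd).
Qed.
Lemma tlE b f : tl (pure b f) = \sw_(c, b3 <- D b) \sw_(b1, b2 <- D c) (f (Sb b3 ∙ b1) : k) *: b2.
Proof.
have L (P1 P2 : wmap [:: ycar B; ycar B] [:: ycar B; ycar B]) (E : wmap [:: ycar B; Bd] [::]) :
    P1 = flip B B -> P2 = flip B B -> (forall b f, E (pure b f) = f b) ->
  ((idm B \ox E) \oc (idm B \ox (bmul hB \oc P1) \ox idm Bd)
  \oc (P2 \ox linv (antip hB) \ox idm Bd) \oc (((bcomul hB \ox idm B) \oc bcomul hB) \ox idm Bd)) (pure b f) =
  \sw_(c, b3 <- D b) \sw_(b1, b2 <- D c) (f (Sb b3 ∙ b1) : k) *: b2.
  move=> -> -> EE; wev; swx (bcomul hB b) => c b3; wev; swx (bcomul hB c) => b1 b2; wev.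
  by rewrite EE.
have P2E : linv (Phi hH B B) = flip B B by rewrite Phi_bb linv_flip.
exact (L _ _ _ Phi_bb P2E evbarE).
Qed.
(** The formula is linear in the tensor and solves the equation describing [trr], so the description
    has a witness; the equation in turn forces the formula. *)
Lemma trE b f x : tr (pure b f) x = \sw_(b1, b2 <- D b) f (Sb b2 ∙ (x ∙ b1)).
Proof.
have L (t : wmap [:: ycar B; Bd] [:: Bd]) (E : wmap [:: ycar B; Bd] [::]) (P1 : wmap [:: ycar B; ycar B] [:: ycar B; ycar B]) :
    P1 = flip B B -> (forall b f, E (pure b f) = f b) ->
    E \oc (idm B \ox t) =1 E \oc ((bmul hB \oc P1 \oc (bmul hB \ox linv (antip hB)) \oc (idm B \ox bcomul hB)) \ox idm Bd) <->
    (forall b f x, (t (pure b f) : Bd) x = \sw_(b1, b2 <- D b) f (Sb b2 ∙ (x ∙ b1))).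
  move=> -> EE.
  have Rr a b' f' : (E \oc ((bmul hB \oc flip B B \oc (bmul hB \ox linv (antip hB)) \oc (idm B \ox bcomul hB)) \ox idm Bd)) (pure a (pure b' f')) =
      \sw_(b1, b2 <- D b') f' (Sb b2 ∙ (a ∙ b1)).
    wev; swx (bcomul hB b') => b1 b2; wev.
    by rewrite EE.
  have Lr a b' f' : (E \oc (idm B \ox t)) (pure a (pure b' f')) = (t (pure b' f') : Bd) a by wev; rewrite EE.
  split=> [Et b' f' a|Et]; first by rewrite -Lr Et Rr.
  by apply: tens_ext3 => a b' f'; rewrite Lr Rr Et.
pose r1 (t : tens B Bd) u := teval (fun (b : B) (f : Bd) => \sw_(b1, b2 <- D b) (f (Sb b2 ∙ (u ∙ b1)) : k^o)) t.
have bx u : bilin (fun (b : B) (f : Bd) => \sw_(b1, b2 <- D b) (f (Sb b2 ∙ (u ∙ b1)) : k^o)) by lin.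
have r1l t : linear (r1 t) by rewrite /r1; lin.
have r2l : linear (fun t => mkLin (r1l t) : Bd).
  move=> c s t; apply: lin_ext => u; rewrite -[LHS]/(r1 (c *: s + t) u) /r1.
  by rewrite (teval_lin (bilinE (bx u))).
have rE b' f' u : ((mkLin r2l (pure b' f') : Bd) u : k^o) = \sw_(b1, b2 <- D b') f' (Sb b2 ∙ (u ∙ b1)).
  by rewrite -[LHS]/(r1 (pure b' f') u) /r1 sw_pure.
have Er := (L (mkLin r2l) _ _ Phi_bb evbarE).2 rE.
apply: (L (trr hH hB) _ _ Phi_bb evbarE).1.
rewrite /trr /the; case: xgetP => [t _ //|/(_ (mkLin r2l))[]]; exact: Er.
Qed.

Lemma DB_mulE f a f' b : xm hD (pure (pure f a) (pure f' b)) =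
  \sw_(a1, a2 <- D a) teval (fun p q : Bd => pure (dmul (pure f (tr (pure a1 q)))) (tl (pure a2 p) ∙ b)) (Dd f').
Proof.
have L (P1 : wmap [:: ycar B; Bd] [:: Bd; ycar B]) (P2 : wmap [:: Bd; Bd] [:: Bd; Bd]) (d : wmap [:: Bd] [:: Bd; Bd])
    (m : wmap [:: Bd; Bd] [:: Bd]) (t : wmap [:: ycar B; Bd] [:: Bd]) (l : wmap [:: ycar B; Bd] [:: ycar B]) :
    P1 = flip B Bd -> P2 = flip Bd Bd ->
  (grp Bd B \oc ((m \ox bmul hB) \oc (idm Bd \ox t \ox l \ox idm B)
  \oc (idm Bd \ox idm B \ox P1 \ox idm Bd \ox idm B)
  \oc (idm Bd \ox bcomul hB \ox (P2 \oc d) \ox idm B)) \oc (ungrp Bd B \ox ungrp Bd B)) (pure (pure f a) (pure f' b)) =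
  \sw_(a1, a2 <- D a) teval (fun p q : Bd => pure (m (pure f (t (pure a1 q)))) (l (pure a2 p) ∙ b)) (d f').
  move=> -> ->.
  pose A3 := idm Bd \ox idm B \ox flip B Bd \ox idm Bd \ox idm B.
  pose A4 := idm Bd \ox t \ox l \ox idm B.
  pose A2 := idm Bd \ox bcomul hB \ox (flip Bd Bd \oc d) \ox idm B.
  have E1 : (ungrp Bd B \ox ungrp Bd B) (pure (pure f a) (pure f' b)) = pure f (pure a (pure f' b)).
    by rewrite hox1 tjoin2.
  have E2 : A2 (pure f (pure a (pure f' b))) =
      \sw_(a1, a2 <- D a) teval (fun p q : Bd => pure f (pure a1 (pure a2 (pure q (pure p b))))) (d f').
    rewrite /A2 hox3 hox2 hox1 tjoin1.
    swx (bcomul hB a) => a1 a2; rewrite hcompE; swx (d f') => p q.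
    by rewrite flip_pure tjoin3 tjoin5.
  have E3 a1 a2 (p q : Bd) : A3 (pure f (pure a1 (pure a2 (pure q (pure p b))))) =
      pure f (pure a1 (pure q (pure a2 (pure p b)))).
    by rewrite /A3 hox5 hox4 hox2 hox1 flip_pure tjoin1 tjoin2 tjoin4 tjoin5.
  have E4 a1 a2 (p q : Bd) : A4 (pure f (pure a1 (pure q (pure a2 (pure p b))))) =
      pure f (pure (t (pure a1 q)) (pure (l (pure a2 p)) b)).
    by rewrite /A4 hox5 hox3 hox1 tjoin1 tjoin2 tjoin3.
  have E5 (q : Bd) c : (m \ox bmul hB) (pure f (pure q (pure c b))) = pure (m (pure f q)) (c ∙ b) by rewrite hox2 tjoin1.
  have Gl : linear (fun u : tens Bd (tens B (tens B (tens Bd (tens Bd B)))) => (m \ox bmul hB) (A4 (A3 u))).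
    by move=> c u u'; rewrite !linearP.
  rewrite /A2 in E2; rewrite /A3 /A4 in E3 E4 Gl.
  rewrite !hcompE E1 E2; clear E1 E2.
  refine (etrans (sw_linear _ _ Gl) _); apply: sw_ext => a1 a2.
  refine (etrans (sw_linear _ _ Gl) _); apply: sw_ext => p q.
  by rewrite E3 E4 E5.
have P2E : linv (Phi hH dB dB) = flip Bd Bd by rewrite Phi_dd linv_flip.
exact (L _ _ (bcomul hBd) (bmul hBd) (trr hH hB) (trl hH hB) Phi_Bd P2E).
Qed.
End Double.
End DoubleStructure.

(** * Group-likes of the double and of its dual *)

Section DoubleGrouplikes.
Local Notation "x ∙ y" := (hmul hB (pure x y)) (at level 40, left associativity).
Local Notation one := (hone hB).
Local Notation D := (hcom hB).
Local Notation e := (hcou hB).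
Local Notation Sb := (hantV hB).
Local Notation Bd := (LinMap B k^o).
Local Notation dB := (dualC hH B).
Local Notation DB := (DB hH B).
Local Notation hD := (hDB hH hB).
Implicit Types (lam mu : {linear B -> k^o}) (f : Bd) (g h a b x y : B).

Section DoublePairs.
Variables (nB : nat) (fdB : hasdim nB B).
Let tB : trivC B := trivC_B.
Let tBd : trivC dB := trivC_dual tB fdB.
Let tDB : trivC DB := trivC_tens tBd tB.
Let fdBd : hasdim (nB * 1) Bd := hasdim_hom fdB unitB_dim.
Let fdDB : hasdim (nB * 1 * nB) DB := hasdim_tens fdBd fdB.

Lemma Dd_char lam : ischar lam -> Dd lam = pure (lam : Bd) (lam : Bd).
Proof.
move=> hl; apply: (Dd_eq fdB) => x y; rewrite sw_pure; last by lin.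
exact: hl.1.
Qed.
Lemma Dd_one1 (W : lmodType k) (F : Bd -> W) f : linear F ->
  teval (fun p q : Bd => (p one : k) *: F q) (Dd f) = F f.
Proof.
move=> Fl; transitivity (F (teval (fun p q : Bd => (p one : k) *: q) (Dd f))).
  by rewrite (sw_linear _ _ Fl); apply: sw_ext => p q; rewrite (linZ _ _ Fl).
congr F; apply: lin_ext => x; rewrite sw_app.
by rewrite -[x in RHS](hmul1l hopfB) -(DdE fdB).
Qed.
Lemma tr_char lam g : ischar lam -> isgrp g -> tr (pure g (lam : Bd)) = lam.
Proof.
move=> hl hg; apply: lin_ext => x; rewrite (trE fdB).
rewrite (sw_grp hg); last by lin.
have E : lam (Sb g) * lam g = 1 :> k.
  have := hantVl hopfB bijB (F := lam) g; rewrite (sw_grp hg); try by lin.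
  by move=> E; rewrite -hl.1 E; [rewrite hg.2 scale1r; exact: hl.2 | lin].
rewrite !hl.1 [lam x * _]mulrC mulrA.
transitivity (1 * lam x : k); [by congr (_ * _) | exact: mul1r].
Qed.
Lemma tl_grp lam g : ischar lam -> isgrp g -> tl (pure g (lam : Bd)) = g.
Proof.
move=> hl hg; rewrite (tlE fdB) (sw_grp hg); last by lin.
rewrite (sw_grp hg); last by lin.
have E : lam (Sb g ∙ g) = 1 :> k.
  have := hantVl hopfB bijB (F := lam) g; rewrite (sw_grp hg); try by lin.
  by move=> E; rewrite E; [rewrite hg.2 scale1r; exact: hl.2 | lin].
by rewrite E scale1r.
Qed.
Lemma dmul_conv lam mu : dmul (pure (lam : Bd) (mu : Bd)) = conv lam mu.
Proof. by apply: lin_ext => x; rewrite (dmulE fdB). Qed.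
Lemma DB_mul_pair lam mu g h : ischar lam -> ischar mu -> isgrp g -> isgrp h ->
  xm hD (pure (pure (lam : Bd) g) (pure (mu : Bd) h)) = pure (conv lam mu : Bd) (g ∙ h).
Proof.
move=> hl hm hg hh; rewrite (DB_mulE fdB) Dd_char //.
transitivity (\sw_(a1, a2 <- D g) pure (dmul (pure (lam : Bd) (tr (pure a1 (mu : Bd))))) (tl (pure a2 (mu : Bd)) ∙ h)).
  by apply: sw_ext => a1 a2; rewrite sw_pure //; lin.
rewrite (sw_grp hg); last by lin.
by rewrite tr_char // tl_grp // dmul_conv.
Qed.

Definition mkw (X : lmodType k) (v : X) : wmap [::] [:: X] := mkLin (lin_sca (f := fun c : k^o => c) v (@lin_id _ k^o)).
Lemma mkwE (X : lmodType k) (v : X) : mkw v (1 : k^o) = v.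
Proof. exact: scale1r. Qed.
Lemma mkw_eq (X : lmodType k) (w : wmap [::] [:: X]) (v : X) : w (1 : k^o) = v -> w = mkw v.
Proof. by move=> E; apply: lin_ext; apply: lin1_eq; rewrite mkwE. Qed.

(** Let [l] and [r] apply the counit of one of the two factors. Then l (x) r after the coproduct is
    the identity of D(B), so a group-like t equals l(t) (x) r(t); the same projections carry over
    group-likeness to both parts. *)
Lemma G_DBP (w : wmap [::] [:: ycar DB]) : grouplike hH hD w <->
  exists lam g, [/\ ischar lam, isgrp g & w = mkw (pure (lam : Bd) g)].
Proof.
apply: (iff_trans (grouplikeP hD w tDB)); split=> [[E1 E2]|[lam [g [hl hg ->]]]]; last first.
  rewrite mkwE; split; last by rewrite DB_couE hg.2 hl.2; exact: mulr1.
  rewrite -[LHS]sw_id (DB_comE fdB); last by lin.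
  rewrite Dd_char // sw_pure; last by lin.
  by rewrite (sw_grp hg) //; lin.
set t := (w (1 : k^o) : tens Bd B) in E1 E2.
have ll : bilin (fun (f : Bd) b => (e b : k) *: f) by lin.
have rl : bilin (fun (f : Bd) b => (f one : k) *: b) by lin.
pose l : {linear tens Bd B -> Bd} := tlift (bilinE ll).
pose r : {linear tens Bd B -> B} := tlift (bilinE rl).
have lE f b : l (pure f b) = (e b : k) *: f by exact: tlift_pure.
have rE f b : r (pure f b) = (f one : k) *: b by exact: tlift_pure.
have H1 (s : tens Bd B) : teval (fun u v => pure (l u) (r v)) (xd hD s) = s.
  move: s; apply: tens_lin_eq; [by lin | by lin | move=> f b].
  rewrite (DB_comE fdB); last by lin.
  transitivity (teval (fun p q : Bd => (p one : k) *: \sw_(b1, b2 <- D b) (e b1 : k) *: pure q b2) (Dd f)).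
    apply: sw_ext => p q; rewrite sw_scale; apply: sw_ext => b1 b2.
    by rewrite lE rE pureZl pureZr !scalerA mulrC.
  rewrite (Dd_one1 (F := fun q : Bd => \sw_(b1, b2 <- D b) (e b1 : k) *: pure q b2)); last by lin.
  by rewrite (hcou1l hopfB (F := fun b2 => pure f b2)) //; lin.
have tE : t = pure (l t) (r t) by rewrite -{1}[t]H1 E1 sw_pure //; lin.
set lam := (l t : {linear B -> k^o}) in tE *; set g := r t in tE *.
have lE' : (e g : k) *: (lam : Bd) = lam by rewrite -lE -tE.
have E3 : (lam one : k) * (e g : k) = 1 by rewrite -E2 {1}tE DB_couE.
have l1 : lam one = (1 : k).
  have : (e g : k) * lam one = lam one by have := congr1 (fun q : Bd => q one) lE'.
  by rewrite mulrC E3 => <-.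
have e1 : e g = (1 : k) by rewrite -E3 l1 mul1r.
exists lam, g; split; last by apply: mkw_eq; exact: tE.
  split=> // y x.
  have := congr1 (teval (fun u v => ((l u : Bd) x : k) *: ((l v : Bd) y : k^o))) E1.
  rewrite sw_pure; last by lin.
  move=> E4; rewrite [RHS]mulrC; refine (etrans _ E4); rewrite {1}tE (DB_comE fdB); last by lin.
  transitivity (teval (fun p q : Bd => (e g : k) *: ((p y : k) *: (q x : k^o))) (Dd lam)).
    by rewrite -sw_scale (DdE fdB) e1 scale1r.
  apply: sw_ext => p q; rewrite -(hcou1l hopfB (F := fun b => (e b : k) *: ((p y : k) *: (q x : k^o)))); last by lin.
  apply: sw_ext => b1 b2; rewrite !lE.
  by rewrite -[LHS]/(e b1 * (e b2 * (p y * q x)) : k) -[RHS]/((e b1 * q x) * (e b2 * p y) : k) mulrACA -!mulrA [q x * p y]mulrC.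
split=> //; have := congr1 (teval (fun u v => pure (r u) (r v))) E1.
rewrite sw_pure; last by lin.
move=> E4; refine (etrans _ E4); rewrite {1}tE (DB_comE fdB); last by lin.
transitivity (teval (fun p q : Bd => (p one : k) *: ((q one : k) *: D g)) (Dd lam)).
  by rewrite (Dd_one1 (F := fun q : Bd => (q one : k) *: D g)) ?l1 ?scale1r //; lin.
apply: sw_ext => p q; rewrite -[D g in LHS]sw_id !sw_scale; apply: sw_ext => b1 b2.
by rewrite !rE pureZl pureZr !scalerA mulrC.
Qed.

Lemma Fp_bilin lam g : bilin (fun (f : Bd) b => (f g : k) *: (lam b : k^o)). Proof. lin. Qed.
Definition Fp lam g : {linear tens Bd B -> k^o} := tlift (bilinE (Fp_bilin lam g)).
Lemma FpE lam g f b : Fp lam g (pure f b) = (f g : k) *: (lam b : k^o).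
Proof. exact: tlift_pure. Qed.

Definition condC lam g : Prop := cg g =1 cl lam.
(* [f (Vg lam g a)] is the value of [Fp lam g] at the product (e (x) a)(f (x) 1). *)
Definition Vg lam g a : B := \sw_(x, r <- D a) \sw_(c2, c3 <- D r) (lam c2 : k) *: (Sb c3 ∙ (g ∙ x)).

(** Moving g across the winding by lam puts Sb(c3) next to the component before it, and they cancel.
    For the converse, multiplying [Vg] by one more component of a undoes Sb. *)
Lemma condC_V lam g : ischar lam -> isgrp g ->
  condC lam g <-> forall a, Vg lam g a = (lam a : k) *: g.
Proof.
move=> hl hg; have hi := char_inv hl.
have WK b : winding (charV lam) (winding lam b) = b by rewrite winding_winding (conv_invl hl) winding_e.
have WK' b : winding lam (winding (charV lam) b) = b by rewrite winding_winding (conv_invr hl) winding_e.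
have clW b : cl lam (winding lam b) = windl lam b by rewrite clE windl_winding WK.
have CE : condC lam g <-> forall b, g ∙ winding lam b = windl lam b ∙ g.
  split=> E b; first by rewrite -clW -(E (winding lam b)) cgE (hmulA hopfB) (grp_invl hg) (hmul1r hopfB).
  by rewrite -[b]WK' clW cgE E (hmulA hopfB) (grp_invr hg) (hmul1r hopfB).
apply: (iff_trans CE).
have VE a : Vg lam g a = \sw_(q, c3 <- D a) Sb c3 ∙ (g ∙ winding lam q).
  rewrite /Vg -(hcomA hopfB (F := fun x c2 c3 => (lam c2 : k) *: (Sb c3 ∙ (g ∙ x)))); last by lin.
  by apply: sw_ext => q c3; rewrite (sw_winding _ (F := fun w => Sb c3 ∙ (g ∙ w))) //; lin.
split=> E a.
  rewrite VE; transitivity (\sw_(q, c3 <- D a) \sw_(x, y <- D q) (lam x : k) *: ((Sb c3 ∙ y) ∙ g)).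
    apply: sw_ext => q c3; rewrite E (sw_windl _ (F := fun w => Sb c3 ∙ (w ∙ g))); last by lin.
    by apply: sw_ext => x y; rewrite (hmulA hopfB).
  rewrite (hcomA hopfB (F := fun x y c3 => (lam x : k) *: ((Sb c3 ∙ y) ∙ g))); last by lin.
  rewrite -[RHS](hcou1r hopfB (F := fun a => (lam a : k) *: g)); last by lin.
  apply: sw_ext => x r.
  rewrite (hantVl hopfB bijB (F := fun w => (lam x : k) *: (w ∙ g))); last by lin.
  by rewrite (hmul1l hopfB).
have L : \sw_(u, v <- D a) v ∙ Vg lam g u = windl lam a ∙ g.
  rewrite (sw_windl _ (F := fun w => w ∙ g)); last by lin.
  by apply: sw_ext => u v; rewrite E pureZr linearZ.
rewrite -L; transitivity (\sw_(u, v <- D a) \sw_(q, c3 <- D u) (v ∙ Sb c3) ∙ (g ∙ winding lam q)); last first.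
  apply: sw_ext => u v; rewrite VE sw_purer sw_lin; apply: sw_ext => q c3.
  by rewrite (hmulA hopfB).
rewrite (hcomA hopfB (F := fun q c3 v => (v ∙ Sb c3) ∙ (g ∙ winding lam q))); last by lin.
rewrite -[LHS](hcou1r hopfB (F := fun a => g ∙ winding lam a)); last by lin.
apply: sw_ext => q r.
rewrite (hantVr hopfB bijB (F := fun w => w ∙ (g ∙ winding lam q))); last by lin.
by rewrite (hmul1l hopfB).
Qed.

(** The component c1 coming from [tl] meets Sb(y) coming from [tr] and cancels; the surviving
    components of a form [Vg]. *)
Lemma Fp_mul lam g f a f' b : ischar lam -> isgrp g ->
  Fp lam g (xm hD (pure (pure f a) (pure f' b))) = (f g : k) *: ((f' (Vg lam g a) : k) *: (lam b : k^o)).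
Proof.
move=> hl hg; rewrite (DB_mulE fdB) (sw_lin _ (Fp lam g)).
pose G x c1 y c2 c3 : k^o := (lam c2 : k) *: f' (Sb c3 ∙ ((c1 ∙ Sb y) ∙ (g ∙ x))).
transitivity ((f g : k) *: ((\sw_(a1, a2 <- D a) \sw_(x, y <- D a1) \sw_(c, c3 <- D a2) \sw_(c1, c2 <- D c) G x c1 y c2 c3 : k) *: (lam b : k^o))).
  rewrite sw_scal sw_scale; apply: sw_ext => a1 a2.
  transitivity (teval (fun p q : Bd => (f g : k) *: ((\sw_(x, y <- D a1) \sw_(c, c3 <- D a2) \sw_(c1, c2 <- D c)
     (lam c2 : k) *: ((p (Sb c3 ∙ c1) : k) *: (q (Sb y ∙ (g ∙ x)) : k^o)) : k) *: (lam b : k^o))) (Dd f')).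
    rewrite (sw_lin _ (Fp lam g)); apply: sw_ext => p q.
    rewrite FpE (dmulE fdB) (sw_grp hg); last by lin.
    rewrite hl.1; transitivity ((f g : k) *: ((tr (pure a1 q) g * lam (tl (pure a2 p)) : k) *: (lam b : k^o))).
      by rewrite -[LHS]/((f g * tr (pure a1 q) g) * (lam (tl (pure a2 p)) * lam b) : k) -[RHS]/(f g * ((tr (pure a1 q) g * lam (tl (pure a2 p))) * lam b) : k) !mulrA.
    have EE : (tr (pure a1 q) g : k) *: (lam (tl (pure a2 p)) : k^o) = \sw_(x, y <- D a1) \sw_(c, c3 <- D a2) \sw_(c1, c2 <- D c)
     (lam c2 : k) *: ((p (Sb c3 ∙ c1) : k) *: (q (Sb y ∙ (g ∙ x)) : k^o)) :> k^o.
      rewrite (trE fdB); transitivity (\sw_(x, y <- D a1) (q (Sb y ∙ (g ∙ x)) : k) *: (lam (tl (pure a2 p)) : k^o)).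
        by rewrite -sw_scal.
      apply: sw_ext => x y; rewrite (tlE fdB).
      rewrite (sw_lin _ lam) sw_scale; apply: sw_ext => c c3.
      rewrite (sw_lin _ lam) sw_scale; apply: sw_ext => c1 c2.
      rewrite linearZ -[LHS]/(q (Sb y ∙ (g ∙ x)) * (p (Sb c3 ∙ c1) * lam c2) : k).
      by rewrite -[RHS]/(lam c2 * (p (Sb c3 ∙ c1) * q (Sb y ∙ (g ∙ x))) : k) mulrC mulrAC mulrC.
    by congr (_ *: (_ *: _)); exact EE.
  rewrite -sw_scale; congr (_ *: _); rewrite -sw_scal; congr (_ *: _).
  have EE : teval (fun p q : Bd => \sw_(x, y <- D a1) \sw_(c, c3 <- D a2) \sw_(c1, c2 <- D c)
     (lam c2 : k) *: ((p (Sb c3 ∙ c1) : k) *: (q (Sb y ∙ (g ∙ x)) : k^o))) (Dd f') =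
     \sw_(x, y <- D a1) \sw_(c, c3 <- D a2) \sw_(c1, c2 <- D c) G x c1 y c2 c3 :> k^o; last exact EE.
  refine (etrans (sw_C _ _ _) _); apply: sw_ext => x y; refine (etrans (sw_C _ _ _) _); apply: sw_ext => c c3.
  refine (etrans (sw_C _ _ _) _); apply: sw_ext => c1 c2.
  by rewrite -sw_scale (DdE fdB) /G !(hmulA hopfB).
congr (_ *: (_ *: _)).
have EE : \sw_(a1, a2 <- D a) \sw_(x, y <- D a1) \sw_(c, c3 <- D a2) \sw_(c1, c2 <- D c) G x c1 y c2 c3 =
  f' (Vg lam g a) :> k^o; last exact EE.
rewrite (hcomA hopfB (F := fun x y a2 => \sw_(c, c3 <- D a2) \sw_(c1, c2 <- D c) G x c1 y c2 c3)); last by rewrite /G; lin.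
rewrite /Vg (sw_lin _ f'); apply: sw_ext => x r.
transitivity (\sw_(y, a2 <- D r) \sw_(c1, s <- D a2) \sw_(c2, c3 <- D s) G x c1 y c2 c3).
  by apply: sw_ext => y a2; rewrite (hcomA hopfB (F := fun c1 c2 c3 => G x c1 y c2 c3)) //; rewrite /G; lin.
rewrite -(hcomA hopfB (F := fun y c1 s => \sw_(c2, c3 <- D s) G x c1 y c2 c3)); last by rewrite /G; lin.
rewrite -[RHS](hcou1l hopfB (F := fun r => f' (\sw_(c2, c3 <- D r) (lam c2 : k) *: (Sb c3 ∙ (g ∙ x))))); last by lin.
apply: sw_ext => w s; rewrite sw_C (sw_lin _ f') sw_scale; apply: sw_ext => c2 c3.
rewrite /G (hantVr hopfB bijB (F := fun w => (lam c2 : k) *: (f' (Sb c3 ∙ (w ∙ (g ∙ x))) : k^o))); last by lin.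
have fl : linear f' by lin.
by rewrite (hmul1l hopfB) (linZ _ _ fl).
Qed.
Lemma DB_mul_r f f' b : xm hD (pure (pure f one) (pure f' b)) = pure (dmul (pure f f')) b.
Proof.
rewrite (DB_mulE fdB) (sw_grp grp_one); last by lin.
rewrite -[RHS](Dd_one1 (F := fun q : Bd => pure (dmul (pure f q)) b)); last by lin.
apply: sw_ext => p q; have -> : tr (pure one q) = q.
  apply: lin_ext => x; rewrite (trE fdB) (sw_grp grp_one); last by lin.
  by rewrite (hantV1 hopfB bijB) (hmul1l hopfB) (hmul1r hopfB).
have -> : tl (pure one p) = (p one : k) *: one.
  rewrite (tlE fdB) (sw_grp grp_one); last by lin.
  rewrite (sw_grp grp_one); last by lin.
  by rewrite (hantV1 hopfB bijB) (hmul1l hopfB).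
by rewrite pureZl linearZ (hmul1l hopfB) pureZr.
Qed.
Lemma DB_mul_l a b : xm hD (pure (pure (e : Bd) a) (pure (e : Bd) b)) = pure (e : Bd) (a ∙ b).
Proof.
have he := char_e; rewrite (DB_mulE fdB).
rewrite -[RHS](hcou1l hopfB (F := fun a => pure (e : Bd) (a ∙ b))); last by lin.
apply: sw_ext => a1 a2; rewrite (Dd_char he) sw_pure; last by lin.
have -> : tr (pure a1 (e : Bd)) = (e a1 : k) *: (e : Bd).
  apply: lin_ext => x; rewrite (trE fdB) -[RHS]/((e a1 : k) *: (e x : k^o)).
  rewrite -[RHS](hcou1l hopfB (F := fun a => (e a : k) *: (e x : k^o))); last by lin.
  apply: sw_ext => b1 b2; rewrite !(hcouM hopfB) (hcouSb hopfB bijB).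
  by rewrite -[RHS]/(e b1 * (e b2 * e x) : k) mulrA mulrC [e b2 * e x]mulrC.
have -> : tl (pure a2 (e : Bd)) = a2.
  rewrite (tlE fdB) -[RHS](hcou1r hopfB (F := id)) //; apply: sw_ext => c b3.
  rewrite -[RHS](hcou1l hopfB (F := fun c => (e b3 : k) *: c)); last by lin.
  apply: sw_ext => b1 b2.
  by rewrite (hcouM hopfB) (hcouSb hopfB bijB) scalerA mulrC.
by rewrite !pureZr linearZ dmul_conv conv_el pureZl.
Qed.

(** The elements f (x) 1 and e (x) b generate D(B), so an algebra map is [Fp lam g] for its two
    restrictions. Multiplicativity on the mixed products (e (x) a)(f (x) 1) is the remaining
    condition, and it amounts to [condC]. *)
Lemma DBd_P (F : LinMap DB k^o) :
  (forall s t, F (xm hD (pure s t)) = (F s : k) * F t) /\ F (xo hD) = (1 : k) <->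
  exists lam g, [/\ ischar lam, isgrp g, condC lam g & F = Fp lam g].
Proof.
split=> [[FM F1]|[lam [g [hl hg hC ->]]]]; last first.
  split; last by rewrite DB_oneE FpE hg.2 hl.2; exact: mulr1.
  have E : forall s t : tens Bd B, Fp lam g (xm hD (pure s t)) = (Fp lam g s : k) *: (Fp lam g t : k^o).
    move=> s t; move: s; apply: tens_lin_eq; [by lin | by lin | move=> f a].
    move: t; apply: tens_lin_eq; [by lin | by lin | move=> f' b].
    have fl : linear f' by lin.
    rewrite Fp_mul // ((condC_V hl hg).1 hC) (linZ _ _ fl) !FpE.
    by rewrite -[LHS]/(f g * ((lam a * f' g) * lam b) : k) -[RHS]/((f g * lam a) * (f' g * lam b) : k) !mulrA.
  exact E.
have [G GF] : exists G : {linear tens Bd B -> k^o}, G = F by exists F.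
subst F.
have ll : linear (fun b => G (pure (e : Bd) b)) by lin.
have rl : linear (fun f : Bd => G (pure f one)) by lin.
pose lam : {linear B -> k^o} := mkLin ll.
have [g gE] := dual_dual fdB (mkLin rl).
have {}gE f : G (pure f one) = f g := gE f.
have FE f b : G (pure f b) = (f g : k) *: (lam b : k^o).
  have -> : pure f b = xm hD (pure (pure f one) (pure (e : Bd) b)).
    by rewrite DB_mul_r dmul_conv conv_er.
  by rewrite FM gE.
have hl : ischar lam.
  split=> [x y|]; last by have := F1; rewrite DB_oneE.
  by rewrite -[LHS]/(G (pure (e : Bd) (x ∙ y))) -DB_mul_l FM.
have hg : isgrp g.
  split; last by rewrite -gE; have := F1; rewrite DB_oneE.
  apply: (tens_sep fdB) => f f'; rewrite sw_pure; last by lin.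
  by rewrite -(dmulE fdB) -gE -DB_mul_r FM !gE.
have GE : G = Fp lam g by apply: lin_ext; apply: tens_ext => f b; rewrite FE FpE.
exists lam, g; split=> //.
apply/(condC_V hl hg) => a; apply: (dual_sep fdB) => f.
have := FM (pure (e : Bd) a) (pure f one).
rewrite gE {1}GE Fp_mul // hg.2 hl.2 scale1r => E.
transitivity ((lam a : k) * f g); last by rewrite linearZ.
refine (etrans _ E); exact: (esym (mulr1 _)).
Qed.
Lemma G_DBdP (w : wmap [::] [:: LinMap DB k^o]) : grouplike hH (dual_bialg hH hD) w <->
  exists lam g, [/\ ischar lam, isgrp g, condC lam g & w = mkw (Fp lam g : LinMap DB k^o)].
Proof.
apply: (iff_trans (dual_grouplike hD tDB fdDB w)); apply: (iff_trans (DBd_P (w (1 : k^o)))).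
split=> -[lam [g [hl hg hC E]]]; exists lam, g; split=> //; first exact: mkw_eq.
by rewrite E mkwE.
Qed.
(** The group-likes multiply in opposite order, again because of the flipped coproduct on the dual
    factor of D(B). *)
Lemma Fp_conv lam mu g h : xm (dual_bialg hH hD) (pure (Fp lam g : LinMap DB k^o) (Fp mu h : LinMap DB k^o)) = Fp (conv lam mu) (h ∙ g) :> LinMap DB k^o.
Proof.
apply: lin_ext => t; rewrite (dual_mulE hD tDB fdDB).
have E (s : tens Bd B) : \sw_(x1, x2 <- xd hD s) (Fp lam g x1 : k) *: (Fp mu h x2 : k^o) = Fp (conv lam mu) (h ∙ g) s.
  move: s; apply: tens_lin_eq; [by lin | by lin | move=> f b].
  rewrite (DB_comE fdB) ?FpE; last by lin.
  rewrite -(DdE fdB) sw_scal; apply: sw_ext => p q.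
  rewrite convE sw_scale; apply: sw_ext => b1 b2; rewrite !FpE.
  by rewrite -[LHS]/((q g * lam b1) * (p h * mu b2) : k) -[RHS]/((p h * q g) * (lam b1 * mu b2) : k) mulrACA [q g * _]mulrC.
exact: E.
Qed.
End DoublePairs.
End DoubleGrouplikes.

(** * The groups, the maps and exactness *)

Section ExactSequence.
Local Notation "x ∙ y" := (hmul hB (pure x y)) (at level 40, left associativity).
Local Notation one := (hone hB).
Local Notation D := (hcom hB).
Local Notation e := (hcou hB).
Local Notation S := (hant hB).
Local Notation Bd := (LinMap B k^o).
Local Notation DB := (DB hH B).
Local Notation hBd := (dual_bialg hH hB).
Local Notation hD := (hDB hH hB).
Implicit Types (lam mu : {linear B -> k^o}) (f : Bd) (g h a b : B).
Local Notation AutC := (AutC hB).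
Local Notation BQ := (BQ hH hB).
Local Notation G_DB := (G_DB hH hB).
Local Notation G_DBd := (G_DBd hH hB).

(** Reduces the group axioms for maps out of k to computations with pairs of a functional and an
    element of B, used for D(B) and for its dual. *)
Lemma is_group_rep (T : Type) (G : grpdata) (P : T -> Prop) (rep : T -> gtype G) (op : T -> T -> T) (u : T) (inv : T -> T) :
  (forall w, gset G w <-> exists2 p, P p & w = rep p) ->
  (forall p q, P p -> P q -> gmul G (rep p) (rep q) = rep (op p q)) -> gone G = rep u -> P u ->
  (forall p q, P p -> P q -> P (op p q)) -> (forall p q r, op p (op q r) = op (op p q) r) ->
  (forall p, op u p = p /\ op p u = p) ->
  (forall p, P p -> [/\ P (inv p), op p (inv p) = u & op (inv p) p = u]) -> is_group G.
Proof.
move=> GP mE oE Pu Pm opA op1 opV; split.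
- by move=> _ _ /GP[p Pp ->] /GP[q Pq ->]; rewrite mE //; apply/GP; exists (op p q) => //; exact: Pm.
- move=> _ _ _ /GP[p Pp ->] /GP[q Pq ->] /GP[r Pr ->].
  have [Pqr Ppq] := (Pm _ _ Pq Pr, Pm _ _ Pp Pq).
  by rewrite (mE q r) // (mE p q) // !mE // opA.
- by apply/GP; exists u.
- by move=> _ /GP[p Pp ->]; rewrite oE !mE //; have [-> ->] := op1 p.
move=> _ /GP[p Pp ->]; have [Pi pi ip] := opV p Pp.
by exists (rep (inv p)); [apply/GP; exists (inv p) | rewrite oE !mE // pi ip].
Qed.

Section Sequence.
Variables (nB : nat) (fdB : hasdim nB B).

Definition pairT : Type := ({linear B -> k^o} * B)%type.
Definition pair_rep (p : pairT) : gtype G_DB := mkw (pure (p.1 : Bd) p.2).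
Definition dpair_rep (p : pairT) : gtype G_DBd := mkw (Fp p.1 p.2 : LinMap DB k^o).
Definition good_pair (p : pairT) : Prop := ischar p.1 /\ isgrp p.2.
Definition central_pair (p : pairT) : Prop := [/\ ischar p.1, isgrp p.2 & condC p.1 p.2].

Lemma G_DB_repP w : gset G_DB w <-> exists2 p, good_pair p & w = pair_rep p.
Proof.
apply: (iff_trans (G_DBP fdB w)); split=> [[lam [g [hl hg E]]]|[[lam g] [hl hg] E]].
  by exists (lam, g).
by exists lam, g.
Qed.
Lemma G_DBd_repP w : gset G_DBd w <-> exists2 p, central_pair p & w = dpair_rep p.
Proof.
apply: (iff_trans (G_DBdP fdB w)); split=> [[lam [g [hl hg hC E]]]|[[lam g] [hl hg hC] E]].
  by exists (lam, g).
by exists lam, g.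
Qed.
Lemma convolutionE (X : lmodType k) (b : bialg X) (v w : X) :
  convolution b (mkw v) (mkw w) = mkw (xm b (pure v w)).
Proof.
apply: mkw_eq; rewrite hcompE hox0l tjoin1.
by rewrite -[LHS]/(xm b (pure (mkw v (1 : k^o)) (mkw w (1 : k^o)))) !mkwE.
Qed.
Lemma pair_mul p q : good_pair p -> good_pair q ->
  gmul G_DB (pair_rep p) (pair_rep q) = pair_rep (conv p.1 q.1, p.2 ∙ q.2).
Proof.
move=> [hl hg] [hm hh]; refine (etrans (convolutionE hD _ _) _).
by rewrite (DB_mul_pair fdB).
Qed.
Lemma dpair_mul p q : gmul G_DBd (dpair_rep p) (dpair_rep q) = dpair_rep (conv p.1 q.1, q.2 ∙ p.2).
Proof.
refine (etrans (convolutionE (dual_bialg hH hD) (Fp p.1 p.2 : LinMap DB k^o) (Fp q.1 q.2 : LinMap DB k^o)) _).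
by rewrite (Fp_conv fdB).
Qed.

Lemma condC_mul lam mu g h : condC lam g -> condC mu h -> condC (conv lam mu) (h ∙ g).
Proof. by move=> E1 E2 b; rewrite cg_mul E1 E2 cl_conv. Qed.
Lemma condC_one : condC (hcou hB) one.
Proof. by move=> b; rewrite cl_e cgE (hant1 hopfB) (hmul1l hopfB) (hmul1r hopfB). Qed.
Lemma condC_inv lam g : ischar lam -> isgrp g -> condC lam g -> condC (charV lam) (S g).
Proof.
move=> hl hg E b; apply: (can_inj (cgK hg)).
by rewrite (cgVK hg) E (clVK hl).
Qed.
(** [cl lam] fixes group-likes, so [condC] forces g to commute with all of them. This reconciles the
    reversed product on the dual side with the product in D(B) and makes [incl] a morphism. *)
Lemma condC_comm lam g h : isgrp h -> ischar lam -> isgrp g -> condC lam g -> h ∙ g = g ∙ h.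
Proof.
move=> hh hl hg E; have := E h; rewrite cl_grp // cgE => {1}<-.
by rewrite (hmulA hopfB) (grp_invl hg) (hmul1r hopfB).
Qed.

Lemma G_DB_group : is_group G_DB.
Proof.
apply: (is_group_rep (P := good_pair) (rep := pair_rep) (op := fun p q => (conv p.1 q.1, p.2 ∙ q.2))
  (u := (hcou hB, one)) (inv := fun p => (charV p.1, S p.2))).
- exact: G_DB_repP.
- exact: pair_mul.
- by apply: mkw_eq; exact: DB_oneE.
- by split; [exact: char_e | exact: grp_one].
- by move=> p q [? ?] [? ?]; split; [exact: char_conv | exact: grp_mul].
- by move=> p q r; rewrite /= conv_assoc (hmulA hopfB).
- by move=> [lam g] /=; rewrite conv_el conv_er (hmul1l hopfB) (hmul1r hopfB).
move=> [lam g] [hl hg] /=; rewrite (conv_invr hl) (conv_invl hl) (grp_invr hg) (grp_invl hg).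
by split=> //; split; [exact: char_inv | exact: grp_inv].
Qed.
Lemma G_DBd_group : is_group G_DBd.
Proof.
apply: (is_group_rep (P := central_pair) (rep := dpair_rep) (op := fun p q => (conv p.1 q.1, q.2 ∙ p.2))
  (u := (hcou hB, one)) (inv := fun p => (charV p.1, S p.2))).
- exact: G_DBd_repP.
- by move=> p q _ _; exact: dpair_mul.
- apply: mkw_eq; apply: lin_ext => t.
  refine (etrans (dual_oneE hD t) _); move: t; apply: tens_lin_eq; [by lin | by lin | move=> f b].
  by rewrite DB_couE FpE.
- by split; [exact: char_e | exact: grp_one | exact: condC_one].
- by move=> p q [? ? ?] [? ? ?]; split; [exact: char_conv | exact: grp_mul | exact: condC_mul].
- by move=> p q r; rewrite /= conv_assoc (hmulA hopfB).
- by move=> [lam g] /=; rewrite conv_el conv_er (hmul1l hopfB) (hmul1r hopfB).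
move=> [lam g] [hl hg hC] /=; rewrite (conv_invr hl) (conv_invl hl) (grp_invr hg) (grp_invl hg).
by split=> //; split; [exact: char_inv | exact: grp_inv | exact: condC_inv].
Qed.

Lemma incl_rep p : good_pair p -> incl hH hB (dpair_rep p) = pair_rep p.
Proof.
case: p => lam g [/= hl hg].
pose f : wmap [:: ycar DB] [::] := evC hH DB \oc (dpair_rep (lam, g) \ox idm DB).
pose la : wmap [:: ycar B] [::] := f \oc grp Bd B \oc (bone hBd \ox idm B).
pose r : wmap [:: Bd] [::] := f \oc grp Bd B \oc (idm Bd \ox bone hB).
pose gs : wmap [::] [:: ycar B] := the [set w : wmap [::] [:: ycar B] | evC hH B \oc (idm Bd \ox w) =1 r].
transitivity (pair_elt hH la gs); first by [].
have fE (t : tens Bd B) : f t = Fp lam g t.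
  have L (w : wmap [::] [:: LinMap DB k^o]) (t' : DB) : (ev DB k^o \oc (w \ox idm DB)) t' = (w (1 : k^o) : LinMap DB k^o) t'.
    by rewrite hcompE hox0l tjoin1 ev_pure.
  by refine (etrans (L _ t) _); rewrite mkwE.
have laE : la = lam.
  apply: lin_ext => b; have L (F : wmap [:: tens Bd B] [::]) (o : wmap [::] [:: Bd]) :
    (F \oc grp Bd B \oc (o \ox idm B)) b = F (pure (o (1 : k^o)) b) by rewrite !hcompE hox0l tjoin1.
  refine (etrans (L f (bone hBd)) _); rewrite -[bone hBd _]/(xo hBd) hBd_one fE FpE hg.2.
  exact: mul1r.
have rE (q : Bd) : r q = q g.
  have L (F : wmap [:: tens Bd B] [::]) (o : wmap [::] [:: ycar B]) :
    (F \oc grp Bd B \oc (idm Bd \ox o)) q = F (pure q (o (1 : k^o))) by rewrite !hcompE hox10.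
  refine (etrans (L f (bone hB)) _); rewrite -[bone hB _]/one fE FpE hl.2.
  exact: mulr1.
have wE (w : wmap [::] [:: ycar B]) (q : Bd) : (evC hH B \oc (idm Bd \ox w)) q = q (w (1 : k^o)).
  have L : (ev B k^o \oc (idm Bd \ox w)) q = q (w (1 : k^o)) by rewrite hcompE hox10 ev_pure.
  exact L.
have gsE : gs = mkw g.
  apply: mkw_eq; apply: (dual_sep fdB) => q; rewrite /gs /the; case: xgetP => [w _ wr|/(_ (mkw g))[]].
    by have := wr q; rewrite wE rE.
  by move=> q'; rewrite wE mkwE rE.
apply: mkw_eq; rewrite laE gsE.
have L (o : wmap [::] [:: Bd]) (v : wmap [::] [:: ycar B]) : (grp Bd B \oc (o \ox v)) (1 : k^o) = pure (o (1 : k^o)) (v (1 : k^o)).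
  by rewrite hcompE hox0l tjoin1.
refine (etrans (L _ _) _); rewrite mkwE; congr (pure _ _).
by apply: lin_ext => b; rewrite curryE tjoin0l scale1r.
Qed.

Lemma conj_gE (w : wmap [::] [:: ycar B]) b : conj_g hB w b = cg (w (1 : k^o)) b.
Proof. by rewrite /conj_g !hcompE hox10 hox0l tjoin1 tjoin2 hox2 tjoin1. Qed.
Lemma conj_lE (la : wmap [:: ycar B] [::]) b : conj_l hB la b = cl (la : {linear B -> k^o}) b.
Proof.
set lam := (la : {linear B -> k^o}).
transitivity (\sw_(c, b3 <- D b) \sw_(b1, b2 <- D c) (lam b1 : k) *: ((lam (S b3) : k) *: b2)).
  rewrite /conj_l !hcompE; swx (bcomul hB b) => c b3; wev; swx (bcomul hB c) => b1 b2; wev.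
  by rewrite !scalerA mulrC.
rewrite clE (sw_windl _ (F := winding (charV lam))); last by lin.
rewrite (hcomA hopfB (F := fun b1 b2 b3 => (lam b1 : k) *: ((lam (S b3) : k) *: b2))); last by lin.
by apply: sw_ext => b1 r; rewrite windingE -sw_scale.
Qed.
Lemma elt_lE p : good_pair p -> elt_l hB (pair_rep p) = p.1.
Proof.
case: p => lam g [/= hl hg]; apply: lin_ext => b.
have L (x : wmap [::] [:: tens Bd B]) : x (1 : k^o) = pure (lam : Bd) g ->
    (ev B k^o \oc (((idm Bd \ox bcounit hB) \oc ungrp Bd B \oc x) \ox idm B)) b = lam b.
  move=> xE; rewrite hcompE hox0l tjoin1 ev_pure !hcompE xE; wev.
  by rewrite -[bcounit hB g]/(e g) hg.2 scale1r.
by apply: (L (pair_rep (lam, g))); rewrite mkwE.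
Qed.
Lemma elt_gE p : good_pair p -> elt_g hB (pair_rep p) (1 : k^o) = p.2.
Proof.
case: p => lam g [/= hl hg].
have cE : (bcounit hBd : {linear Bd -> k^o}) (lam : Bd) = lam one by exact (dual_couE hB (lam : Bd)).
have L (x : wmap [::] [:: tens Bd B]) (c : wmap [:: Bd] [::]) : x (1 : k^o) = pure (lam : Bd) g -> c (lam : Bd) = lam one ->
    ((c \ox idm B) \oc ungrp Bd B \oc x) (1 : k^o) = g.
  by move=> xE cc; rewrite !hcompE xE; wev; rewrite cc hl.2 scale1r.
by apply: (L (pair_rep (lam, g)) (bcounit hBd)); rewrite ?mkwE.
Qed.
Lemma Theta_rep p : good_pair p -> Theta hH hB (pair_rep p) = lcomp (cg p.2) (cl (charV p.1)).
Proof.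
move=> hp; apply: lin_ext => b; rewrite /Theta /Theta_pair elt_lE // hcompE conj_gE elt_gE //.
by rewrite conj_lE.
Qed.

(** [cg] and [cl] commute, and inverting lam makes up for the order reversal in [cl_conv]. *)
Lemma Theta_hom : is_hom (G := G_DB) (K := AutC) (Theta hH hB).
Proof.
split=> [_ /G_DB_repP[p hp ->]|_ _ /G_DB_repP[p hp ->] /G_DB_repP[q hq ->]].
  rewrite Theta_rep //; apply/autP; have [hl hg] := hp.
  exact (hauto_comp (cg_hauto hg) (cl_hauto (char_inv hl))).
have hpq : good_pair (conv p.1 q.1, p.2 ∙ q.2).
  by have [[? ?] [? ?]] := (hp, hq); split; [exact: char_conv | exact: grp_mul].
rewrite pair_mul // !Theta_rep //; apply: lin_ext => b.
rewrite -[LHS]/(cg (p.2 ∙ q.2) (cl (charV (conv p.1 q.1)) b)).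
rewrite -[RHS]/(cg p.2 (cl (charV p.1) (cg q.2 (cl (charV q.1) b)))).
have [[hl hg] [hm hh]] := (hp, hq).
by rewrite cg_mul (cl_cg _ (char_inv hl) hh) cl_conv charV_conv.
Qed.
Lemma incl_hom : is_hom (G := G_DBd) (K := G_DB) (incl hH hB).
Proof.
have good p : central_pair p -> good_pair p by case.
split=> [_ /G_DBd_repP[p hp ->]|_ _ /G_DBd_repP[p hp ->] /G_DBd_repP[q hq ->]].
  by rewrite incl_rep; [apply/G_DB_repP; exists p => //; exact: good | exact: good].
have [[hl hg hC] [hm hh hD']] := (hp, hq).
rewrite dpair_mul !incl_rep; try exact: good.
  by rewrite pair_mul; [congr (pair_rep (_, _)); exact: (condC_comm hh hl hg) | exact: good | exact: good].
by split; [exact: char_conv | exact: grp_mul].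
Qed.
Lemma incl_inj x y : gset G_DBd x -> gset G_DBd y -> incl hH hB x = incl hH hB y -> x = y.
Proof.
move=> /G_DBd_repP[[lam g] [hl hg hC] ->] /G_DBd_repP[[mu h] [hm hh hC'] ->]; rewrite !incl_rep // => E.
have E1 : lam = mu by have := congr1 (elt_l hB) E; rewrite !elt_lE.
have E2 : g = h by have := congr1 (fun w => elt_g hB w (1 : k^o)) E; rewrite !elt_gE.
by rewrite E1 E2.
Qed.

(** On the pair (lam, g), Theta is [cg g] after the inverse of [cl lam]; it is the identity exactly
    when the two maps agree, which is [condC]. *)
Lemma exact_incl_Theta : exact_at (G := G_DBd) (K := G_DB) (L := AutC) (incl hH hB) (Theta hH hB).
Proof.
move=> _ /G_DB_repP[[lam g] hp ->]; have [/= hl hg] := hp; rewrite Theta_rep //=.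
split=> [E|[_ /G_DBd_repP[[mu h] [hm hh hC] ->]]].
  exists (dpair_rep (lam, g)); last exact: incl_rep.
  apply/G_DBd_repP; exists (lam, g) => //; split=> // b.
  have E' : cg g (cl (charV lam) (cl lam b)) = cl lam b := congr1 (fun f : {linear B -> B} => f (cl lam b)) E.
  by rewrite (clK hl) in E'.
rewrite incl_rep // => E.
have E1 : mu = lam by have := congr1 (elt_l hB) E; rewrite !elt_lE.
have E2 : h = g by have := congr1 (fun w => elt_g hB w (1 : k^o)) E; rewrite !elt_gE.
rewrite E1 E2 /= in hC; apply: lin_ext => b.
by rewrite -[LHS]/(cg g (cl (charV lam) b)) hC (clVK hl).
Qed.
(** [Pi_kernel] describes the inverse of y as [cg g] after [cl lam]. Inverting, y is the value of
    Theta at the pair (lam, S g). *)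
Lemma exact_Theta_Pi : exact_at (G := G_DB) (K := AutC) (L := BQ) (Theta hH hB) (Pi hH hB).
Proof.
move=> y /autP hy; have [yK Ky] := linvP (au_bij hy).
apply: (iff_trans (Pi_kernel fdB hy)); split=> [[lam [g [hl hg /(cg_clP _ hl hg) E]]]|[_ /G_DB_repP[[lam g] [hl hg] ->]]].
  have hS := grp_inv hg; have hp : good_pair (lam, S g) by [].
  exists (pair_rep (lam, S g)); first by apply/G_DB_repP; exists (lam, S g).
  rewrite Theta_rep //; apply: lin_ext => b; apply: (can_inj Ky); rewrite yK E.
  rewrite -[LHS]/(cg g (cl lam (cg (S g) (cl (charV lam) b)))).
  by rewrite (cl_cg _ hl hS) (cgVK hg) (clVK hl).
rewrite Theta_rep // => E; have hS := grp_inv hg; have hi := char_inv hl.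
exists lam, (S g); split=> //; apply/(cg_clP _ hl hS) => b; apply: (can_inj yK); rewrite Ky.
have yE c : y c = cg g (cl (charV lam) c) by rewrite -E.
rewrite yE -[LHS]/b.
rewrite -[X in cl _ X]/(cg (S g) (cl lam b)) (cl_cg _ hi hS) (cgVK hg).
by rewrite (clK hl).
Qed.

Lemma exact_sequence : exact_seq (incl hH hB) (Theta hH hB) (Pi hH hB).
Proof.
split.
- by split; [exact: G_DBd_group | exact: G_DB_group | exact: AutC_group | exact: BQ_group].
- by split; [exact: incl_hom | exact: Theta_hom | exact: (Pi_hom fdB)].
- exact: incl_inj.
- exact: exact_incl_Theta.
- exact: exact_Theta_Pi.
Qed.
End Sequence.
End ExactSequence.

End Transparent.

Theorem theorem5p1 (k : fieldType) (H : lmodType k) (hH : hopf H)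
  (hopfH : is_hopf (flip H H) hH) (bijS : bijective (antip hH))
  (B : ydobj H) (hB : hopf B)
  (ydB : is_yd hH B) (hopfB : is_hopfC hH hB) (finB : findim B)
  (transB : forall M : ydobj H, is_yd hH M -> Phi hH B M =1 linv (Phi hH M B)) :
  exact_seq (incl hH hB) (Theta hH hB) (Pi hH hB).
Proof.
have actB := trivial_action hopfH bijS ydB transB.
have coactB := trivial_coaction hopfH bijS ydB transB.
(* With trivial H-structures the braiding of [B] with itself is a flip, so the braided Hopf algebra
   axioms become the ordinary ones. *)
have hopfB' : is_hopf (flip B B) hB.
  by have [hB' _ _ _] := hopfB; rewrite (Phi_BB hopfH bijS actB coactB) in hB'.
have [n fdB] := finB.
exact (exact_sequence hopfH bijS hopfB' (antipode_bijective hopfB' finB) actB coactB fdB).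
Qed.
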